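(* Let $f$ be a germ of dissipative holomorphic diffeomorphisms of $(\mathbb{C}^2,0)$ with a semi-parabolic fixed point at $0$ with an eigenvalue $\lambda=e^{2\pi ip/q}$. Suppose the semi-parabolic multiplicity of $0$ is $\nu$. Let $B\subset\mathbb{C}^2$ be a small enough ball around the origin and $$\Sigma_B=\{x\in B\setminus\{0\}:\ f^{-n}(x)\in B\ \ \forall n\in\mathbb{N},\ f^{-n}(x)\to0\ \text{as } n\to\infty\}.$$ Then $\Sigma_B$ consists of $\nu$ cycles of $q$ repelling petals. Each repelling petal is the image of an injective holomorphic map $\varphi$ from a left half plane of $\mathbb{C}$ into $\mathbb{C}^2$, whose image is a graph $\{(x,k(x))\}$ over the first coordinate, and which satisfies $\varphi(\zeta+1)=f^q(\varphi(\zeta))$ (whenever $\zeta$ and $\zeta+1$ are in the half plane). The inverse of $\varphi$, denoted $\varphi^o$ and defined on the petals of $\Sigma_B$ with values in $\mathbb{C}$ (an outgoing Fatou coordinate), satisfies the Abel equation $\varphi^o(f^q)=\varphi^o+1$.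
   Context: Semi-parabolic: $0$ is an isolated fixed point of $f$, and $df_0$ has eigenvalues $\lambda=e^{2\pi ip/q}$ (a root of unity, $p/q$ in lowest terms) and $\mu$ with $0<|\mu|<1$. After a holomorphic change of coordinates $f$ can be written in the normal form $f(x,y)=(x_1,y_1)$ with $$x_1=\lambda\big(x+x^{\nu q+1}+Cx^{2\nu q+1}+a_{2\nu q+2}(y)x^{2\nu q+2}+\ldots\big),\qquad y_1=\mu y+xh(x,y);$$ the integer $\nu\geq 1$ is the semi-parabolic multiplicity of the fixed point. In such coordinates the $x$-direction is the first coordinate. The petals are one-dimensional, have $0$ in their boundary, and a cycle of $q$ petals is a set of $q$ petals permuted cyclically by $f$ near $0$ (each one being locally invariant under $f^{q}$ and mapped into itself by $f^{-q}$).
   Formalization: Each petal is the image of φ on a connected domain, invariant under ζ→ζ−1, that contains a left half plane, not on a half plane itself: since Σ_B is exactly the union of the petals, the half-plane version fails, e.g. for f(x,y)=(x/(1−x), y/2). *)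

(* Defs.v *)
From Stdlib Require Export Reals ZArith.
From Coquelicot Require Export Coquelicot.

(** The norm of [prod_NormedModule] is the Euclidean one:
    [norm (x, y) = sqrt (Cmod x ^ 2 + Cmod y ^ 2)]. *)
Definition C2 : NormedModule C_AbsRing :=
  prod_NormedModule C_AbsRing C_NormedModule C_NormedModule.

Definition ball0 (r : R) (x : C2) : Prop := (norm x < r)%R.

(** [ex_filterdiff] is taken over the field [C], so this is complex
    (Fréchet) differentiability at every point of the open set [D]. *)
Definition holomorphic_on {E F : NormedModule C_AbsRing}
    (D : E -> Prop) (f : E -> F) : Prop :=
  open D /\ forall x : E, D x -> ex_filterdiff f (locally x).

(** Germs at the origin are given by representatives.  The functions are
    total; only their values on [U] and [V] are meaningful. *)
Definition germ_biholomorphism (U V : C2 -> Prop) (f g : C2 -> C2) : Prop :=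
  holomorphic_on U f /\ holomorphic_on V g /\
  (forall x : C2, U x -> V (f x) /\ g (f x) = x) /\
  (forall y : C2, V y -> U (g y) /\ f (g y) = y) /\
  U zero /\ f zero = zero.

Definition eigenvalue (L : C2 -> C2) (a : C) : Prop :=
  exists v : C2, v <> zero /\ L v = scal a v.

Definition det2 (L : C2 -> C2) : C :=
  let e1 : C2 := L (RtoC 1, RtoC 0) in
  let e2 : C2 := L (RtoC 0, RtoC 1) in
  (fst e1 * snd e2 - fst e2 * snd e1)%C.

Definition dissipative (f : C2 -> C2) : Prop :=
  exists L : C2 -> C2, filterdiff f (locally (zero : C2)) L /\ (Cmod (det2 L) < 1)%R.

(** [exp (2 i pi p / q)] *)
Definition root_of_unity (p : Z) (q : nat) : C :=
  (cos (2 * PI * IZR p / INR q), sin (2 * PI * IZR p / INR q))%R.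

Definition semi_parabolic (f : C2 -> C2) (p : Z) (q : nat) (mu : C) : Prop :=
  (0 < q)%nat /\ Z.gcd p (Z.of_nat q) = 1%Z /\
  (0 < Cmod mu < 1)%R /\
  f zero = zero /\
  (exists eps : R, (0 < eps)%R /\
     forall x : C2, ball0 eps x -> f x = x -> x = zero) /\
  (exists L : C2 -> C2, filterdiff f (locally (zero : C2)) L /\
     eigenvalue L (root_of_unity p q) /\ eigenvalue L mu).

(** [a j y] is the coefficient [a_{2 nu q + 2 + j}(y)] of the expansion in [x]. *)
Definition semi_parabolic_normal_form
    (lambda mu : C) (q nu : nat) (F : C2 -> C2) : Prop :=
  exists (rho : R) (c : C) (a : nat -> C -> C) (h : C2 -> C),
    (0 < rho)%R /\
    (forall j : nat,
       holomorphic_on (E := C_NormedModule) (F := C_NormedModule)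
         (fun y => (Cmod y < rho)%R) (a j)) /\
    holomorphic_on (E := C2) (F := C_NormedModule)
      (fun z => (Cmod (fst z) < rho)%R /\ (Cmod (snd z) < rho)%R) h /\
    forall x y : C, (Cmod x < rho)%R -> (Cmod y < rho)%R ->
      exists t : C,
        is_pseries (K := C_AbsRing) (V := C_NormedModule)
          (fun j => a j y) x t /\
        F (x, y) =
          ((lambda * (x + x ^ (nu * q + 1) + c * x ^ (2 * nu * q + 1)
                      + x ^ (2 * nu * q + 2) * t))%C,
           (mu * y + x * h (x, y))%C).

(** The semi-parabolic multiplicity of [f] at [0] is [nu] exactly when some
    local change of coordinates [Phi], with inverse [Psi], satisfies this. *)
Definition normalizing_coordinates (f : C2 -> C2) (lambda mu : C) (q nu : nat)
    (W W' : C2 -> Prop) (Phi Psi : C2 -> C2) : Prop :=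
  germ_biholomorphism W W' Phi Psi /\
  (1 <= nu)%nat /\
  semi_parabolic_normal_form lambda mu q nu (fun z => Phi (f (Psi z))).

Definition Sigma (finv : C2 -> C2) (B : C2 -> Prop) (x : C2) : Prop :=
  B x /\ x <> zero /\
  (forall n : nat, B (Nat.iter n finv x)) /\
  filterlim (fun n => Nat.iter n finv x) eventually (locally (zero : C2)).

Definition connected (D : C -> Prop) : Prop :=
  forall A A' : C -> Prop, open A -> open A' ->
    (forall z, D z -> A z \/ A' z) ->
    (exists z, D z /\ A z) -> (exists z, D z /\ A' z) ->
    exists z, D z /\ A z /\ A' z.

Definition left_half_plane (a : R) (z : C) : Prop := (Re z < a)%R.

Definition holomorphic_graph (S : C2 -> Prop) : Prop :=
  exists (D : C -> Prop) (k : C -> C),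
    holomorphic_on (E := C_NormedModule) (F := C_NormedModule) D k /\
    forall x y : C, S (x, y) <-> D x /\ y = k x.

(** [phi] is defined on a domain [Omega] containing a left half plane, not on
    the half plane [Re zeta < a] alone: when [a - 1 <= Re zeta < a] and
    [Im zeta] tends to infinity, [phi zeta] tends to [0] while
    [f^q (phi zeta)] is outside [phi (Re zeta < a)], so the image of the half
    plane is not locally invariant under [f^q] and is smaller than the petal.
    Invariance of [Omega] under [zeta => zeta - 1] lets [f^-q] be read in the
    coordinate [zeta] on the whole petal. *)
Definition repelling_petal (f Phi : C2 -> C2) (q : nat) (P : C2 -> Prop) : Prop :=
  (forall eps : R, (0 < eps)%R -> exists x : C2, P x /\ ball0 eps x) /\
  exists (a : R) (Omega : C -> Prop) (phi : C -> C2) (phio : C2 -> C),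
    (forall zeta, left_half_plane a zeta -> Omega zeta) /\
    (forall zeta, Omega zeta -> Omega (zeta - RtoC 1)%C) /\
    connected Omega /\
    holomorphic_on (E := C_NormedModule) (F := C2) Omega phi /\
    (forall zeta zeta', Omega zeta -> Omega zeta' ->
       phi zeta = phi zeta' -> zeta = zeta') /\
    (forall x : C2, P x <-> exists zeta, Omega zeta /\ phi zeta = x) /\
    holomorphic_graph (fun z => exists x : C2, P x /\ Phi x = z) /\
    (forall zeta, Omega zeta -> Omega (zeta + RtoC 1)%C ->
       phi (zeta + RtoC 1)%C = Nat.iter q f (phi zeta)) /\
    (forall zeta, Omega zeta -> phio (phi zeta) = zeta) /\
    (forall x : C2, P x -> P (Nat.iter q f x) ->
       phio (Nat.iter q f x) = (phio x + RtoC 1)%C).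

(** The first clause says that [P (j+1)], with [j+1] taken modulo [q], is the
    part of [f (P j)] lying in [B]. *)
Definition petal_cycle (f finv : C2 -> C2) (B : C2 -> Prop) (q : nat)
    (P : nat -> C2 -> Prop) : Prop :=
  forall j : nat, (j < q)%nat ->
    (forall x : C2, P (S j mod q)%nat x <-> B x /\ exists x' : C2, P j x' /\ f x' = x) /\
    (exists eps : R, (0 < eps)%R /\
       forall x : C2, P j x -> ball0 eps x -> P j (Nat.iter q f x)) /\
    (forall x : C2, P j x -> P j (Nat.iter q finv x)).

(* Main.v *)
(** With [m = nu q], in coordinates in which the linear part is diagonal the germ is
    [(lam x (1 + x^m + O(x^(2m))), mu y + O(|x| (|x| + |y|)))], and [w = -1/(m x^m)] turns it into
    [w => w + 1 + g] with [g = O(|x|^m)].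

    Points of [Sigma_B] are the starting points of backward orbits staying in [B].  Backward steps expand the
    vertical direction, so the difference of two backward orbits lies in a horizontal cone: an orbit is determined
    by its first coordinate, and [|y| <= gam |x|].  Hence [Re w] tends to [-oo] along the orbit and [x_n] is
    eventually [th lam^(-n)] times a fixed branch of [(-m w_n)^(-1/m)], for some [th] with [th^m = 1]: these
    [m] values of [th] are the [nu] cycles of [q] petals.  Within one value of [th], [w_n - w*_n] converges for a
    reference orbit [w*]; its limit, divided by [q], is the outgoing Fatou coordinate.  That it takes all values in
    a left half plane, with orbits depending holomorphically on it, follows from a Picard iteration for the orbit
    started at given [w_0].  The graph property follows from the cone and the invertibility of the coordinate.

    The set [Omega] of values of the Fatou coordinate on a petal is connected because it contains with each point
    a ray in one of the directions [-1 + i], [-1 - i]: if the orbit touched the sphere of radius [r] for a first time,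
    then at the index of contact its distance to [0] would be decreasing along the ray, hence larger than [r] before.

    Holomorphy of all these objects rests on Goursat's theorem, proved for triangles in a half plane and transported
    to a punctured disc by the exponential; this gives the Cauchy estimates. *)
Require Import Defs.
From Stdlib Require Import Psatz Znumtheory Classical IndefiniteDescription.

Local Open Scope R_scope.

(** * Complex differentiability *)

(** Since [g] is only of order 1/|w|, the sequence w_n + n may drift like log n. The difference of
    two orbits on the same branch has increments of order 1/|w|^2 times itself, and therefore
    converges: this is why coordinates are taken relative to a reference orbit. The sum of 1/|w_n|^2
    is O(1/R) for every orbit with |w_n| >= R, so in a small ball each w_n moves like the Fatou
    coordinate up to a small relative error; most numerical constants are margins for this
    comparison. The main obstacle is that the ball is round in the given coordinates, not in the
    normalizing ones, and that a petal is cut out by a condition on all past points. It is not an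
    explicit domain. Its local properties are obtained by going back a multiple of q steps into a
    half plane where the construction is explicit, and then forward again. The norm is close to a
    multiple of |x| only on a thin enough cone, so the aperture [gam] is fixed before the radius of
    the dynamics. The normal form gives a series in x for each y separately; a bound uniform in y
    has to be extracted by a maximum principle. *)

Lemma Cmod_sub (a b : C) : Cmod (a - b) <= Cmod a + Cmod b.
Proof. unfold Cminus. rewrite <- (Cmod_opp b). apply Cmod_triangle. Qed.

Lemma Cmod_swap (a b : C) : Cmod (a - b) = Cmod (b - a).
Proof. rewrite <- (Cmod_opp (a - b)). f_equal; ring. Qed.

Lemma Cmod_tri (a b c : C) : Cmod (a - c) <= Cmod (a - b) + Cmod (b - c).
Proof. replace (a - c)%C with ((a - b) + (b - c))%C by ring. apply Cmod_triangle. Qed.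

Lemma Cmod_tri_inv (a b : C) : Cmod a - Cmod b <= Cmod (a - b).
Proof.
  generalize (Cmod_triangle (a - b) b).
  replace (a - b + b)%C with a by ring. lra.
Qed.

Lemma Cmod_le0 (z : C) : Cmod z <= 0 -> z = 0%C.
Proof. intro h. apply Cmod_eq_0. generalize (Cmod_ge_0 z); lra. Qed.

Lemma Cmod_RtoC (r : R) : 0 <= r -> Cmod (RtoC r) = r.
Proof. intro h. rewrite Cmod_R. apply Rabs_pos_eq, h. Qed.

Lemma Cmod_im_le (z : C) : Rabs (Im z) <= Cmod z.
Proof. eapply Rle_trans; [ | apply Rmax_Cmod ]. apply Rmax_r. Qed.

Lemma Re_le_Cmod (z : C) : Re z <= Cmod z.
Proof. eapply Rle_trans; [ apply Rle_abs | apply re_le_Cmod ]. Qed.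

Lemma Cmod_le_ReIm (z : C) : Cmod z <= Rabs (Re z) + Rabs (Im z).
Proof.
  destruct z as [a b]. unfold Cmod; cbn [fst snd Re Im].
  apply Rsqr_incr_0_var.
  - rewrite Rsqr_sqrt by nra. unfold Rsqr.
    generalize (Rabs_pos a) (Rabs_pos b).
    generalize (Rsqr_abs a) (Rsqr_abs b). unfold Rsqr. intros. nra.
  - generalize (Rabs_pos a) (Rabs_pos b); lra.
Qed.

Lemma Cmod_sqr (z : C) : Cmod z * Cmod z = Re z * Re z + Im z * Im z.
Proof. generalize (Cmod2_alt z); simpl; lra. Qed.

(** Written without a quotient, so that [z' = z] needs no exclusion and all arguments are plain
    inequalities. The filter version is reached only at the end, through [cdble_ex_filterdiff]. *)
Definition cdiff (f : C -> C) (z l : C) : Prop :=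
  forall eps, 0 < eps -> exists d, 0 < d /\
    forall z', Cmod (z' - z) < d ->
      Cmod (f z' - f z - l * (z' - z)) <= eps * Cmod (z' - z).

Definition ccont (f : C -> C) (z : C) : Prop :=
  forall eps, 0 < eps -> exists d, 0 < d /\
    forall z', Cmod (z' - z) < d -> Cmod (f z' - f z) < eps.

Lemma cdiff_lip (f : C -> C) z l : cdiff f z l -> exists d, 0 < d /\
  forall z', Cmod (z' - z) < d -> Cmod (f z' - f z) <= (Cmod l + 1) * Cmod (z' - z).
Proof.
  intros h. destruct (h 1 Rlt_0_1) as [d [hd H]]. exists d; split; auto.
  intros z' hz. specialize (H z' hz).
  replace (f z' - f z)%C with ((f z' - f z - l * (z' - z)) + l * (z' - z))%C by ring.
  eapply Rle_trans; [apply Cmod_triangle|]. rewrite Cmod_mult. lra.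
Qed.

Lemma cdiff_ccont (f : C -> C) z l : cdiff f z l -> ccont f z.
Proof.
  intros h eps he. destruct (cdiff_lip f z l h) as [d [hd H]].
  assert (hl := Cmod_ge_0 l).
  exists (Rmin d (eps / (Cmod l + 1))). split.
  - apply Rmin_glb_lt; auto. apply Rdiv_lt_0_compat; lra.
  - intros z' hz. eapply Rle_lt_trans; [apply H|].
    + eapply Rlt_le_trans; [apply hz|apply Rmin_l].
    + assert (Cmod (z' - z) < eps / (Cmod l + 1)).
      { eapply Rlt_le_trans; [apply hz|apply Rmin_r]. }
      apply Rmult_lt_compat_l with (r := Cmod l + 1) in H0; [|lra].
      replace ((Cmod l + 1) * (eps / (Cmod l + 1))) with eps in H0 by (field; lra). lra.
Qed.

Lemma cdiff_ext_loc (f g : C -> C) z l r : 0 < r ->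
  (forall z', Cmod (z' - z) < r -> f z' = g z') -> cdiff f z l -> cdiff g z l.
Proof.
  intros hr e h eps he. destruct (h eps he) as [d [hd H]].
  exists (Rmin d r). split; [apply Rmin_glb_lt; auto|].
  intros z' hz. rewrite <- (e z'), <- (e z).
  - apply H. eapply Rlt_le_trans; [apply hz|apply Rmin_l].
  - replace (z - z)%C with (RtoC 0) by ring. rewrite Cmod_0; auto.
  - eapply Rlt_le_trans; [apply hz|apply Rmin_r].
Qed.

Lemma cdiff_const (c z : C) : cdiff (fun _ => c) z 0.
Proof.
  intros eps he. exists 1; split; [lra|]. intros z' _.
  replace (c - c - 0 * (z' - z))%C with (RtoC 0) by ring.
  rewrite Cmod_0. generalize (Cmod_ge_0 (z' - z)); nra.
Qed.

Lemma cdiff_id (z : C) : cdiff (fun x => x) z 1.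
Proof.
  intros eps he. exists 1; split; [lra|]. intros z' _.
  replace (z' - z - 1 * (z' - z))%C with (RtoC 0) by ring.
  rewrite Cmod_0. generalize (Cmod_ge_0 (z' - z)); nra.
Qed.

Lemma cdiff_eq (f : C -> C) z l l' : l = l' -> cdiff f z l -> cdiff f z l'.
Proof. intros <-; auto. Qed.

Lemma cdiff_plus (f g : C -> C) z l k :
  cdiff f z l -> cdiff g z k -> cdiff (fun x => f x + g x)%C z (l + k).
Proof.
  intros hf hg eps he.
  destruct (hf (eps / 2)) as [d [hd H]]; [lra|].
  destruct (hg (eps / 2)) as [d' [hd' H']]; [lra|].
  exists (Rmin d d'). split; [apply Rmin_glb_lt; auto|].
  intros z' hz.
  specialize (H z' (Rlt_le_trans _ _ _ hz (Rmin_l _ _))).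
  specialize (H' z' (Rlt_le_trans _ _ _ hz (Rmin_r _ _))).
  replace (f z' + g z' - (f z + g z) - (l + k) * (z' - z))%C with
    ((f z' - f z - l * (z' - z)) + (g z' - g z - k * (z' - z)))%C by ring.
  eapply Rle_trans; [apply Cmod_triangle|]. lra.
Qed.

Lemma cdiff_mult (f g : C -> C) z l k :
  cdiff f z l -> cdiff g z k -> cdiff (fun x => f x * g x)%C z (l * g z + f z * k).
Proof.
  intros hf hg eps he.
  assert (pf := Cmod_ge_0 (f z)). assert (pg := Cmod_ge_0 (g z)).
  assert (pl := Cmod_ge_0 l). assert (pk := Cmod_ge_0 k).
  destruct (cdiff_lip f z l hf) as [d1 [hd1 H1]].
  destruct (cdiff_lip g z k hg) as [d2 [hd2 H2]].
  destruct (hf (eps / 3 / (Cmod (g z) + 1))) as [d3 [hd3 H3]].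
  { apply Rdiv_lt_0_compat; lra. }
  destruct (hg (eps / 3 / (Cmod (f z) + 1))) as [d4 [hd4 H4]].
  { apply Rdiv_lt_0_compat; lra. }
  set (d5 := eps / 3 / ((Cmod l + 1) * (Cmod k + 1))).
  assert (hd5 : 0 < d5). { apply Rdiv_lt_0_compat; [lra|nra]. }
  exists (Rmin (Rmin d1 d2) (Rmin (Rmin d3 d4) d5)).
  split; [repeat apply Rmin_glb_lt; auto|].
  intros z' hz.
  assert (Cmod (z' - z) < d1 /\ Cmod (z' - z) < d2 /\ Cmod (z' - z) < d3 /\ Cmod (z' - z) < d4 /\ Cmod (z' - z) < d5) as (a1 & a2 & a3 & a4 & a5).
  { generalize (Rmin_l (Rmin d1 d2) (Rmin (Rmin d3 d4) d5)) (Rmin_r (Rmin d1 d2) (Rmin (Rmin d3 d4) d5))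
      (Rmin_l d1 d2) (Rmin_r d1 d2) (Rmin_l (Rmin d3 d4) d5) (Rmin_r (Rmin d3 d4) d5) (Rmin_l d3 d4) (Rmin_r d3 d4).
    intros. repeat split; lra. }
  specialize (H1 z' a1). specialize (H2 z' a2). specialize (H3 z' a3). specialize (H4 z' a4).
  replace (f z' * g z' - f z * g z - (l * g z + f z * k) * (z' - z))%C with
    ((f z' - f z - l * (z' - z)) * g z + f z * (g z' - g z - k * (z' - z)) + (f z' - f z) * (g z' - g z))%C by ring.
  eapply Rle_trans; [apply Cmod_triangle|].
  eapply Rle_trans; [apply Rplus_le_compat_r, Cmod_triangle|].
  rewrite !Cmod_mult.
  set (h := Cmod (z' - z)) in *. assert (ph : 0 <= h) by apply Cmod_ge_0.
  assert (b1 : Cmod (f z' - f z - l * (z' - z)) * Cmod (g z) <= eps / 3 * h).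
  { apply Rle_trans with (eps / 3 / (Cmod (g z) + 1) * h * (Cmod (g z) + 1)).
    - apply Rmult_le_compat; auto using Cmod_ge_0; lra.
    - apply Req_le; field; lra. }
  assert (b2 : Cmod (f z) * Cmod (g z' - g z - k * (z' - z)) <= eps / 3 * h).
  { apply Rle_trans with ((Cmod (f z) + 1) * (eps / 3 / (Cmod (f z) + 1) * h)).
    - apply Rmult_le_compat; auto using Cmod_ge_0; lra.
    - apply Req_le; field; lra. }
  assert (b3 : Cmod (f z' - f z) * Cmod (g z' - g z) <= eps / 3 * h).
  { apply Rle_trans with (((Cmod l + 1) * h) * ((Cmod k + 1) * h)).
    - apply Rmult_le_compat; auto using Cmod_ge_0.
    - apply Rle_trans with (((Cmod l + 1) * d5) * ((Cmod k + 1) * h)).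
      + apply Rmult_le_compat_r; [nra|]. apply Rmult_le_compat_l; lra.
      + apply Req_le. unfold d5. field. split; lra. }
  lra.
Qed.

Lemma cdiff_comp (f g : C -> C) z l k :
  cdiff f z l -> cdiff g (f z) k -> cdiff (fun x => g (f x)) z (k * l).
Proof.
  intros hf hg eps he.
  assert (pl := Cmod_ge_0 l). assert (pk := Cmod_ge_0 k).
  destruct (cdiff_lip f z l hf) as [d1 [hd1 H1]].
  destruct (hg (eps / 2 / (Cmod l + 1))) as [d2 [hd2 H2]].
  { apply Rdiv_lt_0_compat; lra. }
  destruct (hf (eps / 2 / (Cmod k + 1))) as [d3 [hd3 H3]].
  { apply Rdiv_lt_0_compat; lra. }
  set (d4 := d2 / (Cmod l + 1)).
  assert (hd4 : 0 < d4) by (apply Rdiv_lt_0_compat; lra).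
  exists (Rmin d1 (Rmin d3 d4)). split; [repeat apply Rmin_glb_lt; auto|].
  intros z' hz.
  assert (Cmod (z' - z) < d1 /\ Cmod (z' - z) < d3 /\ Cmod (z' - z) < d4) as (a1 & a3 & a4).
  { generalize (Rmin_l d1 (Rmin d3 d4)) (Rmin_r d1 (Rmin d3 d4)) (Rmin_l d3 d4) (Rmin_r d3 d4).
    intros; repeat split; lra. }
  specialize (H1 z' a1). specialize (H3 z' a3).
  set (h := Cmod (z' - z)) in *. assert (ph : 0 <= h) by apply Cmod_ge_0.
  assert (c : Cmod (f z' - f z) < d2).
  { eapply Rle_lt_trans; [apply H1|].
    apply Rmult_lt_compat_l with (r := Cmod l + 1) in a4; [|lra].
    unfold d4 in a4. replace ((Cmod l + 1) * (d2 / (Cmod l + 1))) with d2 in a4 by (field; lra). lra. }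
  specialize (H2 _ c).
  replace (g (f z') - g (f z) - k * l * (z' - z))%C with
    ((g (f z') - g (f z) - k * (f z' - f z)) + k * (f z' - f z - l * (z' - z)))%C by ring.
  eapply Rle_trans; [apply Cmod_triangle|]. rewrite Cmod_mult.
  assert (b1 : Cmod (g (f z') - g (f z) - k * (f z' - f z)) <= eps / 2 * h).
  { eapply Rle_trans; [apply H2|].
    apply Rle_trans with (eps / 2 / (Cmod l + 1) * ((Cmod l + 1) * h)).
    - apply Rmult_le_compat_l; auto. apply Rlt_le, Rdiv_lt_0_compat; lra.
    - apply Req_le; field; lra. }
  assert (b2 : Cmod k * Cmod (f z' - f z - l * (z' - z)) <= eps / 2 * h).
  { apply Rle_trans with ((Cmod k + 1) * (eps / 2 / (Cmod k + 1) * h)).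
    - apply Rmult_le_compat; auto using Cmod_ge_0; lra.
    - apply Req_le; field; lra. }
  lra.
Qed.

Lemma cdiff_inv (z : C) : z <> 0%C -> cdiff (fun x => / x)%C z (- / (z * z)).
Proof.
  intros hz eps he.
  assert (pz : 0 < Cmod z) by (apply Cmod_gt_0, hz).
  set (r := Cmod z) in *.
  exists (Rmin (r / 2) (eps * (r * r * r) / 2)). split.
  { apply Rmin_glb_lt; [lra|]. apply Rdiv_lt_0_compat; [|lra].
    repeat apply Rmult_lt_0_compat; auto. }
  intros z' h.
  assert (a1 := Rlt_le_trans _ _ _ h (Rmin_l _ _)).
  assert (a2 := Rlt_le_trans _ _ _ h (Rmin_r _ _)).
  assert (pz' : r / 2 < Cmod z').
  { generalize (Cmod_tri_inv z (z - z')). replace (z - (z - z'))%C with z' by ring.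
    rewrite (Cmod_swap z z'). fold r. lra. }
  assert (hz' : z' <> 0%C) by (apply Cmod_gt_0; lra).
  replace (/ z' - / z - - / (z * z) * (z' - z))%C with
    ((z' - z) * ((z' - z) * / (z * z * z')))%C.
  2:{ field. split; auto. }
  rewrite !Cmod_mult, Cmod_inv, !Cmod_mult.
  2:{ intro e. apply hz'. apply Cmod_le0. apply (f_equal Cmod) in e. rewrite !Cmod_mult, Cmod_0 in e. fold r in e.
      assert (0 < r * r * Cmod z') by (apply Rmult_lt_0_compat; nra). lra. }
  fold r. rewrite (Rmult_comm eps). apply Rmult_le_compat_l; [apply Cmod_ge_0|].
  apply Rle_trans with (eps * (r * r * r) / 2 * / (r * r * (r / 2))).
  - apply Rmult_le_compat; try lra. apply Cmod_ge_0.
    + apply Rlt_le, Rinv_0_lt_compat. apply Rmult_lt_0_compat; nra.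
    + apply Rinv_le_contravar. { apply Rmult_lt_0_compat; nra. }
      apply Rmult_le_compat_l; [nra|lra].
  - apply Req_le. field. lra.
Qed.

Definition cdble (f : C -> C) (z : C) : Prop := exists l, cdiff f z l.

Lemma cdble_const (c z : C) : cdble (fun _ => c) z.
Proof. eexists; apply cdiff_const. Qed.
Lemma cdble_id (z : C) : cdble (fun x => x) z.
Proof. eexists; apply cdiff_id. Qed.
Lemma cdble_plus f g z : cdble f z -> cdble g z -> cdble (fun x => f x + g x)%C z.
Proof. intros [l hl] [k hk]. eexists; apply cdiff_plus; eauto. Qed.
Lemma cdble_mult f g z : cdble f z -> cdble g z -> cdble (fun x => f x * g x)%C z.
Proof. intros [l hl] [k hk]. eexists; apply cdiff_mult; eauto. Qed.
Lemma cdble_ext_loc (f g : C -> C) z r : 0 < r ->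
  (forall z', Cmod (z' - z) < r -> f z' = g z') -> cdble f z -> cdble g z.
Proof. intros hr e [l h]. exists l. eapply cdiff_ext_loc; eauto. Qed.
Lemma cdble_ext (f g : C -> C) z :
  (forall z', f z' = g z') -> cdble f z -> cdble g z.
Proof. intros e. apply (cdble_ext_loc f g z 1); auto; lra. Qed.
Lemma cdble_opp f z : cdble f z -> cdble (fun x => - f x)%C z.
Proof.
  intros h. apply cdble_ext with (fun x => -(1) * f x)%C; [intros; ring|].
  apply cdble_mult; auto. apply (cdble_const (-(1))%C).
Qed.
Lemma cdble_minus f g z : cdble f z -> cdble g z -> cdble (fun x => f x - g x)%C z.
Proof. intros h k. unfold Cminus. apply cdble_plus; auto. apply cdble_opp; auto. Qed.
Lemma cdble_pow f n z : cdble f z -> cdble (fun x => f x ^ n)%C z.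
Proof.
  intro h. induction n as [|n IH]; simpl; [apply (cdble_const 1%C)|].
  apply cdble_mult; auto.
Qed.
Lemma cdble_comp f g z : cdble f z -> cdble g (f z) -> cdble (fun x => g (f x)) z.
Proof. intros [l hl] [k hk]. eexists; apply cdiff_comp; eauto. Qed.
Lemma cdble_inv f z : cdble f z -> f z <> 0%C -> cdble (fun x => / f x)%C z.
Proof. intros h e. apply (cdble_comp f Cinv); auto. eexists; apply cdiff_inv; auto. Qed.
Lemma cdble_ccont f z : cdble f z -> ccont f z.
Proof. intros [l h]. eapply cdiff_ccont; eauto. Qed.

(** * The complex exponential *)

Definition cexp (z : C) : C := (exp (Re z) * cos (Im z), exp (Re z) * sin (Im z)).

Lemma cexp_plus (a b : C) : cexp (a + b) = (cexp a * cexp b)%C.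
Proof.
  destruct a as [a1 a2], b as [b1 b2]. apply injective_projections; cbn -[exp cos sin];
  rewrite exp_plus, ?cos_plus, ?sin_plus; ring.
Qed.

Lemma cexp_0 : cexp 0 = 1%C.
Proof. apply injective_projections; cbn -[exp cos sin]; rewrite exp_0, ?cos_0, ?sin_0; ring. Qed.

Lemma Cmod_cexp (z : C) : Cmod (cexp z) = exp (Re z).
Proof.
  unfold cexp, Cmod; cbn [fst snd].
  replace ((exp (Re z) * cos (Im z)) ^ 2 + (exp (Re z) * sin (Im z)) ^ 2) with (exp (Re z) * exp (Re z)).
  - apply sqrt_square. left; apply exp_pos.
  - generalize (sin2_cos2 (Im z)). unfold Rsqr. intro h.
    transitivity (exp (Re z) * exp (Re z) * (sin (Im z) * sin (Im z) + cos (Im z) * cos (Im z))); [rewrite h|]; ring.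
Qed.

Lemma cexp_neq0 z : cexp z <> 0%C.
Proof. apply Cmod_gt_0. rewrite Cmod_cexp. apply exp_pos. Qed.

Lemma cexp_opp z : cexp (- z) = (/ cexp z)%C.
Proof.
  assert (h : (cexp (- z) * cexp z = 1)%C).
  { rewrite <- cexp_plus. replace (- z + z)%C with (RtoC 0) by ring. apply cexp_0. }
  replace (/ cexp z)%C with (1 * / cexp z)%C by ring. rewrite <- h.
  field. apply cexp_neq0.
Qed.

Lemma cexp_2pi (z : C) : cexp (z + (0, 2 * PI)) = cexp z.
Proof.
  destruct z as [a b]; apply injective_projections; cbn -[exp cos sin PI Rmult Rplus];
  rewrite Rplus_0_r, ?cos_plus, ?sin_plus, cos_2PI, sin_2PI; ring.
Qed.

Lemma cexp_nat_mult (z : C) n : (cexp z ^ n)%C = cexp (INR n * z).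
Proof.
  induction n as [|n IH]; [simpl; rewrite <- cexp_0; f_equal; ring|].
  cbn [Cpow]. rewrite IH, <- cexp_plus. f_equal. rewrite S_INR, RtoC_plus. ring.
Qed.

Lemma real_deriv_eps (f : R -> R) x l : derivable_pt_lim f x l ->
  forall eps, 0 < eps -> exists d, 0 < d /\ forall h, Rabs h < d -> Rabs (f (x + h) - f x - l * h) <= eps * Rabs h.
Proof.
  intros H eps he. destruct (H eps he) as [[d hd] Hd]. exists d; split; auto.
  intros h hh. destruct (Req_dec h 0) as [->|hn].
  - replace (x + 0) with x by ring. replace (f x - f x - l * 0) with 0 by ring. rewrite Rabs_R0; lra.
  - specialize (Hd h hn hh).
    replace (f (x + h) - f x - l * h) with (((f (x + h) - f x) / h - l) * h) by (field; auto).
    rewrite Rabs_mult. apply Rmult_le_compat_r; [apply Rabs_pos|lra].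
Qed.

(** Only the real derivatives of [exp], [cos] and [sin] at 0 enter; [cexp_plus] then carries the
    result to every point. *)
Lemma cdiff_cexp_0 : cdiff cexp 0 1.
Proof.
  intros eps he. set (e := Rmin (eps / 8) 1).
  assert (e1 : 0 < e) by (apply Rmin_glb_lt; lra).
  assert (e2 : e <= eps / 8) by apply Rmin_l.
  assert (e3 : e <= 1) by apply Rmin_r.
  destruct (real_deriv_eps exp 0 1 (eq_ind _ (derivable_pt_lim exp 0) (derivable_pt_lim_exp 0) _ exp_0) e e1) as [d1 [h1 H1]].
  destruct (real_deriv_eps cos 0 (- sin 0) (derivable_pt_lim_cos 0) e e1) as [d2 [h2 H2]].
  destruct (real_deriv_eps sin 0 (cos 0) (derivable_pt_lim_sin 0) e e1) as [d3 [h3 H3]].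
  exists (Rmin (Rmin d1 d2) (Rmin d3 e)). split; [apply Rmin_glb_lt; apply Rmin_glb_lt; assumption|].
  intros z hz. replace (z - 0)%C with z in * by ring.
  assert (Cmod z < d1 /\ Cmod z < d2 /\ Cmod z < d3 /\ Cmod z < e) as (a1 & a2 & a3 & a4).
  { generalize (Rmin_l (Rmin d1 d2) (Rmin d3 e)) (Rmin_r (Rmin d1 d2) (Rmin d3 e)) (Rmin_l d1 d2) (Rmin_r d1 d2) (Rmin_l d3 e) (Rmin_r d3 e).
    intros; repeat split; lra. }
  assert (b1 := re_le_Cmod z). assert (b2 := Cmod_im_le z).
  rewrite cexp_0. destruct z as [a b]. cbn [Re Im fst snd] in *.
  specialize (H1 a ltac:(lra)). specialize (H2 b ltac:(lra)). specialize (H3 b ltac:(lra)).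
  rewrite Rplus_0_l, exp_0 in H1. rewrite Rplus_0_l, cos_0, sin_0 in H2. rewrite Rplus_0_l, cos_0, sin_0 in H3.
  set (M := Cmod (a, b)) in *.
  eapply Rle_trans; [apply Cmod_le_ReIm|].
  unfold cexp. cbn -[exp cos sin Rabs].
  pose proof (COS_bound b). pose proof (SIN_bound b).
  assert (pa := Rabs_pos a). assert (pb := Rabs_pos b).
  set (X := exp a - 1 - 1 * a) in *.
  set (Y := cos b - 1 - - 0 * b) in *.
  set (Z := sin b - 0 - 1 * b) in *.
  replace (exp a * cos b + -(1) + -(1 * a - 0 * b)) with (X * cos b + (1 + a) * Y) by (unfold X, Y; ring).
  replace (exp a * sin b + -0 + -(1 * b + 0 * a)) with (X * sin b + Z + a * (Z + b)) by (unfold X, Z; ring).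
  assert (c1 : Rabs (cos b) <= 1) by (apply Rabs_le; lra).
  assert (c2 : Rabs (sin b) <= 1) by (apply Rabs_le; lra).
  assert (d4 : Rabs (1 + a) <= 2).
  { eapply Rle_trans; [apply Rabs_triang|]. rewrite Rabs_R1. lra. }
  assert (pX := Rabs_pos X). assert (pY := Rabs_pos Y). assert (pZ := Rabs_pos Z).
  assert (Rabs (X * cos b + (1 + a) * Y) <= e * M + 2 * (e * M)).
  { eapply Rle_trans; [apply Rabs_triang|]. rewrite !Rabs_mult.
    pose proof (Rabs_pos (cos b)). pose proof (Rabs_pos (1 + a)). nra. }
  assert (Rabs (X * sin b + Z + a * (Z + b)) <= e * M + e * M + (e * M + e * M)).
  { eapply Rle_trans; [apply Rabs_triang|].
    eapply Rle_trans; [apply Rplus_le_compat_r, Rabs_triang|].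
    rewrite !Rabs_mult. pose proof (Rabs_triang Z b). pose proof (Rabs_pos (sin b)).
    assert (Rabs X * Rabs (sin b) <= e * M) by nra.
    assert (Rabs Z <= e * M) by nra.
    assert (Rabs a * Rabs (Z + b) <= e * (e * M + M)).
    { apply Rmult_le_compat; try apply Rabs_pos; lra. }
    nra. }
  assert (pM : 0 <= M) by apply Cmod_ge_0.
  assert (e * M <= eps / 8 * M) by (apply Rmult_le_compat_r; lra).
  assert (0 <= eps * M) by nra.
  lra.
Qed.

Lemma cdiff_cexp (z : C) : cdiff cexp z (cexp z).
Proof.
  assert (h : cdiff (fun x => cexp z * cexp (x + - z))%C z (cexp z)).
  { eapply cdiff_eq; [|apply (cdiff_mult (fun _ => cexp z) (fun x => cexp (x + - z)))].
    3:{ apply (cdiff_comp (fun x => x + - z)%C cexp).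
      - apply cdiff_plus; [apply cdiff_id|apply cdiff_const].
      - replace (z + - z)%C with (RtoC 0) by ring. apply cdiff_cexp_0. }
    2: apply cdiff_const. cbv beta. ring. }
  eapply cdiff_ext_loc; [apply Rlt_0_1| |apply h].
  intros z' _. cbv beta. rewrite <- cexp_plus. f_equal. ring.
Qed.

Lemma cdble_cexp f z : cdble f z -> cdble (fun x => cexp (f x)) z.
Proof. intro h. apply cdble_comp; auto. exists (cexp (f z)). apply cdiff_cexp. Qed.

(** * Goursat and Cauchy *)

Definition CInt := RInt (V := C_R_CompleteNormedModule).
Definition seg (f : C -> C) (a b : C) : C := CInt (fun t => (b - a) * f (a + t * (b - a)))%C 0 1.

Lemma norm_CR (z : C) : norm (z : C_R_NormedModule) = Cmod z.
Proof.
  unfold norm; simpl. unfold Cmod, prod_norm, norm; simpl. unfold abs; simpl.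
  rewrite !Rmult_1_r.
  rewrite <- !Rabs_mult, !Rabs_pos_eq; auto; apply Rle_0_sqr.
Qed.

Lemma cont_path (h : R -> C) (t : R) :
  (forall eps, 0 < eps -> exists d, 0 < d /\ forall t', Rabs (t' - t) < d -> Cmod (h t' - h t) < eps) ->
  continuous (U := C_R_CompleteNormedModule) h t.
Proof.
  intro H. apply (proj2 (filterlim_locally (U := C_R_CompleteNormedModule) h (h t))).
  intros [eps he]. destruct (H eps he) as [d [hd Hd]].
  exists (mkposreal d hd). intros t' ht.
  specialize (Hd t' ht).
  assert (a1 := re_le_Cmod (h t' - h t)). assert (a2 := Cmod_im_le (h t' - h t)).
  destruct (h t') as [u v], (h t) as [u0 v0]. cbn in *.
  split; unfold ball; simpl; unfold AbsRing_ball, abs, minus, plus, opp; simpl; lra.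
Qed.

Lemma seg_cont (f : C -> C) a b (t : R) : ccont f (a + t * (b - a)) ->
  continuous (U := C_R_CompleteNormedModule) (fun t : R => (b - a) * f (a + t * (b - a)))%C t.
Proof.
  intros hf. apply cont_path. intros eps he.
  assert (p := Cmod_ge_0 (b - a)).
  destruct (hf (eps / (Cmod (b - a) + 1))) as [d [hd H]]; [apply Rdiv_lt_0_compat; lra|].
  exists (d / (Cmod (b - a) + 1)). split; [apply Rdiv_lt_0_compat; lra|].
  intros t' ht.
  replace ((b - a) * f (a + t' * (b - a)) - (b - a) * f (a + t * (b - a)))%C with
    ((b - a) * (f (a + t' * (b - a)) - f (a + t * (b - a))))%C by ring.
  rewrite Cmod_mult.
  assert (Cmod (f (a + t' * (b - a))%C - f (a + t * (b - a))%C) < eps / (Cmod (b - a) + 1)).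
  { apply H. replace (a + t' * (b - a) - (a + t * (b - a)))%C with (RtoC (t' - t) * (b - a))%C by (rewrite RtoC_minus; ring).
    rewrite Cmod_mult, Cmod_R.
    apply Rmult_lt_compat_r with (r := Cmod (b - a) + 1) in ht; [|lra].
    replace (d / (Cmod (b - a) + 1) * (Cmod (b - a) + 1)) with d in ht by (field; lra).
    pose proof (Rabs_pos (t' - t)). nra. }
  apply Rle_lt_trans with (Cmod (b - a) * (eps / (Cmod (b - a) + 1))).
  - apply Rmult_le_compat_l; lra.
  - apply Rlt_le_trans with ((Cmod (b - a) + 1) * (eps / (Cmod (b - a) + 1))).
    + apply Rmult_lt_compat_r; [apply Rdiv_lt_0_compat|]; lra.
    + apply Req_le. field. lra.
Qed.

Definition oncseg (f : C -> C) a b := forall t : R, 0 <= t <= 1 -> ccont f (a + t * (b - a))%C.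

Lemma seg_int (f : C -> C) a b : oncseg f a b ->
  is_RInt (V := C_R_NormedModule) (fun t : R => (b - a) * f (a + t * (b - a)))%C 0 1 (seg f a b).
Proof.
  intro h. apply (RInt_correct (V := C_R_CompleteNormedModule)). apply ex_RInt_continuous. intros t ht.
  apply seg_cont, h. rewrite Rmin_left, Rmax_right in ht; lra.
Qed.

Lemma seg_bound (f : C -> C) a b M : oncseg f a b ->
  (forall t : R, 0 <= t <= 1 -> Cmod (f (a + t * (b - a))%C) <= M) ->
  Cmod (seg f a b) <= Cmod (b - a) * M.
Proof.
  intros h hM. rewrite <- norm_CR.
  eapply Rle_trans; [eapply norm_RInt_le_const; [|intros x hx|apply (seg_int f a b h)]|].
  - lra.
  - rewrite norm_CR, Cmod_mult. apply Rmult_le_compat_l; [apply Cmod_ge_0|]. apply (hM x hx).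
  - lra.
Qed.

Lemma seg_rev (f : C -> C) a b : oncseg f a b -> seg f b a = (- seg f a b)%C.
Proof.
  intro h. apply (is_RInt_unique (V := C_R_CompleteNormedModule)).
  assert (H := is_RInt_comp_lin (V := C_R_NormedModule) (fun t : R => (b - a) * f (a + t * (b - a)))%C (-1) 1 0 1 (- seg f a b)%C).
  eapply is_RInt_ext; [|apply H].
  - intros x _. cbn -[RtoC Cmult Cplus].
    replace (a + RtoC (-1 * x + 1) * (b - a))%C with (b + x * (a - b))%C.
    + unfold scal; simpl. unfold prod_scal, scal; simpl. unfold mult; simpl.
      destruct (f (b + x * (a - b))%C), a, b; unfold Cmult, Cminus, Cplus, Copp; simpl; f_equal; ring.
    + rewrite RtoC_plus, RtoC_mult. unfold RtoC. destruct a, b; unfold Cmult, Cminus, Cplus, Copp; simpl; f_equal; ring.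
  - replace (-1 * 0 + 1) with 1 by ring. replace (-1 * 1 + 1) with 0 by ring.
    exact (is_RInt_swap (V := C_R_NormedModule) _ _ _ _ (seg_int f a b h)).
Qed.

Definition mid (a b : C) : C := ((a + b) / 2)%C.

Lemma seg_mid (f : C -> C) a b : oncseg f a b -> (seg f a b = seg f a (mid a b) + seg f (mid a b) b)%C.
Proof.
  intro h. symmetry.
  assert (HI := seg_int f a b h).
  set (F := fun t : R => ((b - a) * f (a + t * (b - a)))%C) in *.
  assert (E : ex_RInt (V := C_R_NormedModule) F 0 (1/2) /\ ex_RInt (V := C_R_NormedModule) F (1/2) 1).
  { split; apply (ex_RInt_continuous (V := C_R_CompleteNormedModule)); intros t ht; apply seg_cont, h;
    rewrite Rmin_left, Rmax_right in ht; lra. }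
  destruct E as [[I1 E1] [I2 E2]].
  assert (J1 : seg f a (mid a b) = I1).
  { apply (is_RInt_unique (V := C_R_CompleteNormedModule)).
    assert (H := is_RInt_comp_lin (V := C_R_NormedModule) F (1/2) 0 0 1 I1).
    eapply is_RInt_ext; [|apply H].
    - intros x _. unfold F, mid. cbn -[RtoC Cmult Cplus].
      replace (a + RtoC (1 / 2 * x + 0) * (b - a))%C with (a + x * ((a + b) / 2 - a))%C.
      + unfold scal; simpl. unfold prod_scal, scal; simpl. unfold mult; simpl.
        replace ((a + b) / 2 - a)%C with ((1/2)%R * (b - a))%C by (rewrite RtoC_div by lra; field).
        destruct (f (a + x * ((1/2)%R * (b - a)))%C), a, b; unfold Cmult, Cminus, Cplus, Copp, RtoC; simpl; f_equal; field.
      + rewrite RtoC_plus, RtoC_mult, RtoC_div by lra. field.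
    - replace (1 / 2 * 0 + 0) with 0 by lra. replace (1 / 2 * 1 + 0) with (1/2) by lra. exact E1. }
  assert (J2 : seg f (mid a b) b = I2).
  { apply (is_RInt_unique (V := C_R_CompleteNormedModule)).
    assert (H := is_RInt_comp_lin (V := C_R_NormedModule) F (1/2) (1/2) 0 1 I2).
    eapply is_RInt_ext; [|apply H].
    - intros x _. unfold F, mid. cbn -[RtoC Cmult Cplus].
      replace (a + RtoC (1 / 2 * x + 1 / 2) * (b - a))%C with ((a + b) / 2 + x * (b - (a + b) / 2))%C.
      + unfold scal; simpl. unfold prod_scal, scal; simpl. unfold mult; simpl.
        replace (b - (a + b) / 2)%C with ((1/2)%R * (b - a))%C by (rewrite RtoC_div by lra; field).
        destruct (f ((a + b) / 2 + x * ((1/2)%R * (b - a)))%C), a, b; unfold Cmult, Cminus, Cplus, Copp, RtoC; simpl; f_equal; field.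
      + rewrite RtoC_plus, RtoC_mult, RtoC_div by lra. field.
    - replace (1 / 2 * 0 + 1 / 2) with (1/2) by lra. replace (1 / 2 * 1 + 1 / 2) with 1 by lra. exact E2. }
  rewrite J1, J2.
  assert (K := is_RInt_Chasles F 0 (1/2) 1 I1 I2 E1 E2).
  apply (is_RInt_unique (V := C_R_CompleteNormedModule)) in K.
  apply (is_RInt_unique (V := C_R_CompleteNormedModule)) in HI.
  rewrite K in HI. exact HI.
Qed.

Definition clim (u : nat -> C) (l : C) : Prop :=
  forall eps, 0 < eps -> exists N : nat, forall n, (N <= n)%nat -> Cmod (u n - l) < eps.

Lemma clim_complete (u : nat -> C) :
  (forall eps, 0 < eps -> exists N : nat, forall n k, (N <= n)%nat -> (N <= k)%nat -> Cmod (u n - u k) < eps) ->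
  exists l, clim u l.
Proof.
  intro H.
  assert (A1 : Cauchy_crit (fun n => Re (u n))).
  { intros eps he. destruct (H eps he) as [N HN]. exists N. intros n k hn hk.
    unfold Rdist. eapply Rle_lt_trans; [|apply (HN n k); lia].
    replace (Re (u n) - Re (u k)) with (Re (u n - u k)%C) by (unfold Re, Cminus, Cplus, Copp; simpl; ring).
    apply re_le_Cmod. }
  assert (A2 : Cauchy_crit (fun n => Im (u n))).
  { intros eps he. destruct (H eps he) as [N HN]. exists N. intros n k hn hk.
    unfold Rdist. eapply Rle_lt_trans; [|apply (HN n k); lia].
    replace (Im (u n) - Im (u k)) with (Im (u n - u k)%C) by (unfold Im, Cminus, Cplus, Copp; simpl; ring).
    apply Cmod_im_le. }
  destruct (Rcomplete.R_complete _ A1) as [l1 L1]. destruct (Rcomplete.R_complete _ A2) as [l2 L2].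
  exists (l1, l2). intros eps he.
  destruct (L1 (eps / 2)) as [N1 H1]; [lra|]. destruct (L2 (eps / 2)) as [N2 H2]; [lra|].
  exists (max N1 N2). intros n hn.
  specialize (H1 n ltac:(lia)). specialize (H2 n ltac:(lia)). unfold Rdist in *.
  eapply Rle_lt_trans; [apply Cmod_le_ReIm|].
  destruct (u n) as [a b]. cbn in *. unfold Rminus in *. lra.
Qed.

Lemma clim_le (u : nat -> C) l (c : C) M N : clim u l -> (forall n, (N <= n)%nat -> Cmod (u n - c) <= M) -> Cmod (l - c) <= M.
Proof.
  intros h H. apply Rnot_lt_le. intro k.
  destruct (h (Cmod (l - c) - M)) as [N' HN]; [lra|].
  specialize (HN (max N N') ltac:(lia)). specialize (H (max N N') ltac:(lia)).
  generalize (Cmod_tri l (u (max N N')) c). rewrite (Cmod_swap l (u _)). lra.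
Qed.

Lemma clim_unique u l l' : clim u l -> clim u l' -> l = l'.
Proof.
  intros h h'. assert (e : (l - l')%C = 0%C).
  { apply Cmod_le0. apply Rnot_lt_le. intro k.
    destruct (h (Cmod (l - l') / 2)) as [N HN]; [lra|]. destruct (h' (Cmod (l - l') / 2)) as [N' HN']; [lra|].
    specialize (HN (max N N') ltac:(lia)). specialize (HN' (max N N') ltac:(lia)).
    generalize (Cmod_tri l (u (max N N')) l'). rewrite (Cmod_swap l (u _)). lra. }
  replace l with ((l - l') + l')%C by ring. rewrite e. ring.
Qed.

Lemma geom_cauchy (u : nat -> C) K q : 0 <= q < 1 -> 0 <= K ->
  (forall n, Cmod (u (S n) - u n) <= K * q ^ n) ->
  exists l, clim u l /\ forall n, Cmod (l - u n) <= K / (1 - q) * q ^ n.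
Proof.
  intros hq hK H.
  (* The factor 1 - q^k makes the induction on [k] close with equality. *)
  assert (A : forall n k, Cmod (u (n + k)%nat - u n) <= K / (1 - q) * q ^ n * (1 - q ^ k)).
  { intros n k. induction k as [|k IH].
    - rewrite Nat.add_0_r. replace (u n - u n)%C with (RtoC 0) by ring. rewrite Cmod_0. simpl. lra.
    - replace (n + S k)%nat with (S (n + k)) by lia.
      eapply Rle_trans; [apply (Cmod_tri _ (u (n + k)%nat))|].
      eapply Rle_trans; [apply Rplus_le_compat; [apply H|apply IH]|].
      rewrite pow_add. simpl. apply Req_le. field. lra. }
  assert (B : forall n k, (n <= k)%nat -> Cmod (u k - u n) <= K / (1 - q) * q ^ n).
  { intros n k hnk. replace k with (n + (k - n))%nat by lia. eapply Rle_trans; [apply A|].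
    assert (0 <= q ^ (k - n)) by (apply pow_le; lra). assert (0 <= q ^ n) by (apply pow_le; lra).
    assert (0 <= K / (1 - q)) by (apply Rdiv_le_0_compat; lra).
    assert (0 <= K / (1 - q) * q ^ n) by nra. nra. }
  assert (P : 0 <= K / (1 - q)) by (apply Rdiv_le_0_compat; lra).
  destruct (clim_complete u) as [l hl].
  { intros eps he.
    destruct (pow_lt_1_zero q ltac:(rewrite Rabs_pos_eq; lra) (eps / 2 / (K / (1 - q) + 1))) as [N HN].
    { apply Rdiv_lt_0_compat; lra. }
    exists N. intros n k hn hk.
    specialize (HN N ltac:(lia)). rewrite Rabs_pos_eq in HN by (apply pow_le; lra).
    assert (Q : K / (1 - q) * q ^ N < eps / 2).
    { assert (0 <= q ^ N) by (apply pow_le; lra).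
      apply Rmult_lt_compat_l with (r := K / (1 - q) + 1) in HN; [|lra].
      replace ((K / (1 - q) + 1) * (eps / 2 / (K / (1 - q) + 1))) with (eps / 2) in HN by (field; lra). lra. }
    generalize (B N n hn) (B N k hk) (Cmod_tri (u n) (u N) (u k)). rewrite (Cmod_swap (u N)). lra. }
  exists l; split; auto. intro n. apply (clim_le u l (u n) _ n hl). intros k hk. apply B, hk.
Qed.

(** * Goursat's theorem for triangles in a left half plane *)

Definition tri_int (f : C -> C) (a b d : C) : C := (seg f a b + seg f b d + seg f d a)%C.

Lemma Re_seg_le (a b : C) (t c : R) : Re a <= c -> Re b <= c -> 0 <= t <= 1 -> Re (a + t * (b - a))%C <= c.
Proof. destruct a, b; cbn; intros. nra. Qed.

Lemma oncseg_hp (f : C -> C) c a b : (forall z, Re z <= c -> cdble f z) -> Re a <= c -> Re b <= c -> oncseg f a b.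
Proof. intros h ha hb t ht. apply cdble_ccont, h, Re_seg_le; auto. Qed.

Lemma Re_mid a b c : Re a <= c -> Re b <= c -> Re (mid a b) <= c.
Proof.
  intros ha hb. replace (mid a b) with (a + (1/2)%R * (b - a))%C.
  - apply Re_seg_le; auto; lra.
  - unfold mid. rewrite RtoC_div by lra. field.
Qed.

Section Goursat.
Context (f : C -> C) (c : R) (hf : forall z, Re z <= c -> cdble f z).

Definition triang : Type := (C * C * C)%type.
Definition tval (T : triang) := match T with (a, b, d) => tri_int f a b d end.
Definition good_triangle (T : triang) (D : R) := match T with (a, b, d) =>
  Re a <= c /\ Re b <= c /\ Re d <= c /\ Cmod (b - a) <= D /\ Cmod (d - b) <= D /\ Cmod (a - d) <= D end.
Definition first_vertex (T : triang) : C := match T with (a, _, _) => a end.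

(** Three of the four pieces are tested against a quarter of the integral. If all three fail, the
    middle triangle must pass, because the four integrals add up to the whole. Its orientation is
    the one for which the inner edges cancel in [tri_split]. *)
Definition next_triangle (T : triang) : triang :=
  match T with (a, b, d) =>
    let m := mid a b in let n := mid b d in let p := mid d a in
    let v := Cmod (tval T) / 4 in
    if Rle_dec v (Cmod (tval (a, m, p))) then (a, m, p) else
    if Rle_dec v (Cmod (tval (m, b, n))) then (m, b, n) else
    if Rle_dec v (Cmod (tval (n, d, p))) then (n, d, p) else (m, n, p)
  end.

Lemma tri_split a b d : Re a <= c -> Re b <= c -> Re d <= c ->
  let m := mid a b in let n := mid b d in let p := mid d a in
  tri_int f a b d = (tri_int f a m p + tri_int f m b n + tri_int f n d p + tri_int f m n p)%C.
Proof.
  intros ha hb hd m n p.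
  assert (hm : Re m <= c) by (apply Re_mid; auto).
  assert (hn : Re n <= c) by (apply Re_mid; auto).
  assert (hp : Re p <= c) by (apply Re_mid; auto).
  unfold tri_int.
  rewrite (seg_mid f a b), (seg_mid f b d), (seg_mid f d a) by (apply (oncseg_hp f c); auto).
  fold m n p.
  rewrite (seg_rev f m p), (seg_rev f m n), (seg_rev f n p) by (apply (oncseg_hp f c); auto).
  ring.
Qed.

Lemma mid_l a b D : Cmod (b - a) <= D -> Cmod (mid a b - a) <= D / 2.
Proof.
  intro h. replace (mid a b - a)%C with ((b - a) * (/2)%R)%C.
  - rewrite Cmod_mult, Cmod_RtoC; lra.
  - unfold mid. rewrite RtoC_inv by lra. field.
Qed.
Lemma mid_r a b D : Cmod (b - a) <= D -> Cmod (b - mid a b) <= D / 2.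
Proof.
  intro h. replace (b - mid a b)%C with ((b - a) * (/2)%R)%C.
  - rewrite Cmod_mult, Cmod_RtoC; lra.
  - unfold mid. rewrite RtoC_inv by lra. field.
Qed.
Lemma mid_mid a b d D : Cmod (d - b) <= D -> Cmod (mid d a - mid a b) <= D / 2.
Proof.
  intro h. replace (mid d a - mid a b)%C with ((d - b) * (/2)%R)%C.
  - rewrite Cmod_mult, Cmod_RtoC; lra.
  - unfold mid. rewrite RtoC_inv by lra. field.
Qed.

Lemma next_good T D : good_triangle T D ->
  good_triangle (next_triangle T) (D / 2) /\ Cmod (first_vertex (next_triangle T) - first_vertex T) <= D /\ Cmod (tval T) / 4 <= Cmod (tval (next_triangle T)).
Proof.
  destruct T as [[a b] d]. intros (ha & hb & hd & h1 & h2 & h3).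
  assert (s1 := tri_split a b d ha hb hd). cbv zeta in s1.
  unfold next_triangle.
  set (m := mid a b) in *. set (n := mid b d) in *. set (p := mid d a) in *.
  assert (hm : Re m <= c) by (apply Re_mid; auto).
  assert (hn : Re n <= c) by (apply Re_mid; auto).
  assert (hp : Re p <= c) by (apply Re_mid; auto).
  assert (k1 : Cmod (m - a) <= D / 2) by (apply mid_l; auto).
  assert (k2 : Cmod (b - m) <= D / 2) by (apply mid_r; auto).
  assert (k3 : Cmod (n - b) <= D / 2) by (apply mid_l; auto).
  assert (k4 : Cmod (d - n) <= D / 2) by (apply mid_r; auto).
  assert (k5 : Cmod (p - d) <= D / 2) by (apply mid_l; auto).
  assert (k6 : Cmod (a - p) <= D / 2) by (apply mid_r; auto).
  assert (k7 : Cmod (p - m) <= D / 2) by (apply mid_mid; auto).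
  assert (k8 : Cmod (m - n) <= D / 2) by (apply mid_mid; auto).
  assert (k9 : Cmod (n - p) <= D / 2) by (apply mid_mid; auto).
  assert (pD := Cmod_ge_0 (b - a)).
  assert (q : Cmod (n - a) <= D). { generalize (Cmod_tri n m a). rewrite (Cmod_swap n m). lra. }
  repeat (match goal with |- context [Rle_dec ?x ?y] => destruct (Rle_dec x y) end).
  - simpl. repeat split; auto; try (rewrite Cmod_swap; assumption).
    replace (a - a)%C with (RtoC 0) by ring. rewrite Cmod_0; lra.
  - simpl. repeat split; auto; try (rewrite Cmod_swap; assumption). lra.
  - simpl. repeat split; auto; try (rewrite Cmod_swap; assumption).
  - simpl. repeat split; auto; try (rewrite Cmod_swap; assumption). lra.
    simpl in *. rewrite s1.
    generalize (Cmod_triangle (tri_int f a m p + tri_int f m b n + tri_int f n d p) (tri_int f m n p))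
       (Cmod_triangle (tri_int f a m p + tri_int f m b n) (tri_int f n d p)) (Cmod_triangle (tri_int f a m p) (tri_int f m b n)).
    rewrite s1 in *. lra.
Qed.

Lemma seg_affine (al be a b : C) : seg (fun z => al + be * z)%C a b = ((b - a) * (al + be * (a + b) / 2))%C.
Proof.
  unfold seg, CInt.
  set (u := ((b - a) * (al + be * a))%C). set (v := ((b - a) * (be * (b - a)))%C).
  apply (is_RInt_unique (V := C_R_CompleteNormedModule)).
  assert (H := is_RInt_derive (V := C_R_CompleteNormedModule)
    (fun t : R => plus (scal t (u : C_R_CompleteNormedModule)) (scal (t * t / 2) (v : C_R_CompleteNormedModule)))
    (fun t : R => plus (scal 1 (u : C_R_CompleteNormedModule)) (scal t (v : C_R_CompleteNormedModule))) 0 1).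
  match type of H with ?A -> ?B -> is_RInt _ _ _ ?l => assert (E : l = ((b - a) * (al + be * (a + b) / 2))%C) end.
  { unfold u, v. destruct a, b, al, be. cbn. unfold mult; simpl.
    apply injective_projections; cbn; field. }
  rewrite <- E. eapply is_RInt_ext; [|apply H].
  - intros t _. unfold u, v. destruct a, b, al, be. cbn. unfold mult; simpl.
    apply injective_projections; cbn; field.
  - intros t _. apply (is_derive_plus (K := R_AbsRing) (V := C_R_NormedModule)).
    + apply (is_derive_scal_l (V := C_R_NormedModule) (fun t => t)). apply (is_derive_id (K := R_AbsRing)).
    + apply (is_derive_scal_l (V := C_R_NormedModule) (fun t => t * t / 2)). auto_derive; auto; field.
  - intros t _. apply cont_path. intros eps he.
    exists (eps / (Cmod v + 1)). assert (pv := Cmod_ge_0 v). split; [apply Rdiv_lt_0_compat; lra|].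
    intros t' ht.
    replace (plus (scal 1 (u : C_R_CompleteNormedModule)) (scal t' (v : C_R_CompleteNormedModule)) - plus (scal 1 (u : C_R_CompleteNormedModule)) (scal t (v : C_R_CompleteNormedModule)))%C with (RtoC (t' - t) * v)%C.
    + rewrite Cmod_mult, Cmod_R.
      apply Rmult_lt_compat_r with (r := Cmod v + 1) in ht; [|lra].
      replace (eps / (Cmod v + 1) * (Cmod v + 1)) with eps in ht by (field; lra).
      pose proof (Rabs_pos (t' - t)). nra.
    + destruct u, v. cbn. unfold mult; simpl. apply injective_projections; cbn; ring.
Qed.

Lemma tri_affine (al be a b d : C) : tri_int (fun z => al + be * z)%C a b d = 0%C.
Proof. unfold tri_int. rewrite !seg_affine. field. Qed.

Lemma seg_minus (g h : C -> C) a b : oncseg g a b -> oncseg h a b ->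
  seg (fun z => g z - h z)%C a b = (seg g a b - seg h a b)%C.
Proof.
  intros hg hh. apply (is_RInt_unique (V := C_R_CompleteNormedModule)).
  eapply is_RInt_ext; [|apply (is_RInt_minus (V := C_R_NormedModule) _ _ _ _ _ _ (seg_int g a b hg) (seg_int h a b hh))].
  intros t _. cbv beta. unfold minus, plus, opp; cbn -[Cmult]. unfold prod_plus, prod_opp, plus, opp; simpl.
  apply injective_projections; cbn; ring.
Qed.

Lemma ccont_affine al be z : ccont (fun z => al + be * z)%C z.
Proof.
  apply cdble_ccont. apply (cdble_plus (fun _ => al) (fun z => be * z)%C); [apply cdble_const|].
  apply (cdble_mult (fun _ => be) (fun z => z)); [apply cdble_const|apply cdble_id].
Qed.

(** The affine part of [f] at [p] integrates to zero over a triangle. The remainder is at most eps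
    times 3D on each of three sides of length at most D, whence the 9. The distance 2D to the first
    vertex is what the geometric convergence of the nested triangles provides. *)
Lemma tri_local p l eps : cdiff f p l -> 0 < eps -> exists del, 0 < del /\
  forall T D, good_triangle T D -> Cmod (first_vertex T - p) <= 2 * D -> 3 * D < del -> Cmod (tval T) <= 9 * eps * D * D.
Proof.
  intros hp he. destruct (hp eps he) as [del [hd H]]. exists del; split; auto.
  intros [[a b] d] D (ha & hb & hdd & h1 & h2 & h3) hv hD. simpl in hv.
  set (A := fun z => ((f p - l * p) + l * z)%C).
  assert (cc : forall u v, Re u <= c -> Re v <= c -> Cmod (u - p) <= 3 * D -> Cmod (v - p) <= 3 * D -> Cmod (v - u) <= D ->
    Cmod (seg f u v - seg A u v) <= D * (eps * (3 * D))).
  { intros u v hu hv' eu ev euv.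
    assert (cf : oncseg f u v) by (apply (oncseg_hp f c); auto).
    assert (cA : oncseg A u v) by (intros t _; apply ccont_affine).
    rewrite <- seg_minus by auto.
    eapply Rle_trans; [apply seg_bound with (M := eps * (3 * D))|].
    - intros t ht e he'. destruct (cf t ht (e / 2)) as [d1 [hd1 H1]]; [lra|]. destruct (cA t ht (e / 2)) as [d2 [hd2 H2]]; [lra|].
      exists (Rmin d1 d2); split; [apply Rmin_glb_lt; auto|]. intros z hz.
      specialize (H1 z (Rlt_le_trans _ _ _ hz (Rmin_l _ _))). specialize (H2 z (Rlt_le_trans _ _ _ hz (Rmin_r _ _))).
      replace e with (e / 2 + e / 2) by lra. eapply Rle_lt_trans; [|apply (Rplus_lt_compat _ _ _ _ H1 H2)].
      eapply Rle_trans; [|apply Cmod_sub]. apply Req_le. f_equal. ring.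
    - intros t ht.
      assert (e3 : Cmod (u + t * (v - u) - p) <= 3 * D).
      { replace (u + t * (v - u) - p)%C with (RtoC (1 - t) * (u - p) + RtoC t * (v - p))%C by (rewrite RtoC_minus; ring).
        eapply Rle_trans; [apply Cmod_triangle|]. rewrite !Cmod_mult, !Cmod_RtoC by lra. nra. }
      unfold A. replace (f (u + t * (v - u)) - (f p - l * p + l * (u + t * (v - u))))%C with (f (u + t * (v - u)) - f p - l * (u + t * (v - u) - p))%C by ring.
      eapply Rle_trans; [apply H; lra|]. apply Rmult_le_compat_l; lra.
    - apply Rmult_le_compat_r; auto. generalize (Cmod_ge_0 (v - u)). nra. }
  assert (pD : 0 <= D) by (generalize (Cmod_ge_0 (b - a)); lra).
  assert (ea : Cmod (a - p) <= 3 * D) by lra.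
  assert (eb : Cmod (b - p) <= 3 * D) by (generalize (Cmod_tri b a p); lra).
  assert (ed : Cmod (d - p) <= 3 * D) by (generalize (Cmod_tri d a p); rewrite (Cmod_swap d a); lra).
  generalize (cc a b ha hb ea eb h1) (cc b d hb hdd eb ed h2) (cc d a hdd ha ed ea h3). intros c1 c2 c3.
  simpl. replace (tri_int f a b d) with ((seg f a b - seg A a b) + (seg f b d - seg A b d) + (seg f d a - seg A d a))%C.
  2:{ assert (t0 := tri_affine (f p - l * p) l a b d). unfold tri_int in *. fold A in t0.
      transitivity (seg f a b + seg f b d + seg f d a - (seg A a b + seg A b d + seg A d a))%C; [ring|rewrite t0; ring]. }
  eapply Rle_trans; [apply Cmod_triangle|]. eapply Rle_trans; [apply Rplus_le_compat_r, Cmod_triangle|].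
  lra.
Qed.

Lemma goursat a b d : Re a <= c -> Re b <= c -> Re d <= c -> tri_int f a b d = 0%C.
Proof.
  intros ha hb hd.
  set (D := Cmod (b - a) + Cmod (d - b) + Cmod (a - d)).
  assert (p1 := Cmod_ge_0 (b - a)). assert (p2 := Cmod_ge_0 (d - b)). assert (p3 := Cmod_ge_0 (a - d)).
  assert (pD : 0 <= D) by (unfold D; lra).
  set (T := fun n => Nat.iter n next_triangle (a, b, d)).
  assert (hT : forall n, good_triangle (T n) (D * (/ 2) ^ n)).
  { induction n as [|n IH].
    - simpl. unfold D; repeat split; auto; lra.
    - simpl. replace (D * (/ 2 * (/ 2) ^ n)) with (D * (/ 2) ^ n / 2) by field. apply next_good, IH. }
  destruct (geom_cauchy (fun n => first_vertex (T n)) D (/ 2)) as [p [hp1 hp2]]; [lra|auto| |].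
  { intro n. apply (next_good (T n) _ (hT n)). }
  assert (hpc : Re p <= c).
  { apply Rnot_lt_le; intro k. destruct (hp1 (Re p - c)) as [N HN]; [lra|]. specialize (HN N (le_n _)).
    assert (Re (first_vertex (T N)) <= c) by (generalize (hT N); destruct (T N) as [[? ?] ?]; simpl; tauto).
    rewrite Cmod_swap in HN. generalize (Re_le_Cmod (p - first_vertex (T N))).
    replace (Re (p - first_vertex (T N))%C) with (Re p - Re (first_vertex (T N))) by (unfold Re, Cminus, Cplus, Copp; simpl; ring). lra. }
  destruct (hf p hpc) as [l hl].
  apply Cmod_le0. apply Rnot_lt_le; intro k.
  assert (low : forall n, Cmod (tri_int f a b d) * ((/ 2) ^ n * (/ 2) ^ n) <= Cmod (tval (T n))).
  { induction n as [|n IH]; [simpl; lra|].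
    generalize (proj2 (proj2 (next_good (T n) _ (hT n)))). simpl pow. change (T (S n)) with (next_triangle (T n)). lra. }
  (* With this value, 9 eps D^2 is less than half of the modulus of the integral, which contradicts
     the lower bound [low] after division by 4^N. *)
  set (eps := Cmod (tri_int f a b d) / (18 * (D * D + 1))).
  assert (hD2 : 0 < D * D + 1) by nra.
  assert (he : 0 < eps) by (apply Rdiv_lt_0_compat; lra).
  destruct (tri_local p l eps hl he) as [del [hdel H]].
  destruct (pow_lt_1_zero (/ 2) ltac:(rewrite Rabs_pos_eq; lra) (del / (3 * (D + 1)))) as [N HN].
  { apply Rdiv_lt_0_compat; lra. }
  specialize (HN N (le_n _)). rewrite Rabs_pos_eq in HN by (apply pow_le; lra).
  assert (q0 : 0 < (/ 2) ^ N) by (apply pow_lt; lra).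
  specialize (H (T N) _ (hT N)).
  assert (H' := H). clear H.
  assert (Cmod (tval (T N)) <= 9 * eps * (D * (/ 2) ^ N) * (D * (/ 2) ^ N)).
  { apply H'.
    - rewrite Cmod_swap. eapply Rle_trans; [apply hp2|]. apply Req_le. field.
    - apply Rmult_lt_compat_r with (r := 3 * (D + 1)) in HN; [|lra].
      replace (del / (3 * (D + 1)) * (3 * (D + 1))) with del in HN by (field; lra). nra. }
  specialize (low N).
  assert (hq : 0 < (/ 2) ^ N * (/ 2) ^ N) by nra.
  assert (Cmod (tri_int f a b d) * ((/ 2) ^ N * (/ 2) ^ N) <= 9 * eps * D * D * ((/ 2) ^ N * (/ 2) ^ N)) by lra.
  apply Rmult_le_reg_r in H0; auto.
  assert (e2 : Cmod (tri_int f a b d) = eps * (18 * (D * D + 1))) by (unfold eps; field; lra).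
  rewrite e2 in H0. nra.
Qed.

End Goursat.

Lemma le_eps_mult (a b k : R) : 0 <= k -> (forall eps, 0 < eps -> a <= b + k * eps) -> a <= b.
Proof.
  intros hk H. apply Rnot_lt_le; intro h. specialize (H ((a - b) / (2 * (k + 1)))).
  assert (0 < (a - b) / (2 * (k + 1))) by (apply Rdiv_lt_0_compat; lra). specialize (H H0).
  assert (k * ((a - b) / (2 * (k + 1))) <= (a - b) / 2).
  { apply Rle_trans with ((k + 1) * ((a - b) / (2 * (k + 1)))); [apply Rmult_le_compat_r; lra|].
    apply Req_le; field; lra. }
  lra.
Qed.

Lemma exp_ln_neg (d : R) : 0 < d -> forall s, s <= ln d - 1 -> exp s < d.
Proof. intros hd s hs. apply Rlt_le_trans with (exp (ln d)); [apply exp_increasing; lra|rewrite exp_ln; lra]. Qed.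

Definition pt (a b : R) : C := (a, b).

(** * Cauchy estimates on discs *)

Section Cauchy.
Context (f : C -> C) (z0 : C) (r : R) (hf : forall z, Cmod (z - z0) < r -> cdble f z).

(** The exponential turns circles about [z0] into vertical segments of length 2 pi. The function [F]
    has period 2 pi i, so two triangles forming a rectangle show that its integral over such a
    segment does not depend on the abscissa: the horizontal sides cancel. At abscissa ln rho it is
    bounded by 2 pi M / rho, while as the abscissa tends to minus infinity [F] tends to [l]. *)
Lemma cauchy_center rho M l : 0 < rho < r -> f z0 = 0%C -> cdiff f z0 l ->
  (forall z, Cmod (z - z0) = rho -> Cmod (f z) <= M) -> Cmod l <= M / rho.
Proof.
  intros hr f0 hl hM.
  set (F := fun z => (f (z0 + cexp z) * cexp (- z))%C).
  set (sg := ln rho).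
  assert (hF : forall z, Re z <= sg -> cdble F z).
  { intros z hz. apply cdble_mult.
    - apply (cdble_comp (fun z => z0 + cexp z)%C f).
      + apply cdble_plus; [apply cdble_const|]. apply (cdble_cexp (fun z => z)), cdble_id.
      + apply hf. replace (z0 + cexp z - z0)%C with (cexp z) by ring. rewrite Cmod_cexp.
        apply Rle_lt_trans with (exp sg); [|unfold sg; rewrite exp_ln; lra].
        destruct hz as [hz|hz]; [left; apply exp_increasing, hz|right; f_equal; exact hz].
    - apply (cdble_cexp (fun z => - z)%C), cdble_opp, cdble_id. }
  assert (per : forall z, F (z + pt 0 (2 * PI))%C = F z).
  { intro z. unfold F. change (pt 0 (2 * PI)) with ((0, 2 * PI)%R : C). rewrite cexp_2pi. apply f_equal.
    rewrite <- (cexp_2pi (- (z + (0, 2 * PI)%R))). apply f_equal. ring. }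
  set (V := fun s : R => seg F (pt s 0) (pt s (2 * PI))).
  assert (oc : forall u v, Re u <= sg -> Re v <= sg -> oncseg F u v) by (intros; apply (oncseg_hp F sg); auto).
  assert (eqV : forall s, s <= sg -> V s = V sg).
  { intros s hs.
    assert (t1 := goursat F sg hF (pt s 0) (pt sg 0) (pt sg (2 * PI)) hs (Rle_refl _) (Rle_refl _)).
    assert (t2 := goursat F sg hF (pt s 0) (pt sg (2 * PI)) (pt s (2 * PI)) hs (Rle_refl _) hs).
    unfold tri_int in t1, t2.
    rewrite (seg_rev F (pt s 0) (pt sg (2 * PI))) in t1 by (apply oc; cbn; lra).
    rewrite (seg_rev F (pt s 0) (pt s (2 * PI))) in t2 by (apply oc; cbn; lra).
    assert (e : seg F (pt sg (2 * PI)) (pt s (2 * PI)) = (- seg F (pt s 0) (pt sg 0))%C).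
    { rewrite <- seg_rev by (apply oc; cbn; lra). unfold seg, CInt.
      apply (RInt_ext (V := C_R_CompleteNormedModule)). intros t _.
      rewrite <- (per (pt sg 0 + t * (pt s 0 - pt sg 0))%C).
      f_equal; [|f_equal]; apply injective_projections; cbn; ring. }
    rewrite e in t2. unfold V.
    transitivity (seg F (pt s 0) (pt s (2 * PI)) + 0 + 0)%C; [ring|]. rewrite <- t1 at 1. rewrite <- t2. ring. }
  assert (len : forall s : R, Cmod (pt s (2 * PI) - pt s 0) = 2 * PI).
  { intro s. replace (pt s (2 * PI) - pt s 0)%C with (2 * PI * Ci)%C by (apply injective_projections; cbn; ring).
    rewrite !Cmod_mult, Cmod_Ci, !Cmod_RtoC; try lra. generalize PI_RGT_0; lra. }
  assert (ppi := PI_RGT_0).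
  assert (up : Cmod (V sg) <= 2 * PI * (M / rho)).
  { replace (2 * PI * (M / rho)) with (Cmod (pt sg (2 * PI) - pt sg 0) * (M / rho)) by (rewrite len; reflexivity). apply (seg_bound F (pt sg 0) (pt sg (2 * PI)) (M / rho)); [apply oc; cbn; lra|]. intros t ht.
    unfold F. rewrite Cmod_mult, Cmod_cexp.
    assert (er : Re (pt sg 0 + t * (pt sg (2 * PI) - pt sg 0))%C = sg) by (cbn; ring).
    assert (er' : Re (- (pt sg 0 + t * (pt sg (2 * PI) - pt sg 0)))%C = - sg) by (cbn; ring).
    rewrite er'. rewrite exp_Ropp. replace (exp sg) with rho by (unfold sg; rewrite exp_ln; lra). unfold Rdiv.
    apply Rmult_le_compat_r; [left; apply Rinv_0_lt_compat; lra|]. apply hM.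
    match goal with |- Cmod ?x = _ => replace x with (cexp (pt sg 0 + t * (pt sg (2 * PI) - pt sg 0))%C) by ring end.
    rewrite Cmod_cexp, er. unfold sg. apply exp_ln; lra. }
  apply (le_eps_mult _ _ 1); [lra|]. intros eps he.
  destruct (hl eps he) as [d [hd H]].
  set (s := Rmin sg (ln d - 1)).
  assert (hs1 : s <= sg) by apply Rmin_l. assert (hs2 : s <= ln d - 1) by apply Rmin_r.
  rewrite <- (eqV s hs1) in up.
  assert (cl : oncseg (fun z => l + 0 * z)%C (pt s 0) (pt s (2 * PI))) by (intros t _; apply ccont_affine).
  assert (dv : Cmod (V s - (pt s (2 * PI) - pt s 0) * l) <= 2 * PI * eps).
  { replace ((pt s (2 * PI) - pt s 0) * l)%C with (seg (fun z => l + 0 * z)%C (pt s 0) (pt s (2 * PI))).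
    2:{ rewrite seg_affine. field. }
    unfold V. rewrite <- seg_minus by (auto; apply oc; cbn; lra).
    replace (2 * PI * eps) with (Cmod (pt s (2 * PI) - pt s 0) * eps) by (rewrite len; reflexivity). apply (seg_bound (fun z => F z - (l + 0 * z))%C (pt s 0) (pt s (2 * PI)) eps).
    - intros t ht. apply cdble_ccont. apply cdble_minus; [apply hF; cbn; lra|].
      apply cdble_plus; [apply cdble_const|apply (cdble_mult (fun _ => 0%C) (fun z => z)); [apply cdble_const|apply cdble_id]].
    - intros t ht. unfold F.
      set (z := (pt s 0 + t * (pt s (2 * PI) - pt s 0))%C).
      assert (er : Re z = s) by (unfold z; cbn; ring).
      assert (ec : Cmod (cexp z) = exp s) by (rewrite Cmod_cexp, er; auto).
      specialize (H (z0 + cexp z)%C). replace (z0 + cexp z - z0)%C with (cexp z) in H by ring.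
      rewrite ec, f0 in H. specialize (H (exp_ln_neg d hd s hs2)).
      replace (f (z0 + cexp z) * cexp (- z) - (l + 0 * z))%C with ((f (z0 + cexp z) - 0 - l * cexp z) * cexp (- z))%C.
      + rewrite Cmod_mult, Cmod_cexp. replace (Re (- z)%C) with (- s) by (rewrite <- er; cbn; ring).
        apply Rle_trans with (eps * exp s * exp (- s)); [apply Rmult_le_compat_r; [left; apply exp_pos|auto]|].
        rewrite Rmult_assoc, <- exp_plus. replace (s + - s) with 0 by ring. rewrite exp_0. lra.
      + rewrite cexp_opp. field. apply cexp_neq0. }
  assert (2 * PI * Cmod l <= 2 * PI * (M / rho) + 2 * PI * eps).
  { replace (2 * PI * Cmod l) with (Cmod (pt s (2 * PI) - pt s 0) * Cmod l) by (rewrite len; reflexivity). rewrite <- Cmod_mult.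
    generalize (Cmod_tri_inv ((pt s (2 * PI) - pt s 0) * l) (V s)). rewrite Cmod_swap. lra. }
  assert (0 < 2 * PI) by lra. apply Rmult_le_reg_l with (2 * PI); auto. lra.
Qed.

End Cauchy.

(** This is [cauchy_center] for f(z)(z - z0), which vanishes at [z0] with derivative f(z0). *)
Lemma cauchy_val (f : C -> C) z0 r rho M : (forall z, Cmod (z - z0) < r -> cdble f z) ->
  0 < rho < r -> (forall z, Cmod (z - z0) = rho -> Cmod (f z) <= M) -> Cmod (f z0) <= M.
Proof.
  intros hf hr hM.
  destruct (hf z0) as [l hl]. { replace (z0 - z0)%C with (RtoC 0) by ring. rewrite Cmod_0; lra. }
  replace M with (M * rho / rho) by (field; lra).
  apply (cauchy_center (fun z => f z * (z + - z0))%C z0 r); auto.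
  - intros z hz. apply cdble_mult; auto. apply (cdble_plus (fun z => z)); [apply cdble_id|apply cdble_const].
  - ring.
  - eapply cdiff_eq; [|apply (cdiff_mult f (fun z => z + - z0)%C z0 l (1 + 0)); [auto|]].
    + cbv beta. ring.
    + apply (cdiff_plus (fun z => z) (fun _ => - z0)%C); [apply cdiff_id|apply cdiff_const].
  - intros z hz. rewrite Cmod_mult. replace (z + - z0)%C with (z - z0)%C by ring. rewrite hz.
    apply Rmult_le_compat_r; [lra|auto].
Qed.

(** This is [cauchy_center] for f - f(z0) on the circle of radius r/2; the 4 is a factor 2 for the
    subtraction and a factor 2 for the radius. *)
Lemma cauchy_der (f : C -> C) z0 r M l : (forall z, Cmod (z - z0) < r -> cdble f z) ->
  0 < r -> (forall z, Cmod (z - z0) < r -> Cmod (f z) <= M) -> cdiff f z0 l -> Cmod l <= 4 * M / r.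
Proof.
  intros hf hr hM hl.
  assert (h0 : Cmod (z0 - z0) < r). { replace (z0 - z0)%C with (RtoC 0) by ring. rewrite Cmod_0; lra. }
  replace (4 * M / r) with ((2 * M) / (r / 2)) by (field; lra).
  apply (cauchy_center (fun z => f z + - f z0)%C z0 r); try lra.
  - intros z hz. apply cdble_plus; auto. apply cdble_const.
  - ring.
  - eapply cdiff_eq; [|apply (cdiff_plus f (fun _ => - f z0)%C); [apply hl|apply cdiff_const]]. ring.
  - intros z hz. eapply Rle_trans; [apply Cmod_triangle|]. rewrite Cmod_opp.
    generalize (hM z ltac:(lra)) (hM z0 h0). lra.
Qed.

(** * Mean value inequality, Taylor remainders and limits of holomorphic functions *)

Lemma loc2glob (h : R -> C) K :
  (forall t, 0 <= t <= 1 -> exists d, 0 < d /\ forall t', 0 <= t' <= 1 -> Rabs (t' - t) < d -> Cmod (h t' - h t) <= K * Rabs (t' - t)) ->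
  Cmod (h 1 - h 0) <= K.
Proof.
  intro H.
  assert (pK : 0 <= K).
  { destruct (H 0) as [d [hd Hd]]; [lra|].
    set (t := Rmin (d / 2) 1). assert (0 < t) by (apply Rmin_glb_lt; lra).
    assert (t <= d / 2) by apply Rmin_l. assert (t <= 1) by apply Rmin_r.
    specialize (Hd t ltac:(lra)). rewrite Rabs_pos_eq in Hd by lra. specialize (Hd ltac:(lra)).
    generalize (Cmod_ge_0 (h t - h 0)). nra. }
  (* The local estimate at the supremum of this set first shows that the supremum belongs to it, and
     then that it cannot be less than 1. *)
  set (S := fun t => 0 <= t <= 1 /\ Cmod (h t - h 0) <= K * t).
  assert (S0 : S 0). { split; [lra|]. replace (h 0 - h 0)%C with (RtoC 0) by ring. rewrite Cmod_0; lra. }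
  destruct (completeness S) as [T [HT1 HT2]].
  { exists 1. intros t [ht _]; lra. }
  { exists 0; auto. }
  assert (T0 : 0 <= T) by (apply HT1, S0).
  assert (T1 : T <= 1) by (apply HT2; intros t [ht _]; lra).
  destruct (H T (conj T0 T1)) as [d [hd Hd]].
  assert (ST : S T).
  { split; [lra|].
    destruct (classic (exists t, S t /\ T - d < t)) as [[t [ht1 ht2]]|hn].
    - assert (t <= T) by (apply HT1; auto). destruct ht1 as [ht0 ht1].
      specialize (Hd t ht0). rewrite Rabs_left1 in Hd by lra. specialize (Hd ltac:(lra)).
      generalize (Cmod_tri (h T) (h t) (h 0)). rewrite (Cmod_swap (h T) (h t)). lra.
    - exfalso. assert (T <= T - d); [|lra]. apply HT2. intros t ht.
      apply Rnot_lt_le; intro k. apply hn. exists t; auto. }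
  destruct (Rle_lt_or_eq_dec T 1 T1) as [k|k].
  2:{ rewrite k in ST. generalize (proj2 ST). lra. }
  exfalso. set (t := T + Rmin (d / 2) (1 - T)).
  assert (0 < Rmin (d / 2) (1 - T)) by (apply Rmin_glb_lt; lra).
  assert (Rmin (d / 2) (1 - T) <= d / 2) by apply Rmin_l. assert (Rmin (d / 2) (1 - T) <= 1 - T) by apply Rmin_r.
  assert (t <= T); [|unfold t in *; lra]. apply HT1. split; [unfold t; lra|].
  specialize (Hd t ltac:(unfold t; lra)). rewrite Rabs_pos_eq in Hd by (unfold t; lra). specialize (Hd ltac:(unfold t; lra)).
  generalize (Cmod_tri (h t) (h T) (h 0)) (proj2 ST). lra.
Qed.

Lemma path_step (a b : C) (t' t : R) : Cmod (a + t' * (b - a) - (a + t * (b - a))) = Rabs (t' - t) * Cmod (b - a).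
Proof.
  rewrite <- Cmod_R, <- Cmod_mult. f_equal. rewrite RtoC_minus. ring.
Qed.

Lemma loc2glob_C (h : C -> C) a b K : 0 <= K ->
  (forall t : R, 0 <= t <= 1 -> exists d, 0 < d /\ forall z, Cmod (z - (a + t * (b - a))) < d ->
     Cmod (h z - h (a + t * (b - a))%C) <= K * Cmod (z - (a + t * (b - a)))) ->
  Cmod (h b - h a) <= K * Cmod (b - a).
Proof.
  intros hK H.
  replace (h b - h a)%C with ((fun t : R => h (a + t * (b - a))%C) 1 - (fun t : R => h (a + t * (b - a))%C) 0)%C.
  2:{ cbv beta. f_equal; [|f_equal]; f_equal; ring. }
  apply (loc2glob (fun t : R => h (a + t * (b - a))%C)). intros t ht. destruct (H t ht) as [d [hd Hd]].
  assert (p := Cmod_ge_0 (b - a)).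
  exists (d / (Cmod (b - a) + 1)). split; [apply Rdiv_lt_0_compat; lra|].
  intros t' ht' hl.
  apply Rmult_lt_compat_r with (r := Cmod (b - a) + 1) in hl; [|lra].
  replace (d / (Cmod (b - a) + 1) * (Cmod (b - a) + 1)) with d in hl by (field; lra).
  specialize (Hd (a + t' * (b - a))%C). rewrite path_step in Hd.
  pose proof (Rabs_pos (t' - t)). eapply Rle_trans; [apply Hd; nra|]. lra.
Qed.

Lemma mean_value (f : C -> C) a b K : 0 <= K ->
  (forall t : R, 0 <= t <= 1 -> exists l, cdiff f (a + t * (b - a)) l /\ Cmod l <= K) ->
  Cmod (f b - f a) <= K * Cmod (b - a).
Proof.
  intros hK H. apply (le_eps_mult _ _ (Cmod (b - a))); [apply Cmod_ge_0|]. intros eps he.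
  replace (K * Cmod (b - a) + Cmod (b - a) * eps) with ((K + eps) * Cmod (b - a)) by ring.
  apply loc2glob_C; [lra|]. intros t ht. destruct (H t ht) as [l [hl hk]].
  destruct (hl eps he) as [d [hd Hd]]. exists d; split; auto. intros z hz. specialize (Hd z hz).
  set (w := (a + t * (b - a))%C) in *.
  replace (f z - f w)%C with ((f z - f w - l * (z - w)) + l * (z - w))%C by ring.
  eapply Rle_trans; [apply Cmod_triangle|]. rewrite Cmod_mult. generalize (Cmod_ge_0 (z - w)); nra.
Qed.

Lemma seg_in_ball (a b z : C) (t s : R) : Cmod (a - z) <= s -> Cmod (b - z) <= s -> 0 <= t <= 1 -> Cmod (a + t * (b - a) - z) <= s.
Proof.
  intros ha hb ht. replace (a + t * (b - a) - z)%C with (RtoC (1 - t) * (a - z) + RtoC t * (b - z))%C by (rewrite RtoC_minus; ring).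
  eapply Rle_trans; [apply Cmod_triangle|]. rewrite !Cmod_mult, !Cmod_RtoC by lra. nra.
Qed.

Lemma lip_disc (f : C -> C) z0 r M a b : (forall z, Cmod (z - z0) < r -> cdble f z) ->
  0 < r -> (forall z, Cmod (z - z0) < r -> Cmod (f z) <= M) ->
  Cmod (a - z0) <= r / 2 -> Cmod (b - z0) <= r / 2 -> Cmod (f a - f b) <= 8 * M / r * Cmod (a - b).
Proof.
  intros hf hr hM ha hb.
  assert (pM : 0 <= M). { eapply Rle_trans; [apply Cmod_ge_0|apply (hM a)]. lra. }
  apply mean_value; [apply Rdiv_le_0_compat; lra|]. intros t ht.
  assert (hz := seg_in_ball b a z0 t (r / 2) hb ha ht).
  set (z := (b + t * (a - b))%C) in *.
  destruct (hf z) as [l hl]; [lra|]. exists l; split; auto.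
  replace (8 * M / r) with (4 * M / (r / 2)) by (field; lra).
  apply (cauchy_der f z); auto; try lra.
  - intros u hu. apply hf. generalize (Cmod_tri u z z0). lra.
  - intros u hu. apply hM. generalize (Cmod_tri u z z0). lra.
Qed.

Lemma cdiff_shift (f : C -> C) z h l : cdiff f (z + h) l -> cdiff (fun x => f (x + h)%C) z l.
Proof.
  intro H. eapply cdiff_eq; [|apply (cdiff_comp (fun x => x + h)%C f z (1 + 0) l)].
  - ring.
  - apply (cdiff_plus (fun x => x) (fun _ => h)); [apply cdiff_id|apply cdiff_const].
  - exact H.
Qed.

(** No second derivative is used. The derivative at z minus the derivative at [z0] is the derivative
    at [z0] of x |-> f(x + h) - f(x) with h = z - z0. This function is bounded by 8 M s / r on a
    disc of radius r/4, so the Cauchy estimate gives 128 M s / r^2, and the mean value inequality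
    concludes. *)
Lemma taylor2 (f : C -> C) z0 r M l s a b : (forall z, Cmod (z - z0) < r -> cdble f z) ->
  0 < r -> (forall z, Cmod (z - z0) < r -> Cmod (f z) <= M) -> cdiff f z0 l ->
  0 <= s <= r / 4 -> Cmod (a - z0) <= s -> Cmod (b - z0) <= s ->
  Cmod (f a - f b - l * (a - b)) <= 128 * M * s / (r * r) * Cmod (a - b).
Proof.
  intros hf hr hM hl hs ha hb.
  assert (pM : 0 <= M). { eapply Rle_trans; [apply Cmod_ge_0|apply (hM a)]. lra. }
  assert (E : (f a - f b - l * (a - b) = (fun z => f z + - l * z) a - (fun z => f z + - l * z) b)%C) by (cbv beta; ring).
  rewrite E. apply (mean_value (fun z => f z + - l * z)%C).
  { apply Rdiv_le_0_compat; [|nra]. apply Rmult_le_pos; lra. }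
  intros t ht.
  assert (hz := seg_in_ball b a z0 t s hb ha ht).
  set (z := (b + t * (a - b))%C) in *.
  destruct (hf z) as [lz hlz]; [lra|]. exists (lz + (0 * z + - l * 1))%C. split.
  { apply cdiff_plus; auto. apply (cdiff_mult (fun _ => - l)%C (fun z => z)); [apply cdiff_const|apply cdiff_id]. }
  replace (lz + (0 * z + - l * 1))%C with (lz - l)%C by ring.
  set (h := (z - z0)%C) in *.
  apply Rle_trans with (4 * (8 * M / r * s) / (r / 4)).
  2:{ apply Req_le; field; lra. }
  apply (cauchy_der (fun x => f (x + h) + - (f x))%C z0); try lra.
  - intros u hu. apply cdble_plus; [|apply cdble_opp, hf; lra].
    destruct (hf (u + h)%C) as [k hk].
    + replace (u + h - z0)%C with ((u - z0) + h)%C by ring. eapply Rle_lt_trans; [apply Cmod_triangle|]. lra.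
    + exists k. apply cdiff_shift, hk.
  - intros u hu. replace (f (u + h)%C + - f u)%C with (f (u + h)%C - f u)%C by ring.
    eapply Rle_trans; [apply (lip_disc f z0 r M); auto|].
    + replace (u + h - z0)%C with ((u - z0) + h)%C by ring. eapply Rle_trans; [apply Cmod_triangle|]. lra.
    + lra.
    + apply Rmult_le_compat_l; [apply Rdiv_le_0_compat; lra|]. replace (u + h - u)%C with h by ring. auto.
  - unfold Cminus. apply cdiff_plus.
    + apply cdiff_shift. replace (z0 + h)%C with z by (unfold h; ring). auto.
    + eapply cdiff_eq; [|apply cdiff_ext_loc with (f := fun x => (- (1) * f x)%C) (r := 1)].
      2: lra. 2: intros; ring. 2: apply (cdiff_mult (fun _ => - (1))%C f); [apply cdiff_const|apply hl].
      cbv beta. ring.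
Qed.

(** Pointwise convergence and a common bound suffice, because [taylor2] gives a quadratic remainder
    uniform in n. The difference quotients at one small increment then determine the derivatives
    [L n] up to a small error, so these form a Cauchy sequence, and the remainder estimate passes to
    the limit. *)
Lemma weierstrass (fn : nat -> C -> C) (f : C -> C) z0 r M : 0 < r ->
  (forall n z, Cmod (z - z0) < r -> cdble (fn n) z) ->
  (forall n z, Cmod (z - z0) < r -> Cmod (fn n z) <= M) ->
  (forall z, Cmod (z - z0) < r -> clim (fun n => fn n z) (f z)) -> cdble f z0.
Proof.
  intros hr hd hM hl.
  assert (e0 : Cmod (z0 - z0) = 0) by (replace (z0 - z0)%C with (RtoC 0) by ring; apply Cmod_0).
  assert (pM : 0 <= M). { eapply Rle_trans; [apply Cmod_ge_0|apply (hM O z0)]. lra. }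
  assert (hL : forall n, exists l, cdiff (fn n) z0 l) by (intro n; apply hd; lra).
  destruct (functional_choice _ hL) as [L HL].
  set (K := 128 * M / (r * r)). assert (pK : 0 <= K) by (apply Rdiv_le_0_compat; nra).
  assert (T : forall n z, Cmod (z - z0) <= r / 4 -> Cmod (fn n z - fn n z0 - L n * (z - z0)) <= K * Cmod (z - z0) * Cmod (z - z0)).
  { intros n z hz. eapply Rle_trans; [apply (taylor2 (fn n) z0 r M (L n) (Cmod (z - z0))); auto; try lra|].
    - split; [apply Cmod_ge_0|auto].
    - rewrite e0. apply Cmod_ge_0.
    - apply Req_le. unfold K. field. lra. }
  destruct (clim_complete L) as [l HLl].
  { intros eps he.
    set (s := Rmin (r / 4) (eps / (4 * (K + 1)))).
    assert (hs : 0 < s) by (apply Rmin_glb_lt; [lra|apply Rdiv_lt_0_compat; lra]).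
    assert (hs1 : s <= r / 4) by apply Rmin_l.
    assert (hs2 : K * s <= eps / 4).
    { apply Rle_trans with ((K + 1) * (eps / (4 * (K + 1)))).
      - apply Rmult_le_compat; try lra. apply Rmin_r.
      - apply Req_le; field; lra. }
    set (z := (z0 + s)%C).
    assert (ez : (z - z0 = s)%C) by (unfold z; ring).
    assert (cz : Cmod (z - z0) = s) by (rewrite ez; apply Cmod_RtoC; lra).
    destruct (hl z ltac:(lra) (s * (eps / 16)) ltac:(nra)) as [N1 H1].
    destruct (hl z0 ltac:(lra) (s * (eps / 16)) ltac:(nra)) as [N2 H2].
    exists (max N1 N2). intros n k hn hk.
    assert (A1 := H1 n ltac:(lia)). assert (A2 := H1 k ltac:(lia)). assert (A3 := H2 n ltac:(lia)). assert (A4 := H2 k ltac:(lia)).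
    assert (T1 := T n z ltac:(lra)). assert (T2 := T k z ltac:(lra)). rewrite cz, ez in T1, T2.
    assert (B : s * Cmod (L n - L k) < s * eps).
    { rewrite <- (Cmod_RtoC s) at 1 by lra. rewrite <- Cmod_mult.
      replace (s * (L n - L k))%C with
       ((fn n z - f z) - (fn k z - f z) - ((fn n z0 - f z0) - (fn k z0 - f z0)) - ((fn n z - fn n z0 - L n * s) - (fn k z - fn k z0 - L k * s)))%C by ring.
      generalize (Cmod_sub ((fn n z - f z) - (fn k z - f z) - ((fn n z0 - f z0) - (fn k z0 - f z0))) ((fn n z - fn n z0 - L n * s) - (fn k z - fn k z0 - L k * s)))
       (Cmod_sub ((fn n z - f z) - (fn k z - f z)) ((fn n z0 - f z0) - (fn k z0 - f z0)))
       (Cmod_sub (fn n z - f z) (fn k z - f z)) (Cmod_sub (fn n z0 - f z0) (fn k z0 - f z0))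
       (Cmod_sub (fn n z - fn n z0 - L n * s) (fn k z - fn k z0 - L k * s)).
      intros. assert (K * s * s <= eps / 4 * s) by (apply Rmult_le_compat_r; lra). nra. }
    apply Rmult_lt_reg_l in B; auto. }
  exists l.
  assert (TT : forall z, Cmod (z - z0) <= r / 4 -> Cmod (f z - f z0 - l * (z - z0)) <= K * Cmod (z - z0) * Cmod (z - z0)).
  { intros z hz. apply (le_eps_mult _ _ (2 + Cmod (z - z0))); [generalize (Cmod_ge_0 (z - z0)); lra|].
    intros eps he.
    destruct (hl z ltac:(lra) eps he) as [N1 H1]. destruct (hl z0 ltac:(lra) eps he) as [N2 H2]. destruct (HLl eps he) as [N3 H3].
    set (n := max N1 (max N2 N3)).
    specialize (H1 n ltac:(lia)). specialize (H2 n ltac:(lia)). specialize (H3 n ltac:(lia)). specialize (T n z hz).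
    replace (f z - f z0 - l * (z - z0))%C with ((fn n z - fn n z0 - L n * (z - z0)) - (fn n z - f z) + (fn n z0 - f z0) + (L n - l) * (z - z0))%C by ring.
    eapply Rle_trans; [apply Cmod_triangle|]. eapply Rle_trans; [apply Rplus_le_compat_r, Cmod_triangle|].
    eapply Rle_trans; [apply Rplus_le_compat_r, Rplus_le_compat_r, Cmod_sub|]. rewrite Cmod_mult.
    generalize (Cmod_ge_0 (z - z0)). intro. assert (Cmod (L n - l) * Cmod (z - z0) <= eps * Cmod (z - z0)) by (apply Rmult_le_compat_r; lra). lra. }
  intros eps he. exists (Rmin (r / 4) (eps / (K + 1))). split; [apply Rmin_glb_lt; [lra|apply Rdiv_lt_0_compat; lra]|].
  intros z hz.
  assert (a1 := Rlt_le_trans _ _ _ hz (Rmin_l _ _)). assert (a2 := Rlt_le_trans _ _ _ hz (Rmin_r _ _)).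
  eapply Rle_trans; [apply TT; lra|]. apply Rmult_le_compat_r; [apply Cmod_ge_0|].
  apply Rle_trans with ((K + 1) * (eps / (K + 1))); [apply Rmult_le_compat; try lra; apply Cmod_ge_0|].
  apply Req_le; field; lra.
Qed.

Lemma Cmod_self (z : C) : Cmod (z - z) = 0.
Proof. replace (z - z)%C with (RtoC 0) by ring. apply Cmod_0. Qed.

(** * Functions of two variables, inverse functions *)

Definition fdiff (f : C -> C -> C) (x y : C) : Prop := exists a b : C,
  forall eps, 0 < eps -> exists d, 0 < d /\ forall x' y', Cmod (x' - x) < d -> Cmod (y' - y) < d ->
    Cmod (f x' y' - f x y - a * (x' - x) - b * (y' - y)) <= eps * (Cmod (x' - x) + Cmod (y' - y)).

Lemma fdiff_comp f u v z : cdble u z -> cdble v z -> fdiff f (u z) (v z) -> cdble (fun t => f (u t) (v t)) z.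
Proof.
  intros [l hu] [k hv] [a [b H]]. exists (a * l + b * k)%C. intros eps he.
  set (A := Cmod a + Cmod b + Cmod l + Cmod k + 2).
  assert (pa := Cmod_ge_0 a). assert (pb := Cmod_ge_0 b). assert (pl := Cmod_ge_0 l). assert (pk := Cmod_ge_0 k).
  destruct (H (eps / 2 / A)) as [d [hd Hd]]. { apply Rdiv_lt_0_compat; unfold A; lra. }
  destruct (cdiff_lip u z l hu) as [d1 [hd1 H1]]. destruct (cdiff_lip v z k hv) as [d2 [hd2 H2]].
  destruct (hu (eps / 2 / A)) as [d3 [hd3 H3]]. { apply Rdiv_lt_0_compat; unfold A; lra. }
  destruct (hv (eps / 2 / A)) as [d4 [hd4 H4]]. { apply Rdiv_lt_0_compat; unfold A; lra. }
  set (d5 := d / A). assert (hd5 : 0 < d5) by (apply Rdiv_lt_0_compat; unfold A; lra).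
  exists (Rmin (Rmin d1 d2) (Rmin (Rmin d3 d4) d5)). split; [repeat apply Rmin_glb_lt; auto|].
  intros z' hz.
  assert (Cmod (z' - z) < d1 /\ Cmod (z' - z) < d2 /\ Cmod (z' - z) < d3 /\ Cmod (z' - z) < d4 /\ Cmod (z' - z) < d5) as (a1 & a2 & a3 & a4 & a5).
  { generalize (Rmin_l (Rmin d1 d2) (Rmin (Rmin d3 d4) d5)) (Rmin_r (Rmin d1 d2) (Rmin (Rmin d3 d4) d5))
      (Rmin_l d1 d2) (Rmin_r d1 d2) (Rmin_l (Rmin d3 d4) d5) (Rmin_r (Rmin d3 d4) d5) (Rmin_l d3 d4) (Rmin_r d3 d4).
    intros. repeat split; lra. }
  specialize (H1 z' a1). specialize (H2 z' a2). specialize (H3 z' a3). specialize (H4 z' a4).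
  set (h := Cmod (z' - z)) in *. assert (ph : 0 <= h) by apply Cmod_ge_0.
  assert (hA : 0 < A) by (unfold A; lra).
  assert (a5' : A * h < d). { apply Rmult_lt_compat_l with (r := A) in a5; auto. unfold d5 in a5. replace (A * (d / A)) with d in a5 by (field; lra). exact a5. }
  specialize (Hd (u z') (v z')).
  assert (e1 : Cmod (u z' - u z) < d) by (unfold A in a5'; nra).
  assert (e2 : Cmod (v z' - v z) < d) by (unfold A in a5'; nra).
  specialize (Hd e1 e2).
  replace (f (u z') (v z') - f (u z) (v z) - (a * l + b * k) * (z' - z))%C with
   ((f (u z') (v z') - f (u z) (v z) - a * (u z' - u z) - b * (v z' - v z)) + a * (u z' - u z - l * (z' - z)) + b * (v z' - v z - k * (z' - z)))%C by ring.
  eapply Rle_trans; [apply Cmod_triangle|]. eapply Rle_trans; [apply Rplus_le_compat_r, Cmod_triangle|].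
  rewrite !Cmod_mult.
  set (e := eps / 2 / A) in *. assert (pe : 0 < e) by (apply Rdiv_lt_0_compat; lra).
  assert (E : e * A = eps / 2) by (unfold e; field; lra).
  assert (Cmod (f (u z') (v z') - f (u z) (v z) - a * (u z' - u z) - b * (v z' - v z)) <= e * ((Cmod l + Cmod k + 2) * h)).
  { eapply Rle_trans; [apply Hd|]. apply Rmult_le_compat_l; lra. }
  assert (Cmod a * Cmod (u z' - u z - l * (z' - z)) <= Cmod a * (e * h)) by (apply Rmult_le_compat_l; auto).
  assert (Cmod b * Cmod (v z' - v z - k * (z' - z)) <= Cmod b * (e * h)) by (apply Rmult_le_compat_l; auto).
  assert (S : (Cmod l + Cmod k + 2) + Cmod a + Cmod b = A) by (unfold A; ring).
  apply Rle_trans with (e * A * h); [rewrite <- S; lra|]. rewrite E. nra.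
Qed.

Lemma fdiff_x f x y : fdiff f x y -> cdble (fun t => f t y) x.
Proof. intro h. apply (fdiff_comp f (fun t => t) (fun _ => y)); auto. apply cdble_id. apply cdble_const. Qed.
Lemma fdiff_y f x y : fdiff f x y -> cdble (fun t => f x t) y.
Proof. intro h. apply (fdiff_comp f (fun _ => x) (fun t => t)); auto. apply cdble_const. apply cdble_id. Qed.

Lemma fdiff_lip f x y : fdiff f x y -> exists K d, 0 < d /\ 0 <= K /\ forall x' y', Cmod (x' - x) < d -> Cmod (y' - y) < d ->
  Cmod (f x' y' - f x y) <= K * (Cmod (x' - x) + Cmod (y' - y)).
Proof.
  intros [a [b H]]. destruct (H 1 Rlt_0_1) as [d [hd Hd]].
  exists (Cmod a + Cmod b + 1), d. split; auto. assert (pa := Cmod_ge_0 a). assert (pb := Cmod_ge_0 b). split; [lra|].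
  intros x' y' hx hy. specialize (Hd x' y' hx hy).
  replace (f x' y' - f x y)%C with ((f x' y' - f x y - a * (x' - x) - b * (y' - y)) + a * (x' - x) + b * (y' - y))%C by ring.
  eapply Rle_trans; [apply Cmod_triangle|]. eapply Rle_trans; [apply Rplus_le_compat_r, Cmod_triangle|]. rewrite !Cmod_mult.
  generalize (Cmod_ge_0 (x' - x)) (Cmod_ge_0 (y' - y)). nra.
Qed.

(** The Cauchy estimate in each variable separately gives the Lipschitz bound. *)
Lemma lip2 (f : C -> C -> C) x0 y0 a b M x y x' y' : 0 < a -> 0 < b ->
  (forall u v, Cmod (u - x0) < a -> Cmod (v - y0) < b -> cdble (fun t => f t v) u /\ cdble (fun t => f u t) v /\ Cmod (f u v) <= M) ->
  Cmod (x - x0) <= a / 2 -> Cmod (x' - x0) <= a / 2 -> Cmod (y - y0) <= b / 2 -> Cmod (y' - y0) <= b / 2 ->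
  Cmod (f x y - f x' y') <= 8 * M * (Cmod (x - x') / a + Cmod (y - y') / b).
Proof.
  intros ha hb H h1 h2 h3 h4.
  eapply Rle_trans; [apply (Cmod_tri _ (f x' y))|].
  replace (8 * M * (Cmod (x - x') / a + Cmod (y - y') / b)) with (8 * M / a * Cmod (x - x') + 8 * M / b * Cmod (y - y')) by (field; lra).
  apply Rplus_le_compat.
  - apply (lip_disc (fun t => f t y) x0 a M); auto; intros z hz; apply (H z y); auto; lra.
  - apply (lip_disc (fun t => f x' t) y0 b M); auto; intros z hz; apply (H x' z); auto; lra.
Qed.

(** * Local inversion in one variable *)

Lemma banach_solve (G : C -> C) c rho z :
  (forall a b, Cmod (a - c) <= rho -> Cmod (b - c) <= rho -> Cmod (G a - G b - (a - b)) <= / 2 * Cmod (a - b)) ->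
  2 * Cmod (z - G c) <= rho -> exists a, Cmod (a - c) <= 2 * Cmod (z - G c) /\ G a = z.
Proof.
  intros H hz. set (e := Cmod (z - G c)) in *. assert (pe : 0 <= e) by apply Cmod_ge_0.
  (* The map a |-> a + z - G a is a contraction of factor 1/2, since G minus the identity is.
     Started at [c] it moves by at most 2e in all, hence never leaves the disc. *)
  set (u := fun n => Nat.iter n (fun a => a + (z - G a))%C c).
  assert (hu : forall n, Cmod (u n - c) <= 2 * e * (1 - (/ 2) ^ n) /\ Cmod (u (S n) - u n) <= e * (/ 2) ^ n).
  { induction n as [|n [IH1 IH2]].
    - simpl. rewrite Cmod_self. replace (c + (z - G c) - c)%C with (z - G c)%C by ring. fold e. lra.
    - assert (q : 0 < (/ 2) ^ n) by (apply pow_lt; lra). assert (q1 : (/ 2) ^ n <= 1).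
      { rewrite <- (pow1 n). apply pow_incr; lra. }
      assert (B : Cmod (u (S n) - c) <= 2 * e * (1 - (/ 2) ^ S n)).
      { generalize (Cmod_tri (u (S n)) (u n) c). simpl pow. nra. }
      split; [exact B|].
      change (u (S (S n))) with (u (S n) + (z - G (u (S n))))%C.
      assert (E : (u (S n) + (z - G (u (S n))) - u (S n) = - (G (u (S n)) - G (u n) - (u (S n) - u n)))%C).
      { assert (eS : (u (S n) - u n = z - G (u n))%C) by (change (u (S n)) with (u n + (z - G (u n)))%C; ring).
        rewrite eS. ring. }
      rewrite E, Cmod_opp. eapply Rle_trans; [apply H|].
      + eapply Rle_trans; [apply B|]. simpl pow. nra.
      + eapply Rle_trans; [apply IH1|]. nra.
      + simpl pow. lra. }
  destruct (geom_cauchy u e (/ 2)) as [a [ha1 ha2]]; auto; [lra|apply hu|].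
  exists a. assert (ha : Cmod (a - c) <= 2 * e).
  { specialize (ha2 O). simpl in ha2. replace (e / (1 - / 2) * 1) with (2 * e) in ha2 by field. exact ha2. }
  split; auto.
  assert (E : (G a - z)%C = 0%C).
  { apply Cmod_le0. apply (le_eps_mult _ _ 4); [lra|]. intros eps he.
    destruct (ha1 eps he) as [N HN].
    assert (h1 := HN N (le_n _)). assert (h2 := HN (S N) ltac:(lia)).
    replace (G a - z)%C with ((G a - G (u N) - (a - u N)) + (a - u (S N)))%C.
    2:{ change (u (S N)) with (u N + (z - G (u N)))%C. ring. }
    eapply Rle_trans; [apply Cmod_triangle|].
    rewrite (Cmod_swap a (u (S N))).
    assert (Cmod (G a - G (u N) - (a - u N)) <= / 2 * Cmod (a - u N)).
    { apply H; [lra|]. eapply Rle_trans; [apply hu|]. assert (0 < (/ 2) ^ N) by (apply pow_lt; lra). nra. }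
    rewrite (Cmod_swap a) in H0. lra. }
  replace (G a) with ((G a - z) + z)%C by ring. rewrite E. ring.
Qed.

(** This replaces the theorem that an injective holomorphic function has nonvanishing derivative: in
    the applications a linear lower bound is at hand anyway. *)
Lemma cdiff_lower (X : C -> C) a l c r : cdiff X a l -> 0 < r ->
  (forall u, Cmod (u - a) < r -> c * Cmod (u - a) <= Cmod (X u - X a)) -> c <= Cmod l.
Proof.
  intros hl hr H. apply (le_eps_mult _ _ 1); [lra|]. intros eps he.
  destruct (hl eps he) as [d [hd Hd]].
  set (s := Rmin (d / 2) (r / 2)). assert (hs : 0 < s) by (apply Rmin_glb_lt; lra).
  assert (s <= d / 2) by apply Rmin_l. assert (s <= r / 2) by apply Rmin_r.
  assert (e : (a + s - a)%C = s) by ring.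
  specialize (Hd (a + s)%C). specialize (H (a + s)%C). rewrite e in *. rewrite Cmod_RtoC in * by lra.
  specialize (Hd ltac:(lra)). specialize (H ltac:(lra)).
  assert (c * s <= (Cmod l + 1 * eps) * s).
  { eapply Rle_trans; [apply H|].
    replace (X (a + s)%C - X a)%C with ((X (a + s)%C - X a - l * s) + l * s)%C by ring.
    eapply Rle_trans; [apply Cmod_triangle|]. rewrite Cmod_mult, Cmod_RtoC by lra. lra. }
  apply Rmult_le_reg_r in H2; auto.
Qed.

Lemma open_map (X : C -> C) a r c : 0 < r -> 0 < c -> (forall u, Cmod (u - a) < r -> cdble X u) ->
  (forall u, Cmod (u - a) < r -> c * Cmod (u - a) <= Cmod (X u - X a)) ->
  exists s K, 0 < s /\ 0 < K /\ forall z, Cmod (z - X a) < s -> exists u, Cmod (u - a) < r /\ Cmod (u - a) <= K * Cmod (z - X a) /\ X u = z.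
Proof.
  intros hr hc hd hlow.
  destruct (hd a) as [l hl]; [rewrite Cmod_self; auto|].
  assert (hcl : c <= Cmod l) by (apply (cdiff_lower X a l c r); auto).
  destruct (cdiff_lip X a l hl) as [d [hdd Hd]].
  set (r1 := Rmin r d). assert (hr1 : 0 < r1) by (apply Rmin_glb_lt; auto).
  assert (r1r : r1 <= r) by apply Rmin_l. assert (r1d : r1 <= d) by apply Rmin_r.
  set (M := Cmod (X a) + (Cmod l + 1) * r1).
  assert (hM : forall u, Cmod (u - a) < r1 -> Cmod (X u) <= M).
  { intros u hu. specialize (Hd u ltac:(lra)). generalize (Cmod_tri_inv (X u) (X a)).
    assert ((Cmod l + 1) * Cmod (u - a) <= (Cmod l + 1) * r1) by (apply Rmult_le_compat_l; lra). unfold M. lra. }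
  assert (pM : 0 <= M). { eapply Rle_trans; [apply Cmod_ge_0|apply (hM a)]. rewrite Cmod_self; auto. }
  assert (nl : l <> 0%C) by (apply Cmod_gt_0; lra).
  (* Small enough for the constant 128 M rho / r1^2 of [taylor2] to be at most c/2, hence at most
     half of |l|; then X / l satisfies the hypothesis of [banach_solve]. *)
  set (rho := Rmin (r1 / 4) (c * (r1 * r1) / (256 * (M + 1)))).
  assert (hrho : 0 < rho). { apply Rmin_glb_lt; [lra|]. apply Rdiv_lt_0_compat; [|lra]. repeat apply Rmult_lt_0_compat; auto. }
  assert (rho1 : rho <= r1 / 4) by apply Rmin_l.
  assert (rho2 : rho <= c * (r1 * r1) / (256 * (M + 1))) by apply Rmin_r.
  set (G := fun u => (X u / l)%C).
  assert (HG : forall u v, Cmod (u - a) <= rho -> Cmod (v - a) <= rho -> Cmod (G u - G v - (u - v)) <= / 2 * Cmod (u - v)).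
  { intros u v hu hv. unfold G.
    replace (X u / l - X v / l - (u - v))%C with ((X u - X v - l * (u - v)) / l)%C by (field; auto).
    rewrite Cmod_div by auto.
    apply Rle_trans with ((128 * M * rho / (r1 * r1) * Cmod (u - v)) / Cmod l).
    - apply Rmult_le_compat_r; [left; apply Rinv_0_lt_compat; lra|].
      apply (taylor2 X a r1 M l rho); auto; try lra. intros z hz; apply hd; lra.
    - assert (p := Cmod_ge_0 (u - v)).
      apply Rle_trans with (c / 2 * Cmod (u - v) / Cmod l).
      + apply Rmult_le_compat_r; [left; apply Rinv_0_lt_compat; lra|]. apply Rmult_le_compat_r; auto.
        apply Rle_trans with (128 * (M + 1) * (c * (r1 * r1) / (256 * (M + 1))) / (r1 * r1)).
        * apply Rmult_le_compat_r; [left; apply Rinv_0_lt_compat; nra|]. apply Rmult_le_compat; lra.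
        * apply Req_le. field. lra.
      + apply Rle_trans with (Cmod l / 2 * Cmod (u - v) / Cmod l).
        * apply Rmult_le_compat_r; [left; apply Rinv_0_lt_compat; lra|]. apply Rmult_le_compat_r; lra.
        * apply Req_le; field; lra. }
  exists (c * rho / 2), (2 / c). split; [nra|]. split; [apply Rdiv_lt_0_compat; lra|].
  intros z hz.
  assert (e : (z / l - G a)%C = ((z - X a) / l)%C) by (unfold G; field; auto).
  assert (E : Cmod (z / l - G a) <= Cmod (z - X a) / c).
  { rewrite e, Cmod_div by auto. apply Rmult_le_compat_l; [apply Cmod_ge_0|]. apply Rinv_le_contravar; auto. }
  assert (E2 : Cmod (z - X a) / c < rho / 2).
  { apply Rmult_lt_reg_r with c; auto. replace (Cmod (z - X a) / c * c) with (Cmod (z - X a)) by (field; lra). lra. }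
  destruct (banach_solve G a rho (z / l)%C HG) as [u [hu1 hu2]]; [lra|].
  exists u. split; [lra|]. split.
  - replace (2 / c * Cmod (z - X a)) with (2 * (Cmod (z - X a) / c)) by (field; lra). lra.
  - unfold G in hu2. transitivity (X u / l * l)%C; [field; auto|]. rewrite hu2. field; auto.
Qed.

Lemma inv_cdble (X Y : C -> C) a s K : cdble X a -> 0 < s -> Y (X a) = a ->
  (forall z, Cmod (z - X a) < s -> X (Y z) = z /\ Cmod (Y z - a) <= K * Cmod (z - X a)) ->
  (exists c r, 0 < c /\ 0 < r /\ forall u, Cmod (u - a) < r -> c * Cmod (u - a) <= Cmod (X u - X a)) ->
  cdble Y (X a).
Proof.
  intros [l hl] hs e0 H [c [r [hc [hr hlow]]]].
  assert (hcl : c <= Cmod l) by (apply (cdiff_lower X a l c r); auto).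
  assert (nl : l <> 0%C) by (apply Cmod_gt_0; lra).
  assert (hK : 0 <= Rabs K) by apply Rabs_pos.
  exists (/ l)%C. intros eps he.
  destruct (hl (eps * Cmod l / (Rabs K + 1))) as [d [hd Hd]].
  { apply Rdiv_lt_0_compat; [|lra]. apply Rmult_lt_0_compat; lra. }
  exists (Rmin s (d / (Rabs K + 1))). split; [apply Rmin_glb_lt; auto; apply Rdiv_lt_0_compat; lra|].
  intros z hz.
  assert (h1 := Rlt_le_trans _ _ _ hz (Rmin_l _ _)). assert (h2 := Rlt_le_trans _ _ _ hz (Rmin_r _ _)).
  destruct (H z h1) as [e1 e2]. rewrite e0.
  assert (pz := Cmod_ge_0 (z - X a)).
  assert (e3 : Cmod (Y z - a) <= (Rabs K + 1) * Cmod (z - X a)).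
  { eapply Rle_trans; [apply e2|]. apply Rmult_le_compat_r; auto. generalize (Rle_abs K); lra. }
  assert (e4 : Cmod (Y z - a) < d).
  { eapply Rle_lt_trans; [apply e3|]. apply Rmult_lt_compat_l with (r := Rabs K + 1) in h2; [|lra].
    replace ((Rabs K + 1) * (d / (Rabs K + 1))) with d in h2 by (field; lra). exact h2. }
  specialize (Hd _ e4). rewrite e1 in Hd.
  replace (Y z - a - / l * (z - X a))%C with (- ((z - X a - l * (Y z - a)) / l))%C by (field; auto).
  rewrite Cmod_opp, Cmod_div by auto.
  apply Rle_trans with ((eps * Cmod l / (Rabs K + 1) * ((Rabs K + 1) * Cmod (z - X a))) / Cmod l).
  - apply Rmult_le_compat_r; [left; apply Rinv_0_lt_compat; lra|]. eapply Rle_trans; [apply Hd|].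
    apply Rmult_le_compat_l; auto. apply Rdiv_le_0_compat; [|lra]. apply Rmult_le_pos; lra.
  - apply Req_le; field; lra.
Qed.

(** * The logarithm *)

Definition slit (z : C) : Prop := 0 < Re z \/ Im z <> 0.

(** The argument comes from the half-angle formula tan (arg z / 2) = Im z / (|z| + Re z), a single
    expression valid on the whole slit plane. *)
Definition clog (z : C) : C := (ln (Cmod z), 2 * atan (Im z / (Cmod z + Re z))).

Lemma slit_pos z : slit z -> 0 < Cmod z + Re z /\ 0 < Cmod z.
Proof.
  intro h. assert (e := Cmod_sqr z). assert (p := Cmod_ge_0 z).
  assert (q := re_le_Cmod z). apply Rabs_le_between in q.
  destruct h as [h|h].
  - split; nra.
  - assert (0 < Im z * Im z) by (apply Rsqr_pos_lt in h; exact h). split; nra.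
Qed.

Lemma cexp_clog z : slit z -> cexp (clog z) = z.
Proof.
  intro h. destruct (slit_pos z h) as [h1 h2].
  unfold cexp, clog; cbn [Re Im fst snd]. rewrite exp_ln by auto.
  set (u := Im z / (Cmod z + Re z)).
  assert (e := Cmod_sqr z).
  assert (hc : cos (2 * atan u) = (1 - u * u) / (1 + u * u)).
  { rewrite cos_2a_cos. rewrite cos_atan.
    assert (0 < 1 + u²) by (unfold Rsqr; nra).
    replace (2 * (1 / sqrt (1 + u²)) * (1 / sqrt (1 + u²))) with (2 / (sqrt (1 + u²) * sqrt (1 + u²))).
    - rewrite sqrt_sqrt by lra. unfold Rsqr. field. nra.
    - field. apply Rgt_not_eq, sqrt_lt_R0; auto. }
  assert (hs : sin (2 * atan u) = 2 * u / (1 + u * u)).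
  { rewrite sin_2a, cos_atan, sin_atan.
    assert (0 < 1 + u²) by (unfold Rsqr; nra).
    replace (2 * (u / sqrt (1 + u²)) * (1 / sqrt (1 + u²))) with (2 * u / (sqrt (1 + u²) * sqrt (1 + u²))).
    - rewrite sqrt_sqrt by lra. unfold Rsqr. field. nra.
    - field. apply Rgt_not_eq, sqrt_lt_R0; auto. }
  rewrite hc, hs.
  assert (E : 1 + u * u = 2 * Cmod z / (Cmod z + Re z)).
  { unfold u. field_simplify_eq; [|lra]. nra. }
  rewrite E. rewrite (surjective_pairing z). apply injective_projections; cbn [fst snd].
  - change (fst z) with (Re z). replace (1 - u * u) with (2 - (1 + u * u)) by ring. rewrite E.
    rewrite <- surjective_pairing. field. lra.
  - change (snd z) with (Im z). unfold u. rewrite <- surjective_pairing. field. lra.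
Qed.

Lemma cont_R (f : C -> R) z : (forall eps, 0 < eps -> exists d, 0 < d /\ forall z', Cmod (z' - z) < d -> Rabs (f z' - f z) < eps) ->
  continuous (T := C_UniformSpace) (U := R_UniformSpace) f z.
Proof.
  intro H. apply (proj2 (filterlim_locally (U := R_UniformSpace) f (f z))). intros [eps he].
  destruct (H eps he) as [d [hd Hd]].
  assert (hd2 : 0 < d / 2) by lra. exists (mkposreal _ hd2). intros z' [b1 b2].
  unfold ball in *; simpl in *; unfold AbsRing_ball, abs, minus, plus, opp in *; simpl in *.
  apply Hd. eapply Rle_lt_trans; [apply Cmod_le_ReIm|].
  destruct z, z'. cbn in *. lra.
Qed.

Lemma cont_R_inv (f : C -> R) z : continuous (T := C_UniformSpace) (U := R_UniformSpace) f z ->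
  (forall eps, 0 < eps -> exists d, 0 < d /\ forall z', Cmod (z' - z) < d -> Rabs (f z' - f z) < eps).
Proof.
  intros H eps he. destruct (proj1 (filterlim_locally (U := R_UniformSpace) f (f z)) H (mkposreal eps he)) as [[d hd] Hd].
  exists d. split; auto. intros z' hz. apply Hd.
  assert (a1 := re_le_Cmod (z' - z)). assert (a2 := Cmod_im_le (z' - z)).
  destruct z, z'. cbn in *.
  split; unfold ball; simpl; unfold AbsRing_ball, abs, minus, plus, opp; simpl; lra.
Qed.

Lemma Re_sub (a b : C) : Re (a - b)%C = Re a - Re b.
Proof. destruct a, b; reflexivity. Qed.
Lemma Im_sub (a b : C) : Im (a - b)%C = Im a - Im b.
Proof. destruct a, b; reflexivity. Qed.
Lemma Re_add (a b : C) : Re (a + b)%C = Re a + Re b.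
Proof. destruct a, b; reflexivity. Qed.
Lemma Im_add (a b : C) : Im (a + b)%C = Im a + Im b.
Proof. destruct a, b; reflexivity. Qed.
Lemma Rabs_Cmod_sub (a b : C) : Rabs (Cmod a - Cmod b) <= Cmod (a - b).
Proof. apply Rabs_le. generalize (Cmod_tri_inv a b) (Cmod_tri_inv b a). rewrite (Cmod_swap b a). lra. Qed.

Lemma ccont_clog z : slit z -> ccont clog z.
Proof.
  intros h. destruct (slit_pos z h) as [h1 h2].
  assert (cm : continuous (T := C_UniformSpace) (U := R_UniformSpace) Cmod z).
  { apply cont_R. intros eps he. exists eps; split; auto. intros z' hz. eapply Rle_lt_trans; [apply Rabs_Cmod_sub|auto]. }
  assert (cr : continuous (T := C_UniformSpace) (U := R_UniformSpace) Re z).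
  { apply cont_R. intros eps he. exists eps; split; auto. intros z' hz. rewrite <- Re_sub. eapply Rle_lt_trans; [apply re_le_Cmod|auto]. }
  assert (ci : continuous (T := C_UniformSpace) (U := R_UniformSpace) Im z).
  { apply cont_R. intros eps he. exists eps; split; auto. intros z' hz. rewrite <- Im_sub. eapply Rle_lt_trans; [apply Cmod_im_le|auto]. }
  assert (c1 : continuous (T := C_UniformSpace) (U := R_UniformSpace) (fun z => Re (clog z)) z).
  { unfold clog; cbn [Re fst]. apply (continuous_comp Cmod ln); auto.
    apply continuity_pt_filterlim, derivable_continuous_pt. eexists. apply derivable_pt_lim_ln; auto. }
  assert (c2 : continuous (T := C_UniformSpace) (U := R_UniformSpace) (fun z => Im (clog z)) z).
  { unfold clog; cbn [Im snd]. apply (continuous_mult (K := R_AbsRing) (fun _ => 2)); [apply continuous_const|].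
    apply (continuous_comp (fun z => Im z / (Cmod z + Re z)) atan).
    - apply (continuous_mult (K := R_AbsRing)); auto. apply (continuous_comp (fun z => Cmod z + Re z) Rinv).
      + apply (continuous_plus (K := R_AbsRing) (V := R_NormedModule)); auto.
      + apply continuity_pt_filterlim. apply (continuity_pt_inv (fun x => x)); [apply derivable_continuous_pt, derivable_pt_id|lra].
    - apply continuity_pt_filterlim, derivable_continuous_pt, derivable_pt_atan. }
  intros eps he.
  destruct (cont_R_inv _ _ c1 (eps / 2)) as [d1 [hd1 H1]]; [lra|].
  destruct (cont_R_inv _ _ c2 (eps / 2)) as [d2 [hd2 H2]]; [lra|].
  exists (Rmin d1 d2). split; [apply Rmin_glb_lt; auto|]. intros z' hz.
  specialize (H1 z' (Rlt_le_trans _ _ _ hz (Rmin_l _ _))). specialize (H2 z' (Rlt_le_trans _ _ _ hz (Rmin_r _ _))).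
  eapply Rle_lt_trans; [apply Cmod_le_ReIm|]. rewrite Re_sub, Im_sub. lra.
Qed.

Lemma slit_open z : slit z -> exists d, 0 < d /\ forall z', Cmod (z' - z) < d -> slit z'.
Proof.
  intros [h|h].
  - exists (Re z). split; auto. intros z' hz. left.
    assert (q := re_le_Cmod (z' - z)). rewrite Re_sub in q. apply Rabs_le_between in q. lra.
  - exists (Rabs (Im z)). split; [apply Rabs_pos_lt; auto|]. intros z' hz. right. intro e.
    assert (q := Cmod_im_le (z' - z)). rewrite Im_sub, e in q.
    replace (0 - Im z) with (- Im z) in q by ring. rewrite Rabs_Ropp in q. lra.
Qed.

(** [clog] is a continuous right inverse of [cexp]. A first use of the derivative of [cexp], with
    error |z|/2, gives a Lipschitz bound for [clog] at z; a second one, with a fine error, gives the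
    derivative. *)
Lemma cdiff_clog z : slit z -> cdiff clog z (/ z)%C.
Proof.
  intros h eps he. destruct (slit_pos z h) as [_ h2].
  assert (nz : z <> 0%C) by (apply Cmod_gt_0; auto).
  assert (hcd := cdiff_cexp (clog z)). rewrite cexp_clog in hcd by auto.
  assert (hz2 : 0 < Cmod z / 2) by lra.
  destruct (hcd (Cmod z / 2) hz2) as [d0 [hd0 H0]].
  destruct (hcd (Cmod z * (eps * Cmod z / 2))) as [d1 [hd1 H1]]. { apply Rmult_lt_0_compat; auto. apply Rdiv_lt_0_compat; [nra|lra]. }
  destruct (ccont_clog z h (Rmin d0 d1)) as [d2 [hd2 H2]]; [apply Rmin_glb_lt; auto|].
  destruct (slit_open z h) as [d3 [hd3 H3]].
  exists (Rmin d2 d3). split; [apply Rmin_glb_lt; auto|]. intros z' hz.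
  specialize (H2 z' (Rlt_le_trans _ _ _ hz (Rmin_l _ _))).
  specialize (H3 z' (Rlt_le_trans _ _ _ hz (Rmin_r _ _))).
  specialize (H0 (clog z') (Rlt_le_trans _ _ _ H2 (Rmin_l _ _))).
  specialize (H1 (clog z') (Rlt_le_trans _ _ _ H2 (Rmin_r _ _))).
  rewrite !cexp_clog in H0, H1 by auto.
  set (L := (clog z' - clog z)%C) in *.
  assert (b : Cmod L <= 2 / Cmod z * Cmod (z' - z)).
  { assert (Cmod z * Cmod L <= Cmod (z' - z) + Cmod z / 2 * Cmod L).
    { rewrite <- Cmod_mult. generalize (Cmod_tri_inv (z * L) (z' - z)). rewrite (Cmod_swap (z * L)). lra. }
    apply Rmult_le_reg_l with (Cmod z / 2); auto. replace (Cmod z / 2 * (2 / Cmod z * Cmod (z' - z))) with (Cmod (z' - z)) by (field; lra). lra. }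
  replace (L - / z * (z' - z))%C with (- ((z' - z - z * L) / z))%C by (field; auto).
  rewrite Cmod_opp, Cmod_div by auto.
  apply Rle_trans with ((Cmod z * (eps * Cmod z / 2) * (2 / Cmod z * Cmod (z' - z))) / Cmod z).
  - apply Rmult_le_compat_r; [left; apply Rinv_0_lt_compat; auto|]. eapply Rle_trans; [apply H1|].
    apply Rmult_le_compat_l; auto. apply Rmult_le_pos; [lra|]. apply Rdiv_le_0_compat; [nra|lra].
  - apply Req_le. field. lra.
Qed.

Lemma clog_lip a b k : 0 < k -> (forall t : R, 0 <= t <= 1 -> slit (a + t * (b - a))%C /\ k <= Cmod (a + t * (b - a))) ->
  Cmod (clog b - clog a) <= / k * Cmod (b - a).
Proof.
  intros hk H. apply mean_value; [left; apply Rinv_0_lt_compat; auto|]. intros t ht.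
  destruct (H t ht) as [h1 h2]. exists (/ (a + t * (b - a)))%C. split; [apply cdiff_clog; auto|].
  rewrite Cmod_inv by (apply Cmod_gt_0; lra). apply Rinv_le_contravar; auto.
Qed.

(** * Roots of unity *)

Lemma root_of_unity_plus a b n : root_of_unity (a + b) n = (root_of_unity a n * root_of_unity b n)%C.
Proof.
  unfold root_of_unity. replace (2 * PI * IZR (a + b) / INR n) with (2 * PI * IZR a / INR n + 2 * PI * IZR b / INR n) by (rewrite plus_IZR; unfold Rdiv; ring).
  rewrite cos_plus, sin_plus. unfold Cmult. simpl. f_equal; ring.
Qed.

Lemma root_of_unity_0 n : root_of_unity 0 n = 1%C.
Proof. unfold root_of_unity. replace (2 * PI * IZR 0 / INR n) with 0 by (unfold Rdiv; ring). rewrite cos_0, sin_0. reflexivity. Qed.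

Lemma root_of_unity_pow a n k : (root_of_unity a n ^ k)%C = root_of_unity (a * Z.of_nat k) n.
Proof.
  induction k as [|k IH]; [rewrite Z.mul_0_r, root_of_unity_0; auto|]. simpl Cpow. rewrite IH, <- root_of_unity_plus. f_equal. lia.
Qed.

Lemma root_of_unity_mod a n : Cmod (root_of_unity a n) = 1.
Proof.
  apply Rsqr_inj; [apply Cmod_ge_0|lra|]. unfold Rsqr. rewrite Cmod_sqr. unfold root_of_unity. simpl.
  generalize (sin2_cos2 (2 * PI * IZR a / INR n)). unfold Rsqr. lra.
Qed.

Lemma root_of_unity_scale a n k : (1 <= n)%nat -> (1 <= k)%nat -> root_of_unity a n = root_of_unity (a * Z.of_nat k) (k * n).
Proof.
  intros hn hk. assert (1 <= INR n) by (apply (le_INR 1); auto). assert (1 <= INR k) by (apply (le_INR 1); auto).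
  unfold root_of_unity. replace (2 * PI * IZR (a * Z.of_nat k) / INR (k * n)) with (2 * PI * IZR a / INR n); auto.
  rewrite mult_INR, mult_IZR, <- INR_IZR_INZ. field. lra.
Qed.

Lemma cos_sin_1 t : cos t = 1 -> exists k : Z, t = 2 * PI * IZR k.
Proof.
  intro h. assert (s : sin (t / 2) = 0).
  { assert (Q := cos_2a_sin (t / 2)). replace (2 * (t / 2)) with t in Q by field. nra. }
  destruct (sin_eq_0_0 _ s) as [k hk]. exists k. lra.
Qed.

Lemma root_of_unity_eq_1 a n : (1 <= n)%nat -> root_of_unity a n = 1%C <-> (Z.of_nat n | a)%Z.
Proof.
  intro hn. assert (1 <= INR n) by (apply (le_INR 1); auto). split.
  - intro h. assert (c : cos (2 * PI * IZR a / INR n) = 1) by apply (f_equal fst h).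
    destruct (cos_sin_1 _ c) as [k hk]. exists k. apply eq_IZR. rewrite mult_IZR, <- INR_IZR_INZ.
    assert (pp := PI_RGT_0). apply (Rmult_eq_reg_l (2 * PI / INR n)); [|apply Rgt_not_eq, Rdiv_lt_0_compat; lra].
    transitivity (2 * PI * IZR a / INR n); [field; lra|]. rewrite hk. field; lra.
  - intros [k ->]. unfold root_of_unity. rewrite mult_IZR, <- INR_IZR_INZ.
    replace (2 * PI * (IZR k * INR n) / INR n) with (0 + 2 * IZR k * PI) by (field; lra).
    assert (sin (0 + 2 * IZR k * PI) = 0) as ->. { apply sin_eq_0_1. exists (2 * k)%Z. rewrite mult_IZR. ring. }
    replace (0 + 2 * IZR k * PI) with (2 * (IZR k * PI)) by ring. rewrite cos_2a_sin, (sin_eq_0_1 (IZR k * PI)) by (exists k; auto).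
    unfold RtoC. f_equal; ring.
Qed.

Lemma unit_arg (z : C) : Cmod z = 1 -> exists t, z = (cos t, sin t).
Proof.
  intro h. destruct (Rlt_dec 0 (Re z)) as [p|p].
  - exists (asin (Im z)). assert (s := Cmod_sqr z). rewrite h in s. destruct z as [x y]. simpl in *.
    rewrite sin_asin, cos_asin by (split; nra). f_equal. symmetry. replace (1 - y²) with (x * x) by (unfold Rsqr; lra). apply sqrt_square. lra.
  - exists (PI - asin (Im z)). assert (s := Cmod_sqr z). rewrite h in s. destruct z as [x y]. simpl in *.
    rewrite <- sin_PI_x at 1. assert (e : cos (PI - asin y) = - cos (asin y)) by (rewrite cos_minus, cos_PI, sin_PI; ring).
    rewrite e, sin_PI_x, sin_PI_x, sin_asin, cos_asin by (split; nra). f_equal.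
    replace (1 - y²) with ((- x) * (- x)) by (unfold Rsqr; lra). rewrite sqrt_square by lra. ring.
Qed.

Lemma root_of_unity_all n th : (1 <= n)%nat -> (th ^ n = 1)%C -> exists k, th = root_of_unity k n.
Proof.
  intros hn h. assert (pn : 1 <= INR n) by (apply (le_INR 1); auto).
  assert (mt : Cmod th = 1).
  { assert (Q := f_equal Cmod h). rewrite Cmod_pow, Cmod_1 in Q. assert (p := Cmod_ge_0 th).
    destruct (Rtotal_order (Cmod th) 1) as [l|[e|g]]; auto; exfalso.
    - assert (Cmod th ^ n < 1); [|lra]. destruct n as [|n]; [lia|]. simpl.
      assert (Cmod th ^ n <= 1) by (rewrite <- (pow1 n); apply pow_incr; lra). assert (0 <= Cmod th ^ n) by (apply pow_le; auto). nra.
    - assert (1 < Cmod th ^ n) by (apply Rlt_pow_R1; auto; lia). lra. }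
  destruct (unit_arg th mt) as [t ->].
  assert (P : forall k, ((cos t, sin t) ^ k)%C = (cos (INR k * t), sin (INR k * t))).
  { induction k as [|k IH]; [simpl; rewrite Rmult_0_l, cos_0, sin_0; reflexivity|].
    simpl Cpow. rewrite IH, S_INR. replace ((INR k + 1) * t) with (t + INR k * t) by ring. rewrite cos_plus, sin_plus. unfold Cmult. simpl. f_equal; ring. }
  rewrite P in h. destruct (cos_sin_1 (INR n * t) (f_equal fst h)) as [k hk]. exists k. unfold root_of_unity.
  replace (2 * PI * IZR k / INR n) with t; auto. rewrite <- hk. field. lra.
Qed.

(** Since lam = om^(p nu), the root om^i lam^j has exponent i + nu p j modulo nu q. Thus i is the
    exponent modulo nu, and j solves p j = l modulo q for the quotient l, which is possible in
    exactly one way because p is invertible modulo q. Multiplication by lam moves j and fixes i, so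
    i numbers the cycles and j the petals of a cycle. *)
Lemma leaf_index p q nu : (1 <= q)%nat -> (1 <= nu)%nat -> Z.gcd p (Z.of_nat q) = 1%Z ->
  let om := root_of_unity 1 (nu * q) in let lam := root_of_unity p q in
  (forall th, (th ^ (nu * q) = 1)%C <-> exists i j, (i < nu)%nat /\ (j < q)%nat /\ th = (om ^ i * lam ^ j)%C) /\
  (forall i j i' j', (i < nu)%nat -> (j < q)%nat -> (i' < nu)%nat -> (j' < q)%nat -> (om ^ i * lam ^ j = om ^ i' * lam ^ j')%C -> i = i' /\ j = j').
Proof.
  intros hq hnu hg om lam. assert (hm : (1 <= nu * q)%nat) by nia.
  assert (el : lam = root_of_unity (p * Z.of_nat nu) (nu * q)) by (apply root_of_unity_scale; auto).
  assert (E : forall i j, (om ^ i * lam ^ j)%C = root_of_unity (Z.of_nat i + p * Z.of_nat nu * Z.of_nat j) (nu * q)).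
  { intros i j. rewrite el. unfold om. rewrite !root_of_unity_pow, <- root_of_unity_plus. f_equal. lia. }
  assert (S : forall a b, root_of_unity a (nu * q) = root_of_unity b (nu * q) <-> (Z.of_nat (nu * q) | a - b)%Z).
  { intros a b. rewrite <- (root_of_unity_eq_1 _ _ hm). replace a with (b + (a - b))%Z at 1 by lia. rewrite root_of_unity_plus.
    assert (n : root_of_unity b (nu * q) <> 0%C) by (apply Cmod_gt_0; rewrite root_of_unity_mod; lra). split; intro h.
    - transitivity (/ root_of_unity b (nu * q) * (root_of_unity b (nu * q) * root_of_unity (a - b) (nu * q)))%C; [field; auto|rewrite h; field; auto].
    - rewrite h. ring. }
  split.
  - intro th. split.
    + intro h. destruct (root_of_unity_all _ _ hm h) as [k ->].
      set (N := Z.of_nat nu). set (Q := Z.of_nat q). assert (pN : (0 < N)%Z) by (unfold N; lia). assert (pQ : (0 < Q)%Z) by (unfold Q; lia).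
      destruct (rel_prime_bezout p Q) as [u v huv]; [apply Zgcd_1_rel_prime; auto|].
      set (l := (k / N)%Z). assert (dk := Z.div_mod k N ltac:(lia)). fold l in dk. assert (bk := Z.mod_pos_bound k N pN).
      assert (bj := Z.mod_pos_bound (u * l) Q pQ). assert (dj := Z.div_mod (u * l) Q ltac:(lia)).
      set (J := ((u * l) mod Q)%Z) in *. set (d := (u * l / Q)%Z) in *. set (i := (k mod N)%Z) in *.
      exists (Z.to_nat i), (Z.to_nat J). repeat split; [unfold N in *; lia|unfold Q in *; lia|].
      rewrite E. apply S. rewrite !Z2Nat.id by lia. fold N. exists (p * d + v * l)%Z.
      rewrite Nat2Z.inj_mul. fold N Q. clearbody l i J d.
      assert (e : (l - p * J = Q * (p * d + v * l))%Z).
      { transitivity ((u * p + v * Q) * l - p * J)%Z; [rewrite huv; ring|]. transitivity (p * (u * l) + v * Q * l - p * J)%Z; [ring|]. rewrite dj. ring. }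
      rewrite dk. transitivity (N * (l - p * J))%Z; [ring|]. rewrite e. ring.
    + intros (i & j & _ & _ & ->). rewrite E, root_of_unity_pow. apply root_of_unity_eq_1; auto. exists (Z.of_nat i + p * Z.of_nat nu * Z.of_nat j)%Z. lia.
  - intros i j i' j' hi hj hi' hj' h. rewrite !E in h. apply S in h. destruct h as [k hk].
    assert (e1 : (Z.of_nat nu | Z.of_nat i - Z.of_nat i')%Z).
    { exists (k * Z.of_nat q - p * (Z.of_nat j - Z.of_nat j'))%Z. rewrite Nat2Z.inj_mul in hk. lia. }
    assert (ei : i = i'). { destruct e1 as [c hc]. assert (c = 0%Z) by nia. nia. }
    split; auto. subst i'.
    assert (e2 : (Z.of_nat q | p * (Z.of_nat j - Z.of_nat j'))%Z). { exists k. rewrite Nat2Z.inj_mul in hk. nia. }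
    apply Gauss in e2; [|apply Zgcd_1_rel_prime; rewrite Z.gcd_comm; auto]. destruct e2 as [c hc]. assert (c = 0%Z) by nia. nia.
Qed.

(** * Backward orbits near infinity *)

(** The coordinate [w = -1/(m x^m)], in which the map is close to [w + 1]. *)
Definition wof (m : nat) (x : C) : C := (- / (INR m * x ^ m))%C.
Definition gof (m : nat) (fx : C -> C -> C) (x y : C) : C := (wof m (fx x y) - wof m x - 1)%C.

(** The factor |x| in [g_by] reflects that the line x = 0 is mapped linearly by the normal form; the
    factor |x| + |y| requires the linear part to be diagonal already. *)
Record germ (m : nat) (lam mu : C) (fx fy : C -> C -> C) (rho K : R) : Prop := {
  g_m : (1 <= m)%nat;
  g_lam : Cmod lam = 1;
  g_lamm : (lam ^ m = 1)%C;
  g_mu : Cmod mu < 1;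
  g_rho : 0 < rho;
  g_K : 0 <= K;
  g_fx : forall x y, Cmod x < rho -> Cmod y < rho -> fdiff fx x y;
  g_fy : forall x y, Cmod x < rho -> Cmod y < rho -> fdiff fy x y;
  g_bx : forall x y, Cmod x < rho -> Cmod y < rho ->
    Cmod (fx x y - lam * (x * (1 + x ^ m))) <= K * Cmod x ^ (2 * m + 1);
  g_by : forall x y, Cmod x < rho -> Cmod y < rho ->
    Cmod (fy x y - mu * y) <= K * (Cmod x * (Cmod x + Cmod y)) }.

(** These are the estimates used by the orbit theory at scale [rho]. The slopes gam (1 - |mu|)/16
    leave room for the cone of aperture [gam] to be respected. The constant 64 m in [d_x] keeps one
    step from changing the m-th root. In [d_dg] the increment of x is measured relative to |x|,
    since [gof] lives on the punctured disc. *)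
Record dyn (m : nat) (lam mu : C) (fx fy : C -> C -> C) (rho gam Kg : R) : Prop := {
  d_m : (1 <= m)%nat;
  d_lam : Cmod lam = 1;
  d_lamm : (lam ^ m = 1)%C;
  d_mu : Cmod mu < 1;
  d_rho : 0 < rho <= 1;
  d_gam : 0 < gam <= 1;
  d_Kg : 1 <= Kg;
  d_small : Kg * rho <= / 100;
  d_fx : forall x y, Cmod x < rho -> Cmod y < rho -> fdiff fx x y;
  d_fy : forall x y, Cmod x < rho -> Cmod y < rho -> fdiff fy x y;
  d_y0 : fy 0 0 = 0%C;
  d_lx : forall x y x' y', Cmod x < rho -> Cmod y < rho -> Cmod x' < rho -> Cmod y' < rho ->
    Cmod (fx x y - fx x' y' - lam * (x - x')) <= gam * (1 - Cmod mu) / 16 * (Cmod (x - x') + Cmod (y - y'));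
  d_ly : forall x y x' y', Cmod x < rho -> Cmod y < rho -> Cmod x' < rho -> Cmod y' < rho ->
    Cmod (fy x y - fy x' y' - mu * (y - y')) <= gam * (1 - Cmod mu) / 16 * (Cmod (x - x') + Cmod (y - y'));
  d_x : forall x y, Cmod x < rho -> Cmod y < rho -> Cmod (fx x y - lam * x) <= Cmod x / (64 * INR m);
  d_g : forall x y, Cmod x < rho -> Cmod y < rho -> x <> 0%C -> Cmod (gof m fx x y) <= Kg * Cmod x ^ m;
  d_dg : forall x y x' y', Cmod x < rho -> Cmod y < rho -> x <> 0%C -> Cmod y' < rho ->
    Cmod (x' - x) <= Cmod x / 4 ->
    Cmod (gof m fx x' y' - gof m fx x y) <= Kg * (Cmod x ^ m * (Cmod (x' - x) / Cmod x + Cmod (y' - y))) }.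

Lemma pow_le_1 a n : 0 <= a <= 1 -> (1 <= n)%nat -> a ^ n <= a.
Proof.
  intros ha hn. destruct n as [|n]; [lia|]. simpl.
  assert (a ^ n <= 1) by (rewrite <- (pow1 n); apply pow_incr; lra). nra.
Qed.

Lemma one_pow_expand (m : nat) : exists Q0, 0 <= Q0 /\ forall s : C, Cmod s <= 1 -> exists Q : C,
  ((1 + s) ^ m = 1 + INR m * s + s * s * Q)%C /\ Cmod Q <= Q0.
Proof.
  induction m as [|m [Q0 [h0 IH]]].
  - exists 0; split; [lra|]. intros s hs. exists 0%C. split; [simpl; ring|rewrite Cmod_0; lra].
  - exists (Q0 * 2 + INR m). split; [pose proof (pos_INR m); lra|].
    intros s hs. destruct (IH s hs) as [Q [e1 e2]]. exists (Q * (1 + s) + INR m)%C. split.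
    + cbn [Cpow]. rewrite e1, S_INR, RtoC_plus. ring.
    + eapply Rle_trans; [apply Cmod_triangle|]. rewrite Cmod_mult, Cmod_RtoC by apply pos_INR.
      assert (Cmod (1 + s) <= 2). { eapply Rle_trans; [apply Cmod_triangle|]. rewrite Cmod_1; lra. }
      generalize (Cmod_ge_0 Q) (Cmod_ge_0 (1 + s)). nra.
Qed.

Lemma wof_neq (m : nat) (x : C) : (1 <= m)%nat -> x <> 0%C -> (INR m * x ^ m)%C <> 0%C.
Proof.
  intros hm hx. apply Cmod_gt_0. rewrite Cmod_mult, Cmod_pow, Cmod_RtoC by apply pos_INR.
  apply Rmult_lt_0_compat; [apply lt_0_INR; lia|]. apply pow_lt, Cmod_gt_0, hx.
Qed.

Lemma wof_mod (m : nat) (x : C) : (1 <= m)%nat -> x <> 0%C -> Cmod (wof m x) = / (INR m * Cmod x ^ m).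
Proof.
  intros hm hx. unfold wof. rewrite Cmod_opp, Cmod_inv by (apply wof_neq; auto).
  rewrite Cmod_mult, Cmod_pow, Cmod_RtoC by apply pos_INR. reflexivity.
Qed.

Section Germ.
Context (m : nat) (lam mu : C) (fx fy : C -> C -> C) (rho K : R) (G : germ m lam mu fx fy rho K).

Lemma germ_x : exists r0, 0 < r0 <= 1 /\ r0 <= rho /\ forall x y, Cmod x <= r0 -> Cmod x < rho -> Cmod y < rho ->
   Cmod (fx x y - lam * x) <= Cmod x / (64 * INR m) /\ Cmod (fx x y - lam * x) <= (1 + K) * (Cmod x * Cmod x).
Proof.
  destruct G as [hm hl hlm hmu hrho hK _ _ hbx _].
  assert (pm : 1 <= INR m) by (change 1 with (INR 1); apply le_INR; auto).
  set (r0 := Rmin (Rmin rho 1) (/ (64 * INR m * (1 + K)))).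
  assert (q : 0 < 64 * INR m * (1 + K)) by nra.
  assert (0 < r0). { apply Rmin_glb_lt; [apply Rmin_glb_lt; lra|apply Rinv_0_lt_compat; auto]. }
  assert (r0 <= Rmin rho 1) by apply Rmin_l. assert (Rmin rho 1 <= rho) by apply Rmin_l. assert (Rmin rho 1 <= 1) by apply Rmin_r.
  assert (r0 <= / (64 * INR m * (1 + K))) by apply Rmin_r.
  exists r0. split; [lra|]. split; [lra|]. intros x y hx hx' hy.
  assert (px := Cmod_ge_0 x).
  assert (B : Cmod (fx x y - lam * x) <= (1 + K) * (Cmod x * Cmod x)).
  { replace (fx x y - lam * x)%C with ((fx x y - lam * (x * (1 + x ^ m))) + lam * (x * x ^ m))%C by ring.
    eapply Rle_trans; [apply Cmod_triangle|]. rewrite !Cmod_mult, Cmod_pow, hl.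
    assert (Cmod x ^ (2 * m + 1) <= Cmod x * Cmod x).
    { replace (2 * m + 1)%nat with (S (2 * m)) by lia. simpl pow. apply Rmult_le_compat_l; auto. apply pow_le_1; [lra|lia]. }
    assert (Cmod x ^ m <= Cmod x) by (apply pow_le_1; [lra|lia]).
    specialize (hbx x y hx' hy).
    assert (K * Cmod x ^ (2 * m + 1) <= K * (Cmod x * Cmod x)) by (apply Rmult_le_compat_l; auto).
    assert (Cmod x * Cmod x ^ m <= Cmod x * Cmod x) by (apply Rmult_le_compat_l; auto). lra. }
  split; auto. eapply Rle_trans; [apply B|].
  assert ((1 + K) * Cmod x <= / (64 * INR m)).
  { apply Rle_trans with ((1 + K) * / (64 * INR m * (1 + K))); [apply Rmult_le_compat_l; lra|]. apply Req_le; field; lra. }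
  unfold Rdiv. replace ((1 + K) * (Cmod x * Cmod x)) with (Cmod x * ((1 + K) * Cmod x)) by ring.
  apply Rmult_le_compat_l; auto.
Qed.

(** Put X = x^m and fx = lam x (1 + s) with s = X + e; the error e is O(X^2) because the normal form
    has no term between x^(m+1) and x^(2m+1). With v = (1 + s)^m and lam^m = 1, the quantity g
    equals ((v - 1)/(m X) - v)/v. The expansion of v has leading part 1 + m s, so the constants
    cancel and O(|X|) remains; the outer factor 2 in [K1] is for |v| >= 1/2. *)
Lemma germ_g : exists r0 K1, 0 < r0 <= 1 /\ r0 <= rho /\ 0 <= K1 /\ forall x y : C, x <> 0%C -> Cmod x <= r0 -> Cmod x < rho -> Cmod y < rho ->
   fx x y <> 0%C /\ Cmod (gof m fx x y) <= K1 * Cmod x ^ m.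
Proof.
  destruct germ_x as [r1 [hr1 [hr1' H1]]].
  destruct G as [hm hl hlm hmu hrho hK _ _ hbx _].
  assert (pm : 1 <= INR m) by (change 1 with (INR 1); apply le_INR; auto).
  destruct (one_pow_expand m) as [Q0 [hQ0 HQ]].
  assert (nl : lam <> 0%C) by (apply Cmod_gt_0; lra).
  set (c := 2 * INR m + 4 * Q0 + 1).
  set (r0 := Rmin r1 (/ (2 * c * (1 + K)))).
  assert (hc : 1 <= c) by (unfold c; lra).
  assert (q : 0 < 2 * c * (1 + K)) by nra.
  assert (0 < r0) by (apply Rmin_glb_lt; [lra|apply Rinv_0_lt_compat; auto]).
  assert (r0 <= r1) by apply Rmin_l. assert (hr0 : r0 <= / (2 * c * (1 + K))) by apply Rmin_r.
  exists r0, (2 * (K + 4 * Q0 + 2 * INR m + 4 * Q0)). split; [lra|]. split; [lra|]. split; [nra|].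
  intros x y nx hx hx' hy.
  assert (px : 0 < Cmod x) by (apply Cmod_gt_0; auto).
  destruct (H1 x y ltac:(lra) hx' hy) as [b1 _].
  split.
  { apply Cmod_gt_0. generalize (Cmod_tri_inv (lam * x) (lam * x - fx x y)).
    replace (lam * x - (lam * x - fx x y))%C with (fx x y) by ring. rewrite (Cmod_swap (lam * x)), Cmod_mult, hl.
    assert (Cmod x / (64 * INR m) <= Cmod x / 64).
    { apply Rmult_le_compat_l; [lra|]. apply Rinv_le_contravar; lra. } lra. }
  specialize (hbx x y hx' hy).
  set (X := (x ^ m)%C) in *. set (a := Cmod X). assert (ea : a = Cmod x ^ m) by apply Cmod_pow.
  assert (pa : 0 < a) by (rewrite ea; apply pow_lt; auto).
  assert (nX : X <> 0%C) by (apply Cmod_gt_0; auto).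
  assert (ax : a <= Cmod x) by (rewrite ea; apply pow_le_1; [lra|lia]).
  set (e := ((fx x y - lam * (x * (1 + X))) / (lam * x))%C).
  assert (he : Cmod e <= K * (a * a)).
  { unfold e. rewrite Cmod_div by (apply Cmult_neq_0; auto). rewrite Cmod_mult, hl, Rmult_1_l.
    apply Rmult_le_reg_r with (Cmod x); auto. unfold Rdiv. rewrite Rmult_assoc, Rinv_l, Rmult_1_r by lra.
    eapply Rle_trans; [apply hbx|]. apply Req_le. rewrite ea. replace (2 * m + 1)%nat with (m + m + 1)%nat by lia. rewrite !pow_add. ring. }
  set (s := (X + e)%C).
  assert (efx : fx x y = (lam * x * (1 + s))%C) by (unfold s, e; field; split; auto).
  assert (Ka : K * a <= 1 / 2).
  { apply Rle_trans with ((1 + K) * / (2 * c * (1 + K))). apply Rmult_le_compat; lra.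
    replace ((1 + K) * / (2 * c * (1 + K))) with (/ (2 * c)) by (field; lra). rewrite <- (Rmult_1_l (/ (2 * c))).
    apply Rmult_le_reg_r with (2 * c); [lra|]. rewrite Rmult_assoc, Rinv_l by lra. lra. }
  assert (hs : Cmod s <= 2 * a). { unfold s. eapply Rle_trans; [apply Cmod_triangle|]. fold a. nra. }
  assert (ca : c * a <= / 2).
  { apply Rle_trans with (c * / (2 * c * (1 + K))). apply Rmult_le_compat_l; lra.
    replace (c * / (2 * c * (1 + K))) with (/ 2 * / (1 + K)) by (field; lra).
    assert (/ (1 + K) <= / 1) by (apply Rinv_le_contravar; lra). rewrite Rinv_1 in *. lra. }
  assert (hs1 : Cmod s <= 1) by nra.
  destruct (HQ s hs1) as [Q [eQ hQ]].
  set (v := ((1 + s) ^ m)%C) in *.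
  assert (hv1 : Cmod (v - 1) <= c * a).
  { replace (v - 1)%C with (INR m * s + s * s * Q)%C by (rewrite eQ; ring).
    eapply Rle_trans; [apply Cmod_triangle|]. rewrite !Cmod_mult, Cmod_RtoC by apply pos_INR.
    assert (Cmod s * Cmod s <= 2 * a * (2 * a)) by (apply Rmult_le_compat; auto using Cmod_ge_0).
    assert (Cmod s * Cmod s * Cmod Q <= (4 * (a * a)) * Q0) by (apply Rmult_le_compat; auto using Cmod_ge_0; [generalize (Cmod_ge_0 s); nra|lra]).
    assert (INR m * Cmod s <= INR m * (2 * a)) by (apply Rmult_le_compat_l; lra).
    assert (a * a <= a) by nra. unfold c. nra. }
  assert (hv : / 2 <= Cmod v).
  { generalize (Cmod_tri_inv 1 (1 - v)). replace (1 - (1 - v))%C with v by ring. rewrite Cmod_1, Cmod_swap. lra. }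
  assert (nv : v <> 0%C) by (apply Cmod_gt_0; lra).
  assert (INR_m_neq_0 : RtoC (INR m) <> 0%C) by (apply Cmod_gt_0; rewrite Cmod_RtoC; lra).
  unfold gof, wof. rewrite efx, !Cpow_mult_l, hlm. fold X v.
  set (N := (e / X + s * s * Q / (INR m * X) - INR m * s - s * s * Q)%C).
  replace (- / (INR m * (1 * X * v)) - - / (INR m * X) - 1)%C with (N / v)%C.
  2:{ transitivity (((v - 1) / (INR m * X) - v) / v)%C; [|field; repeat split; auto].
      apply (f_equal (fun z => z / v)%C). unfold N. assert (ee : e = (s - X)%C) by (unfold s; ring). rewrite ee.
      rewrite eQ. field. split; auto. }
  rewrite Cmod_div by auto. rewrite <- ea.
  assert (hN : Cmod N <= (K + 4 * Q0 + 2 * INR m + 4 * Q0) * a).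
  { unfold N. eapply Rle_trans; [apply Cmod_sub|]. eapply Rle_trans; [apply Rplus_le_compat_r, Cmod_sub|].
    eapply Rle_trans; [apply Rplus_le_compat_r, Rplus_le_compat_r, Cmod_triangle|].
    rewrite !Cmod_div, !Cmod_mult, !Cmod_RtoC; auto using pos_INR. 2: apply Cmult_neq_0; auto. fold a.
    assert (Cmod s * Cmod s <= 2 * a * (2 * a)) by (apply Rmult_le_compat; auto using Cmod_ge_0).
    assert (hsQ : Cmod s * Cmod s * Cmod Q <= (4 * (a * a)) * Q0) by (apply Rmult_le_compat; auto using Cmod_ge_0; [generalize (Cmod_ge_0 s); nra|lra]).
    assert (INR m * Cmod s <= INR m * (2 * a)) by (apply Rmult_le_compat_l; lra).
    assert (Cmod e / a <= K * a).
    { apply Rmult_le_reg_r with a; auto. unfold Rdiv. rewrite Rmult_assoc, Rinv_l by lra. lra. }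
    assert (Cmod s * Cmod s * Cmod Q / (INR m * a) <= 4 * a * Q0).
    { apply Rmult_le_reg_r with (INR m * a); [nra|]. unfold Rdiv. rewrite Rmult_assoc, Rinv_l by nra.
      assert (0 <= a * a * Q0) by (apply Rmult_le_pos; nra). nra. }
    assert (a * a <= a) by nra. nra. }
  assert (pv : 0 < Cmod v) by lra.
  apply Rmult_le_reg_r with (Cmod v); auto. unfold Rdiv. rewrite Rmult_assoc, Rinv_l by lra. rewrite Rmult_1_r.
  eapply Rle_trans; [apply hN|].
  assert (0 <= (K + 4 * Q0 + 2 * INR m + 4 * Q0) * a) by (apply Rmult_le_pos; lra). nra.
Qed.
End Germ.

Lemma cdble_wof m f z : (1 <= m)%nat -> cdble f z -> f z <> 0%C -> cdble (fun t => wof m (f t)) z.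
Proof.
  intros hm hf nz. unfold wof. apply cdble_opp.
  apply (cdble_inv (fun t => INR m * f t ^ m)%C).
  - apply (cdble_mult (fun _ => RtoC (INR m))); [apply cdble_const|apply cdble_pow; auto].
  - apply wof_neq; auto.
Qed.

(** Bounds on size become Lipschitz bounds through [lip2]. The nonlinear parts are O(r^2) on the
    bidisc of radius 4r, so their slopes are O(r) and fall below the required e. For [gof] the disc
    of radius |x|/2 about x is used, where g is O(|x|^m). [Kg] does not depend on r, so every
    smaller radius works with it. *)
Lemma germ_dyn m lam mu fx fy rho K : germ m lam mu fx fy rho K -> forall gam, 0 < gam <= 1 ->
  exists r0 Kg, 0 < r0 /\ forall r, 0 < r <= r0 -> dyn m lam mu fx fy r gam Kg.
Proof.
  intros G gam hgam.
  destruct (germ_x m lam mu fx fy rho K G) as [r1 [hr1 [hr1' H1]]].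
  destruct (germ_g m lam mu fx fy rho K G) as [r2 [K1 [hr2 [hr2' [hK1 H2]]]]].
  destruct G as [hm hl hlm hmu hrho hK hfx hfy hbx hby].
  set (a := Rmin r1 r2 / 2).
  assert (pa : 0 < a). { unfold a. assert (0 < Rmin r1 r2) by (apply Rmin_glb_lt; lra). lra. }
  assert (ar1 : a < r1). { unfold a in *. generalize (Rmin_l r1 r2). lra. }
  assert (ar2 : a < r2). { unfold a in *. generalize (Rmin_r r1 r2). lra. }
  set (M0 := K1 * 2 ^ m). assert (pM0 : 0 <= M0) by (apply Rmult_le_pos; [auto|apply pow_le; lra]).
  set (Kg := 1 + K1 + 8 * M0 * 2 + 8 * M0 / a).
  assert (pKa : 0 <= 8 * M0 / a) by (apply Rdiv_le_0_compat; lra).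
  assert (hKg : 1 <= Kg) by (unfold Kg; lra).
  set (e := gam * (1 - Cmod mu) / 16). assert (he : 0 < e) by (unfold e; assert (0 < gam * (1 - Cmod mu)) by nra; lra).
  set (r0 := Rmin (a / 4) (Rmin (/ (100 * Kg)) (e / (64 * (1 + K))))).
  assert (p1 : 0 < / (100 * Kg)) by (apply Rinv_0_lt_compat; lra).
  assert (p2 : 0 < e / (64 * (1 + K))) by (apply Rdiv_lt_0_compat; lra).
  exists r0, Kg. split. { apply Rmin_glb_lt; [lra|apply Rmin_glb_lt; auto]. }
  intros r hr.
  assert (c1 : r <= a / 4). { generalize (Rmin_l (a / 4) (Rmin (/ (100 * Kg)) (e / (64 * (1 + K))))). fold r0. lra. }
  assert (c23 : r <= Rmin (/ (100 * Kg)) (e / (64 * (1 + K)))). { generalize (Rmin_r (a / 4) (Rmin (/ (100 * Kg)) (e / (64 * (1 + K))))). fold r0. lra. }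
  assert (c2 : r <= / (100 * Kg)). { eapply Rle_trans; [apply c23|apply Rmin_l]. }
  assert (c3 : r <= e / (64 * (1 + K))). { eapply Rle_trans; [apply c23|apply Rmin_r]. }
  assert (c3' : 64 * (1 + K) * r <= e).
  { apply Rmult_le_compat_l with (r := 64 * (1 + K)) in c3; [|lra]. replace (64 * (1 + K) * (e / (64 * (1 + K)))) with e in c3 by (field; lra). exact c3. }
  assert (z0 : Cmod 0 = 0) by apply Cmod_0.
  assert (lx : forall x y x' y', Cmod x < r -> Cmod y < r -> Cmod x' < r -> Cmod y' < r ->
    Cmod (fx x y - fx x' y' - lam * (x - x')) <= e * (Cmod (x - x') + Cmod (y - y'))).
  { intros x y x' y' h1 h2 h3 h4.
    replace (fx x y - fx x' y' - lam * (x - x'))%C with ((fun u v => fx u v - lam * u) x y - (fun u v => fx u v - lam * u) x' y')%C by (cbv beta; ring).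
    eapply Rle_trans; [apply (lip2 (fun u v => fx u v - lam * u)%C 0 0 (4 * r) (4 * r) (16 * (1 + K) * (r * r))); try lra|].
    - intros u v hu hv. replace (u - 0)%C with u in hu by ring. replace (v - 0)%C with v in hv by ring.
      assert (D : fdiff fx u v) by (apply hfx; lra).
      repeat split.
      + apply cdble_minus; [apply (fdiff_x fx); auto|]. apply (cdble_mult (fun _ => lam) (fun t => t)); [apply cdble_const|apply cdble_id].
      + apply cdble_minus; [apply (fdiff_y fx); auto|apply cdble_const].
      + eapply Rle_trans; [apply H1; lra|]. generalize (Cmod_ge_0 u). intro.
        assert (Cmod u * Cmod u <= 4 * r * (4 * r)) by (apply Rmult_le_compat; lra). nra.
    - replace (x - 0)%C with x by ring; lra.
    - replace (x' - 0)%C with x' by ring; lra.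
    - replace (y - 0)%C with y by ring; lra.
    - replace (y' - 0)%C with y' by ring; lra.
    - replace (8 * (16 * (1 + K) * (r * r)) * (Cmod (x - x') / (4 * r) + Cmod (y - y') / (4 * r))) with
        (32 * (1 + K) * r * (Cmod (x - x') + Cmod (y - y'))) by (field; lra).
      apply Rmult_le_compat_r; [generalize (Cmod_ge_0 (x - x')) (Cmod_ge_0 (y - y')); lra|nra]. }
  assert (ly : forall x y x' y', Cmod x < r -> Cmod y < r -> Cmod x' < r -> Cmod y' < r ->
    Cmod (fy x y - fy x' y' - mu * (y - y')) <= e * (Cmod (x - x') + Cmod (y - y'))).
  { intros x y x' y' h1 h2 h3 h4.
    replace (fy x y - fy x' y' - mu * (y - y'))%C with ((fun u v => fy u v - mu * v) x y - (fun u v => fy u v - mu * v) x' y')%C by (cbv beta; ring).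
    eapply Rle_trans; [apply (lip2 (fun u v => fy u v - mu * v)%C 0 0 (4 * r) (4 * r) (32 * (1 + K) * (r * r))); try lra|].
    - intros u v hu hv. replace (u - 0)%C with u in hu by ring. replace (v - 0)%C with v in hv by ring.
      assert (D : fdiff fy u v) by (apply hfy; lra).
      repeat split.
      + apply cdble_minus; [apply (fdiff_x fy); auto|apply cdble_const].
      + apply cdble_minus; [apply (fdiff_y fy); auto|]. apply (cdble_mult (fun _ => mu) (fun t => t)); [apply cdble_const|apply cdble_id].
      + eapply Rle_trans; [apply hby; lra|]. generalize (Cmod_ge_0 u) (Cmod_ge_0 v). intros.
        assert (Cmod u * (Cmod u + Cmod v) <= 4 * r * (8 * r)) by (apply Rmult_le_compat; lra). nra.
    - replace (x - 0)%C with x by ring; lra.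
    - replace (x' - 0)%C with x' by ring; lra.
    - replace (y - 0)%C with y by ring; lra.
    - replace (y' - 0)%C with y' by ring; lra.
    - replace (8 * (32 * (1 + K) * (r * r)) * (Cmod (x - x') / (4 * r) + Cmod (y - y') / (4 * r))) with
        (64 * (1 + K) * r * (Cmod (x - x') + Cmod (y - y'))) by (field; lra).
      apply Rmult_le_compat_r; [generalize (Cmod_ge_0 (x - x')) (Cmod_ge_0 (y - y')); lra|nra]. }
  constructor; auto; try lra.
  - apply Rle_trans with (Kg * / (100 * Kg)); [apply Rmult_le_compat_l; lra|]. apply Req_le; field; lra.
  - intros; apply hfx; lra.
  - intros; apply hfy; lra.
  - apply Cmod_le0. specialize (hby 0%C 0%C). rewrite z0 in hby. replace (fy 0 0 - mu * 0)%C with (fy 0%C 0%C) in hby by ring. specialize (hby hrho hrho). lra.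
  - intros; apply H1; lra.
  - intros x y hx hy nx. eapply Rle_trans; [apply H2; auto; lra|]. apply Rmult_le_compat_r; [apply pow_le, Cmod_ge_0|]. unfold Kg. lra.
  - intros x y x' y' hx hy nx hy' hxx.
    assert (px : 0 < Cmod x) by (apply Cmod_gt_0; auto).
    eapply Rle_trans; [apply (lip2 (gof m fx) x 0 (Cmod x / 2) a (M0 * Cmod x ^ m)); try lra|].
    + intros u v hu hv. replace (v - 0)%C with v in hv by ring.
      assert (hu1 : Cmod u <= 2 * Cmod x). { generalize (Cmod_tri_inv u x); lra. }
      assert (hu2 : 0 < Cmod u). { generalize (Cmod_tri_inv x u). rewrite (Cmod_swap x u); lra. }
      assert (nu : u <> 0%C) by (apply Cmod_gt_0; auto).
      assert (D : fdiff fx u v) by (apply hfx; lra).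
      destruct (H2 u v nu ltac:(lra) ltac:(lra) ltac:(lra)) as [nf bg].
      repeat split.
      * unfold gof. apply (cdble_minus (fun t => wof m (fx t v) - wof m t)%C); [|apply cdble_const].
        apply cdble_minus; [apply (cdble_wof m (fun t => fx t v)); auto; apply (fdiff_x fx); auto|apply (cdble_wof m (fun t => t)); auto; apply cdble_id].
      * unfold gof. apply (cdble_minus (fun t => wof m (fx u t) - wof m u)%C); [|apply cdble_const].
        apply cdble_minus; [apply (cdble_wof m (fun t => fx u t)); auto; apply (fdiff_y fx); auto|apply cdble_const].
      * eapply Rle_trans; [apply bg|]. unfold M0. rewrite Rmult_assoc. apply Rmult_le_compat_l; auto.
        rewrite <- Rpow_mult_distr. apply pow_incr; lra.
    + rewrite Cmod_self. lra.
    + replace (y' - 0)%C with y' by ring; lra.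
    + replace (y - 0)%C with y by ring; lra.
    + assert (q1 : 0 <= Cmod (x' - x) / Cmod x) by (apply Rdiv_le_0_compat; auto; apply Cmod_ge_0).
      assert (q2 : 0 <= Cmod (y' - y)) by apply Cmod_ge_0.
      assert (q3 : 0 < Cmod x ^ m) by (apply pow_lt; auto).
      replace (8 * (M0 * Cmod x ^ m) * (Cmod (x' - x) / (Cmod x / 2) + Cmod (y' - y) / a)) with
        (Cmod x ^ m * (8 * M0 * 2 * (Cmod (x' - x) / Cmod x) + 8 * M0 / a * Cmod (y' - y))) by (field; lra).
      match goal with |- _ <= Kg * (?P * ?Q) => replace (Kg * (P * Q)) with (P * (Kg * Q)) by ring end. apply Rmult_le_compat_l; [lra|].
      unfold Kg. nra.
Qed.

Lemma one_pow_lin (m : nat) (s : C) : INR m * Cmod s <= / 8 ->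
  Cmod ((1 + s) ^ m - 1 - INR m * s) <= INR m * INR m * (Cmod s * Cmod s).
Proof.
  induction m as [|m IH]; intro h.
  - simpl. replace (1 - 1 - 0 * s)%C with (RtoC 0) by ring. rewrite Cmod_0. lra.
  - rewrite S_INR in *. assert (p := pos_INR m). assert (q := Cmod_ge_0 s). specialize (IH ltac:(nra)).
    cbn [Cpow]. rewrite RtoC_plus.
    replace ((1 + s) * (1 + s) ^ m - 1 - (INR m + 1) * s)%C with (((1 + s) ^ m - 1 - INR m * s) * (1 + s) + INR m * (s * s))%C by ring.
    eapply Rle_trans; [apply Cmod_triangle|]. rewrite !Cmod_mult, Cmod_RtoC by auto.
    assert (b : Cmod (1 + s) <= 1 + Cmod s). { eapply Rle_trans; [apply Cmod_triangle|]. rewrite Cmod_1; lra. }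
    assert (Cmod ((1 + s) ^ m - 1 - INR m * s) * Cmod (1 + s) <= INR m * INR m * (Cmod s * Cmod s) * (1 + Cmod s)).
    { apply Rmult_le_compat; auto using Cmod_ge_0. }
    assert (0 <= Cmod s * Cmod s) by nra.
    assert (INR m * (INR m * Cmod s) * (Cmod s * Cmod s) <= INR m * / 8 * (Cmod s * Cmod s)).
    { apply Rmult_le_compat_r; auto. apply Rmult_le_compat_l; auto. nra. }
    nra.
Qed.

(** With t = (x' - x)/x one has w' = w (1 + t)^(-m), close to w (1 - m t). The two-sided bound
    converts distances between x and w; the second-order bound is needed where the direction of the
    displacement matters, in [exit_step]. *)
Lemma wof_ratio (m : nat) (x x' : C) : (1 <= m)%nat -> x <> 0%C -> Cmod (x' - x) <= Cmod x / (8 * INR m) ->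
  let s := Cmod (x' - x) / Cmod x in let w := wof m x in let w' := wof m x' in
  x' <> 0%C /\ INR m * s * Cmod w / 2 <= Cmod (w' - w) <= 2 * INR m * s * Cmod w /\
  Cmod (w' - w + INR m * w * ((x' - x) / x)) <= 3 * (INR m * INR m) * (s * s) * Cmod w.
Proof.
  intros hm hx hs s w w'.
  assert (pm : 1 <= INR m) by (change 1 with (INR 1); apply le_INR; auto).
  assert (px : 0 < Cmod x) by (apply Cmod_gt_0; auto).
  set (t := ((x' - x) / x)%C). assert (es : Cmod t = s) by (unfold t, s; apply Cmod_div; auto).
  assert (ps : 0 <= s) by (rewrite <- es; apply Cmod_ge_0).
  assert (b : INR m * s <= / 8).
  { unfold s. apply Rmult_le_reg_r with (Cmod x); auto. replace (INR m * (Cmod (x' - x) / Cmod x) * Cmod x) with (INR m * Cmod (x' - x)) by (field; lra).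
    apply Rmult_le_compat_l with (r := INR m) in hs; [|lra]. replace (INR m * (Cmod x / (8 * INR m))) with (/ 8 * Cmod x) in hs by (field; lra). exact hs. }
  assert (ex : x' = (x * (1 + t))%C) by (unfold t; field; auto).
  assert (L := one_pow_lin m t). rewrite es in L. specialize (L b).
  set (v := ((1 + t) ^ m)%C) in *.
  assert (B1 : Cmod (v - 1 - INR m * t) <= / 8 * (INR m * s)).
  { eapply Rle_trans; [apply L|]. replace (INR m * INR m * (s * s)) with ((INR m * s) * (INR m * s)) by ring. apply Rmult_le_compat_r; nra. }
  assert (cm : Cmod (INR m * t) = INR m * s) by (rewrite Cmod_mult, es, Cmod_RtoC; lra).
  assert (up : Cmod (v - 1) <= 9 / 8 * (INR m * s)).
  { replace (v - 1)%C with ((v - 1 - INR m * t) + INR m * t)%C by ring. eapply Rle_trans; [apply Cmod_triangle|]. lra. }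
  assert (lo : 7 / 8 * (INR m * s) <= Cmod (v - 1)).
  { generalize (Cmod_tri_inv (INR m * t) (- (v - 1 - INR m * t))). rewrite Cmod_opp.
    replace (INR m * t - - (v - 1 - INR m * t))%C with (v - 1)%C by ring. lra. }
  assert (v1 : Cmod v <= 1 + 9 / 64).
  { replace v with ((v - 1) + 1)%C by ring. eapply Rle_trans; [apply Cmod_triangle|]. rewrite Cmod_1. lra. }
  assert (v2 : 1 - 9 / 64 <= Cmod v).
  { generalize (Cmod_tri_inv 1 (- (v - 1))). replace (1 - - (v - 1))%C with v by ring. rewrite Cmod_1, Cmod_opp. lra. }
  assert (nv : v <> 0%C) by (apply Cmod_gt_0; lra).
  assert (nt : (1 + t)%C <> 0%C).
  { apply Cmod_gt_0. generalize (Cmod_tri_inv 1 (- t)). replace (1 - - t)%C with (1 + t)%C by ring. rewrite Cmod_1, Cmod_opp, es. nra. }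
  assert (nx' : x' <> 0%C) by (rewrite ex; apply Cmult_neq_0; auto).
  assert (nX : (x ^ m)%C <> 0%C) by (apply Cmod_gt_0; rewrite Cmod_pow; apply pow_lt; auto).
  assert (INR_m_neq_0 : RtoC (INR m) <> 0%C) by (apply Cmod_gt_0; rewrite Cmod_RtoC; lra).
  assert (ew : w' = (w / v)%C).
  { unfold w', w, wof. rewrite ex, Cpow_mult_l. fold v. field. repeat split; auto. }
  assert (pw : 0 <= Cmod w) by apply Cmod_ge_0.
  split; auto. split.
  - replace (w' - w)%C with (- (w * ((v - 1) / v)))%C by (rewrite ew; field; auto).
    rewrite Cmod_opp, Cmod_mult, Cmod_div by auto.
    assert (q1 : INR m * s / 2 <= Cmod (v - 1) / Cmod v).
    { apply Rmult_le_reg_r with (Cmod v); [lra|]. unfold Rdiv at 2. rewrite Rmult_assoc, Rinv_l, Rmult_1_r by lra. nra. }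
    assert (q2 : Cmod (v - 1) / Cmod v <= 2 * INR m * s).
    { apply Rmult_le_reg_r with (Cmod v); [lra|]. unfold Rdiv. rewrite Rmult_assoc, Rinv_l, Rmult_1_r by lra. nra. }
    split; nra.
  - replace (w' - w + INR m * w * t)%C with (w * ((- (v - 1 - INR m * t) + INR m * t * (v - 1)) / v))%C by (rewrite ew; field; auto).
    rewrite Cmod_mult, Cmod_div by auto.
    rewrite (Rmult_comm _ (Cmod w)). apply Rmult_le_compat_l; auto.
    apply Rmult_le_reg_r with (Cmod v); [lra|]. unfold Rdiv. rewrite Rmult_assoc, Rinv_l, Rmult_1_r by lra.
    eapply Rle_trans; [apply Cmod_triangle|]. rewrite Cmod_opp, Cmod_mult, cm.
    assert (INR m * s * Cmod (v - 1) <= INR m * s * (9 / 8 * (INR m * s))) by (apply Rmult_le_compat_l; nra).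
    assert (0 <= INR m * INR m * (s * s)) by (apply Rmult_le_pos; nra). nra.
Qed.

(** * Backward orbits: the horizontal cone and the comparison of two orbits *)

Section Dyn.
Context (m : nat) (lam mu : C) (fx fy : C -> C -> C) (rho gam Kg : R) (D : dyn m lam mu fx fy rho gam Kg).

(** The index grows into the past. Backward orbits are described by the forward map alone, so that
    the inverse is never estimated. *)
Definition orb (x y : nat -> C) : Prop := forall n,
  Cmod (x n) < rho /\ Cmod (y n) < rho /\ fx (x (S n)) (y (S n)) = x n /\ fy (x (S n)) (y (S n)) = y n.

Lemma orb_shift x y k : orb x y -> orb (fun n => x (n + k)%nat) (fun n => y (n + k)%nat).
Proof. intros h n. exact (h (n + k)%nat). Qed.

Let eps := gam * (1 - Cmod mu) / 16.

Lemma eps_bounds : 0 < eps /\ eps <= / 16 /\ 16 * eps <= 1 - Cmod mu /\ 16 * eps <= gam.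
Proof.
  destruct D. assert (pmu := Cmod_ge_0 mu). unfold eps.
  assert (0 < gam * (1 - Cmod mu)) by nra. assert (gam * (1 - Cmod mu) <= 1) by nra.
  repeat split; nra.
Qed.

(** If the difference at [S n] were in the horizontal cone, so would be its image at [n]: the
    forward map nearly preserves |x| and shrinks y by about |mu|, and 16 eps = gam (1 - |mu|)
    absorbs the errors. Outside that cone the vertical part dominates and grows backward. *)
Lemma cone_step x y x' y' n : orb x y -> orb x' y' ->
  gam * Cmod (x' n - x n) < Cmod (y' n - y n) ->
  gam * Cmod (x' (S n) - x (S n)) < Cmod (y' (S n) - y (S n)) /\ Cmod (y' n - y n) <= (1 + Cmod mu) / 2 * Cmod (y' (S n) - y (S n)).
Proof.
  intros h h' hv. destruct eps_bounds as (e0 & e1 & e2 & e3).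
  destruct (h n) as (_ & _ & f1 & f2). destruct (h' n) as (_ & _ & f1' & f2').
  destruct (h (S n)) as (a1 & a2 & _). destruct (h' (S n)) as (a1' & a2' & _).
  assert (L1 := d_lx _ _ _ _ _ _ _ _ D (x' (S n)) (y' (S n)) (x (S n)) (y (S n)) a1' a2' a1 a2).
  assert (L2 := d_ly _ _ _ _ _ _ _ _ D (x' (S n)) (y' (S n)) (x (S n)) (y (S n)) a1' a2' a1 a2).
  rewrite f1, f1' in L1. rewrite f2, f2' in L2. fold eps in L1, L2.
  set (a := Cmod (x' (S n) - x (S n))) in *. set (b := Cmod (y' (S n) - y (S n))) in *.
  assert (pa : 0 <= a) by apply Cmod_ge_0. assert (pb : 0 <= b) by apply Cmod_ge_0.
  assert (pmu := Cmod_ge_0 mu).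
  assert (X : a - eps * (a + b) <= Cmod (x' n - x n)).
  { generalize (Cmod_tri_inv (lam * (x' (S n) - x (S n))) (lam * (x' (S n) - x (S n)) - (x' n - x n))).
    replace (lam * (x' (S n) - x (S n)) - (lam * (x' (S n) - x (S n)) - (x' n - x n)))%C with (x' n - x n)%C by ring.
    rewrite Cmod_mult, (d_lam _ _ _ _ _ _ _ _ D), (Cmod_swap (lam * _)). fold a. lra. }
  assert (Y : Cmod (y' n - y n) <= Cmod mu * b + eps * (a + b)).
  { replace (y' n - y n)%C with ((y' n - y n - mu * (y' (S n) - y (S n))) + mu * (y' (S n) - y (S n)))%C by ring.
    eapply Rle_trans; [apply Cmod_triangle|]. rewrite Cmod_mult. fold b. lra. }
  assert (gg := d_gam _ _ _ _ _ _ _ _ D). assert (hmu := d_mu _ _ _ _ _ _ _ _ D).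
  assert (E16 : 16 * eps = gam * (1 - Cmod mu)) by (unfold eps; field).
  destruct (Rle_lt_dec b (gam * a)) as [k|k].
  - exfalso. assert (gam * (a - eps * (a + b)) < Cmod mu * b + eps * (a + b)).
    { eapply Rle_lt_trans; [|eapply Rlt_le_trans; [apply hv|apply Y]]. apply Rmult_le_compat_l; lra. }
    assert (gam * a <= a) by nra.
    assert (b <= a) by lra.
    assert (Cmod mu * b <= Cmod mu * (gam * a)) by (apply Rmult_le_compat_l; lra).
    assert (eps * (a + b) <= eps * (2 * a)) by (apply Rmult_le_compat_l; lra).
    assert (gam * (eps * (a + b)) <= eps * (2 * a)).
    { apply Rle_trans with (1 * (eps * (a + b))); [apply Rmult_le_compat_r; nra|lra]. }
    assert (gam * a - Cmod mu * (gam * a) = 16 * eps * a) by (rewrite E16; ring). nra.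
  - split; auto. eapply Rle_trans; [apply Y|].
    assert (16 * (eps * a) <= b).
    { assert (16 * (eps * a) = (1 - Cmod mu) * (gam * a)) by (rewrite <- Rmult_assoc, E16; ring). nra. }
    assert (16 * (eps * a) <= (1 - Cmod mu) * b).
    { assert (16 * (eps * a) = (1 - Cmod mu) * (gam * a)) by (rewrite <- Rmult_assoc, E16; ring). nra. }
    nra.
Qed.

(** Otherwise the difference of the orbits lies in the complementary vertical cone, which is mapped into itself and expanded
    by backward steps; but orbits are bounded. *)
Lemma orb_cone x y x' y' n : orb x y -> orb x' y' -> Cmod (y' n - y n) <= gam * Cmod (x' n - x n).
Proof.
  intros h h'. apply Rnot_lt_le. intro k.
  assert (pmu := Cmod_ge_0 mu). assert (hmu := d_mu _ _ _ _ _ _ _ _ D). assert (hr := d_rho _ _ _ _ _ _ _ _ D).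
  assert (gg := d_gam _ _ _ _ _ _ _ _ D).
  set (tau := (1 + Cmod mu) / 2) in *.
  assert (H : forall j, gam * Cmod (x' (n + j)%nat - x (n + j)%nat) < Cmod (y' (n + j)%nat - y (n + j)%nat) /\
     Cmod (y' n - y n) <= tau ^ j * Cmod (y' (n + j)%nat - y (n + j)%nat)).
  { induction j as [|j [I1 I2]].
    - rewrite Nat.add_0_r. simpl. split; auto; lra.
    - destruct (cone_step x y x' y' (n + j) h h' I1) as [J1 J2]. fold tau in J2.
      replace (n + S j)%nat with (S (n + j)) by lia. split; auto.
      simpl pow. assert (0 <= tau ^ j) by (apply pow_le; unfold tau; lra). nra. }
  assert (p : 0 < Cmod (y' n - y n)) by (generalize (Cmod_ge_0 (x' n - x n)); nra).
  destruct (pow_lt_1_zero tau ltac:(rewrite Rabs_pos_eq; unfold tau; lra) (Cmod (y' n - y n) / 2)) as [N HN]; [lra|].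
  specialize (HN N (le_n _)). rewrite Rabs_pos_eq in HN by (apply pow_le; unfold tau; lra).
  destruct (H N) as [_ H2]. assert (Cmod (y' (n + N)%nat - y (n + N)%nat) <= 2).
  { eapply Rle_trans; [apply Cmod_sub|]. destruct (h (n + N)%nat) as (_ & ? & _). destruct (h' (n + N)%nat) as (_ & ? & _). lra. }
  assert (0 <= tau ^ N) by (apply pow_le; unfold tau; lra). nra.
Qed.

Lemma orb_zero : orb (fun _ => 0%C) (fun _ => 0%C).
Proof.
  assert (hr := d_rho _ _ _ _ _ _ _ _ D).
  intros n. rewrite Cmod_0. repeat split; try lra.
  - apply Cmod_le0. assert (H := d_x _ _ _ _ _ _ _ _ D 0 0). rewrite Cmod_0 in H. specialize (H ltac:(lra) ltac:(lra)).
    replace (fx 0 0 - lam * 0)%C with (fx 0%C 0%C) in H by ring. unfold Rdiv in H. rewrite Rmult_0_l in H. exact H.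
  - exact (d_y0 _ _ _ _ _ _ _ _ D).
Qed.

Lemma orb_y_le x y n : orb x y -> Cmod (y n) <= gam * Cmod (x n).
Proof.
  intros h. generalize (orb_cone _ _ _ _ n orb_zero h).
  replace (y n - 0)%C with (y n) by ring. replace (x n - 0)%C with (x n) by ring. auto.
Qed.

(** If the first coordinates agree at [n], the estimate [d_lx] at [S n] bounds their difference
    there by eps times the sum of both differences. By the cone this is at most 2 eps times the
    difference itself, which must vanish. *)
Lemma orb_unique x y x' y' : orb x y -> orb x' y' -> x' O = x O -> forall n, x' n = x n /\ y' n = y n.
Proof.
  intros h h' e0. destruct eps_bounds as (e1 & e2 & _).
  assert (eqx : forall n, x' n = x n).
  { induction n as [|n IH]; auto.
    destruct (h n) as (_ & _ & f1 & f2). destruct (h' n) as (_ & _ & f1' & f2').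
    destruct (h (S n)) as (a1 & a2 & _). destruct (h' (S n)) as (a1' & a2' & _).
    assert (L1 := d_lx _ _ _ _ _ _ _ _ D (x' (S n)) (y' (S n)) (x (S n)) (y (S n)) a1' a2' a1 a2).
    rewrite f1, f1', IH in L1. fold eps in L1.
    replace (x n - x n - lam * (x' (S n) - x (S n)))%C with (- (lam * (x' (S n) - x (S n))))%C in L1 by ring.
    rewrite Cmod_opp, Cmod_mult, (d_lam _ _ _ _ _ _ _ _ D) in L1.
    assert (cc := orb_cone _ _ _ _ (S n) h h'). assert (gg := d_gam _ _ _ _ _ _ _ _ D).
    assert (p := Cmod_ge_0 (x' (S n) - x (S n))).
    assert (z : (x' (S n) - x (S n) = 0)%C).
    { apply Cmod_le0. assert (Cmod (y' (S n) - y (S n)) <= Cmod (x' (S n) - x (S n))) by nra. nra. }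
    replace (x' (S n)) with ((x' (S n) - x (S n)) + x (S n))%C by ring. rewrite z. ring. }
  intro n. split; auto.
  assert (cc := orb_cone _ _ _ _ n h h'). rewrite eqx, Cmod_self, Rmult_0_r in cc.
  apply Cmod_le0 in cc. replace (y' n) with ((y' n - y n) + y n)%C by ring. rewrite cc. ring.
Qed.

Lemma m_pos : 1 <= INR m.
Proof. change 1 with (INR 1). apply le_INR, (d_m _ _ _ _ _ _ _ _ D). Qed.

Lemma fx_nz (x y : C) : Cmod x < rho -> Cmod y < rho -> x <> 0%C -> fx x y <> 0%C.
Proof.
  intros hx hy nx. assert (pm := m_pos). assert (px : 0 < Cmod x) by (apply Cmod_gt_0; auto).
  assert (B := d_x _ _ _ _ _ _ _ _ D x y hx hy). apply Cmod_gt_0.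
  assert (Cmod x / (64 * INR m) <= Cmod x / 64). { apply Rmult_le_compat_l; [lra|]. apply Rinv_le_contravar; lra. }
  generalize (Cmod_tri_inv (lam * x) (lam * x - fx x y)).
  replace (lam * x - (lam * x - fx x y))%C with (fx x y) by ring. rewrite (Cmod_swap (lam * x)), Cmod_mult, (d_lam _ _ _ _ _ _ _ _ D). lra.
Qed.

Lemma orb_nz x y : orb x y -> x O <> 0%C -> forall n, x n <> 0%C.
Proof.
  intros h h0 n. induction n as [|n IH]; auto. intro e. apply IH.
  destruct (h n) as (_ & _ & f1 & _). destruct (h (S n)) as (a1 & a2 & _).
  assert (B := d_x _ _ _ _ _ _ _ _ D _ _ a1 a2). rewrite f1, e, Cmod_0 in B.
  unfold Rdiv in B. rewrite Rmult_0_l in B. apply Cmod_le0 in B.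
  replace (x n) with ((x n - lam * 0) + lam * 0)%C by ring. rewrite B. ring.
Qed.

Lemma gof_small (x y : C) : Cmod x < rho -> Cmod y < rho -> x <> 0%C ->
  Cmod (gof m fx x y) <= Kg / Cmod (wof m x) /\ Cmod (gof m fx x y) <= / 100.
Proof.
  intros hx hy nx. assert (pm := m_pos). assert (px : 0 < Cmod x) by (apply Cmod_gt_0; auto).
  assert (B := d_g _ _ _ _ _ _ _ _ D x y hx hy nx).
  assert (hr := d_rho _ _ _ _ _ _ _ _ D). assert (hK := d_Kg _ _ _ _ _ _ _ _ D). assert (hs := d_small _ _ _ _ _ _ _ _ D).
  assert (p : 0 < Cmod x ^ m) by (apply pow_lt; auto).
  split; eapply Rle_trans; [apply B| |apply B|].
  - rewrite wof_mod by (auto; apply (d_m _ _ _ _ _ _ _ _ D)). unfold Rdiv. rewrite Rinv_inv. apply Rmult_le_compat_l; [lra|]. nra.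
  - assert (Cmod x ^ m <= Cmod x) by (apply pow_le_1; [lra|apply (d_m _ _ _ _ _ _ _ _ D)]). nra.
Qed.

Definition wseq (x : nat -> C) n := wof m (x n).

Lemma orb_w x y n : orb x y -> wseq x n = (wseq x (S n) + 1 + gof m fx (x (S n)) (y (S n)))%C.
Proof. intro h. destruct (h n) as (_ & _ & f1 & _). unfold wseq, gof. rewrite f1. ring. Qed.

Lemma orb_w_step x y n : orb x y -> x O <> 0%C -> Cmod (wseq x (S n) - (wseq x n - 1)) <= / 100.
Proof.
  intros h h0. rewrite (orb_w x y n h).
  replace (wseq x (S n) - (wseq x (S n) + 1 + gof m fx (x (S n)) (y (S n)) - 1))%C with (- gof m fx (x (S n)) (y (S n)))%C by ring.
  rewrite Cmod_opp. destruct (h (S n)) as (a1 & a2 & _). apply gof_small; auto. apply (orb_nz x y); auto.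
Qed.

(** [Theta] telescopes the sums of [1/|w_n|^2] along an orbit. *)
Definition Theta (R s : R) := s / (R + Rabs s).

Lemma Theta_bound R s : 0 < R -> -1 <= Theta R s <= 1.
Proof.
  intro hR. unfold Theta. assert (p := Rabs_pos s). assert (a := Rle_abs s). assert (b := Rle_abs (- s)). rewrite Rabs_Ropp in b.
  split; apply Rmult_le_reg_r with (R + Rabs s); try lra; unfold Rdiv; rewrite Rmult_assoc, Rinv_l by lra; lra.
Qed.

(** The derivative of [Theta] in s is R/(R + |s|)^2, and a step changes s by about -1. Since [Theta]
    stays in [-1, 1], the sum of 1/M^2 along an orbit is at most 18/R, however long the orbit stays
    near the distance R. *)
Lemma Theta_decr R s s' M : 2 <= R -> 99 / 100 <= s - s' <= 101 / 100 -> R <= M -> Rabs s' <= M ->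
  / (M * M) <= 9 / R * (Theta R s - Theta R s').
Proof.
  intros hR hs hM hs'. unfold Theta.
  assert (p := Rabs_pos s). assert (p' := Rabs_pos s').
  assert (key : R * (s - s') / ((R + Rabs s) * (R + Rabs s')) <= s / (R + Rabs s) - s' / (R + Rabs s')).
  { replace (s / (R + Rabs s) - s' / (R + Rabs s')) with ((s * (R + Rabs s') - s' * (R + Rabs s)) / ((R + Rabs s) * (R + Rabs s'))) by (field; lra).
    apply Rmult_le_compat_r; [left; apply Rinv_0_lt_compat; nra|].
    unfold Rabs in *. destruct (Rcase_abs s); destruct (Rcase_abs s'); nra. }
  assert (b1 : R + Rabs s <= 2 * (R + Rabs s')).
  { assert (Rabs s <= Rabs s' + 101 / 100). { unfold Rabs in *. destruct (Rcase_abs s); destruct (Rcase_abs s'); lra. } lra. }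
  assert (b2 : R + Rabs s' <= 2 * M) by lra.
  assert (b3 : (R + Rabs s) * (R + Rabs s') <= 8 * (M * M)).
  { apply Rle_trans with ((4 * M) * (2 * M)); [apply Rmult_le_compat; lra|lra]. }
  assert (pM : 0 < M * M) by nra.
  apply Rle_trans with (9 / R * (R * (s - s') / ((R + Rabs s) * (R + Rabs s')))).
  2:{ apply Rmult_le_compat_l; auto. apply Rdiv_le_0_compat; lra. }
  replace (9 / R * (R * (s - s') / ((R + Rabs s) * (R + Rabs s')))) with (9 * (s - s') / ((R + Rabs s) * (R + Rabs s'))) by (field; lra).
  apply Rle_trans with (9 * (s - s') / (8 * (M * M))).
  - apply Rmult_le_reg_r with (8 * (M * M)); [lra|]. unfold Rdiv. rewrite Rmult_assoc, Rinv_l by lra.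
    replace (/ (M * M) * (8 * (M * M))) with 8 by (field; nra). lra.
  - apply Rmult_le_compat_l; [lra|]. apply Rinv_le_contravar; [nra|auto].
Qed.

(** The change of w' - w in one step is a difference of two values of [gof], at most 4 Kg / |w|^2
    times |w' - w|. These factors sum to O(Kg / R), which is dominated by the telescoping sum [A];
    so w' - w changes by a small fraction of its initial value. The relative closeness of x' and x
    is carried through the induction because [d_dg] and [wof_ratio] require it. *)
Lemma orb_compare x y x' y' R : orb x y -> orb x' y' -> x O <> 0%C -> (forall n, R <= Cmod (wseq x n)) -> 512 * Kg <= R ->
  Cmod (x' O - x O) <= Cmod (x O) / (16 * INR m) -> Cmod (wseq x' O - wseq x O) <= R / 64 ->
  forall n, Cmod (x' n - x n) <= Cmod (x n) / (16 * INR m) /\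
    Cmod ((wseq x' n - wseq x n) - (wseq x' O - wseq x O)) <= 256 * Kg / R * Cmod (wseq x' O - wseq x O).
Proof.
  intros h h' nx0 hR hRK hx0 hw0.
  assert (pm := m_pos). assert (hK := d_Kg _ _ _ _ _ _ _ _ D). assert (hrho := d_rho _ _ _ _ _ _ _ _ D).
  assert (hgam := d_gam _ _ _ _ _ _ _ _ D). assert (hm := d_m _ _ _ _ _ _ _ _ D).
  set (e0 := Cmod (wseq x' O - wseq x O)) in *. assert (pe0 : 0 <= e0) by apply Cmod_ge_0.
  set (A := fun n => 64 * Kg / R * (Theta R (Re (wseq x O)) - Theta R (Re (wseq x n)))).
  assert (nx := orb_nz x y h nx0).
  assert (cK : 0 <= 64 * Kg / R) by (apply Rdiv_le_0_compat; lra).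
  assert (cK' : 64 * Kg / R <= / 8).
  { apply Rmult_le_reg_r with R; [lra|]. unfold Rdiv. rewrite Rmult_assoc, Rinv_l by lra. lra. }
  assert (hA : forall n, A n <= 2 * (64 * Kg / R)).
  { intro n. unfold A. assert (t1 := Theta_bound R (Re (wseq x O)) ltac:(lra)). assert (t2 := Theta_bound R (Re (wseq x n)) ltac:(lra)). nra. }
  assert (main : forall n, Cmod (x' n - x n) <= Cmod (x n) / (16 * INR m) /\ 0 <= A n /\
     Cmod ((wseq x' n - wseq x n) - (wseq x' O - wseq x O)) <= 2 * e0 * A n).
  { induction n as [|n (I1 & IA & I2)].
    - split; auto. unfold A. rewrite Cmod_self. replace (Theta R (Re (wseq x 0)) - Theta R (Re (wseq x 0))) with 0 by ring. lra.
    - destruct (h n) as (b1 & b2 & f1 & f2). destruct (h' n) as (b1' & b2' & f1' & f2').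
      destruct (h (S n)) as (a1 & a2 & _). destruct (h' (S n)) as (a1' & a2' & _).
      assert (px : 0 < Cmod (x n)) by (apply Cmod_gt_0; auto).
      assert (px1 : 0 < Cmod (x (S n))) by (apply Cmod_gt_0; auto).
      set (X := Cmod (x (S n))) in *.
      (* A coarse bound: one backward step may spoil the constant 16 m to 8 m. Once the
         w-coordinates are compared, the end of the induction step restores 16 m. *)
      assert (c1 : Cmod (x' (S n) - x (S n)) <= X / (8 * INR m)).
      { assert (B := d_x _ _ _ _ _ _ _ _ D _ _ a1 a2). assert (B' := d_x _ _ _ _ _ _ _ _ D _ _ a1' a2'). rewrite f1 in B. rewrite f1' in B'. fold X in B.
        set (d := Cmod (x' (S n) - x (S n))) in *.
        assert (X' : Cmod (x' (S n)) <= X + d) by (generalize (Cmod_tri_inv (x' (S n)) (x (S n))); fold X d; lra).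
        assert (Xn : Cmod (x n) <= X + X / 64).
        { replace (x n) with ((x n - lam * x (S n)) + lam * x (S n))%C by ring. eapply Rle_trans; [apply Cmod_triangle|].
          rewrite Cmod_mult, (d_lam _ _ _ _ _ _ _ _ D). fold X.
          assert (X / (64 * INR m) <= X / 64). { apply Rmult_le_compat_l; [lra|]. apply Rinv_le_contravar; lra. } lra. }
        assert (E : Cmod (lam * (x' (S n) - x (S n))) <= Cmod (x' n - x n) + X / (64 * INR m) + Cmod (x' (S n)) / (64 * INR m)).
        { replace (lam * (x' (S n) - x (S n)))%C with ((x' n - x n) + (x n - lam * x (S n)) - (x' n - lam * x' (S n)))%C by ring.
          eapply Rle_trans; [apply Cmod_sub|]. eapply Rle_trans; [apply Rplus_le_compat_r, Cmod_triangle|]. lra. }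
        rewrite Cmod_mult, (d_lam _ _ _ _ _ _ _ _ D) in E. fold d in E.
        assert (pd : 0 <= d) by apply Cmod_ge_0.
        apply Rmult_le_reg_r with (INR m); [lra|]. replace (X / (8 * INR m) * INR m) with (X / 8) by (field; lra).
        apply Rmult_le_compat_r with (r := INR m) in E; [|lra]. apply Rmult_le_compat_r with (r := INR m) in I1; [|lra].
        replace (Cmod (x n) / (16 * INR m) * INR m) with (Cmod (x n) / 16) in I1 by (field; lra).
        replace ((Cmod (x' n - x n) + X / (64 * INR m) + Cmod (x' (S n)) / (64 * INR m)) * INR m) with
          (Cmod (x' n - x n) * INR m + X / 64 + Cmod (x' (S n)) / 64) in E by (field; lra). nra. }
      destruct (wof_ratio m (x (S n)) (x' (S n)) hm (nx (S n)) c1) as (nx' & (r1 & r2) & _).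
      fold (wseq x (S n)) in r1, r2. fold (wseq x' (S n)) in r1, r2. fold X in r1, r2.
      set (s := Cmod (x' (S n) - x (S n)) / X) in *.
      set (w := Cmod (wseq x (S n))) in *.
      assert (pw : R <= w) by apply hR.
      set (e1 := Cmod (wseq x' (S n) - wseq x (S n))) in *. assert (pe1 : 0 <= e1) by apply Cmod_ge_0.
      assert (ps : 0 <= s) by (apply Rdiv_le_0_compat; [apply Cmod_ge_0|auto]).
      assert (dg : Cmod (gof m fx (x' (S n)) (y' (S n)) - gof m fx (x (S n)) (y (S n))) <= 4 * Kg / (w * w) * e1).
      { assert (c2 : Cmod (x' (S n) - x (S n)) <= X / 4).
        { eapply Rle_trans; [apply c1|]. apply Rmult_le_compat_l; [lra|]. apply Rinv_le_contravar; lra. }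
        assert (G := d_dg _ _ _ _ _ _ _ _ D _ _ _ (y' (S n)) a1 a2 (nx (S n)) a2' c2). fold X s in G.
        eapply Rle_trans; [apply G|].
        assert (cc := orb_cone _ _ _ _ (S n) h h').
        assert (dy : Cmod (y' (S n) - y (S n)) <= s).
        { apply Rle_trans with (Cmod (x' (S n) - x (S n))); [generalize (Cmod_ge_0 (x' (S n) - x (S n))); nra|].
          unfold s. apply Rmult_le_reg_r with X; auto. unfold Rdiv. rewrite Rmult_assoc, Rinv_l by lra.
          generalize (Cmod_ge_0 (x' (S n) - x (S n))); nra. }
        assert (xm : X ^ m = / (INR m * w)).
        { unfold w, wseq. rewrite wof_mod by auto. fold X. field. split; first [lra | apply pow_nonzero; lra]. }
        rewrite xm.
        assert (s2 : s <= 2 / (INR m * w) * e1).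
        { apply Rmult_le_reg_r with (INR m * w); [nra|]. replace (2 / (INR m * w) * e1 * (INR m * w)) with (2 * e1) by (field; split; lra). lra. }
        apply Rle_trans with (Kg * (/ (INR m * w) * (2 * (2 / (INR m * w) * e1)))).
        - apply Rmult_le_compat_l; [lra|]. apply Rmult_le_compat_l; [left; apply Rinv_0_lt_compat; nra|]. lra.
        - replace (Kg * (/ (INR m * w) * (2 * (2 / (INR m * w) * e1)))) with (4 * Kg / (w * w) * e1 * (/ INR m * / INR m)) by (field; split; lra).
          assert (/ INR m <= 1) by (rewrite <- Rinv_1; apply Rinv_le_contravar; lra).
          assert (0 < / INR m) by (apply Rinv_0_lt_compat; lra).
          assert (0 <= 4 * Kg / (w * w) * e1) by (apply Rmult_le_pos; auto; apply Rdiv_le_0_compat; nra).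
          assert (/ INR m * / INR m <= 1) by nra. nra. }
      set (kap := 4 * Kg / (w * w)) in *.
      (* The 4 of [kap] times the 9 of [Theta_decr] is 36, below the factor 64 in [A]. *)
      assert (kA : kap <= A (S n) - A n).
      { replace (A (S n) - A n) with (64 * Kg / R * (Theta R (Re (wseq x n)) - Theta R (Re (wseq x (S n))))) by (unfold A; ring).
        assert (st := orb_w_step x y n h nx0).
        assert (T := Theta_decr R (Re (wseq x n)) (Re (wseq x (S n))) w ltac:(lra)).
        assert (q := re_le_Cmod (wseq x (S n) - (wseq x n - 1))). rewrite !Re_sub in q.
        replace (Re (RtoC 1)) with 1 in q by reflexivity. apply Rabs_le_between in q.
        specialize (T ltac:(lra) pw (re_le_Cmod _)).
        unfold kap. replace (4 * Kg / (w * w)) with (4 * Kg * / (w * w)) by reflexivity.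
        apply Rle_trans with (4 * Kg * (9 / R * (Theta R (Re (wseq x n)) - Theta R (Re (wseq x (S n)))))).
        - apply Rmult_le_compat_l; lra.
        - assert (0 < / (w * w)) by (apply Rinv_0_lt_compat; nra).
          assert (0 < 9 / R) by (apply Rdiv_lt_0_compat; lra).
          assert (0 <= Theta R (Re (wseq x n)) - Theta R (Re (wseq x (S n)))) by nra.
          replace (4 * Kg * (9 / R * (Theta R (Re (wseq x n)) - Theta R (Re (wseq x (S n)))))) with
            (36 * Kg / R * (Theta R (Re (wseq x n)) - Theta R (Re (wseq x (S n))))) by (field; lra).
          apply Rmult_le_compat_r; auto. apply Rmult_le_compat_r; [left; apply Rinv_0_lt_compat; lra|lra]. }
      assert (pk : 0 <= kap) by (apply Rdiv_le_0_compat; nra).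
      assert (dd : Cmod ((wseq x' (S n) - wseq x (S n)) - (wseq x' n - wseq x n)) <= kap * e1).
      { rewrite (orb_w x y n h), (orb_w x' y' n h').
        match goal with |- Cmod ?z <= _ => replace z with (- (gof m fx (x' (S n)) (y' (S n)) - gof m fx (x (S n)) (y (S n))))%C by ring end.
        rewrite Cmod_opp. exact dg. }
      assert (hA1 := hA (S n)). assert (hAn := hA n).
      assert (en : Cmod (wseq x' n - wseq x n) <= e0 + 2 * e0 * A n).
      { generalize (Cmod_tri_inv (wseq x' n - wseq x n) (wseq x' 0%nat - wseq x 0%nat)). fold e0. lra. }
      assert (e1le : e1 <= Cmod (wseq x' n - wseq x n) + kap * e1).
      { generalize (Cmod_tri_inv (wseq x' (S n) - wseq x (S n)) (wseq x' n - wseq x n)). fold e1. lra. }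
      assert (k4 : kap <= / 4) by lra.
      assert (A4 : A n <= / 4) by lra.
      assert (e12 : e1 <= 2 * e0) by nra.
      assert (I2' : Cmod ((wseq x' (S n) - wseq x (S n)) - (wseq x' O - wseq x O)) <= 2 * e0 * A (S n)).
      { eapply Rle_trans; [apply (Cmod_tri _ (wseq x' n - wseq x n))|].
        assert (kap * e1 <= kap * (2 * e0)) by (apply Rmult_le_compat_l; auto). nra. }
      split; [|split; auto; lra].
      assert (s * (INR m * w) <= 4 * e0) by lra.
      assert (s * INR m <= / 16).
      { apply Rmult_le_reg_r with w; [lra|]. nra. }
      apply Rmult_le_reg_r with (/ X * INR m). { apply Rmult_lt_0_compat; [apply Rinv_0_lt_compat; auto|lra]. }
      replace (X / (16 * INR m) * (/ X * INR m)) with (/ 16) by (field; split; lra). unfold s, Rdiv in H0. lra. }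
  intro n. destruct (main n) as (I1 & IA & I2). split; auto.
  eapply Rle_trans; [apply I2|]. specialize (hA n).
  replace (256 * Kg / R * e0) with (2 * e0 * (2 * (64 * Kg / R))) by (field; lra).
  apply Rmult_le_compat_l; lra.
Qed.

End Dyn.

Lemma cexp_near (h : C) : Cmod h <= / 4 -> Cmod (cexp h - 1) <= 2 * Cmod h.
Proof.
  intro hh. rewrite <- cexp_0.
  replace (2 * Cmod h) with (2 * Cmod (h - 0)) by (do 2 f_equal; ring).
  apply (mean_value cexp); [lra|]. intros t ht.
  exists (cexp (0 + t * (h - 0)))%C. split; [apply cdiff_cexp|]. rewrite Cmod_cexp.
  assert (q : Re (0 + t * (h - 0))%C <= / 4).
  { replace (0 + t * (h - 0))%C with (t * h)%C by ring. eapply Rle_trans; [apply Re_le_Cmod|].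
    rewrite Cmod_mult, Cmod_RtoC by lra. assert (p := Cmod_ge_0 h).
    apply Rle_trans with (1 * Cmod h); [apply Rmult_le_compat_r|]; lra. }
  assert (e4 : exp (/ 4) * exp (/ 4) * (exp (/ 4) * exp (/ 4)) <= 3).
  { rewrite <- !exp_plus. replace (/ 4 + / 4 + (/ 4 + / 4)) with 1 by lra. apply exp_le_3. }
  assert (p := exp_pos (/ 4)).
  assert (exp (/ 4) <= 2). { apply Rnot_lt_le. intro k. assert (4 < exp (/ 4) * exp (/ 4)) by nra. nra. }
  destruct q as [q|q]; [apply exp_increasing in q; lra|rewrite q; lra].
Qed.

(** Quantitative discreteness of the roots of unity: for t = 1 + s, the identity t^m = 1 gives m |s|
    <= (m |s|)^2 <= m |s| / 8. *)
Lemma unit_root_near (m : nat) (t : C) : (1 <= m)%nat -> (t ^ m = 1)%C -> Cmod (t - 1) <= / (8 * INR m) -> t = 1%C.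
Proof.
  intros hm e h. assert (pm : 1 <= INR m) by (change 1 with (INR 1); apply le_INR; auto).
  set (s := (t - 1)%C) in *. assert (b : INR m * Cmod s <= / 8).
  { apply Rmult_le_compat_l with (r := INR m) in h; [|lra]. replace (INR m * / (8 * INR m)) with (/ 8) in h by (field; lra). exact h. }
  assert (L := one_pow_lin m s b). replace (1 + s)%C with t in L by (unfold s; ring). rewrite e in L.
  replace (1 - 1 - INR m * s)%C with (- (INR m * s))%C in L by ring. rewrite Cmod_opp, Cmod_mult, Cmod_RtoC in L by lra.
  assert (p := Cmod_ge_0 s).
  assert (z : s = 0%C). { apply Cmod_le0. assert (INR m * Cmod s * (INR m * Cmod s) <= / 8 * (INR m * Cmod s)) by (apply Rmult_le_compat_r; nra). nra. }
  replace t with (s + 1)%C by (unfold s; ring). rewrite z. ring.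
Qed.

(** * Construction of backward orbits *)

(** A branch of [x] as a function of [w], so that [wof m (rt m w) = w]. *)
Definition rt (m : nat) (w : C) : C := cexp (- clog (- (INR m * w)) / INR m).

(** For [s = 1] and [s = -1] the half planes [ell s w < -L] together cover a left half plane, and each of them
    is convex and invariant under [w => w - 1 - g] for small_radius [g]. *)
Definition ell (s : R) (w : C) : R := Re w + s * Im w.

Lemma ell_add s a b : ell s (a + b)%C = ell s a + ell s b.
Proof. unfold ell. rewrite Re_add, Im_add. ring. Qed.
Lemma ell_sub s a b : ell s (a - b)%C = ell s a - ell s b.
Proof. unfold ell. rewrite Re_sub, Im_sub. ring. Qed.
Lemma ell_RtoC s (r : R) : ell s (RtoC r) = r.
Proof. unfold ell; cbn. ring. Qed.

Lemma ell_scal s (t : R) a : ell s (t * a)%C = t * ell s a.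
Proof. destruct a. unfold ell; cbn. ring. Qed.

Lemma ell_Cmod s w : s * s = 1 -> Rabs (ell s w) <= 3 / 2 * Cmod w.
Proof.
  intro hs. assert (e := Cmod_sqr w). assert (p := Cmod_ge_0 w). unfold ell.
  apply Rabs_le. assert ((Re w + s * Im w) * (Re w + s * Im w) <= 2 * (Cmod w * Cmod w)).
  { rewrite e. assert (0 <= (Re w - s * Im w) * (Re w - s * Im w)) by apply Rle_0_sqr. nra. }
  split; nra.
Qed.

Lemma ell_slit s w k : s * s = 1 -> ell s w < 0 -> 0 < k -> slit (- (k * w))%C.
Proof.
  intros hs h hk. unfold slit, ell in *. destruct w as [a b]; cbn in *.
  destruct (Req_dec b 0) as [->|hb].
  - left. rewrite Rmult_0_r in h. nra.
  - right. nra.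
Qed.

Section Root.
Context (m : nat) (hm : (1 <= m)%nat).

Lemma INR_m_ge_1 : 1 <= INR m.
Proof. change 1 with (INR 1); apply le_INR; auto. Qed.

Lemma INR_m_neq_0 : RtoC (INR m) <> 0%C.
Proof. apply Cmod_gt_0. rewrite Cmod_RtoC; generalize INR_m_ge_1; lra. Qed.

Lemma rt_nz w : rt m w <> 0%C.
Proof. apply cexp_neq0. Qed.

Lemma rt_pow s w : s * s = 1 -> ell s w < 0 -> (INR m * w * rt m w ^ m = - (1))%C.
Proof.
  intros hs h. assert (sl := ell_slit s w (INR m) hs h ltac:(generalize INR_m_ge_1; lra)).
  unfold rt. rewrite cexp_nat_mult.
  replace (INR m * (- clog (- (INR m * w)) / INR m))%C with (- clog (- (INR m * w)))%C by (field; apply INR_m_neq_0).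
  rewrite cexp_opp, cexp_clog by auto.
  assert (w <> 0%C). { intros ->. unfold ell in h; cbn in h. lra. }
  field. split; [auto|apply INR_m_neq_0].
Qed.

Lemma wof_rt s w : s * s = 1 -> ell s w < 0 -> wof m (rt m w) = w.
Proof.
  intros hs h. assert (e := rt_pow s w hs h). unfold wof.
  assert (n1 := INR_m_neq_0). assert (n2 : (rt m w ^ m)%C <> 0%C).
  { apply Cmod_gt_0. rewrite Cmod_pow. apply pow_lt, Cmod_gt_0, rt_nz. }
  transitivity (- (1) / (INR m * rt m w ^ m))%C; [field; auto|]. rewrite <- e. field. auto.
Qed.

Lemma rt_mod s w : s * s = 1 -> ell s w < 0 -> Cmod (rt m w) ^ m = / (INR m * Cmod w).
Proof.
  intros hs h. assert (e := wof_rt s w hs h). apply (f_equal Cmod) in e.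
  rewrite wof_mod in e by (auto; apply rt_nz). rewrite <- e.
  assert (p : 0 < Cmod (rt m w) ^ m) by (apply pow_lt, Cmod_gt_0, rt_nz). generalize INR_m_ge_1. intro. field. lra.
Qed.

Lemma rt_cdble s w : s * s = 1 -> ell s w < 0 -> cdble (rt m) w.
Proof.
  intros hs h. unfold rt. apply (cdble_cexp (fun w => - clog (- (INR m * w)) / INR m)%C).
  apply (cdble_mult (fun w => - clog (- (INR m * w)))%C (fun _ => / INR m)%C); [|apply cdble_const].
  apply (cdble_opp (fun w => clog (- (INR m * w)))%C).
  apply (cdble_comp (fun w => - (INR m * w))%C clog).
  - apply (cdble_opp (fun w => INR m * w)%C). apply (cdble_mult (fun _ => RtoC (INR m)) (fun w => w)); [apply cdble_const|apply cdble_id].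
  - eexists. apply cdiff_clog. apply (ell_slit s); auto. generalize INR_m_ge_1; lra.
Qed.

(** The segment from [b] to [a] stays in the half plane [ell s w < 0], so both points lie on the
    same side of the cut, and the modulus stays above 15/16 |b|. The logarithms are therefore close,
    and the quotient of the roots is the exponential of a small number. *)
Lemma rt_near s a b : s * s = 1 -> ell s a < 0 -> ell s b < 0 -> Cmod (a - b) <= Cmod b / 16 ->
  Cmod (rt m a / rt m b - 1) <= 3 / INR m * (Cmod (a - b) / Cmod b).
Proof.
  intros hs ha hb hab. assert (pm := INR_m_ge_1).
  assert (pb : 0 < Cmod b). { apply Cmod_gt_0. intros ->. unfold ell in hb; cbn in hb. lra. }
  set (d := Cmod (a - b) / Cmod b). assert (pd : 0 <= d) by (apply Rdiv_le_0_compat; auto; apply Cmod_ge_0).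
  assert (d16 : d <= / 16). { unfold d. apply Rmult_le_reg_r with (Cmod b); auto. unfold Rdiv. rewrite Rmult_assoc, Rinv_l; lra. }
  assert (ed : Cmod (a - b) = d * Cmod b) by (unfold d; field; lra).
  assert (L : Cmod (clog (- (INR m * a)) - clog (- (INR m * b))) <= / (INR m * (15 / 16 * Cmod b)) * Cmod (- (INR m * a) - - (INR m * b))).
  { apply clog_lip; [nra|]. intros t ht.
    replace (- (INR m * b) + t * (- (INR m * a) - - (INR m * b)))%C with (- (INR m * (b + t * (a - b))))%C by ring.
    split.
    - apply (ell_slit s); auto; [|lra]. rewrite ell_add, ell_scal, ell_sub. nra.
    - rewrite Cmod_opp, Cmod_mult, Cmod_RtoC by lra. apply Rmult_le_compat_l; [lra|].
      generalize (Cmod_tri_inv b (- (t * (a - b)))). replace (b - - (t * (a - b)))%C with (b + t * (a - b))%C by ring.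
      rewrite Cmod_opp, Cmod_mult, Cmod_RtoC by lra. generalize (Cmod_ge_0 (a - b)). nra. }
  replace (- (INR m * a) - - (INR m * b))%C with (- (INR m * (a - b)))%C in L by ring.
  rewrite Cmod_opp, Cmod_mult, Cmod_RtoC, ed in L by lra.
  replace (/ (INR m * (15 / 16 * Cmod b)) * (INR m * (d * Cmod b))) with (16 / 15 * d) in L by (field; lra).
  set (h := ((clog (- (INR m * b)) - clog (- (INR m * a))) / INR m)%C).
  assert (eh : (rt m a / rt m b)%C = cexp h).
  { unfold rt, Cdiv at 1. rewrite <- cexp_opp, <- cexp_plus. f_equal. unfold h. field. apply INR_m_neq_0. }
  assert (hh : Cmod h <= 16 / 15 * d / INR m).
  { unfold h. rewrite Cmod_div, Cmod_RtoC by (apply INR_m_neq_0 || lra). apply Rmult_le_compat_r; [left; apply Rinv_0_lt_compat; lra|].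
    rewrite Cmod_swap. exact L. }
  assert (im : / INR m <= 1) by (rewrite <- Rinv_1; apply Rinv_le_contravar; lra).
  assert (im0 : 0 < / INR m) by (apply Rinv_0_lt_compat; lra).
  rewrite eh. eapply Rle_trans; [apply cexp_near|].
  - eapply Rle_trans; [apply hh|]. unfold Rdiv. nra.
  - eapply Rle_trans; [apply Rmult_le_compat_l; [lra|apply hh]|]. unfold Rdiv. nra.
Qed.
End Root.

Section Dyn.
Context (m : nat) (lam mu : C) (fx fy : C -> C -> C) (rho gam Kg : R) (D : dyn m lam mu fx fy rho gam Kg).

Let hm : (1 <= m)%nat := d_m _ _ _ _ _ _ _ _ D.

Lemma lam_nz : lam <> 0%C.
Proof. apply Cmod_gt_0. rewrite (d_lam _ _ _ _ _ _ _ _ D). lra. Qed.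

(** The ratio [t] of the two sides is an m-th root of unity, because x and [rt m w] both solve m w
    x^m = -1 and lam^m = 1. It is also within 1/(8 m) of 1, by [d_x] and [rt_near], hence equal to
    1. The bound 400 makes the displacement of w, at most 2, relatively small. *)
Lemma branch_step s (x y : C) : s * s = 1 -> Cmod x < rho -> Cmod y < rho -> x <> 0%C ->
  ell s (wof m x) < 0 -> ell s (wof m (fx x y)) < 0 -> 400 <= Cmod (wof m x) ->
  (fx x y / rt m (wof m (fx x y)) = lam * (x / rt m (wof m x)))%C.
Proof.
  intros hs hx hy nx l0 l1 hw. assert (pm := INR_m_ge_1 m hm). assert (nl := lam_nz).
  assert (nf := fx_nz m lam mu fx fy rho gam Kg D x y hx hy nx).
  set (x1 := fx x y) in *. set (w := wof m x) in *. set (w1 := wof m x1) in *.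
  assert (nr := rt_nz m w). assert (nr1 := rt_nz m w1).
  assert (px : 0 < Cmod x) by (apply Cmod_gt_0; auto).
  set (t := ((x1 / (lam * x)) * (rt m w / rt m w1))%C).
  assert (pw : forall u : C, u <> 0%C -> (INR m * wof m u * u ^ m = - (1))%C).
  { intros u nu. unfold wof. assert (nq := wof_neq m u hm nu). field. split; [|apply INR_m_neq_0; auto].
    intro k. apply nq. rewrite k. ring. }
  assert (tm : (t ^ m = 1)%C).
  { assert (e1 := pw x nx). fold w in e1. assert (e2 := pw x1 nf). fold w1 in e2.
    assert (e3 := rt_pow m hm s w hs l0). assert (e4 := rt_pow m hm s w1 hs l1).
    assert (hw0 : w <> 0%C) by (apply Cmod_gt_0; lra).
    assert (hw1 : w1 <> 0%C). { intro k. rewrite k in l1. unfold ell in l1; cbn in l1. lra. }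
    assert (nmm := INR_m_neq_0 m hm).
    assert (np : forall u : C, u <> 0%C -> (u ^ m)%C <> 0%C).
    { intros u nu. apply Cmod_gt_0. rewrite Cmod_pow. apply pow_lt, Cmod_gt_0, nu. }
    assert (E : forall (c a b : C), c <> 0%C -> (c * a = - (1))%C -> (c * b = - (1))%C -> a = b).
    { intros c a b nc h1 h2. transitivity ((c * a) / c)%C; [field; auto|]. rewrite h1, <- h2. field; auto. }
    assert (f1 : (rt m w ^ m = x ^ m)%C) by (apply (E (INR m * w)%C); auto; apply Cmult_neq_0; auto).
    assert (f2 : (rt m w1 ^ m = x1 ^ m)%C) by (apply (E (INR m * w1)%C); auto; apply Cmult_neq_0; auto).
    assert (f3 : (t ^ m * (lam ^ m * x ^ m * rt m w1 ^ m) = x1 ^ m * rt m w ^ m)%C).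
    { rewrite <- !Cpow_mult_l. f_equal. unfold t. field. auto. }
    rewrite f1, f2, (d_lamm _ _ _ _ _ _ _ _ D) in f3.
    assert (nz : (x ^ m * x1 ^ m)%C <> 0%C) by (apply Cmult_neq_0; auto).
    transitivity ((t ^ m * (1 * x ^ m * x1 ^ m)) / (x ^ m * x1 ^ m))%C; [field; split; auto|]. rewrite f3. field. split; auto. }
  assert (ca : Cmod (x1 / (lam * x) - 1) <= / (64 * INR m)).
  { replace (x1 / (lam * x) - 1)%C with ((x1 - lam * x) / (lam * x))%C by (field; auto).
    rewrite Cmod_div by (apply Cmult_neq_0; auto). rewrite Cmod_mult, (d_lam _ _ _ _ _ _ _ _ D), Rmult_1_l.
    apply Rmult_le_reg_r with (Cmod x); auto. unfold Rdiv. rewrite Rmult_assoc, Rinv_l, Rmult_1_r by lra.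
    rewrite Rmult_comm. apply (d_x _ _ _ _ _ _ _ _ D); auto. }
  assert (cw : Cmod (w - w1) <= 2).
  { destruct (gof_small m lam mu fx fy rho gam Kg D x y hx hy nx) as [_ g2]. unfold gof in g2. fold x1 w w1 in g2.
    replace (w - w1)%C with (- ((w1 - w - 1) + 1))%C by ring. rewrite Cmod_opp. eapply Rle_trans; [apply Cmod_triangle|]. rewrite Cmod_1. lra. }
  assert (w1b : 398 <= Cmod w1) by (generalize (Cmod_tri_inv w w1); lra).
  assert (cb : Cmod (rt m w / rt m w1 - 1) <= / (64 * INR m)).
  { eapply Rle_trans; [apply (rt_near m hm s); auto; lra|].
    replace (/ (64 * INR m)) with (3 / INR m * (/ 192)) by (field; lra).
    apply Rmult_le_compat_l; [apply Rdiv_le_0_compat; lra|].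
    apply Rmult_le_reg_r with (Cmod w1); [lra|]. unfold Rdiv. rewrite Rmult_assoc, Rinv_l by lra. lra. }
  assert (im : / (64 * INR m) <= / 64) by (apply Rinv_le_contravar; lra).
  assert (im0 : 0 < / (64 * INR m)) by (apply Rinv_0_lt_compat; lra).
  assert (t1 : t = 1%C).
  { apply (unit_root_near m); auto. unfold t.
    set (A := (x1 / (lam * x))%C) in *. set (B := (rt m w / rt m w1)%C) in *.
    replace (A * B - 1)%C with ((A - 1) * (B - 1) + (A - 1) + (B - 1))%C by ring.
    eapply Rle_trans; [apply Cmod_triangle|]. eapply Rle_trans; [apply Rplus_le_compat_r, Cmod_triangle|]. rewrite Cmod_mult.
    replace (/ (8 * INR m)) with (8 * / (64 * INR m)) by (field; lra).
    assert (Cmod (A - 1) * Cmod (B - 1) <= / (64 * INR m) * 1) by (apply Rmult_le_compat; auto using Cmod_ge_0; lra). lra. }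
  transitivity (t * (lam * (x / rt m w)))%C; [unfold t; field; auto|]. rewrite t1. ring.
Qed.

(** * Picard iteration for the backward orbit with given initial w *)

Section Picard.
Context (th : C) (hth : Cmod th = 1) (s : R) (hs : s * s = 1) (L : R).
Context (hL1 : 1000 * Kg <= L) (hL2 : (4 / rho) ^ m <= L / 2).

Definition thn (n : nat) : C := (th * (/ lam) ^ n)%C.

Lemma thn_mod n : Cmod (thn n) = 1.
Proof. unfold thn. rewrite Cmod_mult, Cmod_pow, Cmod_inv by apply lam_nz. rewrite (d_lam _ _ _ _ _ _ _ _ D), hth, Rinv_1, pow1. ring. Qed.

Lemma thn_S n : thn n = (lam * thn (S n))%C.
Proof. unfold thn. cbn [Cpow]. field. apply lam_nz. Qed.

Definition xth (n : nat) (w : C) : C := (thn n * rt m w)%C.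

Lemma xth_mod n w : Cmod (xth n w) = Cmod (rt m w).
Proof. unfold xth. rewrite Cmod_mult, thn_mod. ring. Qed.

Lemma xth_nz n w : xth n w <> 0%C.
Proof. apply Cmod_gt_0. rewrite xth_mod. apply Cmod_gt_0, rt_nz. Qed.

Lemma thn_pow n : (th ^ m = 1)%C -> (thn n ^ m = 1)%C.
Proof.
  intro h. unfold thn. rewrite Cpow_mult_l, h.
  assert (e : ((/ lam) ^ m = 1)%C).
  { rewrite Cpow_inv by apply lam_nz. rewrite (d_lamm _ _ _ _ _ _ _ _ D). field. }
  rewrite <- Cpow_mult_r, Nat.mul_comm, Cpow_mult_r, e, Cpow_1_l. ring.
Qed.

(** This is the purpose of the second condition on [L]; the first one serves the contraction. *)
Lemma rt_small w : ell s w < 0 -> L / 2 <= Cmod w -> Cmod (rt m w) <= rho / 2.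
Proof.
  intros hw hwL. assert (pm := INR_m_ge_1 m hm). assert (hr := d_rho _ _ _ _ _ _ _ _ D). assert (hK := d_Kg _ _ _ _ _ _ _ _ D).
  assert (e := rt_mod m hm s w hs hw). apply Rnot_lt_le. intro k.
  assert (a : (rho / 2) ^ m <= Cmod (rt m w) ^ m) by (apply pow_incr; lra).
  assert (b : (4 / rho) ^ m * (rho / 2) ^ m = 2 ^ m). { rewrite <- Rpow_mult_distr. f_equal. field; lra. }
  assert (c : 2 <= 2 ^ m). { rewrite <- (pow_1 2) at 1. apply Rle_pow; [lra|auto]. }
  assert (d : / (INR m * Cmod w) <= 2 / L).
  { replace (2 / L) with (/ (L / 2)) by (field; lra). apply Rinv_le_contravar; [lra|]. nra. }
  assert (p : 0 < (rho / 2) ^ m) by (apply pow_lt; lra).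
  assert ((4 / rho) ^ m * (rho / 2) ^ m <= L / 2 * (2 / L)).
  { apply Rmult_le_compat; try lra. apply pow_le. apply Rdiv_le_0_compat; lra. }
  replace (L / 2 * (2 / L)) with 1 in H by (field; lra). lra.
Qed.

Lemma xth_dist n (V V' : C) Lam : ell s V < 0 -> ell s V' < 0 -> L / 2 <= Lam -> Lam <= Cmod V -> Lam <= Cmod V' ->
  Cmod (xth n V' - xth n V) <= 16 * rho * (Cmod (V' - V) / Lam) /\
  (Cmod (V' - V) <= Cmod V / 16 -> Cmod (xth n V' - xth n V) / Cmod (xth n V) <= 3 * (Cmod (V' - V) / Lam) /\ Cmod (xth n V' - xth n V) <= Cmod (xth n V) / 4).
Proof.
  intros h h' hl hV hV'. assert (pm := INR_m_ge_1 m hm). assert (hr := d_rho _ _ _ _ _ _ _ _ D). assert (hK := d_Kg _ _ _ _ _ _ _ _ D).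
  assert (q := Cmod_ge_0 (V' - V)).
  assert (r1 := rt_small V h ltac:(lra)). assert (r2 := rt_small V' h' ltac:(lra)).
  assert (pr : 0 < Cmod (rt m V)) by apply Cmod_gt_0, rt_nz.
  assert (near : Cmod (V' - V) <= Cmod V / 16 -> Cmod (xth n V' - xth n V) <= 3 * (Cmod (V' - V) / Cmod V) * Cmod (rt m V)).
  { intro k. assert (N := rt_near m hm s V' V hs h' h k).
    replace (xth n V' - xth n V)%C with (thn n * rt m V * (rt m V' / rt m V - 1))%C by (unfold xth; field; apply rt_nz).
    rewrite !Cmod_mult, thn_mod, Rmult_1_l, Rmult_comm. apply Rmult_le_compat_r; [lra|].
    eapply Rle_trans; [apply N|]. apply Rmult_le_compat_r; [apply Rdiv_le_0_compat; lra|].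
    unfold Rdiv. assert (/ INR m <= 1) by (rewrite <- Rinv_1; apply Rinv_le_contravar; lra). lra. }
  assert (dl : Cmod (V' - V) / Cmod V <= Cmod (V' - V) / Lam) by (apply Rmult_le_compat_l; auto; apply Rinv_le_contravar; lra).
  assert (pd : 0 <= Cmod (V' - V) / Lam) by (apply Rdiv_le_0_compat; lra).
  split.
  - destruct (Rle_lt_dec (Cmod (V' - V)) (Cmod V / 16)) as [k|k].
    + eapply Rle_trans; [apply near, k|].
      assert (3 * (Cmod (V' - V) / Cmod V) * Cmod (rt m V) <= 3 * (Cmod (V' - V) / Lam) * (rho / 2)).
      { apply Rmult_le_compat; try lra. assert (0 <= Cmod (V' - V) / Cmod V) by (apply Rdiv_le_0_compat; lra). lra. } nra.
    + eapply Rle_trans; [apply Cmod_sub|]. rewrite !xth_mod.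
      assert (/ 16 <= Cmod (V' - V) / Lam). { apply Rmult_le_reg_r with Lam; [lra|]. unfold Rdiv. rewrite Rmult_assoc, Rinv_l by lra. lra. }
      nra.
  - intro k. specialize (near k). rewrite !xth_mod. split.
    + apply Rmult_le_reg_r with (Cmod (rt m V)); auto. unfold Rdiv at 1. rewrite Rmult_assoc, Rinv_l, Rmult_1_r by lra.
      eapply Rle_trans; [apply near|]. apply Rmult_le_compat_r; lra.
    + assert (Cmod (V' - V) / Cmod V <= / 16). { apply Rmult_le_reg_r with (Cmod V); [lra|]. unfold Rdiv. rewrite Rmult_assoc, Rinv_l by lra. lra. }
      nra.
Qed.

(** Two successive Picard iterates may differ by an amount comparable with |V|, so closeness cannot
    be assumed. For |V' - V| <= |V|/16 the bound comes from [d_dg]; otherwise |V' - V|/Lam is at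
    least 1/16 and the sizes of both values of [gof] suffice. *)
Lemma gof_xth_lip n (V V' Y Y' : C) Lam : ell s V < 0 -> ell s V' < 0 -> L / 2 <= Lam -> Lam <= Cmod V -> Lam <= Cmod V' -> Cmod Y < rho -> Cmod Y' < rho ->
  Cmod (gof m fx (xth n V') Y' - gof m fx (xth n V) Y) <= 32 * Kg / Lam * (Cmod (V' - V) / Lam + Cmod (Y' - Y)).
Proof.
  intros h h' hl hV hV' hY hY'. assert (pm := INR_m_ge_1 m hm). assert (hr := d_rho _ _ _ _ _ _ _ _ D). assert (hK := d_Kg _ _ _ _ _ _ _ _ D).
  destruct (xth_dist n V V' Lam h h' hl hV hV') as [_ near].
  assert (q := Cmod_ge_0 (V' - V)). assert (q' := Cmod_ge_0 (Y' - Y)).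
  assert (r1 := rt_small V h ltac:(lra)). assert (r2 := rt_small V' h' ltac:(lra)).
  assert (pd : 0 <= Cmod (V' - V) / Lam) by (apply Rdiv_le_0_compat; lra).
  assert (cL : 0 < Kg / Lam) by (apply Rdiv_lt_0_compat; lra).
  replace (32 * Kg / Lam * (Cmod (V' - V) / Lam + Cmod (Y' - Y))) with (Kg / Lam * (32 * (Cmod (V' - V) / Lam + Cmod (Y' - Y)))) by (field; lra).
  destruct (Rle_lt_dec (Cmod (V' - V)) (Cmod V / 16)) as [k|k].
  - destruct (near k) as [n1 n2].
    eapply Rle_trans; [apply (d_dg _ _ _ _ _ _ _ _ D); auto; [rewrite xth_mod; lra|apply xth_nz]|].
    rewrite xth_mod, (rt_mod m hm s V hs h).
    assert (/ (INR m * Cmod V) <= / Lam) by (apply Rinv_le_contravar; [lra|nra]).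
    assert (0 < / (INR m * Cmod V)) by (apply Rinv_0_lt_compat; nra).
    unfold Rdiv at 2. rewrite Rmult_assoc. apply Rmult_le_compat_l; [lra|].
    rewrite xth_mod in n1.
    assert (0 <= Cmod (xth n V' - xth n V) / Cmod (rt m V)) by (apply Rdiv_le_0_compat; [apply Cmod_ge_0|apply Cmod_gt_0, rt_nz]).
    apply Rmult_le_compat; lra.
  - eapply Rle_trans; [apply Cmod_sub|].
    destruct (gof_small m lam mu fx fy rho gam Kg D (xth n V) Y ltac:(rewrite xth_mod; lra) hY (xth_nz n V)) as [g1 _].
    destruct (gof_small m lam mu fx fy rho gam Kg D (xth n V') Y' ltac:(rewrite xth_mod; lra) hY' (xth_nz n V')) as [g2 _].
    assert (ew : forall U, ell s U < 0 -> Cmod (wof m (xth n U)) = Cmod U).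
    { intros U hU. rewrite wof_mod by (auto; apply xth_nz). rewrite xth_mod, <- wof_mod by (auto; apply rt_nz). rewrite (wof_rt m hm s); auto. }
    rewrite ew in g1, g2 by auto.
    assert (Kg / Cmod V <= Kg / Lam) by (apply Rmult_le_compat_l; [lra|]; apply Rinv_le_contravar; lra).
    assert (Kg / Cmod V' <= Kg / Lam) by (apply Rmult_le_compat_l; [lra|]; apply Rinv_le_contravar; lra).
    assert (/ 16 <= Cmod (V' - V) / Lam). { apply Rmult_le_reg_r with Lam; [lra|]. unfold Rdiv. rewrite Rmult_assoc, Rinv_l by lra. lra. }
    apply Rle_trans with (Kg / Lam * 2); [lra|]. apply Rmult_le_compat_l; lra.
Qed.

(** Each direction is solved in its stable time, as in the Lyapunov-Perron method. The relation w_n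
    = w_(n+1) + 1 + g is integrated from the prescribed w0 towards the past, whereas y_n is read
    from index n + 1 ([ynext]): the vertical direction contracts forward, so y takes no initial
    value. *)
Fixpoint vnext (w0 : C) (V Y : nat -> C) (n : nat) : C :=
  match n with
  | O => w0
  | S k => (vnext w0 V Y k - 1 - gof m fx (xth (S k) (V (S k))) (Y (S k)))%C
  end.
Definition ynext (V Y : nat -> C) (n : nat) : C := fy (xth (S n) (V (S n))) (Y (S n)).

Fixpoint picard_iter (i : nat) (w0 : C) : (nat -> C) * (nat -> C) :=
  match i with
  | O => ((fun n => (w0 - INR n)%C) : nat -> C, (fun _ => RtoC 0) : nat -> C)
  | S j => (vnext w0 (fst (picard_iter j w0)) (snd (picard_iter j w0)), ynext (fst (picard_iter j w0)) (snd (picard_iter j w0)))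
  end.

(** The slope 1/10 is room for the sum of the values of [gof], each at most 1/10 here. Within this
    cone about the exact translation, [ell s] still decreases at a definite rate. *)
Definition picard_region (w0 : C) (V Y : nat -> C) : Prop :=
  forall n, Cmod (V n - (w0 - INR n)) <= INR n / 10 /\ Cmod (Y n) <= rho / 2.

Lemma picard_region_lower w0 V Y n : ell s w0 < - L -> picard_region w0 V Y -> ell s (V n) < - L / 2 /\ (L + INR n) / 2 <= Cmod (V n).
Proof.
  intros h H. destruct (H n) as [h1 _]. assert (pn := pos_INR n).
  assert (e : ell s (V n) = ell s (V n - (w0 - INR n))%C + ell s w0 - INR n). { rewrite !ell_sub, ell_RtoC. ring. }
  assert (b := ell_Cmod s (V n - (w0 - INR n)) hs). apply Rabs_le_between in b.
  assert (b' := ell_Cmod s (V n) hs). apply Rabs_le_between in b'.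
  assert (hK := d_Kg _ _ _ _ _ _ _ _ D).
  split; [lra|].
  assert (S2 : (L + 8 / 10 * INR n) * (L + 8 / 10 * INR n) <= 2 * (Cmod (V n) * Cmod (V n))).
  { apply Rle_trans with (ell s (V n) * ell s (V n)).
    - assert (e1 : ell s (V n) <= - (L + 8 / 10 * INR n)); [|nra].
      assert (ell s (V n - (w0 - INR n))%C <= 3 / 2 * (INR n / 10)) by lra.
      lra.
    - rewrite Cmod_sqr. unfold ell. assert (0 <= (Re (V n) - s * Im (V n)) * (Re (V n) - s * Im (V n))) by apply Rle_0_sqr. nra. }
  assert (p := Cmod_ge_0 (V n)). apply Rnot_lt_le. intro k. nra.
Qed.

Lemma picard_region_x w0 V Y n : ell s w0 < - L -> picard_region w0 V Y -> Cmod (xth n (V n)) <= rho / 2.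
Proof.
  intros h H. destruct (picard_region_lower w0 V Y n h H) as [a b]. rewrite xth_mod. assert (pn := pos_INR n).
  assert (hK := d_Kg _ _ _ _ _ _ _ _ D). apply rt_small; lra.
Qed.

Lemma wof_xth n w : ell s w < 0 -> (th ^ m = 1)%C -> wof m (xth n w) = w.
Proof.
  intros hw ht. unfold wof, xth. rewrite Cpow_mult_l, thn_pow by auto.
  replace (1 * rt m w ^ m)%C with (rt m w ^ m)%C by ring. apply (wof_rt m hm s); auto.
Qed.

Lemma gof_xth_small w0 V Y n : ell s w0 < - L -> picard_region w0 V Y -> Cmod (gof m fx (xth n (V n)) (Y n)) <= / 10.
Proof.
  intros h H. assert (hr := d_rho _ _ _ _ _ _ _ _ D). assert (b := picard_region_x w0 V Y n h H). destruct (H n) as [_ hy].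
  destruct (gof_small m lam mu fx fy rho gam Kg D (xth n (V n)) (Y n) ltac:(lra) ltac:(lra) (xth_nz n _)) as [_ g]. lra.
Qed.

Lemma picard_region_next w0 V Y : ell s w0 < - L -> picard_region w0 V Y -> picard_region w0 (vnext w0 V Y) (ynext V Y).
Proof.
  intros h H n. split.
  - induction n as [|n IH].
    + simpl. replace (w0 - (w0 - 0))%C with (RtoC 0) by ring. rewrite Cmod_0. lra.
    + cbn [vnext]. rewrite S_INR, RtoC_plus.
      match goal with |- Cmod ?z <= _ => replace z with ((vnext w0 V Y n - (w0 - INR n)) - gof m fx (xth (S n) (V (S n))) (Y (S n)))%C by ring end.
      eapply Rle_trans; [apply Cmod_sub|]. assert (g := gof_xth_small w0 V Y (S n) h H). lra.
  - unfold ynext. assert (hr := d_rho _ _ _ _ _ _ _ _ D). assert (b := picard_region_x w0 V Y (S n) h H). destruct (H (S n)) as [_ hy].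
    assert (B := d_ly _ _ _ _ _ _ _ _ D (xth (S n) (V (S n))) (Y (S n)) 0 0). rewrite Cmod_0 in B.
    specialize (B ltac:(lra) ltac:(lra) ltac:(lra) ltac:(lra)). rewrite (d_y0 _ _ _ _ _ _ _ _ D) in B.
    destruct (eps_bounds m lam mu fx fy rho gam Kg D) as (e0 & e1 & e2 & e3).
    set (e := gam * (1 - Cmod mu) / 16) in *.
    set (X := xth (S n) (V (S n))) in *. set (y := Y (S n)) in *.
    replace (X - 0)%C with X in B by ring. replace (y - 0)%C with y in B by ring.
    replace (fy X y) with ((fy X y - 0 - mu * y) + mu * y)%C by ring.
    eapply Rle_trans; [apply Cmod_triangle|]. rewrite Cmod_mult. assert (pmu := Cmod_ge_0 mu). assert (hmu := d_mu _ _ _ _ _ _ _ _ D).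
    assert (e * (Cmod X + Cmod y) <= e * rho) by (apply Rmult_le_compat_l; lra).
    assert (Cmod mu * Cmod y <= Cmod mu * (rho / 2)) by (apply Rmult_le_compat_l; lra). nra.
Qed.

Lemma picard_region_0 w0 : picard_region w0 (fun n => w0 - INR n)%C (fun _ => RtoC 0).
Proof.
  intro n. rewrite Cmod_self, Cmod_0. assert (pn := pos_INR n). assert (hr := d_rho _ _ _ _ _ _ _ _ D). lra.
Qed.

Lemma picard_iter_region i w0 : ell s w0 < - L -> picard_region w0 (fst (picard_iter i w0)) (snd (picard_iter i w0)).
Proof. intro h. induction i as [|i IH]; [apply picard_region_0|]. simpl. apply picard_region_next; auto. Qed.

(** Differences of V accumulate linearly in n, so they are weighted by L + n. With this weight the
    Lipschitz bound for [gof] contributes at most del/2 per step. For Y the forward contraction by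
    |mu| leaves the factor (1 + |mu|)/2. *)
Lemma next_contraction w0 V Y V' Y' del : ell s w0 < - L -> picard_region w0 V Y -> picard_region w0 V' Y' -> 0 <= del ->
  (forall n, Cmod (V' n - V n) <= (L + INR n) * del /\ Cmod (Y' n - Y n) <= del) ->
  forall n, Cmod (vnext w0 V' Y' n - vnext w0 V Y n) <= (L + INR n) * ((1 + Cmod mu) / 2 * del) /\
   Cmod (ynext V' Y' n - ynext V Y n) <= (1 + Cmod mu) / 2 * del.
Proof.
  intros h H H' hdel Hd. assert (hr := d_rho _ _ _ _ _ _ _ _ D). assert (hK := d_Kg _ _ _ _ _ _ _ _ D). assert (hsm := d_small _ _ _ _ _ _ _ _ D).
  assert (pmu := Cmod_ge_0 mu). assert (hmu := d_mu _ _ _ _ _ _ _ _ D).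
  assert (dg : forall n, Cmod (gof m fx (xth n (V' n)) (Y' n) - gof m fx (xth n (V n)) (Y n)) <= / 2 * del).
  { intro n. destruct (picard_region_lower w0 V Y n h H) as [a b]. destruct (picard_region_lower w0 V' Y' n h H') as [a' b'].
    destruct (H n) as [_ hy]. destruct (H' n) as [_ hy']. assert (pn := pos_INR n). destruct (Hd n) as [d1 d2].
    eapply Rle_trans; [apply (gof_xth_lip n (V n) (V' n) (Y n) (Y' n) ((L + INR n) / 2)); lra|].
    assert (Cmod (V' n - V n) / ((L + INR n) / 2) <= 2 * del).
    { apply Rmult_le_reg_r with ((L + INR n) / 2); [lra|]. unfold Rdiv at 1. rewrite Rmult_assoc, Rinv_l by lra. lra. }
    assert (32 * Kg / ((L + INR n) / 2) <= 64 / 1000).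
    { apply Rmult_le_reg_r with ((L + INR n) / 2); [lra|]. unfold Rdiv at 1. rewrite Rmult_assoc, Rinv_l by lra. lra. }
    assert (0 <= Cmod (V' n - V n) / ((L + INR n) / 2)) by (apply Rdiv_le_0_compat; [apply Cmod_ge_0|lra]).
    assert (0 <= 32 * Kg / ((L + INR n) / 2)) by (apply Rdiv_le_0_compat; lra).
    apply Rle_trans with (64 / 1000 * (3 * del)); [|lra]. apply Rmult_le_compat; try lra. generalize (Cmod_ge_0 (Y' n - Y n)); lra. }
  intro n. split.
  - assert (Q : Cmod (vnext w0 V' Y' n - vnext w0 V Y n) <= INR n * (/ 2 * del)).
    { induction n as [|n IH].
      - simpl. rewrite Cmod_self. lra.
      - cbn [vnext]. rewrite S_INR. specialize (dg (S n)).
        match goal with |- Cmod ?z <= _ => replace z with ((vnext w0 V' Y' n - vnext w0 V Y n) - (gof m fx (xth (S n) (V' (S n))) (Y' (S n)) - gof m fx (xth (S n) (V (S n))) (Y (S n))))%C by ring end.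
        eapply Rle_trans; [apply Cmod_sub|]. lra. }
    eapply Rle_trans; [apply Q|]. assert (pn := pos_INR n). apply Rmult_le_compat; try lra. nra.
  - unfold ynext.
    destruct (picard_region_lower w0 V Y (S n) h H) as [a b]. destruct (picard_region_lower w0 V' Y' (S n) h H') as [a' b'].
    assert (hx := picard_region_x w0 V Y (S n) h H). assert (hx' := picard_region_x w0 V' Y' (S n) h H').
    destruct (H (S n)) as [_ hy]. destruct (H' (S n)) as [_ hy']. assert (pn := pos_INR (S n)). destruct (Hd (S n)) as [d1 d2].
    assert (B := d_ly _ _ _ _ _ _ _ _ D (xth (S n) (V' (S n))) (Y' (S n)) (xth (S n) (V (S n))) (Y (S n)) ltac:(lra) ltac:(lra) ltac:(lra) ltac:(lra)).
    destruct (xth_dist (S n) (V (S n)) (V' (S n)) ((L + INR (S n)) / 2) ltac:(lra) ltac:(lra) ltac:(lra) b b') as [dx _].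
    assert (dv : Cmod (V' (S n) - V (S n)) / ((L + INR (S n)) / 2) <= 2 * del).
    { apply Rmult_le_reg_r with ((L + INR (S n)) / 2); [lra|]. unfold Rdiv at 1. rewrite Rmult_assoc, Rinv_l by lra. lra. }
    destruct (eps_bounds m lam mu fx fy rho gam Kg D) as (e0 & e1 & e2 & e3).
    set (e := gam * (1 - Cmod mu) / 16) in *.
    set (X := xth (S n) (V (S n))) in *. set (y := Y (S n)) in *. set (X' := xth (S n) (V' (S n))) in *. set (y' := Y' (S n)) in *.
    assert (dX : Cmod (X' - X) <= del).
    { eapply Rle_trans; [apply dx|]. assert (rho <= / 100) by nra.
      assert (0 <= Cmod (V' (S n) - V (S n)) / ((L + INR (S n)) / 2)) by (apply Rdiv_le_0_compat; [apply Cmod_ge_0|lra]).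
      apply Rle_trans with (16 * / 100 * (2 * del)); [apply Rmult_le_compat; lra|lra]. }
    replace (fy X' y' - fy X y)%C with ((fy X' y' - fy X y - mu * (y' - y)) + mu * (y' - y))%C by ring.
    eapply Rle_trans; [apply Cmod_triangle|]. rewrite Cmod_mult.
    assert (e * (Cmod (X' - X) + Cmod (y' - y)) <= e * (2 * del)) by (apply Rmult_le_compat_l; lra).
    assert (Cmod mu * Cmod (y' - y) <= Cmod mu * del) by (apply Rmult_le_compat_l; lra). nra.
Qed.

Lemma picard_iter_step i w0 n : ell s w0 < - L ->
  Cmod (fst (picard_iter (S i) w0) n - fst (picard_iter i w0) n) <= (L + INR n) * ((1 + Cmod mu) / 2) ^ i /\
  Cmod (snd (picard_iter (S i) w0) n - snd (picard_iter i w0) n) <= ((1 + Cmod mu) / 2) ^ i.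
Proof.
  intro h. revert n. assert (hr := d_rho _ _ _ _ _ _ _ _ D). assert (hK := d_Kg _ _ _ _ _ _ _ _ D).
  assert (pmu := Cmod_ge_0 mu). assert (hmu := d_mu _ _ _ _ _ _ _ _ D).
  induction i as [|i IH]; intro n.
  - assert (pn := pos_INR n). destruct (picard_iter_region 1 w0 h n) as [a b]. rewrite !pow_O, !Rmult_1_r.
    change (fst (picard_iter 0 w0) n) with (w0 - INR n)%C. change (snd (picard_iter 0 w0) n) with (RtoC 0).
    replace (snd (picard_iter 1 w0) n - 0)%C with (snd (picard_iter 1 w0) n) by ring. lra.
  - simpl pow. apply (next_contraction w0 (fst (picard_iter i w0)) (snd (picard_iter i w0)) (fst (picard_iter (S i) w0)) (snd (picard_iter (S i) w0)) (((1 + Cmod mu) / 2) ^ i)); auto.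
    + apply picard_iter_region; auto.
    + apply picard_iter_region; auto.
    + apply pow_le; lra.
Qed.

Lemma ell_open w0 : ell s w0 < - L -> exists d, 0 < d /\ forall w, Cmod (w - w0) < d -> ell s w < - L.
Proof.
  intro h. exists ((- L - ell s w0) / 2). split; [lra|]. intros w hw.
  assert (b := ell_Cmod s (w - w0) hs). apply Rabs_le_between in b. rewrite ell_sub in b. lra.
Qed.

Lemma picard_iter_cdble i w0 : ell s w0 < - L -> forall n, cdble (fun w => fst (picard_iter i w) n) w0 /\ cdble (fun w => snd (picard_iter i w) n) w0.
Proof.
  intro h. assert (hr := d_rho _ _ _ _ _ _ _ _ D). assert (hK := d_Kg _ _ _ _ _ _ _ _ D).
  induction i as [|i IH]; intro n.
  - simpl. split; [|apply cdble_const]. apply cdble_minus; [apply cdble_id|apply cdble_const].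
  - assert (I := picard_iter_region i w0 h).
    assert (hx : forall k, cdble (fun w => xth k (fst (picard_iter i w) k)) w0).
    { intro k. apply (cdble_mult (fun _ => thn k)); [apply cdble_const|].
      apply (cdble_comp (fun w => fst (picard_iter i w) k) (rt m)); [apply IH|]. apply (rt_cdble m hm s); auto.
      destruct (picard_region_lower w0 _ _ k h I). lra. }
    assert (dom : forall k, Cmod (xth k (fst (picard_iter i w0) k)) < rho /\ Cmod (snd (picard_iter i w0) k) < rho).
    { intro k. assert (b := picard_region_x w0 _ _ k h I). destruct (I k). lra. }
    assert (hf : forall k, cdble (fun w => fx (xth k (fst (picard_iter i w) k)) (snd (picard_iter i w) k)) w0).
    { intro k. apply (fdiff_comp fx); [apply hx|apply IH|]. apply (d_fx _ _ _ _ _ _ _ _ D); apply dom. }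
    split.
    + cbn [picard_iter fst]. induction n as [|n IHn]; [apply cdble_id|].
      cbn [vnext]. apply cdble_minus; [apply cdble_minus; [exact IHn|apply cdble_const]|].
      unfold gof. apply (cdble_minus (fun w => wof m (fx (xth (S n) (fst (picard_iter i w) (S n))) (snd (picard_iter i w) (S n))) - wof m (xth (S n) (fst (picard_iter i w) (S n))))%C); [|apply cdble_const].
      apply cdble_minus.
      * apply (cdble_wof m (fun w => fx (xth (S n) (fst (picard_iter i w) (S n))) (snd (picard_iter i w) (S n)))); auto.
        apply (fx_nz m lam mu fx fy rho gam Kg D); try apply dom. apply xth_nz.
      * apply (cdble_wof m (fun w => xth (S n) (fst (picard_iter i w) (S n)))); auto. apply xth_nz.
    + cbn [picard_iter snd]. unfold ynext. apply (fdiff_comp fy); [apply hx|apply IH|]. apply (d_fy _ _ _ _ _ _ _ _ D); apply dom.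
Qed.

(** The iterates converge geometrically for each n, the limit is a fixed point because
    [next_contraction] also applies between it and the iterates, and [weierstrass] makes it
    holomorphic in w0, the region providing locally uniform bounds. *)
Lemma picard (hthm : (th ^ m = 1)%C) : exists V Y : C -> nat -> C, forall w0, ell s w0 < - L ->
  V w0 O = w0 /\ picard_region w0 (V w0) (Y w0) /\ orb fx fy rho (fun n => xth n (V w0 n)) (Y w0) /\
  forall n, cdble (fun w => V w n) w0 /\ cdble (fun w => Y w n) w0.
Proof.
  assert (hr := d_rho _ _ _ _ _ _ _ _ D). assert (hK := d_Kg _ _ _ _ _ _ _ _ D).
  assert (pmu := Cmod_ge_0 mu). assert (hmu := d_mu _ _ _ _ _ _ _ _ D).
  set (tau := (1 + Cmod mu) / 2). assert (ht : 0 <= tau < 1) by (unfold tau; lra).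
  assert (LV : forall p : C * nat, exists l, ell s (fst p) < - L -> clim (fun i => fst (picard_iter i (fst p)) (snd p)) l /\
    forall i, Cmod (l - fst (picard_iter i (fst p)) (snd p)) <= (L + INR (snd p)) / (1 - tau) * tau ^ i).
  { intros [w0 n]. cbn [fst snd]. destruct (Rlt_dec (ell s w0) (- L)) as [k|k]; [|exists 0%C; tauto].
    assert (pn := pos_INR n).
    destruct (geom_cauchy (fun i => fst (picard_iter i w0) n) (L + INR n) tau ht ltac:(lra)) as [l hl]; [|exists l; auto].
    intro i. apply picard_iter_step; auto. }
  assert (LY : forall p : C * nat, exists l, ell s (fst p) < - L -> clim (fun i => snd (picard_iter i (fst p)) (snd p)) l /\
    forall i, Cmod (l - snd (picard_iter i (fst p)) (snd p)) <= 1 / (1 - tau) * tau ^ i).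
  { intros [w0 n]. cbn [fst snd]. destruct (Rlt_dec (ell s w0) (- L)) as [k|k]; [|exists 0%C; tauto].
    destruct (geom_cauchy (fun i => snd (picard_iter i w0) n) 1 tau ht ltac:(lra)) as [l hl]; [|exists l; auto].
    intro i. rewrite Rmult_1_l. apply picard_iter_step; auto. }
  destruct (functional_choice _ LV) as [V0 HV]. destruct (functional_choice _ LY) as [Y0 HY].
  set (V := fun w n => V0 (w, n)). set (Y := fun w n => Y0 (w, n)).
  assert (HV' : forall w n, ell s w < - L -> clim (fun i => fst (picard_iter i w) n) (V w n) /\ forall i, Cmod (V w n - fst (picard_iter i w) n) <= (L + INR n) / (1 - tau) * tau ^ i).
  { intros w n h. exact (HV (w, n) h). }
  assert (HY' : forall w n, ell s w < - L -> clim (fun i => snd (picard_iter i w) n) (Y w n) /\ forall i, Cmod (Y w n - snd (picard_iter i w) n) <= 1 / (1 - tau) * tau ^ i).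
  { intros w n h. exact (HY (w, n) h). }
  exists V, Y. intros w0 h.
  assert (I : picard_region w0 (V w0) (Y w0)).
  { intro n. split.
    - apply (clim_le (fun i => fst (picard_iter i w0) n) _ _ _ O); [apply HV'; auto|]. intros i _. apply picard_iter_region; auto.
    - replace (Y w0 n) with (Y w0 n - 0)%C by ring.
      apply (clim_le (fun i => snd (picard_iter i w0) n) _ _ _ O); [apply HY'; auto|]. intros i _.
      replace (snd (picard_iter i w0) n - 0)%C with (snd (picard_iter i w0) n) by ring. apply picard_iter_region; auto. }
  assert (F : forall n, Cmod (vnext w0 (V w0) (Y w0) n - V w0 n) <= 0 /\ Cmod (ynext (V w0) (Y w0) n - Y w0 n) <= 0).
  { set (c := 1 / (1 - tau)). assert (pc : 0 <= c) by (apply Rdiv_le_0_compat; lra).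
    assert (N : forall i n, Cmod (vnext w0 (V w0) (Y w0) n - fst (picard_iter (S i) w0) n) <= (L + INR n) * (tau * (c * tau ^ i)) /\
       Cmod (ynext (V w0) (Y w0) n - snd (picard_iter (S i) w0) n) <= tau * (c * tau ^ i)).
    { intros i. apply (next_contraction w0 (fst (picard_iter i w0)) (snd (picard_iter i w0)) (V w0) (Y w0) (c * tau ^ i)); auto.
      - apply picard_iter_region; auto.
      - apply Rmult_le_pos; auto. apply pow_le; lra.
      - intro n. destruct (HV' w0 n h) as [_ a]. destruct (HY' w0 n h) as [_ b]. specialize (a i). specialize (b i).
        split; auto. eapply Rle_trans; [apply a|]. unfold c. apply Req_le. field. lra. }
    intro n. assert (pn := pos_INR n).
    assert (Z : forall K, 0 <= K -> forall eps, 0 < eps -> exists i, K * tau ^ i <= eps).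
    { intros K pK eps he. destruct (pow_lt_1_zero tau ltac:(rewrite Rabs_pos_eq; lra) (eps / (K + 1)) ltac:(apply Rdiv_lt_0_compat; lra)) as [i Hi].
      exists i. specialize (Hi i (le_n _)). rewrite Rabs_pos_eq in Hi by (apply pow_le; lra).
      assert (0 <= tau ^ i) by (apply pow_le; lra).
      apply Rmult_lt_compat_l with (r := K + 1) in Hi; [|lra]. replace ((K + 1) * (eps / (K + 1))) with eps in Hi by (field; lra). lra. }
    split; apply (le_eps_mult _ _ 1); try lra; intros eps he.
    - destruct (Z (2 * ((L + INR n) * c)) ltac:(apply Rmult_le_pos; [lra|apply Rmult_le_pos; lra]) eps he) as [i Hi].
      destruct (N i n) as [a _]. destruct (HV' w0 n h) as [_ b]. specialize (b (S i)).
      eapply Rle_trans; [apply (Cmod_tri _ (fst (picard_iter (S i) w0) n))|]. rewrite (Cmod_swap (fst (picard_iter (S i) w0) n)).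
      assert (q : 0 <= tau ^ i) by (apply pow_le; lra). assert (q' : 0 <= (L + INR n) * c) by (apply Rmult_le_pos; lra).
      replace ((L + INR n) / (1 - tau) * tau ^ S i) with (tau * ((L + INR n) * c * tau ^ i)) in b by (unfold c; simpl; field; lra).
      assert (0 <= (L + INR n) * c * tau ^ i) by (apply Rmult_le_pos; auto).
      assert (tau * ((L + INR n) * c * tau ^ i) <= 1 * ((L + INR n) * c * tau ^ i)) by (apply Rmult_le_compat_r; lra). lra.
    - destruct (Z (2 * c) ltac:(lra) eps he) as [i Hi].
      destruct (N i n) as [_ a]. destruct (HY' w0 n h) as [_ b]. specialize (b (S i)).
      eapply Rle_trans; [apply (Cmod_tri _ (snd (picard_iter (S i) w0) n))|]. rewrite (Cmod_swap (snd (picard_iter (S i) w0) n)).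
      assert (q : 0 <= tau ^ i) by (apply pow_le; lra). fold c in b. simpl pow in b.
      assert (0 <= c * tau ^ i) by (apply Rmult_le_pos; auto).
      assert (tau * (c * tau ^ i) <= 1 * (c * tau ^ i)) by (apply Rmult_le_compat_r; lra). lra. }
  assert (eqz : forall a b : C, Cmod (a - b) <= 0 -> a = b).
  { intros a b k. apply Cmod_le0 in k. replace a with ((a - b) + b)%C by ring. rewrite k. ring. }
  assert (FV : forall n, vnext w0 (V w0) (Y w0) n = V w0 n) by (intro n; apply eqz, F).
  assert (FY : forall n, ynext (V w0) (Y w0) n = Y w0 n) by (intro n; apply eqz, F).
  split; [symmetry; apply (FV O)|]. split; auto. split.
  - intro n. assert (b := picard_region_x w0 _ _ n h I). assert (b1 := picard_region_x w0 _ _ (S n) h I). destruct (I n) as [_ hy]. destruct (I (S n)) as [_ hy1].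
    split; [lra|]. split; [lra|]. split; [|exact (FY n)].
    destruct (picard_region_lower w0 _ _ n h I) as [r1 r2]. destruct (picard_region_lower w0 _ _ (S n) h I) as [r3 r4].
    assert (pn := pos_INR n). assert (pn1 := pos_INR (S n)).
    set (X := xth (S n) (V w0 (S n))) in *. set (y := Y w0 (S n)) in *.
    assert (wX : wof m X = V w0 (S n)) by (apply wof_xth; auto; lra).
    assert (wF : wof m (fx X y) = V w0 n).
    { assert (E := FV (S n)). cbn [vnext] in E. rewrite (FV n) in E. unfold gof in E. fold X y in E. rewrite wX in E.
      replace (V w0 n) with ((V w0 n - 1 - (wof m (fx X y) - V w0 (S n) - 1)) - V w0 (S n) + wof m (fx X y))%C by ring.
      rewrite E. ring. }
    (* The fixed-point equation determines only [wof m (fx X y)], that is, the point up to an m-th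
       root of unity; [branch_step] selects the root. *)
    assert (B := branch_step s X y hs ltac:(lra) ltac:(lra) (xth_nz _ _) ltac:(rewrite wX; lra) ltac:(rewrite wF; lra) ltac:(rewrite wX; lra)).
    rewrite wF, wX in B.
    transitivity (fx X y / rt m (V w0 n) * rt m (V w0 n))%C; [field; apply rt_nz|]. rewrite B. unfold X, xth. rewrite (thn_S n). field. apply rt_nz.
  - intro n. destruct (ell_open w0 h) as [d [hd Hd]]. assert (pn := pos_INR n).
    split.
    + apply (weierstrass (fun i w => fst (picard_iter i w) n) (fun w => V w n) w0 d (Cmod w0 + d + 2 * INR n)); auto.
      * intros i z hz. apply picard_iter_cdble; auto.
      * intros i z hz. destruct (picard_iter_region i z (Hd z hz) n) as [a _].
        generalize (Cmod_tri_inv (fst (picard_iter i z) n) (z - INR n)) (Cmod_sub z (INR n)) (Cmod_tri_inv z w0). rewrite Cmod_RtoC by auto. lra.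
      * intros z hz. apply HV'; auto.
    + apply (weierstrass (fun i w => snd (picard_iter i w) n) (fun w => Y w n) w0 d (rho / 2)); auto.
      * intros i z hz. apply picard_iter_cdble; auto.
      * intros i z hz. destruct (picard_iter_region i z (Hd z hz) n) as [_ a]. exact a.
      * intros z hz. apply HY'; auto.
Qed.
End Picard.
End Dyn.

Arguments d_m {m lam mu fx fy rho gam Kg} _.
Arguments d_lam {m lam mu fx fy rho gam Kg} _.
Arguments d_lamm {m lam mu fx fy rho gam Kg} _.
Arguments d_mu {m lam mu fx fy rho gam Kg} _.
Arguments d_rho {m lam mu fx fy rho gam Kg} _.
Arguments d_gam {m lam mu fx fy rho gam Kg} _.
Arguments d_Kg {m lam mu fx fy rho gam Kg} _.
Arguments d_fx {m lam mu fx fy rho gam Kg} _.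
Arguments d_fy {m lam mu fx fy rho gam Kg} _.
Arguments lam_nz {m lam mu fx fy rho gam Kg} _.
Arguments m_pos {m lam mu fx fy rho gam Kg} _.
Arguments orb_cone {m lam mu fx fy rho gam Kg} _.
Arguments orb_nz {m lam mu fx fy rho gam Kg} _.
Arguments orb_unique {m lam mu fx fy rho gam Kg} _.
Arguments orb_y_le {m lam mu fx fy rho gam Kg} _.
Arguments orb_w {m fx fy rho} x y n _.
Arguments orb_w_step {m lam mu fx fy rho gam Kg} _.
Arguments gof_small {m lam mu fx fy rho gam Kg} _.
Arguments fx_nz {m lam mu fx fy rho gam Kg} _.
Arguments orb_compare {m lam mu fx fy rho gam Kg} _.
Arguments branch_step {m lam mu fx fy rho gam Kg} _.
Arguments thn_mod {m lam mu fx fy rho gam Kg} _.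
Arguments thn_S {m lam mu fx fy rho gam Kg} _.
Arguments thn_pow {m lam mu fx fy rho gam Kg} _.
Arguments xth_mod {m lam mu fx fy rho gam Kg} _.
Arguments xth_nz {m lam mu fx fy rho gam Kg} _.
Arguments wof_xth {m lam mu fx fy rho gam Kg} _.
Arguments picard_region_lower {m lam mu fx fy rho gam Kg} _.
Arguments picard {m lam mu fx fy rho gam Kg} _.

(** * Classification of backward orbits *)

Lemma eq_of_Cmod (a b : C) : Cmod (a - b) <= 0 -> a = b.
Proof. intro k. apply Cmod_le0 in k. replace a with ((a - b) + b)%C by ring. rewrite k. ring. Qed.

Lemma left_ell (w : C) : exists s, s * s = 1 /\ ell s w = Re w - Rabs (Im w).
Proof.
  unfold ell. destruct (Rle_dec 0 (Im w)) as [h|h].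
  - exists (-1). rewrite Rabs_pos_eq by auto. split; ring.
  - exists 1. rewrite Rabs_left by lra. split; ring.
Qed.

Lemma ell_close s a b : s * s = 1 -> ell s a <= ell s b + 3 / 2 * Cmod (a - b).
Proof. intro hs. assert (p := ell_Cmod s (a - b) hs). apply Rabs_le_between in p. rewrite ell_sub in p. lra. Qed.

(** A common half plane for two relatively close points: [rt_near] and [branch_step] need one sign
    for both. *)
Lemma left_two (a b : C) : Re b <= 0 -> Cmod (a - b) <= Cmod b / 2 -> 0 < Cmod b -> exists s, s * s = 1 /\ ell s a < 0 /\ ell s b < 0.
Proof.
  intros hb h pb. destruct (left_ell b) as [s [hs e]]. exists s. split; auto.
  assert (c := Cmod_le_ReIm b). rewrite (Rabs_left1 (Re b)) in c by auto. assert (q := ell_close s a b hs). lra.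
Qed.

Section Dyn.
Context (m : nat) (lam mu : C) (fx fy : C -> C -> C) (rho gam Kg : R) (D : dyn m lam mu fx fy rho gam Kg).

Let hm : (1 <= m)%nat := d_m D.

(** Demanded only for large indices, since early points may have Re w >= 0 and an orbit may there
    cross the cut of [rt]. *)
Definition branch (th : C) (x : nat -> C) : Prop :=
  exists M : nat, forall n, (M <= n)%nat -> Re (wseq m x n) < 0 /\ x n = xth m lam th n (wseq m x n).

Lemma orb_Re x y : orb fx fy rho x y -> x O <> 0%C -> forall n k, Re (wseq m x (n + k)%nat) <= Re (wseq m x n) - 99 / 100 * INR k.
Proof.
  intros h h0 n k. induction k as [|k IH].
  - rewrite Nat.add_0_r. simpl. lra.
  - replace (n + S k)%nat with (S (n + k)) by lia. rewrite S_INR.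
    assert (st := orb_w_step D x y (n + k) h h0). assert (q := re_le_Cmod (wseq m x (S (n + k)) - (wseq m x (n + k)%nat - 1))).
    rewrite !Re_sub in q. replace (Re (RtoC 1)) with 1 in q by reflexivity. apply Rabs_le_between in q. lra.
Qed.

Lemma orb_Re_lim x y T : orb fx fy rho x y -> x O <> 0%C -> exists M : nat, forall n, (M <= n)%nat -> Re (wseq m x n) < T.
Proof.
  intros h h0. destruct (INR_unbounded (2 * (Rabs (Re (wseq m x O)) + Rabs T + 1))) as [M hM].
  exists M. intros n hn. assert (q := orb_Re x y h h0 0 n). rewrite Nat.add_0_l in q.
  apply le_INR in hn. generalize (Rle_abs (Re (wseq m x 0))) (Rle_abs (- T)) (Rabs_pos (Re (wseq m x 0))) (Rabs_pos T). rewrite Rabs_Ropp. lra.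
Qed.

Lemma wof_pow (x : C) : x <> 0%C -> (INR m * wof m x * x ^ m = - (1))%C.
Proof.
  intros nu. unfold wof. assert (nq := wof_neq m x hm nu). field. split; [|apply INR_m_neq_0; auto].
  intro k. apply nq. rewrite k. ring.
Qed.

(** Once Re w < -400, [branch_step] shows that x_n / [rt m] w_n is multiplied by exactly 1/lam at
    each backward step. Hence its product with lam^n is constant, and this constant is an m-th root
    of unity because both factors of the quotient have the same m-th power. *)
Lemma classify x y : orb fx fy rho x y -> x O <> 0%C -> exists th, (th ^ m = 1)%C /\ branch th x.
Proof.
  intros h h0. assert (hK := d_Kg D). assert (nl := lam_nz D).
  destruct (orb_Re_lim x y (- (400)) h h0) as [M hM].
  assert (nx := orb_nz D x y h h0).
  assert (big : forall n, (M <= n)%nat -> 400 <= Cmod (wseq m x n)).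
  { intros n hn. specialize (hM n hn). assert (q := re_le_Cmod (wseq m x n)). apply Rabs_le_between in q. lra. }
  assert (step : forall n, (M <= n)%nat -> (x n / rt m (wseq m x n) = lam * (x (S n) / rt m (wseq m x (S n))))%C).
  { intros n hn. destruct (h n) as (_ & _ & f1 & _). destruct (h (S n)) as (a1 & a2 & _).
    assert (b := big (S n) ltac:(lia)). assert (c := hM (S n) ltac:(lia)).
    assert (st := orb_w_step D x y n h h0).
    destruct (left_two (wseq m x n) (wseq m x (S n))) as (s & hs & l1 & l2); [lra| |lra|].
    { assert (Cmod (wseq m x n - wseq m x (S n)) <= 2); [|lra].
      replace (wseq m x n - wseq m x (S n))%C with (1 - (wseq m x (S n) - (wseq m x n - 1)))%C by ring.
      eapply Rle_trans; [apply Cmod_sub|]. rewrite Cmod_1. lra. }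
    assert (B := branch_step D s (x (S n)) (y (S n)) hs a1 a2 (nx (S n))). rewrite f1 in B. apply B; auto. }
  set (t := (x M / rt m (wseq m x M))%C).
  assert (tn : forall k, (x (M + k)%nat / rt m (wseq m x (M + k)%nat) = t * (/ lam) ^ k)%C).
  { induction k as [|k IH].
    - rewrite Nat.add_0_r. unfold t. simpl. ring.
    - assert (E := step (M + k)%nat ltac:(lia)). rewrite IH in E. replace (M + S k)%nat with (S (M + k)) by lia.
      cbn [Cpow]. transitivity (/ lam * (t * (/ lam) ^ k))%C; [rewrite E; field; split; [apply rt_nz; auto|auto]|ring]. }
  assert (pl : forall k, (lam ^ k)%C <> 0%C) by (intro k; apply Cpow_nz; auto).
  exists (t * lam ^ M)%C. split.
  - assert (l0 := hM M (le_n _)). destruct (left_two (wseq m x M) (wseq m x M)) as (s & hs & l1 & _).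
    { lra. } { rewrite Cmod_self. generalize (Cmod_ge_0 (wseq m x M)); lra. } { generalize (big M (le_n _)); lra. }
    rewrite Cpow_mult_l, <- Cpow_mult_r, Nat.mul_comm, Cpow_mult_r, (d_lamm D), Cpow_1_l.
    assert (e1 := wof_pow (x M) (nx M)). assert (e2 := rt_pow m hm s _ hs l1). change (wof m (x M)) with (wseq m x M) in e1.
    assert (nw : (INR m * wseq m x M)%C <> 0%C).
    { apply Cmult_neq_0; [apply INR_m_neq_0; auto|]. apply Cmod_gt_0. generalize (big M (le_n _)); lra. }
    assert (ex : (t ^ m * rt m (wseq m x M) ^ m = x M ^ m)%C).
    { rewrite <- Cpow_mult_l. f_equal. unfold t. field. apply rt_nz. }
    assert (nr : (rt m (wseq m x M) ^ m)%C <> 0%C) by apply Cpow_nz, rt_nz.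
    assert (E : (rt m (wseq m x M) ^ m = x M ^ m)%C).
    { transitivity ((INR m * wseq m x M * rt m (wseq m x M) ^ m) / (INR m * wseq m x M))%C; [field; split; [intro k; apply nw; rewrite k; ring|apply INR_m_neq_0; auto]|].
      rewrite e2, <- e1. field. split; [intro k; apply nw; rewrite k; ring|apply INR_m_neq_0; auto]. }
    rewrite <- E in ex. transitivity (t ^ m * rt m (wseq m x M) ^ m / rt m (wseq m x M) ^ m * 1)%C; [field; auto|].
    rewrite ex. field. auto.
  - exists M. intros n hn. split; [specialize (hM n hn); lra|].
    assert (E := tn (n - M)%nat). replace (M + (n - M))%nat with n in E by lia.
    unfold xth, thn. replace (lam ^ M)%C with ((lam ^ M * (/ lam) ^ M) * / ((/ lam) ^ M))%C.
    2:{ field. apply Cpow_nz. intro k. assert (lam * / lam = 0)%C by (rewrite k; ring). rewrite Cinv_r in H by auto. apply C1_nz. exact H. }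
    transitivity (x n / rt m (wseq m x n) * rt m (wseq m x n))%C; [field; apply rt_nz|]. rewrite E.
    replace n with (n - M + M)%nat at 3 by lia. rewrite Cpow_add_r, !Cpow_inv by auto.
    field. repeat split; auto.
Qed.

Lemma branch_unique th th' x : branch th x -> branch th' x -> th = th'.
Proof.
  intros [M h] [M' h']. destruct (h (max M M') ltac:(lia)) as [_ e]. destruct (h' (max M M') ltac:(lia)) as [_ e'].
  set (n := max M M') in *. rewrite e' in e at 1. unfold xth, thn in e.
  assert (nl : ((/ lam) ^ n)%C <> 0%C). { rewrite Cpow_inv by apply (lam_nz D). intro k. assert (nn : (lam ^ n)%C <> 0%C) by (apply Cpow_nz, (lam_nz D)). assert (lam ^ n * / lam ^ n = 0)%C by (rewrite k; ring). rewrite Cinv_r in H by auto. apply C1_nz. exact H. }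
  assert (nr := rt_nz m (wseq m x n)).
  transitivity (th * (/ lam) ^ n * rt m (wseq m x n) / ((/ lam) ^ n * rt m (wseq m x n)))%C; [field; auto|]. rewrite <- e. field. auto.
Qed.

(** The values of [gof] tend to 0 along the orbit because |w| tends to infinity, and their averages
    do the same. Only a sublinear error is claimed. *)
Lemma orb_w_asym x y eps : orb fx fy rho x y -> x O <> 0%C -> 0 < eps -> exists M : nat, (1 <= M)%nat /\ forall n, (M <= n)%nat -> Cmod (wseq m x n + INR n) <= eps * INR n.
Proof.
  intros h h0 he. assert (hK := d_Kg D).
  destruct (orb_Re_lim x y (- (2 * Kg / eps)) h h0) as [M hM].
  assert (nx := orb_nz D x y h h0).
  set (c := Cmod (wseq m x M + INR M)).
  assert (Q : forall k, Cmod (wseq m x (M + k)%nat + INR (M + k)) <= c + eps / 2 * INR k).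
  { induction k as [|k IH].
    - rewrite Nat.add_0_r. fold c. simpl. lra.
    - replace (M + S k)%nat with (S (M + k)) by lia.
      destruct (h (S (M + k))) as (a1 & a2 & _).
      destruct (gof_small D _ _ a1 a2 (nx _)) as [g1 _]. change (wof m (x (S (M + k)))) with (wseq m x (S (M + k))) in g1.
      assert (r1 := hM (S (M + k)) ltac:(lia)). assert (q := re_le_Cmod (wseq m x (S (M + k)))). apply Rabs_le_between in q.
      assert (p2 : 0 < 2 * Kg / eps) by (apply Rdiv_lt_0_compat; lra).
      assert (g2 : Kg / Cmod (wseq m x (S (M + k))) <= eps / 2).
      { replace (eps / 2) with (Kg / (2 * Kg / eps)) by (field; lra). apply Rmult_le_compat_l; [lra|]. apply Rinv_le_contravar; lra. }
      assert (E := orb_w (m := m) x y (M + k) h). rewrite !S_INR, RtoC_plus.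
      replace (wseq m x (S (M + k)) + (INR (M + k) + 1))%C with ((wseq m x (M + k)%nat + INR (M + k)) - gof m fx (x (S (M + k))) (y (S (M + k))))%C by (rewrite E; ring).
      eapply Rle_trans; [apply Cmod_sub|]. lra. }
  destruct (INR_unbounded (2 * c / eps)) as [M1 hM1].
  exists (S (M + M1)). split; [lia|]. intros n hn.
  assert (E := Q (n - M)%nat). replace (M + (n - M))%nat with n in E by lia.
  eapply Rle_trans; [apply E|]. rewrite minus_INR by lia. assert (pM := pos_INR M).
  assert (INR M1 <= INR n) by (apply le_INR; lia).
  assert (c <= eps / 2 * INR n).
  { apply Rle_trans with (eps / 2 * (2 * c / eps)); [apply Req_le; field; lra|]. apply Rmult_le_compat_l; lra. }
  nra.
Qed.

(** Both w-sequences are within n/256 of -n, hence relatively close; as the root of unity [th] is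
    the same, [rt_near] transfers this to x. These are the hypotheses of [compare_from] at every
    late index. *)
Lemma tails_close th x y x' y' : orb fx fy rho x y -> x O <> 0%C -> orb fx fy rho x' y' -> x' O <> 0%C ->
  branch th x -> branch th x' -> exists M : nat, (1 <= M)%nat /\ 1024 * Kg <= INR M /\ forall n, (M <= n)%nat ->
    INR n / 2 <= Cmod (wseq m x n) /\ Cmod (wseq m x' n - wseq m x n) <= INR n / 128 /\
    Cmod (x' n - x n) <= Cmod (x n) / (16 * INR m).
Proof.
  intros h h0 h' h0' [B1 b] [B2 b']. assert (hK := d_Kg D). assert (pm := m_pos D).
  destruct (orb_w_asym x y (/ 256) h h0 ltac:(lra)) as [M1 [_ H1]].
  destruct (orb_w_asym x' y' (/ 256) h' h0' ltac:(lra)) as [M2 [_ H2]].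
  destruct (INR_unbounded (1024 * Kg)) as [M3 H3].
  exists (max (max (max 1 M1) (max M2 M3)) (max B1 B2)). split; [lia|]. split.
  { assert (INR M3 <= INR (max (max (max 1 M1) (max M2 M3)) (max B1 B2))) by (apply le_INR; lia). lra. }
  intros n hn. specialize (H1 n ltac:(lia)). specialize (H2 n ltac:(lia)).
  destruct (b n ltac:(lia)) as [r1 e1]. destruct (b' n ltac:(lia)) as [r2 e2].
  assert (pn : 1 <= INR n) by (change 1 with (INR 1); apply le_INR; lia).
  set (w := wseq m x n) in *. set (w' := wseq m x' n) in *.
  assert (lw : INR n * (255 / 256) <= Cmod w).
  { generalize (Cmod_tri_inv (INR n) (w + INR n)). replace (INR n - (w + INR n))%C with (- w)%C by ring. rewrite Cmod_opp, Cmod_RtoC by lra. lra. }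
  assert (dw : Cmod (w' - w) <= INR n / 128).
  { replace (w' - w)%C with ((w' + INR n) - (w + INR n))%C by ring. eapply Rle_trans; [apply Cmod_sub|]. lra. }
  split; [lra|]. split; [lra|].
  destruct (left_two w' w) as (s & hs & l1 & l2); [lra|lra|lra|].
  assert (N := rt_near m hm s w' w hs l1 l2 ltac:(lra)).
  assert (px : 0 < Cmod (x n)) by (apply Cmod_gt_0, (orb_nz D x y h h0)).
  assert (E : (x' n - x n = x n * (rt m w' / rt m w - 1))%C).
  { rewrite e2, e1. unfold xth. field. apply rt_nz. }
  rewrite E, Cmod_mult. change (Cmod (x n) / (16 * INR m)) with (Cmod (x n) * / (16 * INR m)). apply Rmult_le_compat_l; [lra|].
  eapply Rle_trans; [apply N|].
  apply Rle_trans with (3 / INR m * (/ 100)).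
  - apply Rmult_le_compat_l; [apply Rdiv_le_0_compat; lra|]. apply Rmult_le_reg_r with (Cmod w); [lra|]. unfold Rdiv at 1. rewrite Rmult_assoc, Rinv_l by lra. lra.
  - replace (/ (16 * INR m)) with (/ 16 * / INR m) by (field; lra). unfold Rdiv. assert (0 < / INR m) by (apply Rinv_0_lt_compat; lra). lra.
Qed.

Lemma compare_from x y x' y' R k : orb fx fy rho x y -> x O <> 0%C -> orb fx fy rho x' y' ->
  (forall n, (k <= n)%nat -> R <= Cmod (wseq m x n)) -> 512 * Kg <= R ->
  Cmod (x' k - x k) <= Cmod (x k) / (16 * INR m) -> Cmod (wseq m x' k - wseq m x k) <= R / 64 ->
  forall n, (k <= n)%nat ->
    Cmod ((wseq m x' n - wseq m x n) - (wseq m x' k - wseq m x k)) <= 256 * Kg / R * Cmod (wseq m x' k - wseq m x k).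
Proof.
  intros h h0 h' hR hK hx hw n hn.
  destruct (orb_compare D (fun j => x (j + k)%nat) (fun j => y (j + k)%nat) (fun j => x' (j + k)%nat) (fun j => y' (j + k)%nat) R
    (orb_shift fx fy rho x y k h) (orb_shift fx fy rho x' y' k h') (orb_nz D x y h h0 k) ltac:(intro j; apply hR; lia) hK hx hw (n - k)%nat) as [_ H].
  unfold wseq in *. replace (n - k + k)%nat with n in H by lia. exact H.
Qed.

Definition Zrel (x xr : nat -> C) (l : C) : Prop := clim (fun n => wseq m x n - wseq m xr n)%C l.

(** If the comparison starts at index k, all later w have modulus at least k/2, so the subsequent
    variation of the difference is at most 512 Kg / k times a bounded quantity. This is a Cauchy
    criterion. *)
Lemma Zrel_ex th x y x' y' : orb fx fy rho x y -> x O <> 0%C -> orb fx fy rho x' y' -> x' O <> 0%C ->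
  branch th x -> branch th x' -> exists l, Zrel x' x l.
Proof.
  intros h h0 h' h0' b b'. assert (hK := d_Kg D).
  destruct (tails_close th x y x' y' h h0 h' h0' b b') as [M [hM1 [hM2 H]]].
  assert (Cmp : forall k n, (M <= k)%nat -> (k <= n)%nat -> Cmod ((wseq m x' n - wseq m x n) - (wseq m x' k - wseq m x k)) <= 512 * Kg / INR k * Cmod (wseq m x' k - wseq m x k)).
  { intros k n hk hn. destruct (H k hk) as (c1 & c2 & c3).
    assert (INR M <= INR k) by (apply le_INR; auto).
    replace (512 * Kg / INR k) with (256 * Kg / (INR k / 2)) by (field; lra).
    apply (compare_from x y x' y' (INR k / 2) k); auto; try lra.
    intros j hj. destruct (H j ltac:(lia)) as (d1 & _). assert (INR k <= INR j) by (apply le_INR; auto). lra. }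
  set (e := Cmod (wseq m x' M - wseq m x M)).
  assert (pe : 0 <= e) by apply Cmod_ge_0.
  assert (Bd : forall n, (M <= n)%nat -> Cmod (wseq m x' n - wseq m x n) <= 2 * e).
  { intros n hn. specialize (Cmp M n (le_n _) hn). fold e in Cmp.
    assert (512 * Kg / INR M <= / 2). { apply Rmult_le_reg_r with (INR M); [lra|]. unfold Rdiv. rewrite Rmult_assoc, Rinv_l by lra. lra. }
    generalize (Cmod_tri_inv (wseq m x' n - wseq m x n) (wseq m x' M - wseq m x M)). fold e. nra. }
  destruct (clim_complete (fun n => wseq m x' n - wseq m x n)%C) as [l hl]; [|exists l; exact hl].
  intros eps he. destruct (INR_unbounded (2 * (512 * Kg * (2 * e)) / eps)) as [M2 h2].
  set (k := max M M2). assert (kM : INR M <= INR k) by (apply le_INR; lia). assert (kM2 : INR M2 <= INR k) by (apply le_INR; lia).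
  assert (Q : forall n, (k <= n)%nat -> Cmod ((wseq m x' n - wseq m x n) - (wseq m x' k - wseq m x k)) < eps / 2).
  { intros n hn. eapply Rle_lt_trans; [apply Cmp; lia|].
    apply Rle_lt_trans with (512 * Kg / INR k * (2 * e)).
    - apply Rmult_le_compat_l; [apply Rdiv_le_0_compat; lra|]. apply Bd; lia.
    - apply Rmult_lt_reg_r with (INR k); [lra|].
      replace (512 * Kg / INR k * (2 * e) * INR k) with (512 * Kg * (2 * e)) by (field; lra).
      assert (2 * (512 * Kg * (2 * e)) / eps * eps < INR k * eps) by (apply Rmult_lt_compat_r; lra).
      replace (2 * (512 * Kg * (2 * e)) / eps * eps) with (2 * (512 * Kg * (2 * e))) in H0 by (field; lra). lra. }
  exists k. intros n j hn hj. assert (q1 := Q n hn). assert (q2 := Q j hj).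
  generalize (Cmod_tri (wseq m x' n - wseq m x n) (wseq m x' k - wseq m x k) (wseq m x' j - wseq m x j)).
  rewrite (Cmod_swap (wseq m x' k - wseq m x k)). lra.
Qed.

Lemma orb_back x y x' y' M : orb fx fy rho x y -> orb fx fy rho x' y' -> x' M = x M -> y' M = y M -> forall k, (k <= M)%nat -> x' k = x k /\ y' k = y k.
Proof.
  intros h h' e1 e2 k hk. replace k with (M - (M - k))%nat by lia. generalize (M - k)%nat. intro j.
  induction j as [|j IH]; [rewrite Nat.sub_0_r; auto|].
  destruct (Nat.le_gt_cases M j) as [g|g].
  - replace (M - S j)%nat with (M - j)%nat by lia. auto.
  - destruct (h (M - S j)%nat) as (_ & _ & f1 & f2). destruct (h' (M - S j)%nat) as (_ & _ & f1' & f2').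
    destruct IH as [i1 i2]. replace (S (M - S j)) with (M - j)%nat in * by lia. rewrite i1, i2 in *. split; congruence.
Qed.

Lemma orb_eq_from x y x' y' M : orb fx fy rho x y -> orb fx fy rho x' y' -> x' M = x M -> forall k, x' k = x k /\ y' k = y k.
Proof.
  intros h h' e k.
  assert (U := orb_unique D (fun j => x (j + M)%nat) (fun j => y (j + M)%nat) (fun j => x' (j + M)%nat) (fun j => y' (j + M)%nat)
    (orb_shift fx fy rho x y M h) (orb_shift fx fy rho x' y' M h') e).
  destruct (Nat.le_gt_cases k M) as [g|g].
  - destruct (U O) as [u1 u2]. apply (orb_back x y x' y' M); auto.
  - specialize (U (k - M)%nat). cbv beta in U. replace (k - M + M)%nat with k in U by lia. exact U.
Qed.

(** The limit differs from the value E at index [M] by at most |E|/2, so a zero limit forces E = 0,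
    and then equality of w from [M] on. With the same branch, x agrees at a late index, and a
    backward orbit is determined by any one of its first coordinates. This gives the injectivity of
    the Fatou coordinate on a petal. *)
Lemma Zrel_zero th x y x' y' : orb fx fy rho x y -> x O <> 0%C -> orb fx fy rho x' y' -> x' O <> 0%C ->
  branch th x -> branch th x' -> Zrel x' x 0 -> forall k, x' k = x k /\ y' k = y k.
Proof.
  intros h h0 h' h0' b b' z. assert (hK := d_Kg D).
  destruct (tails_close th x y x' y' h h0 h' h0' b b') as [M [hM1 [hM2 H]]].
  set (E := (wseq m x' M - wseq m x M)%C).
  assert (Cmp : forall n, (M <= n)%nat -> Cmod ((wseq m x' n - wseq m x n) - E) <= 512 * Kg / INR M * Cmod E).
  { intros n hn. destruct (H M (le_n _)) as (c1 & c2 & c3).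
    replace (512 * Kg / INR M) with (256 * Kg / (INR M / 2)) by (field; lra).
    apply (compare_from x y x' y' (INR M / 2) M); auto; try lra.
    intros j hj. destruct (H j ltac:(lia)) as (d1 & _). assert (INR M <= INR j) by (apply le_INR; auto). lra. }
  assert (L := clim_le _ _ E _ M z Cmp).
  assert (512 * Kg / INR M <= / 2). { apply Rmult_le_reg_r with (INR M); [lra|]. unfold Rdiv. rewrite Rmult_assoc, Rinv_l by lra. lra. }
  replace (0 - E)%C with (- E)%C in L by ring. rewrite Cmod_opp in L. assert (pE := Cmod_ge_0 E).
  assert (eE : Cmod E <= 0) by nra. apply eq_of_Cmod in eE.
  destruct b as [B1 b]. destruct b' as [B2 b'].
  set (n := max M (max B1 B2)).
  assert (en : wseq m x' n = wseq m x n).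
  { apply eq_of_Cmod. specialize (Cmp n ltac:(lia)). unfold E in Cmp. rewrite eE, Cmod_self, Rmult_0_r in Cmp. replace (wseq m x' n - wseq m x n - (wseq m x M - wseq m x M))%C with (wseq m x' n - wseq m x n)%C in Cmp by ring. exact Cmp. }
  assert (ex : x' n = x n).
  { destruct (b n ltac:(lia)) as [_ e1]. destruct (b' n ltac:(lia)) as [_ e2]. rewrite e1, e2, en. reflexivity. }
  intro k. apply (orb_eq_from x y x' y' n); auto.
Qed.

End Dyn.

Arguments compare_from {m lam mu fx fy rho gam Kg} _.
Arguments classify {m lam mu fx fy rho gam Kg} _.
Arguments orb_Re_lim {m lam mu fx fy rho gam Kg} _.
Arguments orb_Re {m lam mu fx fy rho gam Kg} _.
Arguments Zrel_ex {m lam mu fx fy rho gam Kg} _.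
Arguments Zrel_zero {m lam mu fx fy rho gam Kg} _.
Arguments branch_unique {m lam mu fx fy rho gam Kg} _.
Arguments orb_eq_from {m lam mu fx fy rho gam Kg} _.
Arguments orb_w_asym {m lam mu fx fy rho gam Kg} _.

(** * Outgoing Fatou coordinates *)

Lemma clim_bounded u l : clim u l -> exists B, forall n, Cmod (u n) <= B.
Proof.
  intro h. destruct (h 1 Rlt_0_1) as [N HN].
  assert (F : exists B, forall n, (n < N)%nat -> Cmod (u n) <= B).
  { clear HN. induction N as [|N [B HB]]; [exists 0; intros; lia|].
    exists (Rmax B (Cmod (u N))). intros n hn. destruct (Nat.eq_dec n N) as [->|k]; [apply Rmax_r|].
    eapply Rle_trans; [apply HB; lia|apply Rmax_l]. }
  destruct F as [B HB]. exists (Rmax B (Cmod l + 1)). intro n.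
  destruct (Nat.le_gt_cases N n) as [k|k].
  - eapply Rle_trans; [|apply Rmax_r]. specialize (HN n k). generalize (Cmod_tri_inv (u n) l). lra.
  - eapply Rle_trans; [apply HB; auto|apply Rmax_l].
Qed.

Lemma clim_minus u v l k : clim u l -> clim v k -> clim (fun n => u n - v n)%C (l - k)%C.
Proof.
  intros h h' eps he. destruct (h (eps / 2)) as [N HN]; [lra|]. destruct (h' (eps / 2)) as [N' HN']; [lra|].
  exists (max N N'). intros n hn. specialize (HN n ltac:(lia)). specialize (HN' n ltac:(lia)).
  replace (u n - v n - (l - k))%C with ((u n - l) - (v n - k))%C by ring.
  eapply Rle_lt_trans; [apply Cmod_sub|]. lra.
Qed.

Lemma clim_ext u v l : (forall n, u n = v n) -> clim u l -> clim v l.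
Proof. intros e h eps he. destruct (h eps he) as [N HN]. exists N. intros n hn. rewrite <- e. auto. Qed.

Lemma clim_const (c : C) : clim (fun _ => c) c.
Proof. intros eps he. exists O. intros n _. rewrite Cmod_self. auto. Qed.

Lemma x_small (m : nat) (x : C) del : (1 <= m)%nat -> x <> 0%C -> 0 < del -> (2 / del) ^ m <= Cmod (wof m x) -> Cmod x <= del.
Proof.
  intros hm nx hd h. assert (pm := INR_m_ge_1 m hm). assert (px : 0 < Cmod x) by (apply Cmod_gt_0; auto).
  apply Rnot_lt_le. intro k.
  assert (e := wof_mod m x hm nx). rewrite e in h.
  assert (a : del ^ m <= Cmod x ^ m) by (apply pow_incr; lra).
  assert (pd : 0 < del ^ m) by (apply pow_lt; auto).
  assert (b : (2 / del) ^ m * del ^ m = 2 ^ m). { rewrite <- Rpow_mult_distr. f_equal. field; lra. }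
  assert (c : 2 <= 2 ^ m). { rewrite <- (pow_1 2) at 1. apply Rle_pow; [lra|auto]. }
  assert (/ (INR m * Cmod x ^ m) <= / del ^ m) by (apply Rinv_le_contravar; nra).
  assert ((2 / del) ^ m * del ^ m <= / del ^ m * del ^ m) by (apply Rmult_le_compat_r; lra).
  rewrite Rinv_l in H0; lra.
Qed.

Section Half.
Context (m : nat) (lam mu : C) (fx fy : C -> C -> C) (rho gam Kg : R) (D : dyn m lam mu fx fy rho gam Kg).
Context (N : C -> C -> R) (KN : R) (hKN : 1 <= KN)
  (n_up : forall x y, Cmod x < rho -> Cmod y < rho -> N x y <= KN * (Cmod x + Cmod y)).
Context (th : C) (thm : (th ^ m = 1)%C).

Let hm : (1 <= m)%nat := d_m D.

(** [petal r xr z x y]: [(x, y)] is the backward orbit with outgoing Fatou coordinate [z]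
    (normalized by the reference orbit [xr]) in the petal of the ball of radius [r]. *)
Definition petal (r : R) (xr : nat -> C) (z : C) (x y : nat -> C) : Prop :=
  orb fx fy rho x y /\ x O <> 0%C /\ (forall n, N (x n) (y n) < r) /\ branch m lam th x /\ Zrel m x xr z.

Lemma th_mod : Cmod th = 1.
Proof.
  assert (e : Cmod th ^ m = 1) by (rewrite <- Cmod_pow, thm; apply Cmod_1).
  destruct (pow_R1 _ _ e) as [k|k]; [|lia]. rewrite Rabs_pos_eq in k by apply Cmod_ge_0. exact k.
Qed.

Lemma Zrel_sub x x' xr l l' : Zrel m x xr l -> Zrel m x' xr l' -> Zrel m x' x (l' - l)%C.
Proof.
  intros h h'. unfold Zrel in *. eapply clim_ext; [|apply (clim_minus _ _ _ _ h' h)]. intro n; cbv beta. ring.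
Qed.

Lemma petal_eq r r' xr z x y x' y' : petal r xr z x y -> petal r' xr z x' y' -> forall k, x' k = x k /\ y' k = y k.
Proof.
  intros (o & x0 & _ & b & zr) (o' & x0' & _ & b' & zr').
  apply (Zrel_zero D th x y x' y'); auto. replace (RtoC 0) with (z - z)%C by ring. eapply Zrel_sub; eauto.
Qed.

(** * The Fatou coordinate as a function of the initial w, and its inverse on a left half plane *)

Section Base.
Context (L0 : R) (hL1 : 100000 * Kg <= L0).
Context (V Y : R -> C -> nat -> C).
Context (HP : forall s w0, s * s = 1 -> ell s w0 < - L0 ->
  V s w0 O = w0 /\ picard_region rho w0 (V s w0) (Y s w0) /\ orb fx fy rho (fun n => xth m lam th n (V s w0 n)) (Y s w0) /\
  forall n, cdble (fun w => V s w n) w0 /\ cdble (fun w => Y s w n) w0).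

Let X s w n := xth m lam th n (V s w n).

Lemma b_L0 : 100000 <= L0.
Proof. assert (h := d_Kg D). lra. Qed.

Lemma b_region s w n L : s * s = 1 -> L0 <= L -> ell s w < - L -> ell s (V s w n) < 0 /\ (L + INR n) / 2 <= Cmod (V s w n).
Proof.
  intros hs hL hw. destruct (HP s w hs ltac:(lra)) as (_ & I & _). assert (b := b_L0). assert (hK := d_Kg D).
  destruct (picard_region_lower D s hs L ltac:(lra) w (V s w) (Y s w) n hw I). split; lra.
Qed.

Lemma b_w s w n : s * s = 1 -> ell s w < - L0 -> wseq m (X s w) n = V s w n.
Proof.
  intros hs hw. destruct (b_region s w n L0 hs ltac:(lra) hw) as [a b]. unfold wseq, X. apply (wof_xth D th s hs); auto.
Qed.

Lemma b_nz s w n : X s w n <> 0%C.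
Proof. apply (xth_nz D th th_mod). Qed.

Lemma b_orb s w : s * s = 1 -> ell s w < - L0 -> orb fx fy rho (X s w) (Y s w).
Proof. intros hs hw. apply (HP s w hs hw). Qed.

Lemma b_branch s w : s * s = 1 -> ell s w < - L0 -> branch m lam th (X s w).
Proof.
  intros hs hw. destruct (orb_Re_lim D _ _ 0 (b_orb s w hs hw) (b_nz s w O)) as [M H].
  exists M. intros n hn. split; [auto|]. rewrite b_w by auto. reflexivity.
Qed.

(** A real point, hence common to the half planes of both signs: it ties the normalizations of the
    two charts together. *)
Definition w_ref : C := RtoC (- (2 * L0)).
Let xr := X 1 w_ref.

Lemma wr_ell s : ell s w_ref < - L0.
Proof. unfold w_ref. rewrite ell_RtoC. generalize b_L0; lra. Qed.

Lemma zet_ex : exists zet : R -> C -> C, forall s w, s * s = 1 -> ell s w < - L0 -> Zrel m (X s w) xr (zet s w).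
Proof.
  assert (H : forall p : R * C, exists l, (fst p) * (fst p) = 1 -> ell (fst p) (snd p) < - L0 -> Zrel m (X (fst p) (snd p)) xr l).
  { intros [s w]. cbn [fst snd]. destruct (classic (s * s = 1 /\ ell s w < - L0)) as [[hs hw]|k]; [|exists 0%C; tauto].
    destruct (Zrel_ex D th xr (Y 1 w_ref) (X s w) (Y s w)) as [l hl]; try apply b_nz; try (apply b_orb; auto using wr_ell; lra); try (apply b_branch; auto using wr_ell; lra).
    exists l; auto. }
  destruct (functional_choice _ H) as [zet hz]. exists (fun s w => zet (s, w)). intros s w. apply (hz (s, w)).
Qed.

Context (zet : R -> C -> C) (hzet : forall s w, s * s = 1 -> ell s w < - L0 -> Zrel m (X s w) xr (zet s w)).

Lemma w_near s w w' n : s * s = 1 -> ell s w < - L0 -> ell s w' < - L0 -> Cmod (w' - w) <= L0 / 256 ->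
  Cmod ((V s w' n - V s w n) - (w' - w)) <= / 16 * Cmod (w' - w).
Proof.
  intros hs hw hw' hd. assert (b := b_L0). assert (hK := d_Kg D). assert (pm := m_pos D).
  destruct (HP s w hs hw) as (e0 & _). destruct (HP s w' hs hw') as (e0' & _).
  destruct (b_region s w O L0 hs ltac:(lra) hw) as [r1 r2]. destruct (b_region s w' O L0 hs ltac:(lra) hw') as [r1' r2'].
  simpl in r2, r2'. rewrite e0 in r1, r2. rewrite e0' in r1', r2'.
  assert (px : 0 < Cmod (X s w O)) by (apply Cmod_gt_0, b_nz).
  assert (C := compare_from D (X s w) (Y s w) (X s w') (Y s w') (L0 / 2) O (b_orb s w hs hw) (b_nz s w O) (b_orb s w' hs hw')).
  rewrite !b_w, e0, e0' in C by auto.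
  assert (C' := fun h1 h2 h3 h4 => C h1 h2 h3 h4 n ltac:(lia)). rewrite !b_w in C' by auto.
  eapply Rle_trans; [apply C'|].
  - intros j _. rewrite b_w by auto. destruct (b_region s w j L0 hs ltac:(lra) hw) as [_ r]. generalize (pos_INR j). lra.
  - lra.
  - assert (Nr := rt_near m hm s w' w hs r1' r1 ltac:(lra)).
    assert (E : (X s w' O - X s w O = X s w O * (rt m w' / rt m w - 1))%C).
    { unfold X, xth. rewrite e0, e0'. field. apply rt_nz. }
    rewrite E, Cmod_mult. change (Cmod (X s w 0%nat) / (16 * INR m)) with (Cmod (X s w 0%nat) * / (16 * INR m)). apply Rmult_le_compat_l; [lra|].
    eapply Rle_trans; [apply Nr|]. replace (/ (16 * INR m)) with (3 / INR m * (/ 48)) by (field; lra).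
    apply Rmult_le_compat_l; [apply Rdiv_le_0_compat; lra|]. apply Rmult_le_reg_r with (Cmod w); [lra|]. unfold Rdiv. rewrite Rmult_assoc, Rinv_l by lra. lra.
  - lra.
  - apply Rmult_le_compat_r; [apply Cmod_ge_0|]. replace (256 * Kg / (L0 / 2)) with (512 * Kg / L0) by (field; lra).
    apply Rmult_le_reg_r with L0; [lra|]. unfold Rdiv. rewrite Rmult_assoc, Rinv_l by lra. lra.
Qed.

Lemma zet_near s w w' : s * s = 1 -> ell s w < - L0 -> ell s w' < - L0 -> Cmod (w' - w) <= L0 / 256 ->
  Cmod ((zet s w' - zet s w) - (w' - w)) <= / 16 * Cmod (w' - w).
Proof.
  intros hs hw hw' hd.
  assert (Z := Zrel_sub _ _ _ _ _ (hzet s w hs hw) (hzet s w' hs hw')).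
  apply (clim_le _ _ _ _ O Z). intros n _. rewrite !b_w by auto. apply w_near; auto.
Qed.

Lemma ell_seg s (a b : C) (t : R) L : ell s a < L -> ell s b < L -> 0 <= t <= 1 -> ell s (a + t * (b - a))%C < L.
Proof. intros ha hb ht. rewrite ell_add, ell_scal, ell_sub. destruct (Req_dec t 0) as [->|k]; nra. Qed.

(** [zet_near] requires |w' - w| to be small compared with L0. The half plane is convex, so the
    local Lipschitz bound for [zet s] minus the identity spreads to all pairs. *)
Lemma zet_far s w w' : s * s = 1 -> ell s w < - L0 -> ell s w' < - L0 ->
  Cmod ((zet s w' - zet s w) - (w' - w)) <= / 16 * Cmod (w' - w).
Proof.
  intros hs hw hw'.
  replace ((zet s w' - zet s w) - (w' - w))%C with ((fun u => zet s u - u) w' - (fun u => zet s u - u) w)%C by (cbv beta; ring).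
  apply (loc2glob_C (fun u => zet s u - u)%C); [lra|]. intros t ht.
  assert (hz := ell_seg s w w' t (- L0) hw hw' ht). set (z := (w + t * (w' - w))%C) in *.
  destruct (ell_open s hs L0 z hz) as [d [hd Hd]].
  exists (Rmin d (L0 / 256)). split; [apply Rmin_glb_lt; auto; generalize b_L0; lra|]. intros u hu.
  assert (h1 := Rlt_le_trans _ _ _ hu (Rmin_l _ _)). assert (h2 := Rlt_le_trans _ _ _ hu (Rmin_r _ _)).
  replace (zet s u - u - (zet s z - z))%C with ((zet s u - zet s z) - (u - z))%C by ring.
  apply zet_near; auto. lra.
Qed.

(** The orbits built from [w_ref] with either sign start at the same x, so [orb_unique] identifies
    them. *)
Lemma zet_wr s : s * s = 1 -> zet s w_ref = 0%C.
Proof.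
  intro hs. apply (clim_unique (fun n => wseq m (X s w_ref) n - wseq m xr n)%C).
  - apply hzet; auto using wr_ell.
  - eapply clim_ext; [|apply clim_const]. intro n. cbv beta.
    assert (U := orb_unique D xr (Y 1 w_ref) (X s w_ref) (Y s w_ref) (b_orb 1 w_ref ltac:(lra) (wr_ell 1)) (b_orb s w_ref hs (wr_ell s))).
    unfold wseq. rewrite (proj1 (U ltac:(unfold xr, X; rewrite (proj1 (HP s w_ref hs (wr_ell s))), (proj1 (HP 1 w_ref ltac:(lra) (wr_ell 1))); reflexivity) n)). ring.
Qed.

Lemma zet_cdble s w : s * s = 1 -> ell s w < - L0 -> cdble (zet s) w.
Proof.
  intros hs hw. destruct (ell_open s hs L0 w hw) as [d [hd Hd]]. assert (b := b_L0).
  destruct (clim_bounded _ _ (hzet s w hs hw)) as [B HB].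
  set (r := Rmin d (L0 / 256)). assert (hr : 0 < r) by (apply Rmin_glb_lt; lra).
  assert (r1 : r <= d) by apply Rmin_l. assert (r2 : r <= L0 / 256) by apply Rmin_r.
  apply (weierstrass (fun n u => V s u n - wseq m xr n)%C (zet s) w r (2 * r + B)); auto.
  - intros n z hz. apply (cdble_minus (fun u => V s u n)); [|apply cdble_const]. apply (HP s z hs). apply Hd; lra.
  - intros n z hz. assert (W := w_near s w z n hs hw (Hd z ltac:(lra)) ltac:(lra)). specialize (HB n). cbv beta in HB. rewrite b_w in HB by auto.
    replace (V s z n - wseq m xr n)%C with ((V s z n - V s w n - (z - w)) + (z - w) + (V s w n - wseq m xr n))%C by ring.
    eapply Rle_trans; [apply Cmod_triangle|]. eapply Rle_trans; [apply Rplus_le_compat_r, Cmod_triangle|]. lra.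
  - intros z hz. eapply clim_ext; [|apply (hzet s z hs); apply Hd; lra]. intro n. cbv beta. rewrite b_w; auto. apply Hd; lra.
Qed.

(** By [zet_far] and [zet_wr], [zet s] is the translation by -[w_ref] up to a relative error 1/16,
    so a preimage of z is sought near c = z + w_ref. The sign s is chosen by [left_ell] so that the
    disc of radius |z|/8 about c lies in the half plane; one sign alone would not reach every z of a
    left half plane. *)
Lemma zet_surj L z : L0 <= L -> Re z < - (2 * L) -> exists s w, s * s = 1 /\ ell s w < - L /\ zet s w = z.
Proof.
  intros hL hz. assert (b := b_L0).
  set (c := (z + w_ref)%C).
  destruct (left_ell c) as [s [hs e]]. exists s.
  assert (ec : ell s c = Re z - 2 * L0 - Rabs (Im z)).
  { rewrite e. unfold c, w_ref. rewrite Re_add, Im_add. cbn [RtoC Re Im fst snd]. rewrite Rplus_0_r. ring. }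
  assert (cz := Cmod_le_ReIm z). rewrite (Rabs_left (Re z)) in cz by lra. assert (pi := Rabs_pos (Im z)).
  assert (hc : forall u, Cmod (u - c) <= Cmod z / 8 -> ell s u < - L).
  { intros u hu. assert (q := ell_close s u c hs). lra. }
  assert (c0 : ell s c < - L) by (apply hc; rewrite Cmod_self; generalize (Cmod_ge_0 z); lra).
  assert (dz : Cmod (z - zet s c) <= Cmod z / 16).
  { assert (F := zet_far s w_ref c hs (wr_ell s) ltac:(lra)). rewrite zet_wr in F by auto.
    replace (c - w_ref)%C with z in F by (unfold c; ring). rewrite Cmod_swap.
    replace (zet s c - z)%C with (zet s c - 0 - z)%C by ring. lra. }
  destruct (banach_solve (zet s) c (Cmod z / 8) z) as [w [h1 h2]].
  - intros u v hu hv. assert (F := zet_far s v u hs ltac:(specialize (hc v hv); lra) ltac:(specialize (hc u hu); lra)). generalize (Cmod_ge_0 (u - v)); lra.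
  - lra.
  - exists w. split; auto. split; auto. apply hc. lra.
Qed.

Lemma zet_chart L z0 : L0 <= L -> Re z0 < - (2 * L) -> exists s d (W : C -> C), s * s = 1 /\ 0 < d /\ cdble W z0 /\
  forall z, Cmod (z - z0) < d -> ell s (W z) < - L /\ zet s (W z) = z.
Proof.
  intros hL hz0. destruct (zet_surj L z0 hL hz0) as (s & w0 & hs & hw0 & e0).
  assert (hLL : ell s w0 < - L0) by lra.
  assert (opn : exists d, 0 < d /\ forall w, Cmod (w - w0) < d -> ell s w < - L).
  { exists ((- L - ell s w0) / 2). split; [lra|]. intros w hw. assert (q := ell_close s w w0 hs). lra. }
  destruct opn as [r [hr Hr]].
  assert (low : forall u, Cmod (u - w0) < r -> / 2 * Cmod (u - w0) <= Cmod (zet s u - zet s w0)).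
  { intros u hu. assert (F := zet_far s w0 u hs hLL ltac:(specialize (Hr u hu); lra)).
    generalize (Cmod_tri_inv (u - w0) (u - w0 - (zet s u - zet s w0))).
    replace (u - w0 - (u - w0 - (zet s u - zet s w0)))%C with (zet s u - zet s w0)%C by ring. rewrite (Cmod_swap (u - w0)).
    generalize (Cmod_ge_0 (u - w0)). lra. }
  destruct (open_map (zet s) w0 r (/ 2) hr ltac:(lra)) as (d & K & hd & hK & H); auto.
  { intros u hu. apply zet_cdble; auto. specialize (Hr u hu). lra. }
  rewrite e0 in H.
  assert (CH : forall z, exists u, Cmod (z - z0) < d -> Cmod (u - w0) < r /\ Cmod (u - w0) <= K * Cmod (z - z0) /\ zet s u = z).
  { intro z. destruct (Rlt_dec (Cmod (z - z0)) d) as [k|k]; [|exists 0%C; tauto]. destruct (H z k) as [u hu]. exists u; auto. }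
  destruct (functional_choice _ CH) as [W HW].
  exists s, d, W. split; auto. split; auto. split.
  - rewrite <- e0. apply (inv_cdble (zet s) W w0 d K); auto.
    + apply zet_cdble; auto.
    + rewrite e0. destruct (HW z0) as (_ & h & _); [rewrite Cmod_self; auto|]. rewrite Cmod_self, Rmult_0_r in h. apply eq_of_Cmod, h.
    + rewrite e0. intros z hz. destruct (HW z hz) as (_ & h1 & h2). auto.
    + exists (/ 2), r. split; [lra|]. split; auto.
  - intros z hz. destruct (HW z hz) as (h1 & _ & h2). split; auto.
Qed.

Lemma halfplane_base r : 0 < r -> exists a, forall z0, Re z0 < a -> exists d (XX YY : C -> nat -> C), 0 < d /\
  (forall z, Cmod (z - z0) < d -> petal r xr z (XX z) (YY z)) /\
  forall n, cdble (fun z => XX z n) z0 /\ cdble (fun z => YY z n) z0.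
Proof.
  intro hr. assert (b := b_L0). assert (hrho := d_rho D). assert (hgam := d_gam D).
  (* If |x| <= del, the cone gives |y| <= del and a norm of at most 2 KN del = r/2. The value of [L]
     then forces |w| >= (2/del)^m along the orbit, which implies |x| <= del by [x_small]. *)
  set (del := r / (4 * KN)). assert (hdel : 0 < del) by (apply Rdiv_lt_0_compat; lra).
  set (L := L0 + 2 * (2 / del) ^ m). assert (hL : L0 <= L).
  { unfold L. assert (0 <= (2 / del) ^ m); [|lra]. apply pow_le, Rlt_le, Rdiv_lt_0_compat; lra. }
  exists (- (2 * L)). intros z0 hz0.
  destruct (zet_chart L z0 hL hz0) as (s & d & W & hs & hd & cW & HW).
  exists d, (fun z => X s (W z)), (fun z => Y s (W z)). split; auto. split.
  - intros z hz. destruct (HW z hz) as [h1 h2]. assert (h1' : ell s (W z) < - L0) by lra.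
    assert (o := b_orb s (W z) hs h1'). split; auto. split; [apply b_nz|]. split; [|split; [apply b_branch; auto|rewrite <- h2 at 2; apply hzet; auto]].
    intro n. destruct (o n) as (o1 & o2 & _). assert (oy := orb_y_le D _ _ n o).
    assert (sm : Cmod (X s (W z) n) <= del).
    { apply (x_small m); auto; [apply b_nz|]. change (wof m (X s (W z) n)) with (wseq m (X s (W z)) n). rewrite b_w by auto.
      destruct (b_region s (W z) n L hs hL h1) as [_ q]. assert (pn := pos_INR n). unfold L in q. lra. }
    eapply Rle_lt_trans; [apply n_up; auto|].
    assert (Cmod (Y s (W z) n) <= del) by (generalize (Cmod_ge_0 (X s (W z) n)); nra).
    apply Rle_lt_trans with (KN * (2 * del)); [apply Rmult_le_compat_l; lra|]. unfold del. replace (KN * (2 * (r / (4 * KN)))) with (r / 2) by (field; lra). lra.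
  - intro n. destruct (HW z0) as [h1 _]; [rewrite Cmod_self; auto|]. assert (h1' : ell s (W z0) < - L0) by lra.
    destruct (HP s (W z0) hs h1') as (_ & _ & _ & cc). destruct (cc n) as [c1 c2]. split.
    + unfold X, xth. apply (cdble_mult (fun _ => thn lam th n)); [apply cdble_const|].
      apply (cdble_comp (fun z => V s (W z) n) (rt m)); [apply (cdble_comp W (fun w => V s w n)); auto|].
      apply (rt_cdble m hm s); auto. apply (b_region s (W z0) n L0 hs ltac:(lra) h1').
    + apply (cdble_comp W (fun w => Y s w n)); auto.
Qed.
End Base.

(** The reference orbit is chosen before the radius, so coordinates of points seen in balls of
    different radii can be compared. *)
Lemma halfplane : exists xr yr, orb fx fy rho xr yr /\ xr O <> 0%C /\ branch m lam th xr /\ forall r, 0 < r ->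
  exists a, forall z0, Re z0 < a -> exists d (XX YY : C -> nat -> C), 0 < d /\
  (forall z, Cmod (z - z0) < d -> petal r xr z (XX z) (YY z)) /\
  forall n, cdble (fun z => XX z n) z0 /\ cdble (fun z => YY z n) z0.
Proof.
  assert (hK := d_Kg D). assert (hrho := d_rho D).
  set (L0 := 100000 * Kg + 2 * (4 / rho) ^ m).
  assert (p : 0 <= (4 / rho) ^ m) by (apply pow_le, Rlt_le, Rdiv_lt_0_compat; lra).
  assert (hL1 : 100000 * Kg <= L0) by (unfold L0; lra).
  assert (hL2 : (4 / rho) ^ m <= L0 / 2) by (unfold L0; lra).
  assert (E : forall s : R, exists p : (C -> nat -> C) * (C -> nat -> C), s * s = 1 -> forall w0, ell s w0 < - L0 ->
    fst p w0 O = w0 /\ picard_region rho w0 (fst p w0) (snd p w0) /\ orb fx fy rho (fun n => xth m lam th n (fst p w0 n)) (snd p w0) /\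
    forall n, cdble (fun w => fst p w n) w0 /\ cdble (fun w => snd p w n) w0).
  { intro s. destruct (Req_dec (s * s) 1) as [hs|k]; [|exists (fun _ _ => RtoC 0, fun _ _ => RtoC 0); tauto].
    destruct (picard D th th_mod s hs L0 ltac:(lra) hL2 thm) as (V & Y & H). exists (V, Y). intros _. exact H. }
  destruct (functional_choice _ E) as [VY HVY].
  set (V := fun s => fst (VY s)). set (Y := fun s => snd (VY s)).
  assert (HP : forall s w0, s * s = 1 -> ell s w0 < - L0 ->
    V s w0 O = w0 /\ picard_region rho w0 (V s w0) (Y s w0) /\ orb fx fy rho (fun n => xth m lam th n (V s w0 n)) (Y s w0) /\
    forall n, cdble (fun w => V s w n) w0 /\ cdble (fun w => Y s w n) w0).
  { intros s w0 hs hw. apply (HVY s hs w0 hw). }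
  destruct (zet_ex L0 hL1 V Y HP) as [zet hzet].
  exists (fun n => xth m lam th n (V 1 (w_ref L0) n)), (Y 1 (w_ref L0)).
  assert (h1 : 1 * 1 = 1) by lra. assert (hw := wr_ell L0 hL1 1).
  split; [apply (HP 1 _ h1 hw)|]. split; [apply (xth_nz D th th_mod)|].
  split; [apply (b_branch L0 hL1 V Y HP 1 (w_ref L0) h1 hw)|].
  intros r hr. exact (halfplane_base L0 hL1 V Y HP zet hzet r hr).
Qed.
End Half.

Arguments petal_eq {m lam mu fx fy rho gam Kg} _ {N th r r' xr z x y x' y'} _ _.
Arguments Zrel_sub {m x x' xr l l'} _ _.

(** [N x y] is the norm of the point of the source ball with straightened coordinates [(x, y)]. It need not be
    a function of [|x|] and [|y|], but it is close to [a |x|] on the orb_cone [|y| <= gam |x|]. *)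
Record nrm (m : nat) (rho gam : R) (N : C -> C -> R) (KN a : R) : Prop := {
  n_KN : 1 <= KN;
  n_a : 0 < a;
  n_up : forall x y, Cmod x < rho -> Cmod y < rho -> N x y <= KN * (Cmod x + Cmod y);
  n_low : forall x y, Cmod x < rho -> Cmod y < rho -> Cmod x + Cmod y <= KN * N x y;
  n_cont : forall x y, Cmod x < rho -> Cmod y < rho -> forall eps, 0 < eps -> exists d, 0 < d /\
    forall x' y', Cmod (x' - x) < d -> Cmod (y' - y) < d -> Rabs (N x' y' - N x y) < eps;
  n_mod : forall x y, Cmod x < rho -> Cmod y <= gam * Cmod x ->
    (1 - / (400 * INR m)) * (a * Cmod x) <= N x y <= (1 + / (400 * INR m)) * (a * Cmod x);
  n_inc : forall x y x' y', Cmod x < rho -> Cmod x' < rho -> Cmod y <= gam * Cmod x -> Cmod y' <= gam * Cmod x' ->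
    Cmod (y' - y) <= gam * Cmod (x' - x) -> x' <> x ->
    / 10 * (Cmod x * Cmod (x' - x)) <= Re (Cconj x * (x' - x))%C -> N x y < N x' y' }.

(** * Geometry of orbits close to a translation *)

Lemma near_translation (u : nat -> C) : (forall n, Cmod (u (S n) - (u n - 1)) <= / 100) -> forall n j, Cmod (u (n + j)%nat - (u n - INR j)) <= INR j / 100.
Proof.
  intros h n j. induction j as [|j IH].
  - rewrite Nat.add_0_r. simpl. replace (u n - (u n - 0))%C with (RtoC 0) by ring. rewrite Cmod_0. lra.
  - replace (n + S j)%nat with (S (n + j)) by lia. rewrite S_INR, RtoC_plus.
    replace (u (S (n + j)) - (u n - (INR j + 1)))%C with ((u (S (n + j)) - (u (n + j)%nat - 1)) + (u (n + j)%nat - (u n - INR j)))%C by ring.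
    eapply Rle_trans; [apply Cmod_triangle|]. specialize (h (n + j)%nat). lra.
Qed.

Lemma near_translation_ReIm (u : nat -> C) : (forall n, Cmod (u (S n) - (u n - 1)) <= / 100) -> forall n j,
  Rabs (Re (u (n + j)%nat) - Re (u n) + INR j) <= INR j / 100 /\ Rabs (Im (u (n + j)%nat) - Im (u n)) <= INR j / 100.
Proof.
  intros h n j. assert (H := near_translation u h n j).
  assert (a := re_le_Cmod (u (n + j)%nat - (u n - INR j))). assert (b := Cmod_im_le (u (n + j)%nat - (u n - INR j))).
  rewrite !Re_sub in a. rewrite !Im_sub in b. cbn [RtoC Re Im fst snd] in a, b.
  change (fst (u (n + j)%nat)) with (Re (u (n + j)%nat)) in a. change (fst (u n)) with (Re (u n)) in a.
  change (snd (u (n + j)%nat)) with (Im (u (n + j)%nat)) in b. change (snd (u n)) with (Im (u n)) in b.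
  split.
  - replace (Re (u (n + j)%nat) - Re (u n) + INR j) with (Re (u (n + j)%nat) - (Re (u n) - INR j)) by ring. lra.
  - replace (Im (u (n + j)%nat) - Im (u n)) with (Im (u (n + j)%nat) - (Im (u n) - 0)) by ring. lra.
Qed.

(** A step moves the real part by less than 2. An index with nonpositive real part whose predecessor
    has positive real part thus lies within 2 of the imaginary axis; if there is none after [k],
    then [k] itself is already on the left. *)
Lemma first_left (u : nat -> C) : (forall n, Cmod (u (S n) - (u n - 1)) <= / 100) -> forall k M, (k <= M)%nat -> Re (u M) <= 0 ->
  exists n0, (k <= n0)%nat /\ Re (u n0) <= 0 /\ (n0 = k \/ -2 <= Re (u n0)) /\ (0 < Re (u k) -> -2 <= Re (u n0)).
Proof.
  intros h k M hk hM. induction M as [|M IH].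
  - exists O. replace k with O in * by lia. repeat split; auto; lra.
  - destruct (Nat.eq_dec k (S M)) as [->|nk].
    + exists (S M). repeat split; auto; lra.
    + destruct (Rle_dec (Re (u M)) 0) as [r|r]; [apply IH; auto; lia|].
      exists (S M). assert (st := proj1 (near_translation_ReIm u h M 1)). rewrite Nat.add_1_r in st. simpl INR in st. apply Rabs_le_between in st.
      split; [lia|]. split; auto. split; [right|intros _]; lra.
Qed.

(** On the first sphere touched while [w] is moved in the direction [-1 + i s], the motion increases [|w k|]. *)
Lemma exit_direction (u w : nat -> C) s T k rho n0 M : s * s = 1 -> 0 <= T -> 1000 <= rho ->
  (forall n, Cmod (u (S n) - (u n - 1)) <= / 100) -> (forall n, Cmod (w (S n) - (w n - 1)) <= / 100) ->
  (forall n, 99 / 100 * rho <= Cmod (w n)) -> Cmod (w k) = rho -> Cmod (w k - u k - T * (- (1) + s * Ci)) <= T / 500 ->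
  Re (u n0) <= 0 -> (n0 = O \/ -2 <= Re (u n0)) -> 0 <= s * Im (u n0) -> (k <= M)%nat -> Re (w M) <= 0 ->
  6 / 10 * rho <= - Re (w k) + s * Im (w k).
Proof.
  intros hs hT hr hu hw hmin hwk hd hn1 hn2 hn3 hkM hM.
  assert (a := re_le_Cmod (w k - u k - T * (- (1) + s * Ci))). assert (b := Cmod_im_le (w k - u k - T * (- (1) + s * Ci))).
  rewrite !Re_sub in a. rewrite !Im_sub in b.
  replace (Re (T * (- (1) + s * Ci))%C) with (- T) in a by (cbn; ring). replace (Im (T * (- (1) + s * Ci))%C) with (s * T) in b by (cbn; ring).
  assert (a1 : Rabs (Re (w k) - Re (u k) - - T) <= T / 500) by lra. assert (b1 : Rabs (Im (w k) - Im (u k) - s * T) <= T / 500) by lra.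
  clear a b. apply Rabs_le_between in a1. apply Rabs_le_between in b1.
  assert (sc : s = 1 \/ s = -1). { assert ((s - 1) * (s + 1) = 0) by lra. apply Rmult_integral in H. lra. }
  assert (cr := re_le_Cmod (w k)). rewrite hwk in cr. apply Rabs_le_between in cr.
  (* An orbit drifts vertically by at most about one hundredth of its horizontal displacement.
     Between [k] and the index [n0], where s Im u is nonnegative, this displacement is at most about
     rho + T, and the motion itself adds about T to s Im w. *)
  assert (low : - (2 / 100 * rho) <= s * Im (w k)).
  { destruct (Nat.le_gt_cases n0 k) as [g|g].
    - destruct (near_translation_ReIm u hu n0 (k - n0)) as [p q]. replace (n0 + (k - n0))%nat with k in * by lia.
      set (j := INR (k - n0)) in *. assert (pj : 0 <= j) by apply pos_INR.
      apply Rabs_le_between in p. apply Rabs_le_between in q. destruct sc as [-> | ->]; lra.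
    - destruct (near_translation_ReIm u hu k (n0 - k)) as [p q]. replace (k + (n0 - k))%nat with n0 in * by lia.
      set (j := INR (n0 - k)) in *. assert (pj : 0 <= j) by apply pos_INR.
      apply Rabs_le_between in p. apply Rabs_le_between in q. destruct hn2 as [-> |hn2]; [lia|]. destruct sc as [-> | ->]; lra. }
  assert (sq := Cmod_sqr (w k)). rewrite hwk in sq.
  set (A := Re (w k)) in *. set (B := Im (w k)) in *.
  assert (sB : (s * B) * (s * B) = B * B) by (transitivity ((s * s) * (B * B)); [ring|rewrite hs; ring]).
  destruct (Rle_lt_dec A 0) as [g|g].
  - destruct (Rle_lt_dec 0 (s * B)) as [g'|g'].
    + assert (rho * rho <= (- A + s * B) * (- A + s * B)) by nra.
      apply Rnot_lt_le. intro kk. nra.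
    + assert (B * B <= 2 / 100 * rho * (2 / 100 * rho)) by nra.
      assert (9 / 10 * rho <= - A). { apply Rnot_lt_le. intro kk. nra. } lra.
  (* Here w k is to the right of the imaginary axis. The orbit crosses the axis later at a modulus
     of at least 99/100 rho, so the imaginary part is nearly rho there, and already nearly rho at
     [k]; then [low] fixes its sign, and little is left for the real part. *)
  - destruct (first_left w hw k M hkM hM) as (n1 & hk1 & h1 & _ & h2). specialize (h2 g).
    destruct (near_translation_ReIm w hw k (n1 - k)) as [p q]. replace (k + (n1 - k))%nat with n1 in * by lia.
    set (j := INR (n1 - k)) in *. assert (pj : 0 <= j) by apply pos_INR. fold A in p. fold B in q.
    apply Rabs_le_between in p. apply Rabs_le_between in q.
    assert (sq1 := Cmod_sqr (w n1)). assert (m1 := hmin n1).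
    assert (I1 : 98 / 100 * rho <= Rabs (Im (w n1))).
    { apply Rnot_lt_le. intro kk. assert (Re (w n1) * Re (w n1) <= 4) by nra.
      assert (Im (w n1) * Im (w n1) = Rabs (Im (w n1)) * Rabs (Im (w n1))) by (rewrite <- Rabs_mult; symmetry; apply Rabs_pos_eq, Rle_0_sqr).
      assert (pa := Rabs_pos (Im (w n1))).
      assert (Rabs (Im (w n1)) * Rabs (Im (w n1)) <= 98 / 100 * rho * (98 / 100 * rho)) by nra.
      assert (99 / 100 * rho * (99 / 100 * rho) <= Cmod (w n1) * Cmod (w n1)) by nra. nra. }
    assert (I2 : 96 / 100 * rho <= s * B).
    { destruct sc as [-> | ->]; unfold Rabs in I1; destruct (Rcase_abs (Im (w n1))); lra. }
    assert (A <= 3 / 10 * rho). { apply Rnot_lt_le. intro kk. assert (96 / 100 * rho * (96 / 100 * rho) <= B * B) by nra. nra. }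
    lra.
Qed.

Lemma clim_shift u l k : clim u l -> clim (fun n => u (n + k)%nat) l.
Proof. intros h eps he. destruct (h eps he) as [N HN]. exists N. intros n hn. apply HN. lia. Qed.

Lemma clim_unshift u l k : clim (fun n => u (n + k)%nat) l -> clim u l.
Proof.
  intros h eps he. destruct (h eps he) as [N HN]. exists (N + k)%nat. intros n hn.
  specialize (HN (n - k)%nat ltac:(lia)). cbv beta in HN. replace (n - k + k)%nat with n in HN by lia. exact HN.
Qed.

Lemma clim_plus u v l k : clim u l -> clim v k -> clim (fun n => u n + v n)%C (l + k)%C.
Proof.
  intros h h' eps he. destruct (h (eps / 2)) as [N HN]; [lra|]. destruct (h' (eps / 2)) as [N' HN']; [lra|].
  exists (max N N'). intros n hn. specialize (HN n ltac:(lia)). specialize (HN' n ltac:(lia)).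
  replace (u n + v n - (l + k))%C with ((u n - l) + (v n - k))%C by ring.
  eapply Rle_lt_trans; [apply Cmod_triangle|]. lra.
Qed.

(** * Continuation of a petal from the half plane to the whole ball *)

Section Petal.
Context (m : nat) (lam mu : C) (fx fy : C -> C -> C) (rho gam Kg : R) (D : dyn m lam mu fx fy rho gam Kg).
Context (N : C -> C -> R) (KN a : R) (Nm : nrm m rho gam N KN a).
Context (th : C) (thm : (th ^ m = 1)%C) (q : nat) (hq : (1 <= q)%nat) (lamq : (lam ^ q = 1)%C).
Context (xr yr : nat -> C) (xo : orb fx fy rho xr yr) (xn : xr O <> 0%C) (xb : branch m lam th xr).

Let hm : (1 <= m)%nat := d_m D.
Let P r z x y := petal m lam fx fy rho N th r xr z x y.

Lemma lamq_mult j : (lam ^ (q * j) = 1)%C.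
Proof. rewrite Cpow_mult_r, lamq. apply Cpow_1_l. Qed.

Lemma thn_period j n : thn lam th (n + q * j) = thn lam th n.
Proof.
  unfold thn. rewrite Cpow_add_r, (Cpow_inv lam (q * j)) by apply (lam_nz D). rewrite lamq_mult. field.
Qed.

(** Each of the k steps contributes -1 - g, and g tends to 0 along the reference orbit. This limit
    is the source of the Abel equation. *)
Lemma xr_shift k : clim (fun n => wseq m xr (n + k)%nat - wseq m xr n)%C (- INR k)%C.
Proof.
  intros eps he. destruct (orb_w_asym D xr yr (Rmin (eps / (4 * (INR k + 1))) (/ 4)) xo xn) as [M [_ HM]].
  { apply Rmin_glb_lt; [|lra]. apply Rdiv_lt_0_compat; generalize (pos_INR k); lra. }
  clear M HM. assert (hK := d_Kg D). assert (pk := pos_INR k).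
  destruct (orb_Re_lim D xr yr (- (2 * Kg * (INR k + 1) / eps)) xo xn) as [M HM].
  exists M. intros n hn.
  assert (Q : forall j, Cmod (wseq m xr (n + j)%nat - wseq m xr n - - INR j) <= INR j * (eps / (2 * (INR k + 1)))).
  { induction j as [|j IH].
    - rewrite Nat.add_0_r. simpl. replace (wseq m xr n - wseq m xr n - - 0)%C with (RtoC 0) by ring. rewrite Cmod_0. lra.
    - replace (n + S j)%nat with (S (n + j)) by lia. rewrite S_INR, RtoC_plus.
      destruct (xo (S (n + j))) as (a1 & a2 & _).
      destruct (gof_small D _ _ a1 a2 (orb_nz D xr yr xo xn _)) as [g1 _]. change (wof m (xr (S (n + j)))) with (wseq m xr (S (n + j))) in g1.
      assert (r1 := HM (S (n + j)) ltac:(lia)). assert (qq := re_le_Cmod (wseq m xr (S (n + j)))). apply Rabs_le_between in qq.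
      assert (p2 : 0 < 2 * Kg * (INR k + 1) / eps) by (apply Rdiv_lt_0_compat; nra).
      assert (g2 : Kg / Cmod (wseq m xr (S (n + j))) <= eps / (2 * (INR k + 1))).
      { replace (eps / (2 * (INR k + 1))) with (Kg / (2 * Kg * (INR k + 1) / eps)) by (field; lra). apply Rmult_le_compat_l; [lra|]. apply Rinv_le_contravar; lra. }
      assert (E := orb_w (m := m) xr yr (n + j) xo).
      replace (wseq m xr (S (n + j)) - wseq m xr n - - (INR j + 1))%C with ((wseq m xr (n + j)%nat - wseq m xr n - - INR j) - gof m fx (xr (S (n + j))) (yr (S (n + j))))%C by (rewrite E; ring).
      eapply Rle_trans; [apply Cmod_sub|]. lra. }
  eapply Rle_lt_trans; [apply Q|].
  apply Rmult_lt_reg_r with (2 * (INR k + 1)); [lra|].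
  replace (INR k * (eps / (2 * (INR k + 1))) * (2 * (INR k + 1))) with (INR k * eps) by (field; lra). nra.
Qed.

Lemma petal_mono r r' z x y : r <= r' -> P r z x y -> P r' z x y.
Proof. intros hr (h1 & h2 & h3 & h4 & h5). repeat split; auto; try apply h1. intro n. specialize (h3 n). lra. Qed.

(** Only multiples of q are allowed: [thn] has period q, so such a shift keeps the branch [th]. *)
Lemma petal_shift r z x y j : P r z x y -> P r (z - INR (q * j))%C (fun n => x (n + q * j)%nat) (fun n => y (n + q * j)%nat).
Proof.
  intros (h1 & h2 & h3 & [M hM] & h5). set (k := (q * j)%nat). split; [apply (orb_shift fx fy rho x y k h1)|].
  split; [apply (orb_nz D x y h1 h2)|]. split; [intro n; apply h3|]. split.
  - exists M. intros n hn. destruct (hM (n + k)%nat ltac:(lia)) as [r1 r2]. split; [exact r1|].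
    cbv beta. unfold wseq in *. rewrite r2 at 1. unfold xth. unfold k at 1. rewrite thn_period. reflexivity.
  - unfold Zrel. eapply clim_ext; [|apply (clim_plus _ _ _ _ (clim_shift _ _ k h5) (xr_shift k))].
    intro n. cbv beta. unfold wseq. ring.
Qed.

Definition pair_map (p : C * C) : C * C := (fx (fst p) (snd p), fy (fst p) (snd p)).

Lemma orb_pair_map x y n j : orb fx fy rho x y -> (j <= n)%nat -> Nat.iter j pair_map (x n, y n) = (x (n - j)%nat, y (n - j)%nat).
Proof.
  intros h. induction j as [|j IH]; intro hj; [rewrite Nat.sub_0_r; auto|].
  simpl. rewrite IH by lia. destruct (h (n - S j)%nat) as (_ & _ & f1 & f2). replace (S (n - S j)) with (n - j)%nat in * by lia.
  unfold pair_map; cbn [fst snd]. rewrite f1, f2. reflexivity.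
Qed.

Definition prepend (k : nat) (x y : nat -> C) (n : nat) : C * C :=
  if lt_dec n k then Nat.iter (k - n) pair_map (x O, y O) else (x (n - k)%nat, y (n - k)%nat).

Lemma petal_ext r1 r2 z x y j : r1 <= r2 -> P r1 (z - INR (q * j))%C x y ->
  (forall i, (i <= q * j)%nat -> Cmod (fst (Nat.iter i pair_map (x O, y O))) < rho /\ Cmod (snd (Nat.iter i pair_map (x O, y O))) < rho /\
     N (fst (Nat.iter i pair_map (x O, y O))) (snd (Nat.iter i pair_map (x O, y O))) < r2) ->
  P r2 z (fun n => fst (prepend (q * j) x y n)) (fun n => snd (prepend (q * j) x y n)).
Proof.
  intros hr (h1 & h2 & h3 & [M hM] & h5) H. set (k := (q * j)%nat) in *.
  assert (big : forall n, prepend k x y (n + k)%nat = (x n, y n)).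
  { intro n. unfold prepend. destruct (lt_dec (n + k) k); [lia|]. replace (n + k - k)%nat with n by lia. reflexivity. }
  assert (dom : forall n, Cmod (fst (prepend k x y n)) < rho /\ Cmod (snd (prepend k x y n)) < rho /\ N (fst (prepend k x y n)) (snd (prepend k x y n)) < r2).
  { intro n. unfold prepend. destruct (lt_dec n k) as [g|g].
    - apply H. lia.
    - cbn [fst snd]. destruct (h1 (n - k)%nat) as (a1 & a2 & _). specialize (h3 (n - k)%nat). repeat split; auto; lra. }
  assert (step : forall n, pair_map (prepend k x y (S n)) = prepend k x y n).
  { intro n. unfold prepend. destruct (lt_dec (S n) k) as [g|g]; destruct (lt_dec n k) as [g'|g']; try lia.
    - replace (k - n)%nat with (S (k - S n)) by lia. reflexivity.
    - replace (k - n)%nat with 1%nat by lia. replace (S n - k)%nat with O by lia. reflexivity.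
    - unfold pair_map; cbn [fst snd]. destruct (h1 (n - k)%nat) as (_ & _ & f1 & f2). replace (S n - k)%nat with (S (n - k)) by lia. rewrite f1, f2. reflexivity. }
  assert (o : orb fx fy rho (fun n => fst (prepend k x y n)) (fun n => snd (prepend k x y n))).
  { intro n. destruct (dom n) as (d1 & d2 & _). split; auto. split; auto. rewrite <- (step n). split; reflexivity. }
  split; auto. split.
  -
    assert (B : forall i, (i <= k)%nat -> fst (prepend k x y (k - i)%nat) <> 0%C).
    { induction i as [|i IH]; intro hi.
      - replace (k - 0)%nat with (0 + k)%nat by lia. rewrite big. exact h2.
      - replace (prepend k x y (k - S i)%nat) with (pair_map (prepend k x y (S (k - S i)))) by apply step.
        replace (S (k - S i)) with (k - i)%nat by lia. destruct (dom (k - i)%nat) as (d1 & d2 & _).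
        apply (fx_nz D); auto. apply IH; lia. }
    specialize (B k (le_n _)). rewrite Nat.sub_diag in B. exact B.
  - split; [intro n; apply dom|]. split.
    + exists (M + k)%nat. intros n hn. replace n with ((n - k) + k)%nat by lia. unfold wseq. rewrite big. cbn [fst].
      destruct (hM (n - k)%nat ltac:(lia)) as [r3 r4]. unfold wseq in r3, r4. split; auto.
      rewrite r4 at 1. unfold xth. unfold k at 4. rewrite thn_period. reflexivity.
    + apply (clim_unshift _ _ k).
      replace z with ((z - INR k) - (- INR k))%C by ring.
      eapply clim_ext; [|apply (clim_minus _ _ _ _ h5 (xr_shift k))]. intro n. cbv beta. unfold wseq. rewrite big. cbn [fst]. ring.
Qed.

Context (HH : forall r, 0 < r -> exists a, forall z0, Re z0 < a -> exists d (XX YY : C -> nat -> C), 0 < d /\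
  (forall z, Cmod (z - z0) < d -> P r z (XX z) (YY z)) /\
  forall n, cdble (fun z => XX z n) z0 /\ cdble (fun z => YY z n) z0).

Lemma shift_below (b x : R) : exists j, x - INR (q * j) < b.
Proof.
  destruct (INR_unbounded (x - b)) as [j hj]. exists j. rewrite mult_INR.
  assert (1 <= INR q) by (change 1 with (INR 1); apply le_INR; auto). generalize (pos_INR j). nra.
Qed.

Lemma pair_map_cdble (u v : C -> C) z k : cdble u z -> cdble v z ->
  (forall i, (i < k)%nat -> Cmod (fst (Nat.iter i pair_map (u z, v z))) < rho /\ Cmod (snd (Nat.iter i pair_map (u z, v z))) < rho) ->
  forall i, (i <= k)%nat -> cdble (fun t => fst (Nat.iter i pair_map (u t, v t))) z /\ cdble (fun t => snd (Nat.iter i pair_map (u t, v t))) z.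
Proof.
  intros hu hv H i. induction i as [|i IH]; intro hi; [split; auto|].
  destruct (IH ltac:(lia)) as [c1 c2]. destruct (H i ltac:(lia)) as [d1 d2]. simpl. unfold pair_map at 1 3; cbn [fst snd]. split.
  - apply (fdiff_comp fx (fun t => fst (Nat.iter i pair_map (u t, v t))) (fun t => snd (Nat.iter i pair_map (u t, v t)))); auto. apply (d_fx D); auto.
  - apply (fdiff_comp fy (fun t => fst (Nat.iter i pair_map (u t, v t))) (fun t => snd (Nat.iter i pair_map (u t, v t)))); auto. apply (d_fy D); auto.
Qed.

Lemma near_all (k : nat) (Q : nat -> C -> Prop) z0 : (forall i, (i <= k)%nat -> exists d, 0 < d /\ forall z, Cmod (z - z0) < d -> Q i z) ->
  exists d, 0 < d /\ forall z, Cmod (z - z0) < d -> forall i, (i <= k)%nat -> Q i z.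
Proof.
  induction k as [|k IH]; intro H.
  - destruct (H O (le_n _)) as [d [hd Hd]]. exists d; split; auto. intros z hz i hi. replace i with O by lia. auto.
  - destruct IH as [d1 [h1 H1]]; [intros i hi; apply H; lia|]. destruct (H (S k) (le_n _)) as [d2 [h2 H2]].
    exists (Rmin d1 d2). split; [apply Rmin_glb_lt; auto|]. intros z hz i hi.
    destruct (Nat.eq_dec i (S k)) as [->|ne].
    + apply H2. eapply Rlt_le_trans; [apply hz|apply Rmin_r].
    + apply H1; [eapply Rlt_le_trans; [apply hz|apply Rmin_l]|lia].
Qed.

Lemma dom_open (u v : C -> C) z r : cdble u z -> cdble v z -> Cmod (u z) < rho -> Cmod (v z) < rho -> N (u z) (v z) < r ->
  exists d, 0 < d /\ forall t, Cmod (t - z) < d -> Cmod (u t) < rho /\ Cmod (v t) < rho /\ N (u t) (v t) < r.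
Proof.
  intros hu hv h1 h2 h3. apply cdble_ccont in hu. apply cdble_ccont in hv.
  destruct (n_cont _ _ _ _ _ _ Nm _ _ h1 h2 (r - N (u z) (v z)) ltac:(lra)) as [d0 [hd0 H0]].
  destruct (hu (Rmin d0 (rho - Cmod (u z)))) as [d1 [hd1 H1]]; [apply Rmin_glb_lt; lra|].
  destruct (hv (Rmin d0 (rho - Cmod (v z)))) as [d2 [hd2 H2]]; [apply Rmin_glb_lt; lra|].
  exists (Rmin d1 d2). split; [apply Rmin_glb_lt; auto|]. intros t ht.
  specialize (H1 t (Rlt_le_trans _ _ _ ht (Rmin_l _ _))). specialize (H2 t (Rlt_le_trans _ _ _ ht (Rmin_r _ _))).
  assert (e1 := Rlt_le_trans _ _ _ H1 (Rmin_l _ _)). assert (e2 := Rlt_le_trans _ _ _ H1 (Rmin_r _ _)).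
  assert (e3 := Rlt_le_trans _ _ _ H2 (Rmin_l _ _)). assert (e4 := Rlt_le_trans _ _ _ H2 (Rmin_r _ _)).
  split; [generalize (Cmod_tri_inv (u t) (u z)); lra|]. split; [generalize (Cmod_tri_inv (v t) (v z)); lra|].
  specialize (H0 (u t) (v t) e1 e3). apply Rabs_def2 in H0. lra.
Qed.

Lemma cdble_translate (f : C -> C) z c : cdble f (z - c)%C -> cdble (fun t => f (t - c)%C) z.
Proof. intro h. apply (cdble_comp (fun t => t - c)%C f); auto. apply cdble_minus; [apply cdble_id|apply cdble_const]. Qed.

(** The point is shifted back by q j steps into the half plane, where the orbit depends
    holomorphically on z, and the result is pushed forward by the same finite number of steps; the
    images of nearby orbits stay in the ball by continuity. *)
Lemma petal_chart r z0 x y : 0 < r -> P r z0 x y -> exists d (XX YY : C -> nat -> C), 0 < d /\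
  (forall z, Cmod (z - z0) < d -> P r z (XX z) (YY z)) /\
  forall n, cdble (fun z => XX z n) z0 /\ cdble (fun z => YY z n) z0.
Proof.
  intros hr hp. destruct (HH r hr) as [b Hb]. destruct (shift_below b (Re z0)) as [j hj]. set (k := (q * j)%nat) in *.
  set (c := RtoC (INR k)).
  destruct (Hb (z0 - c)%C) as (d & XX & YY & hd & H1 & H2). { rewrite Re_sub. unfold c. exact hj. }
  assert (p0 : P r (z0 - c)%C (XX (z0 - c)%C) (YY (z0 - c)%C)) by (apply H1; rewrite Cmod_self; auto).
  assert (eq0 := petal_eq D (petal_shift r z0 x y j hp) p0). fold k in eq0. cbv beta in eq0.
  destruct (eq0 O) as [ex ey]. rewrite Nat.add_0_l in ex, ey.
  destruct hp as (o & nx & hN & _ & _).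
  set (u := fun t => XX (t - c)%C O). set (v := fun t => YY (t - c)%C O).
  assert (cu : cdble u z0) by (apply (cdble_translate (fun t => XX t O)), H2).
  assert (cv : cdble v z0) by (apply (cdble_translate (fun t => YY t O)), H2).
  assert (it : forall i, (i <= k)%nat -> Nat.iter i pair_map (u z0, v z0) = (x (k - i)%nat, y (k - i)%nat)).
  { intros i hi. unfold u, v. rewrite ex, ey. apply orb_pair_map; auto. }
  assert (cc := pair_map_cdble u v z0 k cu cv).
  assert (cc' : forall i, (i <= k)%nat -> cdble (fun t => fst (Nat.iter i pair_map (u t, v t))) z0 /\ cdble (fun t => snd (Nat.iter i pair_map (u t, v t))) z0).
  { apply cc. intros i hi. rewrite it by lia. cbn [fst snd]. destruct (o (k - i)%nat) as (a1 & a2 & _). auto. }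
  destruct (near_all k (fun i t => Cmod (fst (Nat.iter i pair_map (u t, v t))) < rho /\ Cmod (snd (Nat.iter i pair_map (u t, v t))) < rho /\
    N (fst (Nat.iter i pair_map (u t, v t))) (snd (Nat.iter i pair_map (u t, v t))) < r) z0) as [d1 [hd1 Hd1]].
  { intros i hi. destruct (cc' i hi) as [c1 c2].
    destruct (o (k - i)%nat) as (a1 & a2 & _). specialize (hN (k - i)%nat).
    apply (dom_open (fun t => fst (Nat.iter i pair_map (u t, v t))) (fun t => snd (Nat.iter i pair_map (u t, v t)))); auto; rewrite it by auto; auto. }
  exists (Rmin d d1), (fun z n => fst (prepend k (XX (z - c)%C) (YY (z - c)%C) n)), (fun z n => snd (prepend k (XX (z - c)%C) (YY (z - c)%C) n)).
  split; [apply Rmin_glb_lt; auto|]. split.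
  - intros z hz. assert (z1 := Rlt_le_trans _ _ _ hz (Rmin_l _ _)). assert (z2 := Rlt_le_trans _ _ _ hz (Rmin_r _ _)).
    apply (petal_ext r r); [lra| |].
    + apply H1. replace (z - c - (z0 - c))%C with (z - z0)%C by ring. auto.
    + intros i hi. apply (Hd1 z z2 i hi).
  - intro n. unfold prepend. destruct (lt_dec n k) as [g|g].
    + apply cc'. lia.
    + cbn [fst snd]. split; [apply (cdble_translate (fun t => XX t (n - k)%nat))|apply (cdble_translate (fun t => YY t (n - k)%nat))]; apply H2.
Qed.

Context (R0 : R) (hR0 : 1000000 * Kg <= R0).

Definition small_radius (r : R) : Prop := 0 < r /\ KN * r < rho /\ forall x : C, x <> 0%C -> Cmod x <= KN * r -> R0 <= Cmod (wof m x).

Lemma petal_wbig r z x y n : small_radius r -> P r z x y -> R0 <= Cmod (wseq m x n).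
Proof.
  intros (h1 & h2 & h3) (o & nx & hN & _). apply h3; [apply (orb_nz D x y o nx)|].
  destruct (o n) as (a1 & a2 & _). specialize (hN n). assert (L := n_low _ _ _ _ _ _ Nm _ _ a1 a2).
  assert (k := n_KN _ _ _ _ _ _ Nm). generalize (Cmod_ge_0 (y n)). nra.
Qed.

(** z - z0 is the limit of the differences of w, and [compare_from] started at index n shows that
    the limit differs from the n-th difference by a relative error 256 Kg / R0. The chart only
    provides the initial closeness that the comparison requires. *)
Lemma local_w r z0 x y n : small_radius r -> P r z0 x y -> exists d, 0 < d /\ forall z x' y', Cmod (z - z0) < d -> P r z x' y' ->
  Cmod ((wseq m x' n - wseq m x n) - (z - z0)) <= / 1000 * Cmod (z - z0) /\
  Cmod (x' n - x n) <= Cmod (x n) / (16 * INR m).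
Proof.
  intros hs hp. assert (hK := d_Kg D). assert (pm := m_pos D).
  destruct (petal_chart r z0 x y (proj1 hs) hp) as (d & XX & YY & hd & H1 & H2).
  assert (p0 : P r z0 (XX z0) (YY z0)) by (apply H1; rewrite Cmod_self; auto).
  assert (eq0 := petal_eq D hp p0).
  assert (hp' := hp). destruct hp' as (o & nx & hN & hb & hz).
  assert (nxn := orb_nz D x y o nx n). assert (px : 0 < Cmod (x n)) by (apply Cmod_gt_0; auto).
  destruct (H2 n) as [c1 _].
  assert (c2 : cdble (fun z => wof m (XX z n)) z0). { apply (cdble_wof m (fun z => XX z n)); auto. rewrite (proj1 (eq0 n)). auto. }
  apply cdble_ccont in c1. apply cdble_ccont in c2.
  destruct (c1 (Cmod (x n) / (16 * INR m))) as [d1 [hd1 D1]]; [apply Rdiv_lt_0_compat; lra|].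
  destruct (c2 (R0 / 64)) as [d2 [hd2 D2]]; [lra|].
  exists (Rmin d (Rmin d1 d2)). split; [repeat apply Rmin_glb_lt; auto|].
  intros z x' y' hzz hp'.
  assert (z1 : Cmod (z - z0) < d) by (eapply Rlt_le_trans; [apply hzz|apply Rmin_l]).
  assert (z23 : Cmod (z - z0) < Rmin d1 d2) by (eapply Rlt_le_trans; [apply hzz|apply Rmin_r]).
  specialize (D1 z (Rlt_le_trans _ _ _ z23 (Rmin_l _ _))). specialize (D2 z (Rlt_le_trans _ _ _ z23 (Rmin_r _ _))).
  assert (eq1 := petal_eq D (H1 z z1) hp').
  rewrite <- (proj1 (eq1 n)), (proj1 (eq0 n)) in D1, D2.
  split; [|lra].
  assert (hpp := hp'). destruct hp' as (o' & nx' & hN' & hb' & hz').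
  assert (Cm := compare_from D x y x' y' R0 n o nx o' ltac:(intros j _; apply (petal_wbig r z0 x y j hs hp)) ltac:(lra) ltac:(lra)).
  specialize (Cm ltac:(unfold wseq; lra)).
  set (E := (wseq m x' n - wseq m x n)%C) in *.
  assert (L := clim_le _ _ E _ n (Zrel_sub hz hz') Cm).
  assert (256 * Kg / R0 <= 256 / 1000000). { apply Rmult_le_reg_r with R0; [lra|]. unfold Rdiv at 1. rewrite Rmult_assoc, Rinv_l by lra. lra. }
  assert (pE := Cmod_ge_0 E).
  assert (L2 : Cmod (z - z0 - E) <= 256 / 1000000 * Cmod E) by nra.
  rewrite Cmod_swap. generalize (Cmod_tri_inv E (z - z0)). rewrite (Cmod_swap E (z - z0)). intro. lra.
Qed.

(** This supplies the lower bound required by [open_map] and [inv_cdble]: w at index 0 moves at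
    least half as fast as z, and [wof_ratio] converts this into a displacement of x. *)
Lemma x_lower r z0 x y : small_radius r -> P r z0 x y -> exists d c, 0 < d /\ 0 < c /\ forall z x' y', Cmod (z - z0) < d -> P r z x' y' ->
  c * Cmod (z - z0) <= Cmod (x' O - x O).
Proof.
  intros hs hp. destruct (local_w r z0 x y O hs hp) as [d [hd Hd]]. assert (pm := m_pos D). assert (hK := d_Kg D).
  assert (nx : x O <> 0%C) by apply hp. assert (px : 0 < Cmod (x O)) by (apply Cmod_gt_0; auto).
  set (w := Cmod (wseq m x O)). assert (pw : 0 < w). { generalize (petal_wbig r z0 x y O hs hp). fold w. lra. }
  exists d, (/ 2 * (Cmod (x O) / (2 * INR m * w))). split; auto. split.
  { apply Rmult_lt_0_compat; [lra|]. apply Rdiv_lt_0_compat; nra. }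
  intros z x' y' hz hp'. destruct (Hd z x' y' hz hp') as [h1 h2].
  assert (h3 : Cmod (x' O - x O) <= Cmod (x O) / (8 * INR m)).
  { eapply Rle_trans; [apply h2|]. apply Rmult_le_compat_l; [lra|]. apply Rinv_le_contravar; lra. }
  destruct (wof_ratio m (x O) (x' O) hm nx h3) as (_ & (_ & r2) & _).
  change (wof m (x' O)) with (wseq m x' O) in r2. change (wof m (x O)) with (wseq m x O) in r2. fold w in r2.
  assert (Cmod (z - z0) <= 2 * Cmod (wseq m x' 0%nat - wseq m x 0%nat)).
  { generalize (Cmod_tri_inv (z - z0) (wseq m x' O - wseq m x O)). rewrite (Cmod_swap (z - z0)). generalize (Cmod_ge_0 (z - z0)). lra. }
  apply Rmult_le_reg_r with (2 * INR m * w); [nra|].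
  replace (/ 2 * (Cmod (x O) / (2 * INR m * w)) * Cmod (z - z0) * (2 * INR m * w)) with (/ 2 * Cmod (z - z0) * Cmod (x O)) by (field; lra).
  replace (2 * INR m * (Cmod (x' O - x O) / Cmod (x O)) * w) with (Cmod (x' O - x O) * (2 * INR m * w) / Cmod (x O)) in r2 by (field; lra).
  apply Rle_trans with (Cmod (x' O - x O) * (2 * INR m * w) / Cmod (x O) * Cmod (x O)); [|apply Req_le; field; lra].
  apply Rmult_le_compat_r; lra.
Qed.

Lemma petal_x_inj r z z' x y x' y' : P r z x y -> P r z' x' y' -> x' O = x O -> z' = z.
Proof.
  intros (o & _ & _ & _ & hz) (o' & _ & _ & _ & hz') e.
  apply (clim_unique _ _ _ hz'). eapply clim_ext; [|apply hz]. intro n. cbv beta. unfold wseq.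
  rewrite (proj1 (orb_unique D x y x' y' o o' e n)). reflexivity.
Qed.

Lemma closed_left (f : C -> C) (g : R -> C) T M d0 : 0 < d0 -> 0 < T -> (forall t1 t2, Cmod (g t1 - g t2) <= 2 * Rabs (t1 - t2)) ->
  ccont f (g T) -> (forall t, 0 <= t < T -> Cmod (g t - g T) < d0 -> Cmod (f (g t)) <= M) -> Cmod (f (g T)) <= M.
Proof.
  intros hd0 hT hg hc H. apply (le_eps_mult _ _ 1); [lra|]. intros eps he.
  destruct (hc eps he) as [d [hd Hd]].
  set (tau := Rmin T (Rmin (d / 4) (d0 / 4))).
  assert (ht : 0 < tau) by (repeat apply Rmin_glb_lt; lra).
  assert (t1 : tau <= T) by apply Rmin_l. assert (t23 : tau <= Rmin (d / 4) (d0 / 4)) by apply Rmin_r.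
  assert (t2 : tau <= d / 4) by (eapply Rle_trans; [apply t23|apply Rmin_l]). assert (t3 : tau <= d0 / 4) by (eapply Rle_trans; [apply t23|apply Rmin_r]).
  assert (G := hg (T - tau) T). replace (T - tau - T) with (- tau) in G by ring. rewrite Rabs_Ropp, Rabs_pos_eq in G by lra.
  specialize (Hd (g (T - tau)) ltac:(lra)). specialize (H (T - tau) ltac:(lra) ltac:(lra)).
  generalize (Cmod_tri_inv (f (g T)) (f (g (T - tau)))). rewrite (Cmod_swap (f (g T))). lra.
Qed.

Lemma direction s : s * s = 1 -> 1 <= Cmod (- (1) + s * Ci) <= 3 / 2.
Proof.
  intro hs. assert (e := Cmod_sqr (- (1) + s * Ci)).
  replace (Re (- (1) + s * Ci)%C) with (-1) in e by (cbn; ring). replace (Im (- (1) + s * Ci)%C) with s in e by (cbn; ring).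
  assert (p := Cmod_ge_0 (- (1) + s * Ci)). split; nra.
Qed.

Lemma Cconj_mul_self (x : C) : (Cconj x * x)%C = RtoC (Cmod x * Cmod x).
Proof. destruct x as [u v]. rewrite Cmod_sqr. apply injective_projections; cbn; ring. Qed.

(** Moving backwards in [z] along [-1 + i s] from a point at distance exactly [r] increases the distance. *)
Lemma exit_step r (z0 z1 : C) x y x' y' n s tau d : small_radius r -> P r z0 x y -> P r z1 x' y' -> s * s = 1 ->
  (forall z x' y', Cmod (z - z0) < d -> P r z x' y' ->
    Cmod ((wseq m x' n - wseq m x n) - (z - z0)) <= / 1000 * Cmod (z - z0) /\
    Cmod (x' n - x n) <= Cmod (x n) / (16 * INR m)) ->
  0 < tau <= / 100 -> 2 * tau < d -> (z1 - z0 = - (tau * (- (1) + s * Ci)))%C ->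
  6 / 10 * Cmod (wseq m x n) <= - Re (wseq m x n) + s * Im (wseq m x n) -> N (x n) (y n) < N (x' n) (y' n).
Proof.
  intros hs hp hp' hss Hd htau hd2 ez hg.
  assert (hK := d_Kg D). assert (pm := m_pos D). assert (dv := direction s hss).
  set (v := (- (1) + s * Ci)%C) in *.
  assert (cz : Cmod (z1 - z0) = tau * Cmod v) by (rewrite ez, Cmod_opp, Cmod_mult, Cmod_RtoC; lra).
  destruct (Hd z1 x' y' ltac:(rewrite cz; nra) hp') as [h1 h2].
  assert (big := petal_wbig r z0 x y n hs hp).
  destruct hp as (o & nx & _). destruct hp' as (o' & _).
  assert (nxn := orb_nz D x y o nx n). assert (px : 0 < Cmod (x n)) by (apply Cmod_gt_0; auto).
  destruct (wof_ratio m (x n) (x' n) hm nxn) as (_ & (r1 & _) & r3).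
  { eapply Rle_trans; [apply h2|]. apply Rmult_le_compat_l; [lra|]. apply Rinv_le_contravar; lra. }
  change (wof m (x' n)) with (wseq m x' n) in r1, r3. change (wof m (x n)) with (wseq m x n) in r1, r3.
  set (w := wseq m x n) in *. set (E := (wseq m x' n - w)%C) in *.
  set (xi := ((x' n - x n) / x n)%C) in *. assert (es : Cmod (x' n - x n) / Cmod (x n) = Cmod xi) by (symmetry; apply Cmod_div; auto).
  rewrite es in r1, r3. rewrite cz in h1. rewrite ez in h1.
  assert (pw : 1000 <= Cmod w) by lra.
  assert (hE : Cmod E <= 1502 / 1000 * tau).
  { generalize (Cmod_tri_inv E (- (tau * v))). rewrite Cmod_opp, Cmod_mult, Cmod_RtoC by lra. nra. }
  set (del := (INR m * w * xi - tau * v)%C).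
  assert (hdel : Cmod del <= 2 / 1000 * tau).
  { replace del with ((E + INR m * w * xi) - (E - - (tau * v)))%C by (unfold del; ring).
    eapply Rle_trans; [apply Cmod_sub|].
    assert (q1 : INR m * Cmod xi * Cmod w <= 3004 / 1000 * tau) by lra.
    assert (q0 : 0 <= INR m * Cmod xi * Cmod w) by (apply Rmult_le_pos; [apply Rmult_le_pos; [lra|apply Cmod_ge_0]|lra]).
    (* The quadratic remainder of [wof_ratio] is of order tau^2 / |w|, negligible because tau <=
       1/100 and |w| >= 1000. *)
    assert (q2 : 3 * (INR m * INR m) * (Cmod xi * Cmod xi) * Cmod w <= 3 / 10000 * tau).
    { apply Rmult_le_reg_r with (Cmod w); [lra|].
      replace (3 * (INR m * INR m) * (Cmod xi * Cmod xi) * Cmod w * Cmod w) with (3 * ((INR m * Cmod xi * Cmod w) * (INR m * Cmod xi * Cmod w))) by ring.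
      assert ((INR m * Cmod xi * Cmod w) * (INR m * Cmod xi * Cmod w) <= 3004 / 1000 * tau * (3004 / 1000 * tau)) by (apply Rmult_le_compat; auto).
      assert (tau * tau <= tau * / 100) by (apply Rmult_le_compat_l; lra).
      assert (3 / 10000 * tau * 1000 <= 3 / 10000 * tau * Cmod w) by (apply Rmult_le_compat_l; lra). lra. }
    nra. }
  assert (exi : (INR m * w * xi = tau * v + del)%C) by (unfold del; ring).
  (* Multiplication by the conjugate of w isolates Re xi, the relative growth of |x|: the real part
     of v times that conjugate is -Re w + s Im w, which the hypothesis bounds from below. *)
  assert (R1 : 59 / 100 * tau * Cmod w <= INR m * (Cmod w * Cmod w) * Re xi).
  { assert (e1 : (RtoC (INR m * (Cmod w * Cmod w)) * xi = tau * (v * Cconj w) + del * Cconj w)%C).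
    { rewrite RtoC_mult, <- Cconj_mul_self. transitivity ((INR m * w * xi) * Cconj w)%C; [ring|rewrite exi; ring]. }
    apply (f_equal Re) in e1. rewrite Re_add in e1.
    replace (Re (RtoC (INR m * (Cmod w * Cmod w)) * xi)%C) with (INR m * (Cmod w * Cmod w) * Re xi) in e1 by (destruct xi; cbn; ring).
    replace (Re (tau * (v * Cconj w))%C) with (tau * (- Re w + s * Im w)) in e1 by (unfold v; destruct w; cbn; ring).
    assert (B := re_le_Cmod (del * Cconj w)). rewrite Cmod_mult, Cmod_conj in B. apply Rabs_le_between in B.
    assert (tau * (6 / 10 * Cmod w) <= tau * (- Re w + s * Im w)) by (apply Rmult_le_compat_l; lra).
    assert (Cmod del * Cmod w <= 2 / 1000 * tau * Cmod w) by (apply Rmult_le_compat_r; lra). nra. }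
  assert (R2 : INR m * Cmod w * Cmod xi <= 1502 / 1000 * tau).
  { assert (e1 : Cmod (INR m * w * xi) = INR m * Cmod w * Cmod xi) by (rewrite !Cmod_mult, Cmod_RtoC; lra).
    rewrite <- e1, exi. eapply Rle_trans; [apply Cmod_triangle|]. rewrite Cmod_mult, Cmod_RtoC by lra. nra. }
  assert (R3 : / 10 * Cmod xi <= Re xi).
  { apply Rmult_le_reg_l with (INR m * (Cmod w * Cmod w)); [apply Rmult_lt_0_compat; nra|].
    assert (Cmod w * (INR m * Cmod w * Cmod xi) <= Cmod w * (1502 / 1000 * tau)) by (apply Rmult_le_compat_l; lra). nra. }
  assert (R4 : 0 < Re xi).
  { apply Rmult_lt_reg_l with (INR m * (Cmod w * Cmod w)); [apply Rmult_lt_0_compat; nra|]. rewrite Rmult_0_r. eapply Rlt_le_trans; [|apply R1]. nra. }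
  assert (exx : (x' n - x n = x n * xi)%C) by (unfold xi; field; auto).
  destruct (o n) as (a1 & _). destruct (o' n) as (a1' & _).
  apply (n_inc _ _ _ _ _ _ Nm); auto.
  - apply (orb_y_le D); auto.
  - apply (orb_y_le D); auto.
  - apply (orb_cone D); auto.
  - intro k. assert (xi = 0)%C by (unfold xi; rewrite k; field; auto). rewrite H in R4. cbn in R4. lra.
  - rewrite exx, Cmod_mult. rewrite Cmult_assoc, Cconj_mul_self.
    replace (Re (RtoC (Cmod (x n) * Cmod (x n)) * xi)%C) with (Cmod (x n) * Cmod (x n) * Re xi) by (destruct xi; cbn; ring).
    assert (Cmod (x n) * Cmod (x n) * (/ 10 * Cmod xi) <= Cmod (x n) * Cmod (x n) * Re xi) by (apply Rmult_le_compat_l; nra). lra.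
Qed.

(** On the cone the norm equals a |x| up to 1/(400 m), so |x'| exceeds |x| by a factor of at most
    about 1 + 1/(200 m); Bernoulli's inequality bounds the m-th power. Hence at an index of contact
    with the sphere, |w| is minimal along the orbit up to one per cent. *)
Lemma mod_ratio r (x y x' y' : C) : Cmod x < rho -> Cmod x' < rho -> x <> 0%C -> x' <> 0%C -> Cmod y <= gam * Cmod x -> Cmod y' <= gam * Cmod x' ->
  N x y = r -> N x' y' <= r -> 99 / 100 * Cmod (wof m x) <= Cmod (wof m x').
Proof.
  intros hx hx' nx nx' hy hy' hr hr'. assert (pm := m_pos D). assert (pa := n_a _ _ _ _ _ _ Nm).
  assert (M1 := n_mod _ _ _ _ _ _ Nm x y hx hy). assert (M2 := n_mod _ _ _ _ _ _ Nm x' y' hx' hy').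
  assert (px : 0 < Cmod x) by (apply Cmod_gt_0; auto). assert (px' : 0 < Cmod x') by (apply Cmod_gt_0; auto).
  set (e := / (400 * INR m)) in *.
  assert (he : 0 < e) by (apply Rinv_0_lt_compat; lra).
  assert (he' : INR m * e = / 400) by (unfold e; field; lra).
  assert (e1 : e <= / 400) by (apply Rinv_le_contravar; lra).
  assert (le : (1 - e) * Cmod x' <= (1 + e) * Cmod x).
  { apply Rmult_le_reg_l with a; auto. lra. }
  assert (le2 : (1 - 2 * e) * Cmod x' <= Cmod x) by nra.
  assert (bern : forall k, 1 - 2 * e * INR k <= (1 - 2 * e) ^ k).
  { induction k as [|k IH]; [simpl; lra|]. rewrite S_INR. simpl pow. assert (pk := pos_INR k).
    assert ((1 - 2 * e) * (1 - 2 * e * INR k) <= (1 - 2 * e) * (1 - 2 * e) ^ k) by (apply Rmult_le_compat_l; lra). nra. }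
  specialize (bern m).
  assert (pw : (1 - 2 * e) ^ m * Cmod x' ^ m <= Cmod x ^ m).
  { rewrite <- Rpow_mult_distr. apply pow_incr. split; [apply Rmult_le_pos; lra|auto]. }
  rewrite !wof_mod by auto.
  assert (qx : 0 < Cmod x ^ m) by (apply pow_lt; auto). assert (qx' : 0 < Cmod x' ^ m) by (apply pow_lt; auto).
  apply Rmult_le_reg_r with (INR m * Cmod x ^ m * (Cmod x' ^ m)); [apply Rmult_lt_0_compat; nra|].
  replace (99 / 100 * / (INR m * Cmod x ^ m) * (INR m * Cmod x ^ m * Cmod x' ^ m)) with (99 / 100 * Cmod x' ^ m) by (field; lra).
  replace (/ (INR m * Cmod x' ^ m) * (INR m * Cmod x ^ m * Cmod x' ^ m)) with (Cmod x ^ m) by (field; lra).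
  eapply Rle_trans; [|apply pw]. apply Rmult_le_compat_r; lra.
Qed.

(** The larger radius r' makes room for the critical parameter T: the limit orbit satisfies only
    norm <= r, so it belongs to the petal for r', and the local estimates hold there as well. *)
Lemma petal_path r r' z0 x y : small_radius r -> small_radius r' -> r < r' -> P r z0 x y -> exists s, s * s = 1 /\
  forall t : R, 0 <= t -> exists x' y', P r (z0 + t * (- (1) + s * Ci))%C x' y'.
Proof.
  intros hs hs' hrr hp. assert (hK := d_Kg D). assert (hrho := d_rho D).
  assert (hpo := proj1 hp). assert (hpn := proj1 (proj2 hp)).
  assert (stx : forall n, Cmod (wseq m x (S n) - (wseq m x n - 1)) <= / 100) by (intro n; apply (orb_w_step D x y n hpo hpn)).
  destruct (orb_Re_lim D x y 0 hpo hpn) as [M0 HM0].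
  destruct (first_left (wseq m x) stx O M0 ltac:(lia) ltac:(specialize (HM0 M0 (le_n _)); lra)) as (n0 & _ & k1 & k2 & _).
  (* The ray is directed by the half plane in which the orbit passes the imaginary axis, or in which
     it starts if it starts on the left. *)
  assert (Hs : exists s, s * s = 1 /\ 0 <= s * Im (wseq m x n0)).
  { destruct (Rle_dec 0 (Im (wseq m x n0))); [exists 1|exists (-1)]; split; lra. }
  destruct Hs as [s [hss hsi]]. exists s. split; auto.
  set (v := (- (1) + s * Ci)%C). set (Zt := fun t : R => (z0 + t * v)%C).
  assert (hv := direction s hss). fold v in hv.
  assert (Zd : forall t1 t2 : R, Cmod (Zt t1 - Zt t2) = Rabs (t1 - t2) * Cmod v).
  { intros t1 t2. unfold Zt. replace (z0 + t1 * v - (z0 + t2 * v))%C with (RtoC (t1 - t2) * v)%C by (rewrite RtoC_minus; ring). rewrite Cmod_mult, Cmod_R. reflexivity. }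
  assert (Zd2 : forall t1 t2 : R, Cmod (Zt t1 - Zt t2) <= 2 * Rabs (t1 - t2)).
  { intros t1 t2. rewrite Zd. generalize (Rabs_pos (t1 - t2)). nra. }
  set (Q := fun t => exists x' y', P r (Zt t) x' y').
  change (forall t : R, 0 <= t -> Q t).
  assert (Zt0 : Zt 0 = z0) by (unfold Zt; ring).
  assert (Q0 : Q 0) by (exists x, y; rewrite Zt0; exact hp).
  apply NNPP. intro neg. apply not_all_ex_not in neg. destruct neg as [t1 neg]. apply imply_to_and in neg. destruct neg as [ht1 nq].
  set (S := fun T => 0 <= T /\ forall t, 0 <= t <= T -> Q t).
  assert (S0 : S 0). { split; [lra|]. intros t ht. replace t with 0 by lra. exact Q0. }
  assert (Sb : forall T, S T -> T <= t1). { intros T [hT HT]. apply Rnot_lt_le. intro k. apply nq, HT. lra. }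
  destruct (completeness S) as [T [HT1 HT2]]; [exists t1; exact Sb|exists 0; exact S0|].
  assert (T0 : 0 <= T) by (apply HT1, S0).
  assert (before : forall t, 0 <= t < T -> Q t).
  { intros t ht. apply NNPP. intro k. assert (T <= t); [|lra]. apply HT2. intros T' [hT' HT']. apply Rnot_lt_le. intro kk. apply k, HT'. lra. }
  assert (noT : ~ Q T).
  { intros (X & Y & hX). destruct (petal_chart r (Zt T) X Y (proj1 hs) hX) as (d & XX & YY & hd & H1 & _).
    assert (ST : S (T + d / 4)).
    { split; [lra|]. intros t ht. destruct (Rlt_le_dec t T) as [k|k]; [apply before; lra|].
      exists (XX (Zt t)), (YY (Zt t)). apply H1. assert (G := Zd2 t T). rewrite Rabs_pos_eq in G by lra. lra. }
    apply HT1 in ST. lra. }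
  assert (Tpos : 0 < T). { destruct (Rle_lt_or_eq_dec 0 T T0) as [k|k]; auto. exfalso. apply noT. rewrite <- k. exact Q0. }
  (* The limit orbit is produced without compactness: the point of coordinate Zt T is first built q
     j steps back, in the half plane, and then pushed forward. The non-strict bounds at T follow by
     continuity from the parameters t < T, one image at a time since each image must be defined
     before the next. *)
  assert (lim : exists X Y, P r' (Zt T) X Y /\ forall n, N (X n) (Y n) <= r).
  { destruct (HH r (proj1 hs)) as [b Hb]. destruct (shift_below b (Re z0)) as [j hj]. set (k := (q * j)%nat) in *. set (c := RtoC (INR k)).
    destruct (Hb (Zt T - c)%C) as (d & XX & YY & hd & H1 & H2).
    { rewrite Re_sub. unfold Zt. rewrite Re_add. replace (Re (T * v)%C) with (- T) by (unfold v; cbn; ring). unfold c. cbn [RtoC Re fst]. change (fst z0) with (Re z0). lra. }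
    set (u := fun z => XX (z - c)%C O). set (w := fun z => YY (z - c)%C O).
    assert (cu : cdble u (Zt T)) by (apply (cdble_translate (fun z => XX z O)), H2).
    assert (cw : cdble w (Zt T)) by (apply (cdble_translate (fun z => YY z O)), H2).
    assert (vals : forall i, (i <= k)%nat -> forall t, 0 <= t < T -> Cmod (Zt t - Zt T) < d ->
       Cmod (fst (Nat.iter i pair_map (u (Zt t), w (Zt t)))) <= KN * r /\ Cmod (snd (Nat.iter i pair_map (u (Zt t), w (Zt t)))) <= KN * r /\
       N (fst (Nat.iter i pair_map (u (Zt t), w (Zt t)))) (snd (Nat.iter i pair_map (u (Zt t), w (Zt t)))) < r).
    { intros i hi t ht hz. destruct (before t ht) as (xt & yt & hpt).
      assert (pc : P r (Zt t - c)%C (XX (Zt t - c)%C) (YY (Zt t - c)%C)).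
      { apply H1. replace (Zt t - c - (Zt T - c))%C with (Zt t - Zt T)%C by ring. exact hz. }
      destruct (petal_eq D (petal_shift r (Zt t) xt yt j hpt) pc O) as [ex ey]. fold k in ex, ey. rewrite Nat.add_0_l in ex, ey.
      unfold u, w. rewrite ex, ey. destruct hpt as (ot & _ & Nt & _). rewrite (orb_pair_map xt yt k i ot hi). cbn [fst snd].
      destruct (ot (k - i)%nat) as (a1 & a2 & _). specialize (Nt (k - i)%nat). assert (L := n_low _ _ _ _ _ _ Nm _ _ a1 a2).
      assert (kk := n_KN _ _ _ _ _ _ Nm). generalize (Cmod_ge_0 (xt (k - i)%nat)) (Cmod_ge_0 (yt (k - i)%nat)). intros. repeat split; auto; nra. }
    assert (cl : forall i, (i <= k)%nat -> (cdble (fun z => fst (Nat.iter i pair_map (u z, w z))) (Zt T) /\ cdble (fun z => snd (Nat.iter i pair_map (u z, w z))) (Zt T)) /\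
       Cmod (fst (Nat.iter i pair_map (u (Zt T), w (Zt T)))) <= KN * r /\ Cmod (snd (Nat.iter i pair_map (u (Zt T), w (Zt T)))) <= KN * r).
    { intros i. induction i as [i IH] using lt_wf_ind. intro hi.
      assert (cc : cdble (fun z => fst (Nat.iter i pair_map (u z, w z))) (Zt T) /\ cdble (fun z => snd (Nat.iter i pair_map (u z, w z))) (Zt T)).
      { apply (pair_map_cdble u w (Zt T) i cu cw); auto. intros i' hi'. destruct (IH i' hi' ltac:(lia)) as [_ [b1 b2]]. generalize (proj1 (proj2 hs)). lra. }
      split; auto. destruct cc as [c1 c2]. split.
      - apply (closed_left (fun z => fst (Nat.iter i pair_map (u z, w z))) Zt T (KN * r) d hd Tpos Zd2 (cdble_ccont _ _ c1)). intros t ht hz. apply (vals i hi t ht hz).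
      - apply (closed_left (fun z => snd (Nat.iter i pair_map (u z, w z))) Zt T (KN * r) d hd Tpos Zd2 (cdble_ccont _ _ c2)). intros t ht hz. apply (vals i hi t ht hz). }
    assert (Nle : forall i, (i <= k)%nat -> N (fst (Nat.iter i pair_map (u (Zt T), w (Zt T)))) (snd (Nat.iter i pair_map (u (Zt T), w (Zt T)))) <= r).
    { intros i hi. destruct (cl i hi) as [[c1 c2] [b1 b2]]. apply cdble_ccont in c1. apply cdble_ccont in c2.
      set (U := fun z => fst (Nat.iter i pair_map (u z, w z))) in *. set (W := fun z => snd (Nat.iter i pair_map (u z, w z))) in *.
      apply (le_eps_mult _ _ 1); [lra|]. intros eps he.
      assert (hsm := proj1 (proj2 hs)).
      destruct (n_cont _ _ _ _ _ _ Nm (U (Zt T)) (W (Zt T)) ltac:(unfold U; lra) ltac:(unfold W; lra) eps he) as [d0 [hd0 H0]].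
      destruct (c1 d0 hd0) as [d1 [hd1 D1]]. destruct (c2 d0 hd0) as [d2 [hd2 D2]].
      set (tau := Rmin (Rmin T (d / 4)) (Rmin (d1 / 4) (d2 / 4))).
      assert (ht : 0 < tau) by (apply Rmin_glb_lt; apply Rmin_glb_lt; lra).
      assert (tau <= T /\ tau <= d / 4 /\ tau <= d1 / 4 /\ tau <= d2 / 4) as (e1 & e2 & e3 & e4).
      { generalize (Rmin_l (Rmin T (d / 4)) (Rmin (d1 / 4) (d2 / 4))) (Rmin_r (Rmin T (d / 4)) (Rmin (d1 / 4) (d2 / 4))) (Rmin_l T (d / 4)) (Rmin_r T (d / 4)) (Rmin_l (d1 / 4) (d2 / 4)) (Rmin_r (d1 / 4) (d2 / 4)).
        fold tau. intros. repeat split; lra. }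
      assert (G := Zd2 (T - tau) T). replace (T - tau - T) with (- tau) in G by ring. rewrite Rabs_Ropp, Rabs_pos_eq in G by lra.
      specialize (H0 _ _ (D1 (Zt (T - tau)) ltac:(lra)) (D2 (Zt (T - tau)) ltac:(lra))).
      destruct (vals i hi (T - tau) ltac:(lra) ltac:(lra)) as (_ & _ & V3). apply Rabs_def2 in H0. unfold U, W in *. lra. }
    exists (fun n => fst (prepend k (XX (Zt T - c)%C) (YY (Zt T - c)%C) n)), (fun n => snd (prepend k (XX (Zt T - c)%C) (YY (Zt T - c)%C) n)).
    assert (pc : P r (Zt T - c)%C (XX (Zt T - c)%C) (YY (Zt T - c)%C)) by (apply H1; rewrite Cmod_self; auto).
    split.
    - apply (petal_ext r r'); [lra|exact pc|]. intros i hi. destruct (cl i hi) as [_ [b1 b2]]. specialize (Nle i hi). assert (hsm := proj1 (proj2 hs)).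
      change (XX (Zt T - c)%C O) with (u (Zt T)). change (YY (Zt T - c)%C O) with (w (Zt T)). repeat split; lra.
    - intro n. unfold prepend. destruct (lt_dec n k) as [g|g]; [apply Nle; lia|]. cbn [fst snd]. left. apply pc. }
  destruct lim as (X & Y & hX & hXN).
  assert (hXo := proj1 hX). assert (hXn := proj1 (proj2 hX)).
  (* Without a contact index the limit orbit would itself be in the petal for r, contrary to
     [noT]. *)
  destruct (classic (forall n, N (X n) (Y n) < r)) as [all|ex].
  { apply noT. exists X, Y. destruct hX as (q1 & q2 & q3 & q4 & q5). repeat split; auto; apply q1. }
  apply not_all_ex_not in ex. destruct ex as [n hn].
  assert (Nr : N (X n) (Y n) = r) by (specialize (hXN n); lra).
  assert (onseg : forall t, exists p : (nat -> C) * (nat -> C), 0 <= t <= T -> P r' (Zt t) (fst p) (snd p)).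
  { intro t. destruct (classic (0 <= t <= T)) as [k|k]; [|exists (fun _ => RtoC 0, fun _ => RtoC 0); tauto].
    destruct (Req_dec t T) as [->|ne]; [exists (X, Y); auto|].
    destruct (before t ltac:(lra)) as (xt & yt & hpt). exists (xt, yt). intros _. apply (petal_mono r); auto; lra. }
  destruct (functional_choice _ onseg) as [XT HXT].
  (* This is w_n minus the uniform motion along the ray, on a path rescaled to [0, 1]. By [local_w]
     its variation is at most 2T/1000, the input of [exit_direction]. *)
  set (h := fun t : R => (wseq m (fst (XT (t * T)%R)) n - t * T * v)%C).
  assert (dist : Cmod (h 1 - h 0) <= T / 500).
  { apply loc2glob. intros t ht. assert (htT : 0 <= t * T <= T) by nra.
    destruct (local_w r' (Zt (t * T)) _ _ n hs' (HXT (t * T) htT)) as [d [hd Hd]].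
    exists (d / (2 * (T + 1))). split; [apply Rdiv_lt_0_compat; lra|]. intros t' ht' hl. assert (htT' : 0 <= t' * T <= T) by nra.
    assert (G := Zd2 (t' * T) (t * T)). replace (t' * T - t * T) with ((t' - t) * T) in G by ring. rewrite Rabs_mult, (Rabs_pos_eq T) in G by lra.
    assert (Rabs (t' - t) * (2 * (T + 1)) < d).
    { apply Rmult_lt_compat_r with (r := 2 * (T + 1)) in hl; [|lra]. replace (d / (2 * (T + 1)) * (2 * (T + 1))) with d in hl by (field; lra). exact hl. }
    pose proof (Rabs_pos (t' - t)).
    destruct (Hd (Zt (t' * T)) _ _ ltac:(nra) (HXT (t' * T) htT')) as [L _].
    unfold h. replace (wseq m (fst (XT (t' * T)%R)) n - t' * T * v - (wseq m (fst (XT (t * T)%R)) n - t * T * v))%C with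
      (wseq m (fst (XT (t' * T)%R)) n - wseq m (fst (XT (t * T)%R)) n - (Zt (t' * T)%R - Zt (t * T)%R))%C by (unfold Zt; rewrite !RtoC_mult; ring).
    eapply Rle_trans; [apply L|]. nra. }
  assert (h1 : h 1 = (wseq m X n - T * v)%C).
  { unfold h. rewrite Rmult_1_l. unfold wseq. rewrite (proj1 (petal_eq D hX (HXT T ltac:(lra)) n)). ring. }
  assert (h0 : h 0 = wseq m x n).
  { unfold h. rewrite Rmult_0_l. assert (p0 := HXT 0 ltac:(lra)). rewrite Zt0 in p0. unfold wseq. rewrite (proj1 (petal_eq D hp p0 n)). ring. }
  rewrite h1, h0 in dist. replace (wseq m X n - T * v - wseq m x n)%C with (wseq m X n - wseq m x n - T * v)%C in dist by ring.
  destruct (orb_Re_lim D X Y 0 hXo hXn) as [M HM].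
  assert (big := petal_wbig r' (Zt T) X Y n hs' hX).
  assert (geo := exit_direction (wseq m x) (wseq m X) s T n (Cmod (wseq m X n)) n0 (max n M) hss T0 ltac:(lra) stx
    ltac:(intro i; apply (orb_w_step D X Y i hXo hXn))).
  assert (geo' : 6 / 10 * Cmod (wseq m X n) <= - Re (wseq m X n) + s * Im (wseq m X n)).
  { apply geo; auto.
    - intro i. destruct (hXo i) as (a1 & _). destruct (hXo n) as (b1 & _).
      apply (mod_ratio r (X n) (Y n) (X i) (Y i)); auto; try apply (orb_y_le D); auto; apply (orb_nz D X Y hXo hXn).
    - lia.
    - specialize (HM (max n M) ltac:(lia)). lra. }
  destruct (local_w r' (Zt T) X Y n hs' hX) as [d [hd Hd]].
  set (tau := Rmin T (Rmin (/ 100) (d / 4))).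
  assert (ht : 0 < tau) by (apply Rmin_glb_lt; [auto|apply Rmin_glb_lt; lra]).
  assert (e1 : tau <= T) by apply Rmin_l. assert (e23 : tau <= Rmin (/ 100) (d / 4)) by apply Rmin_r.
  assert (e2 : tau <= / 100) by (eapply Rle_trans; [apply e23|apply Rmin_l]). assert (e3 : tau <= d / 4) by (eapply Rle_trans; [apply e23|apply Rmin_r]).
  destruct (before (T - tau) ltac:(lra)) as (x' & y' & hp').
  (* At the contact index the norm is r at T, and [exit_step] makes it larger than r slightly before
     T, where all norms are less than r. *)
  assert (inc : N (X n) (Y n) < N (x' n) (y' n)).
  { apply (exit_step r' (Zt T) (Zt (T - tau)) X Y x' y' n s tau d hs' hX (petal_mono r r' _ _ _ ltac:(lra) hp') hss Hd); auto; try lra.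
    unfold Zt. fold v. rewrite RtoC_minus. ring. }
  destruct hp' as (_ & _ & N' & _). specialize (N' n). lra.
Qed.
End Petal.

(** * Complex differentiability in two variables *)

Lemma norm_C2 (x y : C) : norm ((x, y) : C2) = sqrt (Cmod x ^ 2 + Cmod y ^ 2).
Proof. reflexivity. Qed.

Lemma norm_C2_bounds (x y : C) : Cmod x <= norm ((x, y) : C2) /\ Cmod y <= norm ((x, y) : C2) /\ norm ((x, y) : C2) <= Cmod x + Cmod y.
Proof.
  rewrite norm_C2. assert (px := Cmod_ge_0 x). assert (py := Cmod_ge_0 y).
  repeat split.
  - rewrite <- (sqrt_pow2 (Cmod x)) at 1 by auto. apply sqrt_le_1_alt. nra.
  - rewrite <- (sqrt_pow2 (Cmod y)) at 1 by auto. apply sqrt_le_1_alt. nra.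
  - rewrite <- (sqrt_pow2 (Cmod x + Cmod y)) by lra. apply sqrt_le_1_alt. nra.
Qed.

Lemma locally_C (z : C) (P : C -> Prop) : locally (T := C_UniformSpace) z P <-> exists d, 0 < d /\ forall z', Cmod (z' - z) < d -> P z'.
Proof.
  split.
  - intros [[d hd] H]. exists d; split; auto. intros z' hz. apply H.
    assert (a1 := re_le_Cmod (z' - z)). assert (a2 := Cmod_im_le (z' - z)). destruct z, z'. cbn in *.
    split; unfold ball; simpl; unfold AbsRing_ball, abs, minus, plus, opp; simpl; lra.
  - intros [d [hd H]]. assert (hd2 : 0 < d / 2) by lra. exists (mkposreal _ hd2). intros z' [b1 b2]. apply H.
    eapply Rle_lt_trans; [apply Cmod_le_ReIm|]. destruct z, z'.
    unfold ball in *; simpl in *; unfold AbsRing_ball, abs, minus, plus, opp in *; simpl in *. lra.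
Qed.

Lemma locally_C2 (x y : C) (P : C2 -> Prop) : locally (T := C2) (x, y) P <-> exists d, 0 < d /\ forall x' y' : C, Cmod (x' - x) < d -> Cmod (y' - y) < d -> P (x', y').
Proof.
  split.
  - intros [[d hd] H]. exists d; split; auto. intros x' y' hx hy. apply H.
    assert (a1 := re_le_Cmod (x' - x)). assert (a2 := Cmod_im_le (x' - x)). assert (a3 := re_le_Cmod (y' - y)). assert (a4 := Cmod_im_le (y' - y)).
    destruct x, y, x', y'. cbn in *.
    split; split; unfold ball; simpl; unfold AbsRing_ball, abs, minus, plus, opp; simpl; lra.
  - intros [d [hd H]]. assert (hd2 : 0 < d / 2) by lra. exists (mkposreal _ hd2). intros [x' y'] [[b1 b2] [b3 b4]]. apply H.
    + eapply Rle_lt_trans; [apply Cmod_le_ReIm|]. destruct x, y, x', y'.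
      unfold ball in *; simpl in *; unfold AbsRing_ball, abs, minus, plus, opp in *; simpl in *. lra.
    + eapply Rle_lt_trans; [apply Cmod_le_ReIm|]. destruct x, y, x', y'.
      unfold ball in *; simpl in *; unfold AbsRing_ball, abs, minus, plus, opp in *; simpl in *. lra.
Qed.

Lemma linear_C2 {F : NormedModule C_AbsRing} (L : C2 -> F) (h k : C) : is_linear L -> L (h, k) = plus (scal h (L (RtoC 1, RtoC 0))) (scal k (L (RtoC 0, RtoC 1))).
Proof.
  intro hL. rewrite <- !(linear_scal L hL), <- (linear_plus L hL). f_equal.
  apply injective_projections; cbn; unfold mult; cbn; apply injective_projections; cbn; ring.
Qed.

Lemma ex_filterdiff_fdiff_C (h : C2 -> C) (x y : C) : ex_filterdiff (U := C2) (V := C_NormedModule) h (locally ((x, y) : C2)) -> fdiff (fun u v => h (u, v)) x y.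
Proof.
  intros [L [hL H]]. specialize (H (x, y) (fun P HP => HP)).
  exists (L (RtoC 1, RtoC 0)), (L (RtoC 0, RtoC 1)). intros eps he.
  specialize (H (mkposreal eps he)). apply locally_C2 in H. destruct H as [d [hd H]].
  exists d; split; auto. intros x' y' hx hy. specialize (H x' y' hx hy).
  assert (e : minus ((x', y') : C2) (x, y) = ((x' - x)%C, (y' - y)%C)) by reflexivity.
  rewrite e, (linear_C2 L _ _ hL) in H.
  assert (nb := proj2 (proj2 (norm_C2_bounds (x' - x) (y' - y)))).
  change (Cmod (h (x', y') - h (x, y) - ((x' - x) * L (RtoC 1, RtoC 0) + (y' - y) * L (RtoC 0, RtoC 1))) <= eps * norm (((x' - x)%C, (y' - y)%C) : C2)) in H.
  replace (h (x', y') - h (x, y) - L (RtoC 1, RtoC 0) * (x' - x) - L (RtoC 0, RtoC 1) * (y' - y))%C with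
    (h (x', y') - h (x, y) - ((x' - x) * L (RtoC 1, RtoC 0) + (y' - y) * L (RtoC 0, RtoC 1)))%C by ring.
  eapply Rle_trans; [apply H|]. apply Rmult_le_compat_l; lra.
Qed.

Lemma ex_filterdiff_fdiff (f : C2 -> C2) (x y : C) : ex_filterdiff (U := C2) (V := C2) f (locally ((x, y) : C2)) ->
  fdiff (fun u v => fst (f (u, v))) x y /\ fdiff (fun u v => snd (f (u, v))) x y.
Proof.
  intros [L [hL H]]. specialize (H (x, y) (fun P HP => HP)).
  assert (G : forall eps, 0 < eps -> exists d, 0 < d /\ forall x' y', Cmod (x' - x) < d -> Cmod (y' - y) < d ->
     Cmod (fst (f (x', y')) - fst (f (x, y)) - fst (L (RtoC 1, RtoC 0)) * (x' - x) - fst (L (RtoC 0, RtoC 1)) * (y' - y)) <= eps * (Cmod (x' - x) + Cmod (y' - y)) /\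
     Cmod (snd (f (x', y')) - snd (f (x, y)) - snd (L (RtoC 1, RtoC 0)) * (x' - x) - snd (L (RtoC 0, RtoC 1)) * (y' - y)) <= eps * (Cmod (x' - x) + Cmod (y' - y))).
  { intros eps he. specialize (H (mkposreal eps he)). apply locally_C2 in H. destruct H as [d [hd H]].
    exists d; split; auto. intros x' y' hx hy. specialize (H x' y' hx hy).
    assert (e : minus ((x', y') : C2) (x, y) = ((x' - x)%C, (y' - y)%C)) by reflexivity.
    rewrite e, (linear_C2 L _ _ hL) in H.
    assert (nb := proj2 (proj2 (norm_C2_bounds (x' - x) (y' - y)))).
    set (u := (fst (f (x', y')) - fst (f (x, y)) - ((x' - x) * fst (L (RtoC 1, RtoC 0)) + (y' - y) * fst (L (RtoC 0, RtoC 1))))%C).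
    set (v := (snd (f (x', y')) - snd (f (x, y)) - ((x' - x) * snd (L (RtoC 1, RtoC 0)) + (y' - y) * snd (L (RtoC 0, RtoC 1))))%C).
    change (norm ((u, v) : C2) <= eps * norm (((x' - x)%C, (y' - y)%C) : C2)) in H.
    destruct (norm_C2_bounds u v) as (n1 & n2 & _).
    assert (eps * norm (((x' - x)%C, (y' - y)%C) : C2) <= eps * (Cmod (x' - x) + Cmod (y' - y))) by (apply Rmult_le_compat_l; lra).
    split.
    - match goal with |- Cmod ?t <= _ => replace t with u by (unfold u; ring) end. lra.
    - match goal with |- Cmod ?t <= _ => replace t with v by (unfold v; ring) end. lra. }
  split; [exists (fst (L (RtoC 1, RtoC 0))), (fst (L (RtoC 0, RtoC 1)))|exists (snd (L (RtoC 1, RtoC 0))), (snd (L (RtoC 0, RtoC 1)))];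
  intros eps he; destruct (G eps he) as [d [hd Hd]]; exists d; split; auto; intros x' y' hx hy; apply (Hd x' y' hx hy).
Qed.

Lemma is_linear_scal_r {F : NormedModule C_AbsRing} (l : F) : is_linear (U := C_NormedModule) (V := F) (fun h : C => scal h l).
Proof.
  split.
  - intros x y. apply (scal_distr_r (K := C_AbsRing) x y l).
  - intros k x. symmetry. apply (scal_assoc (K := C_AbsRing) k x l).
  - exists (norm l + 1). split; [generalize (norm_ge_0 l); lra|]. intro x.
    eapply Rle_trans; [apply (norm_scal (K := C_AbsRing) x l)|].
    change (Cmod x * norm l <= (norm l + 1) * Cmod x). generalize (Cmod_ge_0 x) (norm_ge_0 l). nra.
Qed.

Lemma cdble_ex_filterdiff (f : C -> C) (z : C) : cdble f z -> ex_filterdiff (U := C_NormedModule) (V := C_NormedModule) f (locally (T := C_UniformSpace) z).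
Proof.
  intros [l h]. exists (fun k : C => scal (k : C) (l : C_NormedModule)). split; [apply (is_linear_scal_r (F := C_NormedModule))|].
  intros z' hz'. apply (is_filter_lim_locally_unique (V := C_NormedModule)) in hz'. subst z'.
  intros [eps he]. apply locally_C. destruct (h eps he) as [d [hd H]]. exists d; split; auto. intros z' hz. specialize (H z' hz).
  change (Cmod (f z' - f z - (z' - z) * l) <= eps * Cmod (z' - z)). replace ((z' - z) * l)%C with (l * (z' - z))%C by ring. exact H.
Qed.

Lemma cdble_ex_filterdiff2 (f1 f2 : C -> C) (z : C) : cdble f1 z -> cdble f2 z ->
  ex_filterdiff (U := C_NormedModule) (V := C2) (fun t : C => (f1 t, f2 t)) (locally (T := C_UniformSpace) z).
Proof.
  intros [l1 h1] [l2 h2]. exists (fun k : C => scal (k : C) ((l1, l2) : C2)). split; [apply (is_linear_scal_r (F := C2))|].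
  intros z' hz'. apply (is_filter_lim_locally_unique (V := C_NormedModule)) in hz'. subst z'.
  intros [eps he]. apply locally_C.
  destruct (h1 (eps / 2) ltac:(lra)) as [d1 [hd1 H1]]. destruct (h2 (eps / 2) ltac:(lra)) as [d2 [hd2 H2]].
  exists (Rmin d1 d2); split; [apply Rmin_glb_lt; auto|]. intros z' hz.
  specialize (H1 z' (Rlt_le_trans _ _ _ hz (Rmin_l _ _))). specialize (H2 z' (Rlt_le_trans _ _ _ hz (Rmin_r _ _))).
  change (norm (((f1 z' - f1 z - (z' - z) * l1)%C, (f2 z' - f2 z - (z' - z) * l2)%C) : C2) <= eps * Cmod (z' - z)).
  eapply Rle_trans; [apply norm_C2_bounds|].
  replace ((z' - z) * l1)%C with (l1 * (z' - z))%C by ring. replace ((z' - z) * l2)%C with (l2 * (z' - z))%C by ring. lra.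
Qed.

Lemma open_C (D : C -> Prop) : (forall z, D z -> exists d, 0 < d /\ forall z', Cmod (z' - z) < d -> D z') -> open (T := C_UniformSpace) D.
Proof. intros H z hz. apply locally_C. apply H, hz. Qed.

Lemma open_C_inv (D : C -> Prop) z : open (T := C_UniformSpace) D -> D z -> exists d, 0 < d /\ forall z', Cmod (z' - z) < d -> D z'.
Proof. intros H hz. apply locally_C. apply H, hz. Qed.

(** * The germ in straightened normalizing coordinates *)

Lemma Cminus_0_r (z : C) : (z - 0)%C = z.
Proof. ring. Qed.

Lemma is_series_clim (u : nat -> C) (l : C) : is_series (K := C_AbsRing) (V := C_NormedModule) u l -> clim (fun n => sum_n (G := C_AbelianMonoid) u n) l.
Proof.
  intros h eps he.
  destruct (h (fun z => Cmod (z - l) < eps)) as [M HM].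
  - apply locally_C. exists eps. auto.
  - exists M. intros n hn. apply (HM n hn).
Qed.

Lemma sum_n_C_S (u : nat -> C) n : sum_n (G := C_AbelianMonoid) u (S n) = (sum_n (G := C_AbelianMonoid) u n + u (S n))%C.
Proof. exact (sum_Sn (G := C_AbelianMonoid) u n). Qed.

Lemma pow_n_C (x : C) n : pow_n (K := C_AbsRing) x n = (x ^ n)%C.
Proof. induction n as [|n IH]; [reflexivity|]. simpl. rewrite <- IH. reflexivity. Qed.

(** Convergence at the single point [x1] bounds the terms there, and for |x| <= |x1|/2 the tail is
    dominated by a geometric series. This gives differentiability of the sum times x at 0 without
    any theory of the sum function. *)
Lemma pseries_near_0 (a : nat -> C) (x1 t1 : C) : x1 <> 0%C -> is_pseries (K := C_AbsRing) (V := C_NormedModule) a x1 t1 ->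
  exists B, 0 <= B /\ forall x t, is_pseries (K := C_AbsRing) (V := C_NormedModule) a x t -> Cmod x <= Cmod x1 / 2 -> Cmod (t - a O) <= B * Cmod x.
Proof.
  intros hx h. assert (px := proj1 (Cmod_gt_0 x1) hx).
  assert (E : forall x k, scal (V := C_NormedModule) (pow_n (K := C_AbsRing) x k) (a k) = (x ^ k * a k)%C) by (intros; rewrite pow_n_C; reflexivity).
  apply is_series_clim in h. destruct (clim_bounded _ _ h) as [B0 HB0].
  assert (b0 : 0 <= B0) by (eapply Rle_trans; [apply Cmod_ge_0|apply (HB0 O)]).
  assert (T : forall k, Cmod (x1 ^ S k * a (S k)) <= 2 * B0).
  { intro k. assert (e := sum_n_C_S (fun k => scal (V := C_NormedModule) (pow_n (K := C_AbsRing) x1 k) (a k)) k). cbv beta in e.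
    rewrite (E x1 (S k)) in e.
    replace (x1 ^ S k * a (S k))%C with (sum_n (G := C_AbelianMonoid) (fun k => scal (V := C_NormedModule) (pow_n (K := C_AbsRing) x1 k) (a k)) (S k) -
      sum_n (G := C_AbelianMonoid) (fun k => scal (V := C_NormedModule) (pow_n (K := C_AbsRing) x1 k) (a k)) k)%C by (rewrite e; ring).
    eapply Rle_trans; [apply Cmod_sub|]. generalize (HB0 k) (HB0 (S k)). cbv beta. lra. }
  exists (4 * B0 / Cmod x1). split; [apply Rdiv_le_0_compat; lra|]. intros x t ht hxx. apply is_series_clim in ht.
  set (s := Cmod x / Cmod x1). assert (ps : 0 <= s) by (apply Rdiv_le_0_compat; [apply Cmod_ge_0|auto]).
  assert (hs : s <= / 2). { unfold s. apply (Rmult_le_reg_r (Cmod x1)); auto. replace (Cmod x / Cmod x1 * Cmod x1) with (Cmod x) by (field; lra). lra. }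
  assert (S1 : forall n, Cmod (sum_n (G := C_AbelianMonoid) (fun k => scal (V := C_NormedModule) (pow_n (K := C_AbsRing) x k) (a k)) n - a O) <= 4 * B0 * (s - s * (/ 2) ^ n)).
  { induction n as [|n IH].
    - rewrite sum_O, E. simpl Cpow. replace (1 * a O - a O)%C with (RtoC 0) by ring. rewrite Cmod_0. simpl. lra.
    - rewrite sum_n_C_S, E. set (u := sum_n _ n) in *. replace (u + x ^ S n * a (S n) - a O)%C with ((u - a O) + x ^ S n * a (S n))%C by ring.
      eapply Rle_trans; [apply Cmod_triangle|].
      assert (Q : Cmod (x ^ S n * a (S n)) <= s * (/ 2) ^ n * (2 * B0)).
      { rewrite Cmod_mult, Cmod_pow. replace (Cmod x) with (s * Cmod x1) by (unfold s; field; lra).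
        rewrite Rpow_mult_distr, Rmult_assoc, <- Cmod_pow, <- Cmod_mult.
        apply Rmult_le_compat; [apply pow_le; auto|apply Cmod_ge_0| |apply T].
        simpl. apply Rmult_le_compat_l; auto. apply pow_incr. lra. }
      simpl pow. lra. }
  replace (4 * B0 / Cmod x1 * Cmod x) with (4 * B0 * s) by (unfold s; field; lra).
  apply le_epsilon. intros eps he. destruct (ht eps he) as [M HM]. specialize (HM M (Nat.le_refl _)). specialize (S1 M). cbv beta in HM.
  set (u := sum_n _ M) in *. replace (t - a O)%C with ((u - a O) - (u - t))%C by ring.
  eapply Rle_trans; [apply Cmod_sub|]. assert (0 < (/ 2) ^ M) by (apply pow_lt; lra). assert (0 <= 4 * B0 * (s * (/ 2) ^ M)) by (clearbody s; apply Rmult_le_pos; [lra|apply Rmult_le_pos; lra]). lra.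
Qed.

(** The series depends on y with no uniformity, so the remainder cannot be estimated from it
    directly. For fixed y the quotient [s y] of the remainder by x^(2m+1) is holomorphic in x, the
    series serving only to remove the singularity at 0. Away from 0 it is bounded uniformly in y
    because F is, and [cauchy_val] carries that bound to small x. *)
Lemma normal_form_bound (F : C -> C -> C) (lam c : C) (a : nat -> C -> C) m rho : Cmod lam = 1 -> 0 < rho ->
  (forall x y, Cmod x < rho -> Cmod y < rho -> fdiff F x y) ->
  (forall x y, Cmod x < rho -> Cmod y < rho -> exists t, is_pseries (K := C_AbsRing) (V := C_NormedModule) (fun j => a j y) x t /\
     F x y = (lam * (x + x ^ (m + 1) + c * x ^ (2 * m + 1) + x ^ (2 * m + 2) * t))%C) ->
  exists r K, 0 < r /\ 0 <= K /\ forall x y, Cmod x < r -> Cmod y < r -> Cmod (F x y - lam * (x * (1 + x ^ m))) <= K * Cmod x ^ (2 * m + 1).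
Proof.
  intros hl hr hF hT. assert (ln : lam <> 0%C) by (intro e; rewrite e, Cmod_0 in hl; lra).
  destruct (fdiff_lip F 0 0) as (K0 & d & hd & hK0 & HK); [apply hF; rewrite Cmod_0; auto|].
  assert (F0 : forall y, Cmod y < rho -> F 0 y = 0%C).
  { intros y hy. destruct (hT 0%C y) as (t & _ & ->); [rewrite Cmod_0; auto|auto|]. rewrite !Nat.add_succ_r. simpl. ring. }
  set (r1 := Rmin (Rmin rho d) 1 / 2). assert (p1 : 0 < Rmin (Rmin rho d) 1) by (repeat apply Rmin_glb_lt; lra).
  assert (l1 := Rmin_l (Rmin rho d) 1). assert (l2 := Rmin_r (Rmin rho d) 1). assert (l3 := Rmin_l rho d). assert (l4 := Rmin_r rho d).
  assert (h1 : 0 < r1 /\ r1 < rho /\ r1 < d /\ r1 < 1) by (unfold r1; lra). clearbody r1. clear p1 l1 l2 l3 l4.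
  set (E x y := (F x y * / lam - x - x ^ (m + 1) - c * x ^ (2 * m + 1))%C).
  set (M := K0 * 2 + 2 + Cmod c). assert (pM : 0 <= M) by (unfold M; generalize (Cmod_ge_0 c); lra).
  assert (hE : forall x y, Cmod x < r1 -> Cmod y < r1 -> Cmod (E x y) <= M).
  { intros x y hx hy. unfold E, M.
    assert (q1 : Cmod (F x y * / lam) <= K0 * 2).
    { rewrite Cmod_mult, Cmod_inv, hl, Rinv_1, Rmult_1_r by auto.
      assert (Q := HK x y). rewrite F0, !Cminus_0_r in Q by (rewrite Cmod_0; lra).
      eapply Rle_trans; [apply Q; lra|]. apply Rmult_le_compat_l; lra. }
    assert (q2 : forall k, Cmod (x ^ (k + 1)) <= 1).
    { intro k. rewrite Cmod_pow. rewrite <- (pow1 (k + 1)). apply pow_incr. split; [apply Cmod_ge_0|lra]. }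
    assert (q3 := q2 m). assert (q4 := q2 (2 * m)%nat).
    assert (q5 : Cmod (c * x ^ (2 * m + 1)) <= Cmod c) by (rewrite Cmod_mult; generalize (Cmod_ge_0 c) (Cmod_ge_0 (x ^ (2 * m + 1))); nra).
    eapply Rle_trans; [apply Cmod_sub|]. eapply Rle_trans; [apply Rplus_le_compat_r, Cmod_sub|].
    eapply Rle_trans; [apply Rplus_le_compat_r, Rplus_le_compat_r, Cmod_sub|]. lra. }
  set (s y x := (E x y * / x ^ (2 * m + 1))%C).
  assert (powS : forall x : C, (x ^ (2 * m + 2) = x ^ (2 * m + 1) * x)%C).
  { intro x. replace (2 * m + 2)%nat with (S (2 * m + 1)) by lia. simpl. ring. }
  assert (sd : forall y x, Cmod y < r1 -> Cmod x < r1 -> cdble (s y) x).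
  { intros y x hy hx. destruct (classic (x = 0%C)) as [-> |nx].
    - destruct (hT (RtoC (r1 / 2)) y) as (t1 & hp1 & _); [rewrite Cmod_RtoC; lra|lra|].
      destruct (pseries_near_0 (fun j => a j y) (RtoC (r1 / 2)) t1) as (B & hB & H); auto.
      { intro e. apply RtoC_inj in e. lra. } rewrite Cmod_RtoC in H by lra.
      exists (a O y). intros eps he. exists (Rmin (r1 / 4) (eps / (B + 1))). split; [apply Rmin_glb_lt; [lra|apply Rdiv_lt_0_compat; lra]|].
      (* E vanishes at x = 0, so the quotient is 0 there whatever value [/ 0] has; this is the right
         value, because the quotient is x t for x different from 0. *)
      intros x hx'. rewrite Cminus_0_r in *. assert (e0 : s y 0%C = 0%C).
      { unfold s. assert (E 0%C y = 0%C) as ->; [|ring]. unfold E. rewrite F0 by lra. rewrite !Nat.add_1_r. simpl. ring. }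
      rewrite e0. destruct (classic (x = 0%C)) as [-> |nx].
      + rewrite e0. replace (0 - 0 - a O y * 0)%C with (RtoC 0) by ring. rewrite Cmod_0. lra.
      + assert (c1 := Rlt_le_trans _ _ _ hx' (Rmin_l _ _)). assert (c2 := Rlt_le_trans _ _ _ hx' (Rmin_r _ _)).
        destruct (hT x y) as (t & ht & e); [lra|lra|].
        assert (es : s y x = (x * t)%C).
        { unfold s, E. rewrite e, powS. field. split; [apply Cpow_nz; auto|auto]. }
        rewrite es. replace (x * t - 0 - a O y * x)%C with (x * (t - a O y))%C by ring. rewrite Cmod_mult, Rmult_comm.
        apply Rmult_le_compat_r; [apply Cmod_ge_0|]. eapply Rle_trans; [apply (H x t ht); lra|].
        apply (Rmult_lt_compat_r (B + 1)) in c2; [|lra]. replace (eps / (B + 1) * (B + 1)) with eps in c2 by (field; lra).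
        generalize (Cmod_ge_0 x). nra.
    - unfold s. apply (cdble_mult (fun x => E x y)).
      + unfold E. repeat first [apply cdble_minus|apply cdble_mult]; try apply cdble_const; try apply cdble_id; try (apply (cdble_pow (fun x => x)); apply cdble_id).
        apply fdiff_x, hF; lra.
      + apply (cdble_inv (fun x => x ^ (2 * m + 1))%C); [apply (cdble_pow (fun x => x)); apply cdble_id|apply Cpow_nz; auto]. }
  set (B := M * / (r1 / 4) ^ (2 * m + 1)).
  assert (pB : 0 <= B) by (apply Rmult_le_pos; auto; apply Rlt_le, Rinv_0_lt_compat, pow_lt; lra).
  exists (r1 / 4), (B + Cmod c). split; [lra|]. split; [generalize (Cmod_ge_0 c); lra|]. intros x y hx hy.
  (* A circle of radius r1/2 about a point with |x| < r1/4 stays in the annulus r1/4 <= |z| <= 3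
     r1/4, away from the singularity. *)
  assert (sB : Cmod (s y x) <= B).
  { apply (cauchy_val (s y) x (3 * r1 / 4) (r1 / 2)); [|lra|].
    - intros z hz. apply sd; [lra|]. assert (Q := Cmod_tri z x 0). rewrite !Cminus_0_r in Q. lra.
    - intros z hz. assert (Q := Cmod_tri z x 0). rewrite !Cminus_0_r in Q. assert (Q' := Cmod_tri_inv z x). assert (Q2 := Cmod_tri_inv (z - x) z).
      replace (z - x - z)%C with (- x)%C in Q2 by ring. rewrite Cmod_opp in Q2.
      unfold s, B. rewrite Cmod_mult. apply Rmult_le_compat; [apply Cmod_ge_0|apply Cmod_ge_0|apply hE; lra|].
      assert (zn : z <> 0%C) by (intro e; rewrite e, Cmod_0 in *; lra).
      rewrite Cmod_inv, Cmod_pow by (apply Cpow_nz; auto). apply Rinv_le_contravar; [apply pow_lt; lra|]. apply pow_incr. lra. }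
  assert (eq : (F x y - lam * (x * (1 + x ^ m)) = lam * (x ^ (2 * m + 1) * (s y x + c)))%C).
  { destruct (classic (x = 0%C)) as [-> |nx].
    - rewrite F0 by lra. rewrite !Nat.add_1_r. simpl. ring.
    - unfold s, E. rewrite Nat.add_1_r with (n := m). simpl (x ^ S m)%C. field. split; [apply Cpow_nz; auto|auto]. }
  rewrite eq, !Cmod_mult, hl, Cmod_pow, Rmult_1_l, Rmult_comm. apply Rmult_le_compat_r; [apply pow_le, Cmod_ge_0|].
  eapply Rle_trans; [apply Cmod_triangle|]. lra.
Qed.

Lemma fdiff_shear (f : C -> C -> C) (k x y : C) : fdiff f x (y + k * x) -> fdiff (fun s t => f s (t + k * s)%C) x y.
Proof.
  intros (a & b & H). exists (a + b * k)%C, b. intros eps he. assert (pk := Cmod_ge_0 k).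
  destruct (H (eps / (1 + Cmod k))) as (d & hd & Hd); [apply Rdiv_lt_0_compat; lra|].
  exists (d / (2 * (1 + Cmod k))). split; [apply Rdiv_lt_0_compat; lra|]. intros x' y' hx hy.
  assert (e : d / (2 * (1 + Cmod k)) * (1 + Cmod k) = d / 2) by (field; lra).
  assert (T : Cmod (y' + k * x' - (y + k * x)) <= Cmod (y' - y) + Cmod k * Cmod (x' - x)).
  { replace (y' + k * x' - (y + k * x))%C with ((y' - y) + k * (x' - x))%C by ring. eapply Rle_trans; [apply Cmod_triangle|]. rewrite Cmod_mult. lra. }
  assert (px := Cmod_ge_0 (x' - x)). assert (py := Cmod_ge_0 (y' - y)).
  assert (D0 : d / (2 * (1 + Cmod k)) <= d / 2). { rewrite <- e. assert (0 < d / (2 * (1 + Cmod k))) by (apply Rdiv_lt_0_compat; lra). nra. }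
  replace (f x' (y' + k * x') - f x (y + k * x) - (a + b * k) * (x' - x) - b * (y' - y))%C
    with (f x' (y' + k * x') - f x (y + k * x) - a * (x' - x) - b * (y' + k * x' - (y + k * x)))%C by ring.
  eapply Rle_trans; [apply Hd; [lra|]|].
  - eapply Rle_lt_trans; [apply T|]. assert (Cmod k * Cmod (x' - x) <= Cmod k * (d / (2 * (1 + Cmod k)))) by (apply Rmult_le_compat_l; lra). nra.
  - replace (eps * (Cmod (x' - x) + Cmod (y' - y))) with (eps / (1 + Cmod k) * ((1 + Cmod k) * (Cmod (x' - x) + Cmod (y' - y)))) by (field; lra).
    apply Rmult_le_compat_l; [apply Rlt_le, Rdiv_lt_0_compat; lra|]. nra.
Qed.

Lemma fdiff_lin (f g : C -> C -> C) (k x y : C) : fdiff f x y -> fdiff g x y -> fdiff (fun s t => f s t - k * g s t)%C x y.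
Proof.
  intros (a & b & H) (a' & b' & H'). exists (a - k * a')%C, (b - k * b')%C. intros eps he. assert (pk := Cmod_ge_0 k).
  destruct (H (eps / 2)) as (d & hd & Hd); [lra|]. destruct (H' (eps / 2 / (1 + Cmod k))) as (d' & hd' & Hd'); [apply Rdiv_lt_0_compat; lra|].
  exists (Rmin d d'). split; [apply Rmin_glb_lt; auto|]. intros x' y' hx hy.
  assert (Q := Hd x' y' (Rlt_le_trans _ _ _ hx (Rmin_l _ _)) (Rlt_le_trans _ _ _ hy (Rmin_l _ _))).
  assert (Q' := Hd' x' y' (Rlt_le_trans _ _ _ hx (Rmin_r _ _)) (Rlt_le_trans _ _ _ hy (Rmin_r _ _))).
  match goal with |- Cmod ?t <= _ => replace t with ((f x' y' - f x y - a * (x' - x) - b * (y' - y)) - k * (g x' y' - g x y - a' * (x' - x) - b' * (y' - y)))%C by ring end.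
  eapply Rle_trans; [apply Cmod_sub|]. rewrite Cmod_mult. set (u := Cmod (x' - x) + Cmod (y' - y)) in *.
  assert (pu : 0 <= u) by (unfold u; generalize (Cmod_ge_0 (x' - x)) (Cmod_ge_0 (y' - y)); lra).
  apply (Rmult_le_compat_l (Cmod k)) in Q'; auto.
  assert (E : Cmod k * (eps / 2 / (1 + Cmod k) * u) <= eps / 2 * u).
  { replace (eps / 2 * u) with ((1 + Cmod k) * (eps / 2 / (1 + Cmod k) * u)) by (field; lra).
    apply Rmult_le_compat_r; [|lra]. apply Rmult_le_pos; auto. apply Rlt_le, Rdiv_lt_0_compat; lra. }
  lra.
Qed.

(** Differentiability at the origin becomes strict differentiability: the remainder is small
    compared with t on a bidisc of radius t, and the Cauchy estimates of [lip2] turn this into a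
    small Lipschitz constant. *)
Lemma small_lip (f : C -> C -> C) (A B : C) s e : 0 < s -> 0 < e -> f 0%C 0%C = 0%C ->
  (forall x y, Cmod x < s -> Cmod y < s -> fdiff f x y) ->
  (forall eps, 0 < eps -> exists d, 0 < d /\ forall x y, Cmod x < d -> Cmod y < d -> Cmod (f x y - A * x - B * y) <= eps * (Cmod x + Cmod y)) ->
  exists r, 0 < r <= s /\ forall x y x' y', Cmod x < r -> Cmod y < r -> Cmod x' < r -> Cmod y' < r ->
    Cmod (f x y - f x' y' - A * (x - x') - B * (y - y')) <= e * (Cmod (x - x') + Cmod (y - y')).
Proof.
  intros hs he f0 hf H. destruct (H (e / 16)) as (d & hd & Hd); [lra|].
  set (t := Rmin s d). assert (pt : 0 < t) by (apply Rmin_glb_lt; auto). assert (ts : t <= s) by apply Rmin_l. assert (td : t <= d) by apply Rmin_r.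
  exists (t / 2). split; [lra|]. intros x y x' y' h1 h2 h3 h4.
  assert (Q := lip2 (fun u v => f u v - A * u - B * v)%C 0 0 t t (e / 16 * (2 * t)) x y x' y' pt pt).
  replace (f x y - f x' y' - A * (x - x') - B * (y - y'))%C with (f x y - A * x - B * y - (f x' y' - A * x' - B * y'))%C by ring.
  replace (e * (Cmod (x - x') + Cmod (y - y'))) with (8 * (e / 16 * (2 * t)) * (Cmod (x - x') / t + Cmod (y - y') / t)) by (field; lra).
  rewrite !Cminus_0_r in Q. apply Q; try lra. intros u v hu hv. rewrite !Cminus_0_r in *.
  assert (F := hf u v ltac:(lra) ltac:(lra)). split; [|split].
  - apply cdble_minus; [apply cdble_minus|apply cdble_const]; [apply (fdiff_x f u v F)|apply cdble_mult; [apply cdble_const|apply cdble_id]].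
  - apply cdble_minus; [apply cdble_minus|]; [apply (fdiff_y f u v F)|apply cdble_const|apply cdble_mult; [apply cdble_const|apply cdble_id]].
  - eapply Rle_trans; [apply Hd; lra|]. apply Rmult_le_compat_l; lra.
Qed.

(** * The Euclidean norm read in straightened coordinates *)

Lemma norm_C2_sqr (p : C2) : norm p * norm p = Cmod (fst p) * Cmod (fst p) + Cmod (snd p) * Cmod (snd p).
Proof.
  rewrite (surjective_pairing p) at 1 2. rewrite norm_C2. rewrite sqrt_sqrt; [ring|].
  generalize (pow2_ge_0 (Cmod (fst p))) (pow2_ge_0 (Cmod (snd p))). lra.
Qed.

Lemma Cmod_plus_sqr (u v : C) : Cmod (u + v) * Cmod (u + v) = Cmod u * Cmod u + 2 * Re (Cconj u * v)%C + Cmod v * Cmod v.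
Proof. rewrite !Cmod_sqr. destruct u, v. simpl. ring. Qed.

Lemma norm_C2_dist (p p' : C2) : Rabs (norm p - norm p') <= Cmod (fst p - fst p') + Cmod (snd p - snd p').
Proof.
  eapply Rle_trans; [apply (norm_triangle_inv p p')|]. apply (norm_C2_bounds (fst p - fst p')%C (snd p - snd p')%C).
Qed.

(** Half of the first-order growth of |u|^2 under an increment du is the real part of conj(u) du.
    The bound compares it with its value for the linear map x |-> A x, when u and du are known up to
    relative errors [eta]. *)
Lemma Cconj_err (A x dx s r : C) eta : 0 <= eta -> Cmod s <= eta * Cmod x -> Cmod r <= eta * Cmod dx ->
  Cmod A * Cmod A * Re (Cconj x * dx)%C - (2 * (eta * Cmod A) + eta * eta) * (Cmod x * Cmod dx) <= Re (Cconj (A * x + s) * (A * dx + r))%C.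
Proof.
  intros he hs hr.
  assert (E : Re (Cconj (A * x + s) * (A * dx + r))%C = Cmod A * Cmod A * Re (Cconj x * dx)%C + Re (Cconj (A * x) * r + Cconj s * (A * dx) + Cconj s * r)%C).
  { rewrite Cmod_sqr. destruct A, x, dx, s, r. simpl. ring. }
  rewrite E. assert (Q := re_le_Cmod (Cconj (A * x) * r + Cconj s * (A * dx) + Cconj s * r)). apply Rabs_le_between in Q.
  assert (T : Cmod (Cconj (A * x) * r + Cconj s * (A * dx) + Cconj s * r) <= (2 * (eta * Cmod A) + eta * eta) * (Cmod x * Cmod dx)).
  { eapply Rle_trans; [apply Cmod_triangle|]. eapply Rle_trans; [apply Rplus_le_compat_r, Cmod_triangle|].
    rewrite !Cmod_mult, !Cmod_conj, !Cmod_mult. assert (pA := Cmod_ge_0 A). assert (px := Cmod_ge_0 x). assert (pd := Cmod_ge_0 dx). assert (ps := Cmod_ge_0 s). assert (pr := Cmod_ge_0 r).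
    assert (Cmod A * Cmod x * Cmod r <= Cmod A * Cmod x * (eta * Cmod dx)) by (apply Rmult_le_compat_l; [apply Rmult_le_pos|]; auto).
    assert (Cmod s * (Cmod A * Cmod dx) <= eta * Cmod x * (Cmod A * Cmod dx)) by (apply Rmult_le_compat_r; [apply Rmult_le_pos|]; auto).
    assert (Cmod s * Cmod r <= eta * Cmod x * (eta * Cmod dx)) by (apply Rmult_le_compat; auto). lra. }
  lra.
Qed.

(** On a thin cone the contribution of y to the derivative of [PP] is absorbed in the error, so [PP]
    is eta-close to x |-> (A1 x, A2 x), whose norm is a |x|. The aperture [gam] is dictated by this
    and has nothing to do with the dynamics. *)
Lemma nrm_exists (PP : C -> C -> C2) s K m : 0 < s -> (1 <= m)%nat -> PP 0%C 0%C = (RtoC 0, RtoC 0) ->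
  (forall x y, Cmod x < s -> Cmod y < s -> fdiff (fun u v => fst (PP u v)) x y /\ fdiff (fun u v => snd (PP u v)) x y) ->
  (forall x y, Cmod x < s -> Cmod y < s -> Cmod x + Cmod y <= K * norm (PP x y)) ->
  exists gam rho0 KN a, 0 < gam <= 1 /\ 0 < rho0 /\ forall rho, 0 < rho <= rho0 -> nrm m rho gam (fun x y => norm (PP x y)) KN a.
Proof.
  intros hs hm P0 hP hK.
  assert (z0 : Cmod 0 < s) by (rewrite Cmod_0; auto).
  destruct (hP 0%C 0%C z0 z0) as [F1 F2].
  destruct (fdiff_lip _ _ _ F1) as (k1 & d1 & hd1 & hk1 & L1). destruct (fdiff_lip _ _ _ F2) as (k2 & d2 & hd2 & hk2 & L2).
  destruct F1 as (A1 & B1 & G1). destruct F2 as (A2 & B2 & G2). rewrite P0 in *. cbn [fst snd] in *.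
  assert (H1 : forall eps, 0 < eps -> exists d, 0 < d /\ forall x y, Cmod x < d -> Cmod y < d -> Cmod (fst (PP x y) - A1 * x - B1 * y) <= eps * (Cmod x + Cmod y)).
  { intros eps he. destruct (G1 eps he) as (d & hd & Hd). exists d; split; auto. intros x y hx hy. specialize (Hd x y). rewrite !Cminus_0_r in Hd. auto. }
  assert (H2 : forall eps, 0 < eps -> exists d, 0 < d /\ forall x y, Cmod x < d -> Cmod y < d -> Cmod (snd (PP x y) - A2 * x - B2 * y) <= eps * (Cmod x + Cmod y)).
  { intros eps he. destruct (G2 eps he) as (d & hd & Hd). exists d; split; auto. intros x y hx hy. specialize (Hd x y). rewrite !Cminus_0_r in Hd. auto. }
  clear G1 G2. set (a := norm ((A1, A2) : C2)).
  assert (nA : forall x, norm ((A1 * x, A2 * x)%C : C2) = a * Cmod x).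
  { intro x. apply Rsqr_inj; [apply norm_ge_0|apply Rmult_le_pos; [apply norm_ge_0|apply Cmod_ge_0]|]. unfold Rsqr.
    rewrite norm_C2_sqr. transitivity ((a * a) * (Cmod x * Cmod x)); [|ring]. unfold a. rewrite norm_C2_sqr. cbn [fst snd]. rewrite !Cmod_mult. ring. }
  assert (nB := norm_C2_bounds A1 A2). fold a in nB.
  (* If a = 0, the norm of PP(x, 0) would be o(|x|), against the lower bound by (|x| + |y|)/K. *)
  assert (pa : 0 < a).
  { destruct (Req_dec a 0) as [e|]; [exfalso|generalize (norm_ge_0 ((A1, A2) : C2)); fold a; lra].
    assert (A1 = 0%C /\ A2 = 0%C) as [eA1 eA2] by (split; apply Cmod_le0; lra). clear nA.
    set (K' := Rabs K + 1). assert (pK : 0 < K') by (unfold K'; generalize (Rabs_pos K); lra).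
    destruct (H1 (/ (4 * K'))) as (d & hd & Hd); [apply Rinv_0_lt_compat; lra|]. destruct (H2 (/ (4 * K'))) as (d' & hd' & Hd'); [apply Rinv_0_lt_compat; lra|].
    set (x := Rmin (Rmin d d') s / 2). assert (0 < Rmin (Rmin d d') s) by (repeat apply Rmin_glb_lt; auto).
    assert (l1 := Rmin_l (Rmin d d') s). assert (l2 := Rmin_r (Rmin d d') s). assert (l3 := Rmin_l d d'). assert (l4 := Rmin_r d d').
    assert (px : 0 < x /\ x < d /\ x < d' /\ x < s) by (unfold x; lra).
    assert (mx : Cmod x = x) by (apply Cmod_RtoC; lra).
    assert (q1 := Hd x 0%C). assert (q2 := Hd' x 0%C). assert (q3 := hK x 0%C). rewrite eA1, ?eA2, mx, Cmod_0 in *.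
    assert (zz : forall u b v : C, (u - 0 * v - b * 0)%C = u) by (intros; ring). rewrite zz in q1, q2.
    specialize (q1 ltac:(lra) ltac:(lra)). specialize (q2 ltac:(lra) ltac:(lra)). specialize (q3 ltac:(lra) ltac:(lra)).
    assert (q4 := proj2 (proj2 (norm_C2_bounds (fst (PP x 0%C)) (snd (PP x 0%C))))). rewrite <- surjective_pairing in q4.
    assert (q5 : norm (PP x 0%C) <= / (2 * K') * x). { replace (/ (2 * K') * x) with (/ (4 * K') * (x + 0) + / (4 * K') * (x + 0)) by (field; lra). lra. }
    assert (q6 : K * norm (PP x 0%C) <= K' * norm (PP x 0%C)). { apply Rmult_le_compat_r; [apply norm_ge_0|]. unfold K'. generalize (Rle_abs K). lra. }
    apply (Rmult_le_compat_l K') in q5; [|lra]. replace (K' * (/ (2 * K') * x)) with (x / 2) in q5 by (field; lra). lra. }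
  assert (pm : 1 <= INR m) by (apply (le_INR 1); auto).
  (* Each of the two components contributes an error eta |x|, and 2 eta = a/(400 m) is the tolerance
     of [n_mod]. *)
  set (eta := a / (800 * INR m)). assert (pe : 0 < eta) by (apply Rdiv_lt_0_compat; lra).
  assert (eta_a : eta <= a / 800). { unfold eta. apply (Rmult_le_reg_r (800 * INR m)); [lra|]. replace (a / (800 * INR m) * (800 * INR m)) with a by (field; lra). nra. }
  destruct (small_lip (fun u v => fst (PP u v)) A1 B1 s (eta / 4) hs ltac:(lra)) as (s1 & hs1 & S1); auto.
  { rewrite P0. auto. } { intros x y hx hy. apply (hP x y hx hy). }
  destruct (small_lip (fun u v => snd (PP u v)) A2 B2 s (eta / 4) hs ltac:(lra)) as (s2 & hs2 & S2); auto.
  { rewrite P0. auto. } { intros x y hx hy. apply (hP x y hx hy). }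
  assert (b1 := Cmod_ge_0 B1). assert (b2 := Cmod_ge_0 B2).
  (* Makes the terms B1 y and B2 y at most eta/2 times |x| on the cone. *)
  set (gam := Rmin 1 (eta / (2 * (Cmod B1 + Cmod B2 + 1)))).
  assert (pg : 0 < gam) by (apply Rmin_glb_lt; [lra|apply Rdiv_lt_0_compat; lra]).
  assert (g1 : gam <= 1) by apply Rmin_l.
  assert (gB : gam * (Cmod B1 + Cmod B2 + 1) <= eta / 2).
  { apply (Rmult_le_reg_r 2); [lra|]. assert (Q := Rmin_r 1 (eta / (2 * (Cmod B1 + Cmod B2 + 1)))). fold gam in Q.
    apply (Rmult_le_compat_r (2 * (Cmod B1 + Cmod B2 + 1))) in Q; [|lra]. replace (eta / (2 * (Cmod B1 + Cmod B2 + 1)) * (2 * (Cmod B1 + Cmod B2 + 1))) with eta in Q by (field; lra). lra. }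
  set (rho0 := Rmin (Rmin s1 s2) (Rmin d1 d2)).
  assert (pr0 : 0 < rho0) by (repeat apply Rmin_glb_lt; lra).
  assert (lr : rho0 <= s1 /\ rho0 <= s2 /\ rho0 <= d1 /\ rho0 <= d2).
  { unfold rho0. generalize (Rmin_l (Rmin s1 s2) (Rmin d1 d2)) (Rmin_r (Rmin s1 s2) (Rmin d1 d2)) (Rmin_l s1 s2) (Rmin_r s1 s2) (Rmin_l d1 d2) (Rmin_r d1 d2). lra. }
  exists gam, rho0, (Rabs K + k1 + k2 + 1), a. split; [lra|]. split; auto. intros rho hrho.
  assert (comp : forall A B P x y x' y', Cmod (P x y - P x' y' - A * (x - x') - B * (y - y')) <= eta / 4 * (Cmod (x - x') + Cmod (y - y')) ->
     Cmod (y - y') <= gam * Cmod (x - x') -> Cmod B <= Cmod B1 + Cmod B2 -> Cmod (P x y - P x' y' - A * (x - x')) <= eta * Cmod (x - x')).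
  { intros A B P x y x' y' h1 h2 h3. replace (P x y - P x' y' - A * (x - x'))%C with ((P x y - P x' y' - A * (x - x') - B * (y - y')) + B * (y - y'))%C by ring.
    eapply Rle_trans; [apply Cmod_triangle|]. rewrite Cmod_mult. assert (p1 := Cmod_ge_0 (x - x')). assert (p2 := Cmod_ge_0 (y - y')). assert (p3 := Cmod_ge_0 B).
    assert (Cmod B * Cmod (y - y') <= (Cmod B1 + Cmod B2) * (gam * Cmod (x - x'))) by (apply Rmult_le_compat; auto).
    assert (gam * (Cmod B1 + Cmod B2 + 1) * Cmod (x - x') <= eta / 2 * Cmod (x - x')) by (apply Rmult_le_compat_r; auto).
    assert (gam * Cmod (x - x') <= 1 * Cmod (x - x')) by (apply Rmult_le_compat_r; auto).
    assert (eta / 4 * (Cmod (x - x') + Cmod (y - y')) <= eta / 4 * (2 * Cmod (x - x'))) by (apply Rmult_le_compat_l; lra).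
    assert (0 <= gam * Cmod (x - x')) by (apply Rmult_le_pos; lra). lra. }
  assert (D1 : forall x y x' y', Cmod x < rho -> Cmod y < rho -> Cmod x' < rho -> Cmod y' < rho -> Cmod (y - y') <= gam * Cmod (x - x') ->
    Cmod (fst (PP x y) - fst (PP x' y') - A1 * (x - x')) <= eta * Cmod (x - x') /\ Cmod (snd (PP x y) - snd (PP x' y') - A2 * (x - x')) <= eta * Cmod (x - x')).
  { intros x y x' y' q1 q2 q3 q4 q5. split.
    - apply (comp A1 B1 (fun u v => fst (PP u v))); auto; [|lra]. apply S1; lra.
    - apply (comp A2 B2 (fun u v => snd (PP u v))); auto; [|lra]. apply S2; lra. }
  assert (D0 : forall x y, Cmod x < rho -> Cmod y <= gam * Cmod x -> Cmod (fst (PP x y) - A1 * x) <= eta * Cmod x /\ Cmod (snd (PP x y) - A2 * x) <= eta * Cmod x).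
  { intros x y q1 q2. assert (px := Cmod_ge_0 x). assert (Cmod y < rho) by nra.
    destruct (D1 x y 0%C 0%C) as [u v]; rewrite ?Cmod_0, ?Cminus_0_r; auto; try lra. rewrite P0 in u, v. cbn [fst snd] in u, v. rewrite !Cminus_0_r in u, v. auto. }
  constructor.
  - generalize (Rabs_pos K). lra.
  - exact pa.
  - intros x y hx hy. assert (q1 := L1 x y). assert (q2 := L2 x y). rewrite !Cminus_0_r in q1, q2. specialize (q1 ltac:(lra) ltac:(lra)). specialize (q2 ltac:(lra) ltac:(lra)).
    assert (q := proj2 (proj2 (norm_C2_bounds (fst (PP x y)) (snd (PP x y))))). rewrite <- surjective_pairing in q.
    assert (0 <= Rabs K * (Cmod x + Cmod y)) by (apply Rmult_le_pos; [apply Rabs_pos|generalize (Cmod_ge_0 x) (Cmod_ge_0 y); lra]).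
    generalize (Cmod_ge_0 x) (Cmod_ge_0 y). lra.
  - intros x y hx hy. eapply Rle_trans; [apply hK; lra|]. apply Rmult_le_compat_r; [apply norm_ge_0|]. generalize (Rle_abs K). lra.
  - intros x y hx hy eps he. destruct (hP x y ltac:(lra) ltac:(lra)) as [f1 f2].
    destruct (fdiff_lip _ _ _ f1) as (c1 & e1 & he1 & hc1 & M1). destruct (fdiff_lip _ _ _ f2) as (c2 & e2 & he2 & hc2 & M2).
    set (w := eps / (4 * (c1 + c2 + 1))). assert (pw : 0 < w) by (apply Rdiv_lt_0_compat; lra).
    exists (Rmin w (Rmin e1 e2)). split; [repeat apply Rmin_glb_lt; auto|]. intros x' y' hx' hy'.
    assert (l1 := Rmin_l w (Rmin e1 e2)). assert (l2 := Rmin_r w (Rmin e1 e2)). assert (l3 := Rmin_l e1 e2). assert (l4 := Rmin_r e1 e2).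
    eapply Rle_lt_trans; [apply norm_C2_dist|]. assert (q1 := M1 x' y' ltac:(lra) ltac:(lra)). assert (q2 := M2 x' y' ltac:(lra) ltac:(lra)).
    assert (e : (c1 + c2 + 1) * (2 * w) = eps / 2) by (unfold w; field; lra).
    assert ((c1 + c2 + 1) * (Cmod (x' - x) + Cmod (y' - y)) <= (c1 + c2 + 1) * (2 * w)) by (apply Rmult_le_compat_l; lra).
    generalize (Cmod_ge_0 (x' - x)) (Cmod_ge_0 (y' - y)). lra.
  - intros x y hx hy. destruct (D0 x y hx hy) as [u v]. assert (Q := norm_C2_dist (PP x y) ((A1 * x, A2 * x)%C : C2)). cbn [fst snd] in Q. rewrite nA in Q.
    apply Rabs_le_between in Q. assert (e : / (400 * INR m) * (a * Cmod x) = 2 * (eta * Cmod x)) by (unfold eta; field; lra). lra.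
  - intros x y x' y' hx hx' hy hy' hyy hne hre. assert (px := Cmod_ge_0 x). assert (px' := Cmod_ge_0 x').
    assert (p1 : 0 < Cmod (x' - x)). { apply Cmod_gt_0. intro e. apply hne. replace x' with (x' - x + x)%C by ring. rewrite e. ring. }
    assert (hy2 : Cmod y < rho) by nra. assert (hy2' : Cmod y' < rho) by nra.
    destruct (D0 x y hx hy) as [u1 u2]. destruct (D1 x' y' x y hx' hy2' hx hy2 hyy) as [v1 v2].
    apply Rsqr_incrst_0; try apply norm_ge_0. unfold Rsqr.
    destruct (Rle_lt_or_eq_dec 0 (Cmod x) px) as [nx|nx].
    (* The square of the norm grows by twice the real Hermitian product with the increment, plus a
       nonnegative square. The main part of the product is at least a^2 X / 10 and the errors are at
       most a^2 X / 100. *)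
    + rewrite !norm_C2_sqr.
      assert (E1 := Cconj_err A1 x (x' - x) (fst (PP x y) - A1 * x) (fst (PP x' y') - fst (PP x y) - A1 * (x' - x)) eta ltac:(lra) u1 v1).
      assert (E2 := Cconj_err A2 x (x' - x) (snd (PP x y) - A2 * x) (snd (PP x' y') - snd (PP x y) - A2 * (x' - x)) eta ltac:(lra) u2 v2).
      assert (zz : forall u v : C, (u + (v - u))%C = v) by (intros; ring). rewrite !zz in E1, E2.
      assert (S3 := Cmod_plus_sqr (fst (PP x y)) (fst (PP x' y') - fst (PP x y))). assert (S4 := Cmod_plus_sqr (snd (PP x y)) (snd (PP x' y') - snd (PP x y))).
      rewrite zz in S3, S4.
      rewrite S3, S4. assert (n2 := norm_C2_sqr ((A1, A2) : C2)). fold a in n2. cbn [fst snd] in n2.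
      set (R := Re (Cconj x * (x' - x))%C) in *. set (X := Cmod x * Cmod (x' - x)) in *. assert (pX : 0 < X) by (apply Rmult_lt_0_compat; auto).
      assert (0 <= Cmod (fst (PP x' y') - fst (PP x y)) * Cmod (fst (PP x' y') - fst (PP x y))) by apply Rle_0_sqr.
      assert (0 <= Cmod (snd (PP x' y') - snd (PP x y)) * Cmod (snd (PP x' y') - snd (PP x y))) by apply Rle_0_sqr.
      assert (I : a * a * R - (2 * (eta * (2 * a)) + 2 * (eta * eta)) * X <= a * a * R - (2 * (eta * (Cmod A1 + Cmod A2)) + 2 * (eta * eta)) * X).
      { apply Rplus_le_compat_l, Ropp_le_contravar, Rmult_le_compat_r; [lra|]. apply Rplus_le_compat_r, Rmult_le_compat_l; [lra|]. apply Rmult_le_compat_l; lra. }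
      assert (J : a * a * (/ 10 * X) <= a * a * R) by (apply Rmult_le_compat_l; [nra|auto]).
      assert (L : (2 * (eta * (2 * a)) + 2 * (eta * eta)) * X <= (a * a / 100) * X). { apply Rmult_le_compat_r; [lra|]. nra. }
      assert (0 < a * a * X) by (repeat apply Rmult_lt_0_compat; auto).
      assert (0 < 2 * (Re (Cconj (fst (PP x y)) * (fst (PP x' y') - fst (PP x y)))%C + Re (Cconj (snd (PP x y)) * (snd (PP x' y') - snd (PP x y)))%C)); [|lra].
      rewrite n2 in *. lra.
    + assert (ex : x = 0%C) by (apply Cmod_le0; lra). rewrite <- nx in hy. assert (ey : y = 0%C) by (apply Cmod_le0; lra). rewrite ex, ey, P0 in *.
      assert (norm ((RtoC 0, RtoC 0) : C2) * norm ((RtoC 0, RtoC 0) : C2) = 0) as ->. { rewrite norm_C2_sqr. cbn [fst snd]. rewrite Cmod_0. ring. }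
      assert (Q := hK x' y' ltac:(lra) ltac:(lra)). rewrite Cminus_0_r in p1. assert (py' := Cmod_ge_0 y').
      assert (norm (PP x' y') <> 0) by (intro e; rewrite e in Q; lra). nra.
Qed.

(** * Petals *)

Lemma small_mono m rho KN R0 r r' : 0 <= KN -> small_radius m rho KN R0 r -> 0 < r' <= r -> small_radius m rho KN R0 r'.
Proof.
  intros hK (h1 & h2 & h3) hr. assert (KN * r' <= KN * r) by (apply Rmult_le_compat_l; lra).
  split; [lra|]. split; [lra|]. intros x hx hx'. apply h3; auto; lra.
Qed.

Lemma C2_minus_0 (u : C2) : minus u (zero : C2) = u.
Proof.
  apply (injective_projections (A := C) (B := C)); [change (fst u - 0 = fst u)%C|change (snd u - 0 = snd u)%C]; ring.
Qed.

Lemma iter_S_r {A : Type} (f : A -> A) n x : Nat.iter (S n) f x = Nat.iter n f (f x).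
Proof. induction n as [|n IH]; auto. rewrite Nat.iter_succ, IH. reflexivity. Qed.

Lemma open_line (A : C -> Prop) (z v : C) (t : R) : open (T := C_UniformSpace) A -> A (z + t * v)%C ->
  exists d, 0 < d /\ forall t' : R, Rabs (t' - t) < d -> A (z + t' * v)%C.
Proof.
  intros hA h. destruct (open_C_inv A _ hA h) as [e [he H]]. assert (pv := Cmod_ge_0 v).
  exists (e / (Cmod v + 1)). split; [apply Rdiv_lt_0_compat; lra|]. intros t' ht. apply H.
  replace (z + t' * v - (z + t * v))%C with ((t' - t)%R * v)%C by (rewrite RtoC_minus; ring).
  rewrite Cmod_mult, Cmod_R.
  apply (Rmult_lt_compat_r (Cmod v + 1)) in ht; [|lra]. replace (e / (Cmod v + 1) * (Cmod v + 1)) with e in ht by (field; lra).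
  assert (pt := Rabs_pos (t' - t)). nra.
Qed.

Lemma segment_meet (A A' : C -> Prop) (z v : C) (T : R) : open (T := C_UniformSpace) A -> open (T := C_UniformSpace) A' -> 0 <= T ->
  (forall t : R, 0 <= t <= T -> A (z + t * v)%C \/ A' (z + t * v)%C) -> A z -> A' (z + T * v)%C ->
  exists t : R, 0 <= t <= T /\ A (z + t * v)%C /\ A' (z + t * v)%C.
Proof.
  intros hA hA' hT cov h0 h1. set (E (t : R) := 0 <= t <= T /\ A (z + t * v)%C).
  destruct (completeness E) as [s [ub lub]].
  - exists T. intros t [ht _]. lra.
  - exists 0. split; [lra|]. replace (z + 0 * v)%C with z by ring. auto.
  - assert (s0 : 0 <= s). { apply ub. split; [lra|]. replace (z + 0 * v)%C with z by ring. auto. }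
    assert (s1 : s <= T) by (apply lub; intros t [ht _]; lra).
    destruct (cov s (conj s0 s1)) as [h|h].
    + destruct (open_line A z v s hA h) as [d [hd H]].
      destruct (Req_dec s T) as [->|ns]; [exists T; auto|].
      exfalso. assert (s' : E (Rmin (s + d / 2) T)).
      { split; [split; [apply Rmin_glb; lra|apply Rmin_r]|]. apply H.
        assert (Rmin (s + d / 2) T <= s + d / 2) by apply Rmin_l. assert (s <= Rmin (s + d / 2) T) by (apply Rmin_glb; lra).
        apply Rabs_lt_between; lra. }
      apply ub in s'. assert (s < Rmin (s + d / 2) T) by (apply Rmin_glb_lt; lra). lra.
    + destruct (open_line A' z v s hA' h) as [d [hd H]].
      destruct (classic (exists t, E t /\ s - d < t)) as [[t [[ht hat] hst]]|n].
      * exists t. repeat split; try tauto. apply H. assert (t <= s) by (apply ub; split; auto). apply Rabs_lt_between. lra.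
      * exfalso. assert (s <= s - d); [|lra]. apply lub. intros t ht. apply Rnot_lt_le. intro k. apply n. exists t; auto.
Qed.

(** Rays from different points may have different directions, but all enter the left half plane,
    which is convex. Two points are thus joined by at most three segments, and two disjoint open
    sets cannot share a segment. *)
Lemma path_connected_left (Om : C -> Prop) a : (forall z, Re z < a -> Om z) ->
  (forall z, Om z -> exists v, Re v < 0 /\ forall t : R, 0 <= t -> Om (z + t * v)%C) -> connected Om.
Proof.
  intros hl hp A A' oA oA' cov [z [z1 z2]] [z' [z1' z2']]. apply NNPP. intro no.
  assert (stay : forall B B' : C -> Prop, open (T := C_UniformSpace) B -> open (T := C_UniformSpace) B' -> (forall u, Om u -> B u \/ B' u) ->
    (forall u, Om u -> B u -> B' u -> False) -> forall (u v : C) (T : R), 0 <= T -> (forall t : R, 0 <= t <= T -> Om (u + t * v)%C) -> B u -> B (u + T * v)%C).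
  { intros B B' oB oB' c d u v T hT ho hu. destruct (c (u + T * v)%C (ho T ltac:(lra))) as [h|h]; auto. exfalso.
    destruct (segment_meet B B' u v T oB oB' hT) as [t [ht [t1 t2]]]; auto. apply (d (u + t * v)%C); auto. }
  assert (no' : forall u, Om u -> A u -> A' u -> False) by (intros u h1 h2 h3; apply no; exists u; auto).
  assert (far : forall u (B B' : C -> Prop), open (T := C_UniformSpace) B -> open (T := C_UniformSpace) B' -> (forall u, Om u -> B u \/ B' u) ->
    (forall u, Om u -> B u -> B' u -> False) -> Om u -> B u -> exists u', Re u' < a /\ B u').
  { intros u B B' oB oB' c d hu hB. destruct (hp u hu) as [v [hv H]].
    set (T := (Rabs (Re u) + Rabs a + 1) / (- Re v)). assert (hT : 0 <= T).
    { unfold T. apply Rlt_le, Rdiv_lt_0_compat; [|lra]. generalize (Rabs_pos (Re u)) (Rabs_pos a). lra. }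
    exists (u + T * v)%C. split.
    - replace (Re (u + T * v)%C) with (Re u + T * Re v) by (destruct u, v; cbn; ring).
      assert (T * Re v = - (Rabs (Re u) + Rabs a + 1)) by (unfold T; field; lra).
      generalize (Rle_abs (Re u)) (Rle_abs (- a)). rewrite Rabs_Ropp. lra.
    - apply (stay B B'); auto. intros t ht. apply H. lra. }
  destruct (far z A A') as [u [hu Bu]]; auto.
  destruct (far z' A' A) as [u' [hu' Bu']]; auto.
  { intros w hw. destruct (cov w hw); auto. } { intros w w1 w2 w3. apply (no' w); auto. }
  assert (Q := stay A A' oA oA' cov no' u (u' - u)%C 1 ltac:(lra)).
  replace (u + 1 * (u' - u))%C with u' in Q by ring.
  apply (no' u'); auto. apply Q; auto. intros t ht. apply hl.
  replace (Re (u + t * (u' - u))%C) with ((1 - t) * Re u + t * Re u') by (destruct u, u'; cbn; ring).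
  destruct (Req_dec t 0) as [->|]; [lra|]. assert (t * Re u' < t * a) by (apply Rmult_lt_compat_l; lra).
  assert ((1 - t) * Re u <= (1 - t) * a) by (apply Rmult_le_compat_l; lra). lra.
Qed.

Lemma cont_upto (f : C2 -> C2) k eps : (forall k eps, 0 < eps -> exists d, 0 < d /\ forall p, norm p < d -> norm (Nat.iter k f p) < eps) ->
  0 < eps -> exists d, 0 < d /\ forall p i, norm p < d -> (i <= k)%nat -> norm (Nat.iter i f p) < eps.
Proof.
  intros M_cont he. induction k as [|k [d [hd H]]].
  - exists eps; split; auto. intros p i hp hi. replace i with O by lia. exact hp.
  - destruct (M_cont (S k) eps he) as [d' [hd' H']]. exists (Rmin d d'). split; [apply Rmin_glb_lt; auto|].
    intros p i hp hi. destruct (Nat.eq_dec i (S k)) as [->|n].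
    + apply H'. eapply Rlt_le_trans; [apply hp|apply Rmin_r].
    + apply H; [|lia]. eapply Rlt_le_trans; [apply hp|apply Rmin_l].
Qed.

(** [PP] is the inverse of the straightened normalizing coordinates [(zx, zy)], in which the germ [f] becomes [(fx, fy)]. *)
Section Model.
Context (m : nat) (lam mu : C) (fx fy : C -> C -> C) (rho gam Kg : R) (D : dyn m lam mu fx fy rho gam Kg).
Context (PP : C -> C -> C2) (zx zy : C2 -> C) (f g : C2 -> C2) (KN a : R).
Let N x y := norm (PP x y).
Context (Nm : nrm m rho gam N KN a).
Context (q : nat) (hq : (1 <= q)%nat) (lamq : (lam ^ q = 1)%C).
Context (r0 r1 R0 : R) (hR0 : 1000000 * Kg <= R0) (hr0 : 0 < r0 <= r1) (sm : small_radius m rho KN R0 r0).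
Context (M_zz : forall p, norm p < r1 -> Cmod (zx p) < rho /\ Cmod (zy p) < rho /\ PP (zx p) (zy p) = p).
Context (M_PP : forall x y, Cmod x < rho -> Cmod y < rho -> zx (PP x y) = x /\ zy (PP x y) = y).
Context (M_f : forall x y, Cmod x < rho -> Cmod y < rho -> fx x y = zx (f (PP x y)) /\ fy x y = zy (f (PP x y)) /\
  PP (fx x y) (fy x y) = f (PP x y) /\ g (f (PP x y)) = PP x y).
Context (M_inv : forall p, norm p < r1 -> f (g p) = p /\ g (f p) = p).
Context (M_iter : forall p k, norm p < r0 -> (k <= q)%nat -> norm (Nat.iter k f p) < r1).
Context (M_cont : forall k eps, 0 < eps -> exists d, 0 < d /\ forall p, norm p < d -> norm (Nat.iter k f p) < eps).
Context (M_0 : PP 0 0 = zero).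

Let hm : (1 <= m)%nat := d_m D.

Definition tame_orbit r (x y : nat -> C) := orb fx fy rho x y /\ x O <> 0%C /\ forall n, norm (PP (x n) (y n)) < r.

(** The petal with label [th] in the ball of radius r, as a set of starting points of backward
    orbits. *)
Definition fiber r th (p : C2) := exists x y, tame_orbit r x y /\ branch m lam th x /\ p = PP (x O) (y O).

Lemma orbit_inv x y n : orb fx fy rho x y -> Nat.iter n g (PP (x O) (y O)) = PP (x n) (y n).
Proof.
  intros h. induction n as [|n IH]; auto. rewrite Nat.iter_succ, IH.
  destruct (h (S n)) as (h1 & h2 & _). destruct (h n) as (_ & _ & h3 & h4).
  destruct (M_f _ _ h1 h2) as (_ & _ & h5 & h6). rewrite h3, h4 in h5. rewrite h5. exact h6.
Qed.

Lemma orbit_fwd x y n : orb fx fy rho x y -> f (PP (x (S n)) (y (S n))) = PP (x n) (y n).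
Proof.
  intros h. destruct (h (S n)) as (h1 & h2 & _). destruct (h n) as (_ & _ & h3 & h4).
  destruct (M_f _ _ h1 h2) as (_ & _ & h5 & h6). rewrite <- h5, h3, h4. reflexivity.
Qed.

Lemma orbit_fwd_iter x y k n : orb fx fy rho x y -> Nat.iter k f (PP (x (n + k)%nat) (y (n + k)%nat)) = PP (x n) (y n).
Proof.
  intros h. revert n; induction k as [|k IH]; intro n; [rewrite Nat.add_0_r; auto|].
  replace (n + S k)%nat with (S (n + k)) by lia. rewrite iter_S_r, orbit_fwd by auto. apply IH.
Qed.

Lemma PP_inj x y x' y' : Cmod x < rho -> Cmod y < rho -> Cmod x' < rho -> Cmod y' < rho -> PP x y = PP x' y' -> x = x' /\ y = y'.
Proof.
  intros h1 h2 h3 h4 e. destruct (M_PP x y h1 h2) as [e1 e2]. destruct (M_PP x' y' h3 h4) as [e3 e4].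
  rewrite e in e1, e2. split; congruence.
Qed.

Lemma orb_tends_0 x y del : orb fx fy rho x y -> x O <> 0%C -> 0 < del -> exists M, forall n, (M <= n)%nat -> Cmod (x n) <= del.
Proof.
  intros h hx hd. destruct (orb_Re_lim D x y (- (2 / del) ^ m) h hx) as [M HM]. exists M. intros n hn. specialize (HM n hn).
  apply (x_small m); auto; [apply (orb_nz D x y h hx)|]. fold (wseq m x n).
  assert (b := re_le_Cmod (wseq m x n)). apply Rabs_le_between in b. lra.
Qed.

(** The convergence to 0 required by [Sigma] is automatic: Re w tends to minus infinity along the
    orbit, and the cone controls y. The cone also shows that a nonzero point has x different from
    0. *)
Lemma Sigma_orbit r p : 0 < r <= r1 -> Sigma g (ball0 r) p <-> exists x y, tame_orbit r x y /\ p = PP (x O) (y O).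
Proof.
  intros hr. unfold Sigma, ball0, tame_orbit. split.
  - intros (h1 & h2 & h3 & h4).
    assert (Ho : orb fx fy rho (fun n => zx (Nat.iter n g p)) (fun n => zy (Nat.iter n g p))).
    { intro n. assert (a1 := h3 n). assert (a2 := h3 (S n)).
      destruct (M_zz (Nat.iter n g p)) as (b1 & b2 & b3); [lra|]. destruct (M_zz (Nat.iter (S n) g p)) as (c1 & c2 & c3); [lra|].
      destruct (M_f _ _ c1 c2) as (d1 & d2 & _). rewrite c3 in d1, d2.
      assert (e : f (Nat.iter (S n) g p) = Nat.iter n g p) by (apply (M_inv (Nat.iter n g p)); lra). rewrite e in d1, d2.
      cbv beta in *. repeat split; auto. }
    exists (fun n => zx (Nat.iter n g p)), (fun n => zy (Nat.iter n g p)).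
    assert (E : forall n, PP (zx (Nat.iter n g p)) (zy (Nat.iter n g p)) = Nat.iter n g p) by (intro n; apply M_zz; specialize (h3 n); lra).
    split; [split; [exact Ho|split]|].
    + intro e. apply h2. assert (y0 := orb_y_le D _ _ O Ho). cbv beta in y0. rewrite e, Cmod_0, Rmult_0_r in y0. apply Cmod_le0 in y0.
      assert (e0 := E O). cbn [Nat.iter nat_rect] in *. rewrite <- e0, e, y0. exact M_0.
    + intro n. rewrite E. apply h3.
    + symmetry. apply (E O).
  - intros (x & y & (h1 & h2 & h3) & ->). split; [apply h3|].
    assert (I : forall n, Nat.iter n g (PP (x O) (y O)) = PP (x n) (y n)) by (intro; apply orbit_inv; auto).
    split; [|split].
    + rewrite <- M_0. intro e. apply PP_inj in e; try apply h1; rewrite ?Cmod_0; try apply (d_rho D). apply h2, e.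
    + intro n. rewrite I. apply h3.
    + intros P [eps HP]. destruct (orb_tends_0 x y (Rmin (eps / (4 * KN)) (rho / 2)) h1 h2) as [M HM].
      { assert (k1 := n_KN _ _ _ _ _ _ Nm). assert (he := cond_pos eps). apply Rmin_glb_lt; [apply Rdiv_lt_0_compat; lra|]. generalize (d_rho D); lra. }
      exists M. intros n hn. apply HP. rewrite I. apply (norm_compat1 (zero : C2)).
      assert (e0 : minus (PP (x n) (y n)) (zero : C2) = PP (x n) (y n)) by apply C2_minus_0. rewrite e0.
      assert (k1 := n_KN _ _ _ _ _ _ Nm). destruct (h1 n) as (c1 & c2 & _).
      assert (u := n_up _ _ _ _ _ _ Nm _ _ c1 c2). assert (v := orb_y_le D x y n h1). assert (hg := d_gam D).
      assert (b := HM n hn). assert (b' := Rle_trans _ _ _ b (Rmin_l _ _)). assert (pc := Cmod_ge_0 (x n)).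
      assert (Cmod (y n) <= Cmod (x n)) by nra. unfold N in u.
      assert (KN * (Cmod (x n) + Cmod (y n)) <= KN * (2 * (eps / (4 * KN)))) by (apply Rmult_le_compat_l; lra).
      replace (KN * (2 * (eps / (4 * KN)))) with (eps / 2) in H0 by (field; lra). generalize (cond_pos eps). lra.
Qed.

Lemma fiber_Sigma r p : 0 < r <= r1 -> Sigma g (ball0 r) p <-> exists th, (th ^ m = 1)%C /\ fiber r th p.
Proof.
  intro hr. rewrite (Sigma_orbit r p hr). split.
  - intros (x & y & T & e). destruct T as (h1 & h2 & h3). destruct (classify D x y h1 h2) as [th [t1 t2]].
    exists th; split; auto. exists x, y. repeat split; auto; apply h1.
  - intros (th & _ & x & y & T & _ & e). exists x, y. auto.
Qed.

Lemma fiber_unique r th th' p : fiber r th p -> fiber r th' p -> th = th'.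
Proof.
  intros (x & y & (h1 & h2 & h3) & b & e) (x' & y' & (h1' & h2' & h3') & b' & e').
  rewrite e in e'. apply PP_inj in e'; [|apply h1|apply h1|apply h1'|apply h1'].
  assert (E := orb_unique D x y x' y' h1 h1' (eq_sym (proj1 e'))).
  apply (branch_unique D th th' x); auto. destruct b' as [M HM]. exists M. intros n hn.
  destruct (HM n hn) as [u v]. unfold wseq in *. rewrite !(proj1 (E n)) in u, v. auto.
Qed.

Lemma fiber_norm r th p : fiber r th p -> norm p < r.
Proof. intros (x & y & (_ & _ & h3) & _ & ->). apply h3. Qed.

(** Dropping the first point of an orbit divides the label by lam. So the inverse map divides labels
    by lam and f multiplies them by lam, which is the cyclic permutation of the petals. *)
Lemma fiber_back r th p : fiber r (th * lam)%C p -> fiber r th (g p).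
Proof.
  intros (x & y & (h1 & h2 & h3) & [M b] & e). exists (fun n => x (n + 1)%nat), (fun n => y (n + 1)%nat).
  split; [split; [|split]|split].
  - apply (orb_shift fx fy rho x y 1 h1).
  - apply (orb_nz D x y h1 h2).
  - intro n. apply h3.
  - exists M. intros n hn. destruct (b (n + 1)%nat ltac:(lia)) as [b1 b2]. split; [exact b1|].
    rewrite b2 at 1. unfold xth, thn, wseq. rewrite Nat.add_1_r. simpl Cpow. field. apply (lam_nz D).
  - subst p. apply (orbit_inv x y 1 h1).
Qed.

Lemma fiber_fwd r th p : 0 < r <= r1 -> fiber r th p -> norm (f p) < r -> fiber r (th * lam)%C (f p).
Proof.
  intros hr (x & y & (h1 & h2 & h3) & [M b] & e) hf.
  set (x' := fun n => match n with O => zx (f p) | S k => x k end). set (y' := fun n => match n with O => zy (f p) | S k => y k end).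
  destruct (M_zz (f p)) as (c1 & c2 & c3); [lra|].
  assert (Ho : orb fx fy rho x' y').
  { intros [|n]; unfold x', y'; [|apply h1]. destruct (h1 O) as (d1 & d2 & _). destruct (M_f _ _ d1 d2) as (e1 & e2 & _).
    rewrite <- e in e1, e2. auto. }
  exists x', y'. split; [split; [exact Ho|split]|split].
  - intro z. apply h2. assert (Q := orb_unique D (fun _ => 0%C) (fun _ => 0%C) x' y' (orb_zero _ _ _ _ _ _ _ _ D) Ho z 1%nat). apply Q.
  - intros [|n]; unfold x', y'; [rewrite c3; exact hf|apply h3].
  (* The old point of index n now has index n + 1, and the shift by one turns the label [th] into th
     lam. *)
  - exists (S M). intros [|n] hn; [lia|]. destruct (b n ltac:(lia)) as [b1 b2]. split; [exact b1|].
    unfold x' at 1. rewrite b2 at 1. unfold xth, thn, wseq. simpl Cpow. unfold x'. field. apply (lam_nz D).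
  - unfold x', y'. auto.
Qed.

Lemma fiber_f_g r th p : r <= r1 -> fiber r th p -> f (g p) = p /\ g (f p) = p.
Proof. intros hr h. apply M_inv. generalize (fiber_norm _ _ _ h). lra. Qed.

Lemma fiber_back_iter r th p k : fiber r (th * lam ^ k)%C p -> fiber r th (Nat.iter k g p).
Proof.
  revert p; induction k as [|k IH]; intros p h.
  - simpl in *. rewrite Cmult_1_r in h. auto.
  - rewrite iter_S_r. apply IH, fiber_back. rewrite <- Cmult_assoc. simpl in h. rewrite (Cmult_comm (lam ^ k)%C). auto.
Qed.

Lemma fiber_fwd_iter r th p k : 0 < r <= r1 -> fiber r th p -> (forall i, (i <= k)%nat -> norm (Nat.iter i f p) < r) ->
  fiber r (th * lam ^ k)%C (Nat.iter k f p).
Proof.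
  intros hr h. induction k as [|k IH]; intro hi.
  - simpl. rewrite Cmult_1_r. auto.
  - simpl. replace (th * (lam * lam ^ k))%C with (th * lam ^ k * lam)%C by ring. apply fiber_fwd; auto. apply (hi (S k)). lia.
Qed.

Lemma fiber_cycle r om : 0 < r <= r1 -> petal_cycle f g (ball0 r) q (fun j => fiber r (om * lam ^ j)%C).
Proof.
  intros hr j hj. split; [|split].
  - assert (E : (lam ^ (S j mod q) = lam ^ j * lam)%C).
    (* The cycle closes because lam^q = 1. *)
    { destruct (Nat.eq_dec (S j) q) as [e|e].
      - rewrite e, Nat.Div0.mod_same. simpl Cpow. transitivity (lam ^ S j)%C; [rewrite e, lamq; auto|simpl; ring].
      - rewrite Nat.mod_small by lia. simpl. ring. }
    intro p. rewrite E, Cmult_assoc. split.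
    + intro h. split; [apply (fiber_norm _ _ _ h)|]. exists (g p). split; [apply fiber_back, h|]. apply (fiber_f_g _ _ _ (proj2 hr) h).
    + intros [h1 (p' & h2 & <-)]. apply fiber_fwd; auto.
  - destruct (cont_upto f q r M_cont ltac:(lra)) as [d [hd H]]. exists d; split; auto. intros p h hp.
    assert (Q := fiber_fwd_iter r _ p q hr h (fun i hi => H p i hp hi)). rewrite lamq, Cmult_1_r in Q. exact Q.
  - intros p h. apply fiber_back_iter. rewrite lamq, Cmult_1_r. exact h.
Qed.

Section Leaf.
Context (th : C) (thm : (th ^ m = 1)%C) (xr yr : nat -> C) (xo : orb fx fy rho xr yr) (xn : xr O <> 0%C) (xb : branch m lam th xr).
Context (HH : forall r, 0 < r -> exists a, forall z0, Re z0 < a -> exists d (XX YY : C -> nat -> C), 0 < d /\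
  (forall z, Cmod (z - z0) < d -> petal m lam fx fy rho N th r xr z (XX z) (YY z)) /\
  forall n, cdble (fun z => XX z n) z0 /\ cdble (fun z => YY z n) z0).
Context (M_PPd : forall x y, Cmod x < rho -> Cmod y < rho -> fdiff (fun u v => fst (PP u v)) x y /\ fdiff (fun u v => snd (PP u v)) x y).
Context (Phi : C2 -> C2) (kap : C) (M_Phi : forall p, norm p < r1 -> Phi p = (zx p, zy p + kap * zx p)%C).
Context (r : R) (hr : 0 < r < r0).

Let P z x y := petal m lam fx fy rho N th r xr z x y.
Let Dom z := exists x y, P z x y.

Lemma petal_fiber z x y : P z x y -> fiber r th (PP (x O) (y O)).
Proof. intros (h1 & h2 & h3 & h4 & h5). exists x, y. repeat split; auto; apply h1. Qed.

Lemma fiber_petal p : fiber r th p -> exists z x y, P z x y /\ p = PP (x O) (y O).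
Proof.
  intros (x & y & (h1 & h2 & h3) & h4 & h5). destruct (Zrel_ex D th xr yr x y xo xn h1 h2 xb h4) as [z hz].
  exists z, x, y. split; auto. split; auto.
Qed.

Lemma petal_start : exists X Y : C -> C, forall z x y, P z x y -> X z = x O /\ Y z = y O.
Proof.
  destruct (functional_choice (fun (z : C) (uv : C * C) => forall x y, P z x y -> fst uv = x O /\ snd uv = y O)) as [XY H].
  - intro z. destruct (classic (Dom z)) as [(x & y & h)|n].
    + exists (x O, y O). intros x' y' h'. destruct (petal_eq D h' h O). auto.
    + exists (RtoC 0, RtoC 0). intros x y h. exfalso. apply n. exists x, y. auto.
  - exists (fun z => fst (XY z)), (fun z => snd (XY z)). intro z. apply H.
Qed.

Context (X Y : C -> C) (XY : forall z x y, P z x y -> X z = x O /\ Y z = y O).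

Let smr : small_radius m rho KN R0 r.
Proof. apply (small_mono _ _ _ _ r0); auto. generalize (n_KN _ _ _ _ _ _ Nm). lra. lra. Qed.

Lemma Dom_chart z0 : Dom z0 -> exists d, 0 < d /\ (forall z, Cmod (z - z0) < d -> Dom z) /\ cdble X z0 /\ cdble Y z0.
Proof.
  intros (x & y & h). destruct (petal_chart m lam mu fx fy rho gam Kg D N KN a Nm th q hq lamq xr yr xo xn HH r z0 x y (proj1 hr) h) as (d & XX & YY & hd & H & H').
  exists d. split; auto. split; [intros z hz; exists (XX z), (YY z); apply H, hz|].
  destruct (H' O) as [c1 c2]. split; [apply (cdble_ext_loc (fun z => XX z O) X z0 d)|apply (cdble_ext_loc (fun z => YY z O) Y z0 d)]; auto;
  intros z hz; destruct (XY z _ _ (H z hz)); auto.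
Qed.

Lemma X_inj z z' : Dom z -> Dom z' -> X z' = X z -> z' = z.
Proof.
  intros (x & y & h) (x' & y' & h') e. destruct (XY _ _ _ h) as [e1 _]. destruct (XY _ _ _ h') as [e2 _].
  apply (petal_x_inj m lam mu fx fy rho gam Kg D N th xr r z z' x y x' y' h h'). congruence.
Qed.

Lemma X_lower z0 : Dom z0 -> exists d c, 0 < d /\ 0 < c /\ forall z, Cmod (z - z0) < d -> Dom z /\ c * Cmod (z - z0) <= Cmod (X z - X z0).
Proof.
  intros h0. destruct (Dom_chart z0 h0) as (d & hd & H & _). destruct h0 as (x & y & h).
  destruct (x_lower m lam mu fx fy rho gam Kg D N KN a Nm th q hq lamq xr yr xo xn HH R0 hR0 r z0 x y smr h) as (d' & c & hd' & hc & H').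
  exists (Rmin d d'), c. split; [apply Rmin_glb_lt; auto|]. split; auto. intros z hz.
  assert (Dz : Dom z) by (apply H; eapply Rlt_le_trans; [apply hz|apply Rmin_l]). split; auto.
  destruct Dz as (x' & y' & h'). destruct (XY _ _ _ h) as [-> _]. destruct (XY _ _ _ h') as [-> _].
  apply (H' z x' y'); auto. eapply Rlt_le_trans; [apply hz|apply Rmin_r].
Qed.

Lemma X_open z0 : Dom z0 -> exists s K, 0 < s /\ 0 < K /\ forall xi, Cmod (xi - X z0) < s -> exists u, Dom u /\ Cmod (u - z0) <= K * Cmod (xi - X z0) /\ X u = xi.
Proof.
  intros h0. destruct (X_lower z0 h0) as (d & c & hd & hc & H).
  destruct (open_map X z0 d c hd hc) as (s & K & hs & hK & Q).
  - intros u hu. destruct (H u hu) as [hD _]. destruct (Dom_chart u hD) as (? & _ & _ & c1 & _). exact c1.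
  - intros u hu. apply H, hu.
  - exists s, K. repeat split; auto. intros xi hxi. destruct (Q xi hxi) as (u & u1 & u2 & u3). exists u. repeat split; auto. apply H, u1.
Qed.

(** X, the first coordinate as a function of z, is injective with a holomorphic inverse Z on an open
    image. The graph is that of Y composed with Z; the term kap xi undoes the shear, since the graph
    is taken in the original normalizing coordinates. *)
Lemma leaf_graph : holomorphic_graph (fun z => exists p, fiber r th p /\ Phi p = z).
Proof.
  destruct (functional_choice (fun (xi z : C) => (exists u, Dom u /\ X u = xi) -> Dom z /\ X z = xi)) as [Z HZ].
  { intro xi. destruct (classic (exists u, Dom u /\ X u = xi)) as [[u hu]|n]; [exists u; auto|exists (RtoC 0); tauto]. }
  exists (fun xi => exists u, Dom u /\ X u = xi), (fun xi => Y (Z xi) + kap * xi)%C. split; [split|].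
  - apply open_C. intros xi (u & hu & <-). destruct (X_open u hu) as (s & K & hs & hK & Q). exists s; split; auto.
    intros xi hxi. destruct (Q xi hxi) as (u' & u1 & _ & u3). exists u'; auto.
  - intros xi (u & hu & <-). apply cdble_ex_filterdiff. apply cdble_plus; [|apply cdble_mult; [apply cdble_const|apply cdble_id]].
    destruct (X_open u hu) as (s & K & hs & hK & Q). destruct (Dom_chart u hu) as (d & hd & _ & c1 & c2).
    assert (Zu : forall v, Dom v -> Z (X v) = v). { intros v hv. destruct (HZ (X v)) as [z1 z2]; [exists v; auto|]. apply X_inj; auto. }
    apply (cdble_comp Z Y).
    + apply (inv_cdble X Z u s K); auto.
      * intros xi hxi. destruct (Q xi hxi) as (v & v1 & v2 & <-). rewrite (Zu v v1). auto.
      * destruct (X_lower u hu) as (d' & c & hd' & hc & H). exists c, d'. repeat split; auto. intros v hv. apply H, hv.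
    + rewrite (Zu u hu). auto.
  - intros x y. split.
    + intros (p & hp & e). rewrite M_Phi in e by (generalize (fiber_norm _ _ _ hp); lra).
      destruct (fiber_petal p hp) as (z & x' & y' & h & ->). destruct (XY _ _ _ h) as [e1 e2]. destruct (proj1 h O) as (b1 & b2 & _).
      destruct (M_PP _ _ b1 b2) as [m1 m2]. rewrite m1, m2 in e. injection e as <- <-.
      assert (dz : Dom z) by (exists x', y'; auto).
      split; [exists z; auto|]. rewrite <- e1, <- e2. f_equal. f_equal.
      destruct (HZ (X z)) as [z1 z2]; [exists z; auto|]. symmetry. apply X_inj; auto.
    + intros [hx ->]. destruct (HZ x hx) as [(x' & y' & h) z2]. destruct (XY _ _ _ h) as [e1 e2].
      exists (PP (x' O) (y' O)). split; [apply (petal_fiber _ _ _ h)|]. destruct (proj1 h O) as (b1 & b2 & _).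
      rewrite M_Phi. destruct (M_PP _ _ b1 b2) as [-> ->]. rewrite e2, <- e1, z2. reflexivity.
      apply petal_fiber in h. apply fiber_norm in h. lra.
Qed.

Lemma Dom_left z : Dom z -> exists v, Re v < 0 /\ forall t : R, 0 <= t -> Dom (z + t * v)%C.
Proof.
  intros (x & y & h).
  (* [r0] serves as the larger radius; this is why r < r0 is strict. *)
  destruct (petal_path m lam mu fx fy rho gam Kg D N KN a Nm th q hq lamq xr yr xo xn HH R0 hR0 r r0 z x y smr sm (proj2 hr) h) as (s & hs & H).
  exists (- (1) + s * Ci)%C. split; [cbn; lra|]. intros t ht. apply H, ht.
Qed.

Lemma leaf_petal : repelling_petal f Phi q (fiber r th).
Proof.
  split.
  (* Orbits far to the left in the half plane for the radius min(r, eps) have norm less than eps and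
     belong to the same petal. *)
  - intros eps he. destruct (HH (Rmin r eps)) as [A HA]; [apply Rmin_glb_lt; lra|].
    destruct (HA (A - 1)%R) as (d & XX & YY & hd & H & _); [cbn; lra|].
    specialize (H (A - 1)%R). rewrite Cmod_self in H. specialize (H hd). destruct H as (h1 & h2 & h3 & h4 & h5).
    exists (PP (XX (RtoC (A - 1)) O) (YY (RtoC (A - 1)) O)). split.
    + exists (XX (RtoC (A - 1))), (YY (RtoC (A - 1))). repeat split; auto; try apply h1. intro n. eapply Rlt_le_trans; [apply h3|apply Rmin_l].
    + eapply Rlt_le_trans; [apply h3|apply Rmin_r].
  - assert (qp : 0 < INR q) by (apply lt_0_INR; lia).
    assert (qn : RtoC (INR q) <> 0%C) by (intro e; apply RtoC_inj in e; lra).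
    assert (HX : forall z x y, P z x y -> PP (X z) (Y z) = PP (x O) (y O)) by (intros z x y h; destruct (XY _ _ _ h) as [-> ->]; auto).
    destruct (functional_choice (fun (p : C2) (zeta : C) => fiber r th p -> Dom (INR q * zeta)%C /\ p = PP (X (INR q * zeta)) (Y (INR q * zeta)))) as [phio Hphio].
    { intro p. destruct (classic (fiber r th p)) as [h|n]; [|exists (RtoC 0); tauto].
      destruct (fiber_petal p h) as (z & x & y & hp & ->). exists (z / INR q)%C. intros _.
      replace (INR q * (z / INR q))%C with z by (field; auto). rewrite (HX _ _ _ hp). split; auto. exists x, y; auto. }
    destruct (HH r (proj1 hr)) as [A HA].
    assert (inj : forall z z', Dom z -> Dom z' -> PP (X z) (Y z) = PP (X z') (Y z') -> z = z').
    { intros z z' hz hz' e. apply X_inj; auto. destruct hz as (x & y & h). destruct hz' as (x' & y' & h').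
      destruct (XY _ _ _ h) as [e1 e2]. destruct (XY _ _ _ h') as [e3 e4]. rewrite e1, e2, e3, e4 in *.
      apply PP_inj in e; try apply (proj1 h); try apply (proj1 h'). apply e. }
    assert (step : forall z, Dom (z + INR q)%C -> Dom z /\ PP (X (z + INR q)) (Y (z + INR q)) = Nat.iter q f (PP (X z) (Y z)) /\ Nat.iter q g (PP (X (z + INR q)) (Y (z + INR q))) = PP (X z) (Y z)).
    { intros z (x & y & h). assert (sh := petal_shift m lam mu fx fy rho gam Kg D N th q hq lamq xr yr xo xn r _ x y 1 h).
      rewrite Nat.mul_1_r in sh. cbv beta in sh. replace (z + INR q - INR q)%C with z in sh by ring.
      rewrite (HX _ _ _ h), (HX _ _ _ sh). split; [exists (fun n => x (n + q)%nat), (fun n => y (n + q)%nat); exact sh|]. split.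
      - symmetry. apply (orbit_fwd_iter x y q 0). apply h.
      - apply (orbit_inv x y q). apply h. }
    assert (inj_q : forall z, (INR q * (z / INR q))%C = z) by (intro; field; auto).
    (* The coordinate z advances by 1 at each application of f, so it is divided by q to make f^q
       the unit translation. *)
    exists (A / INR q), (fun zeta => Dom (INR q * zeta)%C), (fun zeta => PP (X (INR q * zeta)) (Y (INR q * zeta))), phio.
    assert (left : forall zeta, left_half_plane (A / INR q) zeta -> Dom (INR q * zeta)%C).
    { intros zeta hz. unfold left_half_plane in hz.
      assert (hz' : Re (INR q * zeta)%C < A).
      { replace (Re (INR q * zeta)%C) with (INR q * Re zeta) by (destruct zeta; cbn; ring).
        apply (Rmult_lt_compat_l (INR q)) in hz; auto. replace (INR q * (A / INR q)) with A in hz by (field; lra). auto. }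
      destruct (HA _ hz') as (d & XX & YY & hd & H & _). exists (XX (INR q * zeta)%C), (YY (INR q * zeta)%C). apply H. rewrite Cmod_self. auto. }
    repeat match goal with |- _ /\ _ => split end.
    + exact left.
    + intros zeta hz. apply (step (INR q * (zeta - 1))%C). replace (INR q * (zeta - 1) + INR q)%C with (INR q * zeta)%C by ring. auto.
    + apply (path_connected_left _ (A / INR q) left). intros zeta hz. destruct (Dom_left _ hz) as (v & hv & H).
      exists (v / INR q)%C. split.
      * replace (Re (v / INR q)%C) with (Re v / INR q). apply Rmult_lt_reg_r with (INR q); auto. replace (Re v / INR q * INR q) with (Re v) by (field; lra). lra.
        transitivity (Re (v * RtoC (/ INR q))%C); [|rewrite RtoC_inv by lra; reflexivity]. destruct v as [v1 v2]. simpl. unfold Rdiv. ring.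
      * intros t ht. replace (INR q * (zeta + t * (v / INR q)))%C with (INR q * zeta + t * v)%C by (field; auto). auto.
    + split.
      * apply open_C. intros zeta hz. destruct (Dom_chart _ hz) as (d & hd & H & _). exists (d / INR q). split; [apply Rdiv_lt_0_compat; auto|].
        intros z' hz'. apply H. replace (INR q * z' - INR q * zeta)%C with (INR q * (z' - zeta))%C by ring. rewrite Cmod_mult, Cmod_RtoC by lra.
        apply (Rmult_lt_compat_l (INR q)) in hz'; auto. replace (INR q * (d / INR q)) with d in hz' by (field; lra). auto.
      * intros zeta hz. assert (cX : cdble (fun zeta => X (INR q * zeta)) zeta /\ cdble (fun zeta => Y (INR q * zeta)) zeta).
        { destruct (Dom_chart _ hz) as (d & hd & _ & H1 & H2).
          split; [apply (cdble_comp (fun z => INR q * z)%C X)|apply (cdble_comp (fun z => INR q * z)%C Y)]; auto; apply cdble_mult; try apply cdble_const; apply cdble_id. }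
        destruct cX as [cX cY]. destruct hz as (x & y & h). destruct (XY _ _ _ h) as [e1 e2]. destruct (proj1 h O) as (b1 & b2 & _).
        destruct (M_PPd _ _ b1 b2) as [F1 F2]. rewrite <- e1, <- e2 in F1, F2.
        assert (Q := cdble_ex_filterdiff2 _ _ zeta (fdiff_comp _ _ _ _ cX cY F1) (fdiff_comp _ _ _ _ cX cY F2)).
        eapply ex_filterdiff_ext; [|exact Q]. intro t. symmetry. apply (surjective_pairing (PP (X (INR q * t)) (Y (INR q * t)))).
    + intros z z' hz hz' e. apply (inj _ _ hz hz') in e. rewrite <- (inj_q z), <- (inj_q z').
      replace (INR q * (z / INR q))%C with ((INR q * z) / INR q)%C by (field; auto). rewrite e. field; auto.
    + intro p. split.
      * intro h. exists (phio p). destruct (Hphio p h) as [h1 h2]. auto.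
      * intros (zeta & (x & y & h) & <-). rewrite (HX _ _ _ h). apply (petal_fiber _ _ _ h).
    + apply leaf_graph.
    + intros zeta _ hz. replace (INR q * (zeta + 1))%C with (INR q * zeta + INR q)%C in * by ring. apply step, hz.
    + intros zeta hz. assert (F : fiber r th (PP (X (INR q * zeta)) (Y (INR q * zeta)))).
      { destruct hz as (x & y & h). rewrite (HX _ _ _ h). apply (petal_fiber _ _ _ h). }
      destruct (Hphio _ F) as [h1 h2]. apply inj in h2; auto.
      set (u := phio _) in *. transitivity (INR q * u / INR q)%C; [field; auto|]. rewrite <- h2. field; auto.
    + intros p hp hfp. destruct (Hphio _ hp) as [h1 h2]. destruct (Hphio _ hfp) as [h3 h4].
      set (u := phio p) in *. set (v := phio (Nat.iter q f p)) in *.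
      assert (e : (INR q * v = INR q * (v - 1) + INR q)%C) by ring.
      assert (h3' := h3). rewrite e in h3'. destruct (step _ h3') as (s1 & s2 & s3). rewrite <- e in s3. rewrite <- h4 in s3.
      (* Only p and f^q p are known to lie in the petal. The points between may leave the ball of
         radius r, but they stay in that of radius r1, where g inverts f. Going back q steps from
         f^q p therefore yields p, and [step] identifies its coordinate as one less. *)
      assert (back : forall k, (k <= q)%nat -> Nat.iter k g (Nat.iter k f p) = p).
      { induction k as [|k IH]; intro hk; auto. rewrite iter_S_r. rewrite Nat.iter_succ.
        rewrite (proj2 (M_inv (Nat.iter k f p) (M_iter p k ltac:(generalize (fiber_norm _ _ _ hp); lra) ltac:(lia)))). apply IH. lia. }
      rewrite back in s3 by lia. rewrite h2 in s3. apply inj in s3; auto.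
      assert (w : u = (v - 1)%C). { replace u with (INR q * u / INR q)%C by (field; auto). rewrite s3. field; auto. }
      rewrite w. ring.
Qed.

End Leaf.

End Model.

(** * Straightening of the linear part and choice of the radii *)

Lemma shear_mod (k x y : C) s : Cmod x < s -> Cmod y < s -> Cmod (y + k * x) < (1 + Cmod k) * s.
Proof.
  intros hx hy. eapply Rle_lt_trans; [apply Cmod_triangle|]. rewrite Cmod_mult.
  assert (Cmod k * Cmod x <= Cmod k * s) by (apply Rmult_le_compat_l; [apply Cmod_ge_0|lra]). lra.
Qed.

(** The linear part sends (x, y) to (lam x, mu y + h(0,0) x), and the condition on [kap] says that
    (1, kap) is its eigenvector for lam. The shear y + kap x diagonalizes it without changing x, so
    the bound on [F1], uniform in y, and graphs over x survive. *)
Lemma germ_straight (F1 F2 h : C -> C -> C) (lam mu kap : C) m rho K1 : (1 <= m)%nat -> Cmod lam = 1 -> (lam ^ m = 1)%C -> Cmod mu < 1 ->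
  0 < rho -> 0 <= K1 -> (forall x y, Cmod x < rho -> Cmod y < rho -> fdiff F1 x y /\ fdiff F2 x y) ->
  (forall x y, Cmod x < rho -> Cmod y < rho -> Cmod (F1 x y - lam * (x * (1 + x ^ m))) <= K1 * Cmod x ^ (2 * m + 1)) ->
  (forall x y, Cmod x < rho -> Cmod y < rho -> F2 x y = (mu * y + x * h x y)%C) ->
  fdiff h 0 0 -> (kap * (lam - mu) = h 0 0)%C ->
  exists s K, 0 < s /\ germ m lam mu (fun x y => F1 x (y + kap * x)%C) (fun x y => F2 x (y + kap * x) - kap * F1 x (y + kap * x))%C s K.
Proof.
  intros hm hl hlm hmu hr hK1 hF hb1 hb2 hh hk.
  destruct (fdiff_lip h 0 0 hh) as (Kh & d & hd & hKh & Hh). assert (pk := Cmod_ge_0 kap).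
  set (w := Rmin (Rmin rho d) 1). assert (pw : 0 < w) by (repeat apply Rmin_glb_lt; lra).
  assert (w1 : w <= 1) by apply Rmin_r. assert (wl := Rmin_l (Rmin rho d) 1). fold w in wl. assert (wl1 := Rmin_l rho d). assert (wl2 := Rmin_r rho d).
  assert (w_ref : w <= rho) by lra. assert (wd : w <= d) by lra. clear wl wl1 wl2.
  exists (w / (1 + Cmod kap)), (K1 + Kh * (1 + Cmod kap) + Cmod kap * K1 + Cmod kap).
  assert (ps : 0 < w / (1 + Cmod kap)) by (apply Rdiv_lt_0_compat; lra).
  assert (sw : (1 + Cmod kap) * (w / (1 + Cmod kap)) = w) by (field; lra).
  set (s := w / (1 + Cmod kap)) in *. clearbody s. assert (sw' : s <= w) by nra.
  assert (Sh : forall x y, Cmod x < s -> Cmod y < s -> Cmod (y + kap * x) < w) by (intros; rewrite <- sw; apply shear_mod; auto).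
  split; auto. assert (0 <= Kh * (1 + Cmod kap)) by (apply Rmult_le_pos; lra). assert (0 <= Cmod kap * K1) by (apply Rmult_le_pos; lra).
  constructor; auto; try lra.
  - intros x y hx hy. apply (fdiff_shear F1). apply hF; [lra|]. assert (Sh1 := Sh x y hx hy). lra.
  - intros x y hx hy. assert (Sh1 := Sh x y hx hy). destruct (hF x (y + kap * x)%C) as [f1 f2]; [lra|lra|].
    apply (fdiff_lin (fun x y => F2 x (y + kap * x)%C) (fun x y => F1 x (y + kap * x)%C)); [apply (fdiff_shear F2), f2|apply (fdiff_shear F1), f1].
  - intros x y hx hy. assert (Sh1 := Sh x y hx hy). eapply Rle_trans; [apply hb1; lra|]. apply Rmult_le_compat_r; [apply pow_le, Cmod_ge_0|]. lra.
  - intros x y hx hy. assert (Sh1 := Sh x y hx hy). rewrite hb2 by lra.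
    set (e := (F1 x (y + kap * x) - lam * (x * (1 + x ^ m)))%C).
    assert (he : Cmod e <= K1 * Cmod x ^ (2 * m + 1)) by (apply hb1; lra).
    assert (px := Cmod_ge_0 x). assert (py := Cmod_ge_0 y).
    assert (pw2 : forall j, (2 <= j)%nat -> Cmod x ^ j <= Cmod x * Cmod x).
    { intros j hj. replace j with (2 + (j - 2))%nat by lia. rewrite pow_add. assert (Cmod x ^ (j - 2) <= 1) by (rewrite <- (pow1 (j - 2)); apply pow_incr; lra).
      assert (0 <= Cmod x ^ 2) by (apply pow_le; auto). replace (Cmod x * Cmod x) with (Cmod x ^ 2) by ring. nra. }
    replace (mu * (y + kap * x) + x * h x (y + kap * x) - kap * F1 x (y + kap * x) - mu * y)%C
      with (x * (h x (y + kap * x) - h 0 0) - kap * e - kap * lam * x ^ S m)%C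
      by (unfold e; rewrite <- hk; simpl Cpow; ring).
    eapply Rle_trans; [apply Cmod_sub|]. eapply Rle_trans; [apply Rplus_le_compat_r, Cmod_sub|]. rewrite !Cmod_mult, hl, Cmod_pow.
    assert (q1 : Cmod (h x (y + kap * x) - h 0 0)%C <= Kh * ((1 + Cmod kap) * (Cmod x + Cmod y))).
    { assert (Q := Hh x (y + kap * x)%C). rewrite !Cminus_0_r in Q. eapply Rle_trans; [apply Q; lra|].
      apply Rmult_le_compat_l; auto. assert (T := Cmod_triangle y (kap * x)). rewrite Cmod_mult in T. assert (0 <= Cmod kap * Cmod y) by (apply Rmult_le_pos; auto). lra. }
    assert (q2 := pw2 (2 * m + 1)%nat ltac:(lia)). assert (q3 := pw2 (S m) ltac:(lia)).
    apply (Rmult_le_compat_l (Cmod x)) in q1; auto.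
    assert (Cmod kap * Cmod e <= Cmod kap * (K1 * (Cmod x * Cmod x))).
    { apply Rmult_le_compat_l; auto. eapply Rle_trans; [apply he|]. apply Rmult_le_compat_l; auto. }
    assert (Cmod kap * 1 * Cmod x ^ S m <= Cmod kap * (Cmod x * Cmod x)) by (rewrite Rmult_1_r; apply Rmult_le_compat_l; auto).
    assert (0 <= Cmod x * Cmod y) by (apply Rmult_le_pos; auto). assert (0 <= Cmod x * Cmod x) by (apply Rmult_le_pos; auto).
    assert (0 <= K1 * (Cmod x * (Cmod x + Cmod y))) by (apply Rmult_le_pos; lra).
    assert (0 <= Cmod kap * K1 * (Cmod x * Cmod y)) by (apply Rmult_le_pos; lra).
    assert (0 <= Cmod kap * (Cmod x * Cmod y)) by (apply Rmult_le_pos; lra). lra.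
Qed.

Lemma C2_zero : (zero : C2) = (RtoC 0, RtoC 0).
Proof. reflexivity. Qed.

Lemma open_C2_0 (S : C2 -> Prop) : open S -> S zero -> exists d, 0 < d /\ forall p, norm p < d -> S p.
Proof.
  intros h h0. specialize (h _ h0). rewrite C2_zero in h. apply locally_C2 in h. destruct h as (d & hd & H). exists d; split; auto.
  intros [x y] hp. destruct (norm_C2_bounds x y) as (n1 & n2 & _). apply H; rewrite Cminus_0_r; [apply (Rle_lt_trans _ _ _ n1 hp)|apply (Rle_lt_trans _ _ _ n2 hp)].
Qed.

Lemma holo_lip_0 (F : C2 -> C2) : ex_filterdiff F (locally (zero : C2)) -> F zero = zero -> exists K d, 0 < d /\ 0 < K /\ forall p, norm p < d -> norm (F p) <= K * norm p.
Proof.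
  intros h F0. rewrite C2_zero in h. apply ex_filterdiff_fdiff in h. destruct h as [f1 f2].
  destruct (fdiff_lip _ _ _ f1) as (k1 & d1 & hd1 & hk1 & L1). destruct (fdiff_lip _ _ _ f2) as (k2 & d2 & hd2 & hk2 & L2).
  exists (2 * (k1 + k2 + 1)), (Rmin d1 d2). split; [apply Rmin_glb_lt; auto|]. split; [lra|]. intros [x y] hp.
  destruct (norm_C2_bounds x y) as (n1 & n2 & _).
  assert (l1 := Rlt_le_trans _ _ _ hp (Rmin_l _ _)). assert (l2 := Rlt_le_trans _ _ _ hp (Rmin_r _ _)).
  assert (q1 := L1 x y). assert (q2 := L2 x y). cbv beta in q1, q2. rewrite <- C2_zero, F0 in q1, q2. change (fst (zero : C2)) with (RtoC 0) in q1. change (snd (zero : C2)) with (RtoC 0) in q2.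
  rewrite !Cminus_0_r in q1, q2. specialize (q1 (Rle_lt_trans _ _ _ n1 l1) (Rle_lt_trans _ _ _ n2 l1)). specialize (q2 (Rle_lt_trans _ _ _ n1 l2) (Rle_lt_trans _ _ _ n2 l2)).
  assert (q := proj2 (proj2 (norm_C2_bounds (fst (F (x, y))) (snd (F (x, y)))))). rewrite <- surjective_pairing in q.
  set (nn := norm ((x, y) : C2)). assert (n1' : Cmod x <= nn) by exact n1. assert (n2' : Cmod y <= nn) by exact n2.
  change (norm (F (x, y)) <= 2 * (k1 + k2 + 1) * nn). eapply Rle_trans; [exact q|]. eapply Rle_trans; [exact (Rplus_le_compat _ _ _ _ q1 q2)|].
  assert ((k1 + k2) * (Cmod x + Cmod y) <= (k1 + k2) * (2 * nn)) by (apply Rmult_le_compat_l; lra). assert (0 <= nn) by apply norm_ge_0. lra.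
Qed.

Lemma holo_cont_0 (F : C2 -> C2) : ex_filterdiff F (locally (zero : C2)) -> F zero = zero -> forall eps, 0 < eps -> exists d, 0 < d /\ forall p, norm p < d -> norm (F p) < eps.
Proof.
  intros h F0 eps he. destruct (holo_lip_0 F h F0) as (K & d & hd & hK & H). exists (Rmin d (eps / K)). split; [apply Rmin_glb_lt; auto; apply Rdiv_lt_0_compat; auto|].
  intros p hp. eapply Rle_lt_trans; [apply H, (Rlt_le_trans _ _ _ hp), Rmin_l|]. assert (Q := Rlt_le_trans _ _ _ hp (Rmin_r _ _)).
  apply (Rmult_lt_compat_l K) in Q; auto. replace (K * (eps / K)) with eps in Q by (field; lra). auto.
Qed.

Lemma iter_cont_0 (F : C2 -> C2) : (forall eps, 0 < eps -> exists d, 0 < d /\ forall p, norm p < d -> norm (F p) < eps) ->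
  forall k eps, 0 < eps -> exists d, 0 < d /\ forall p, norm p < d -> norm (Nat.iter k F p) < eps.
Proof.
  intros h k. induction k as [|k IH]; intros eps he; [exists eps; auto|].
  destruct (h eps he) as (d & hd & H). destruct (IH d hd) as (d' & hd' & H'). exists d'; split; auto. intros p hp. apply H, H', hp.
Qed.

Lemma small_exists m rho KN R0 : (1 <= m)%nat -> 0 < rho -> 1 <= KN -> 1 <= R0 -> exists r, small_radius m rho KN R0 r.
Proof.
  intros hm hr hK hR. assert (pm : 1 <= INR m) by (apply (le_INR 1); auto).
  set (d := Rmin (rho / 2) (/ (INR m * R0))). assert (p1 : 1 <= INR m * R0) by nra. assert (pd : 0 < d) by (apply Rmin_glb_lt; [lra|apply Rinv_0_lt_compat; lra]).
  assert (d1 : d <= rho / 2) by apply Rmin_l. assert (d2 : d <= / (INR m * R0)) by apply Rmin_r.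
  assert (d3 : d * (INR m * R0) <= 1). { apply (Rmult_le_compat_r (INR m * R0)) in d2; [|lra]. rewrite Rinv_l in d2 by lra. auto. }
  exists (d / KN). assert (e : KN * (d / KN) = d) by (field; lra). split; [apply Rdiv_lt_0_compat; lra|]. rewrite e. split; [lra|].
  intros x hx hxd. rewrite wof_mod by auto. assert (px := proj1 (Cmod_gt_0 x) hx). assert (d <= 1) by nra.
  assert (Cmod x ^ m <= Cmod x). { destruct m as [|k]; [lia|]. simpl. assert (Cmod x ^ k <= 1) by (rewrite <- (pow1 k); apply pow_incr; lra). nra. }
  assert (0 < Cmod x ^ m) by (apply pow_lt; auto).
  apply (Rmult_le_reg_r (INR m * Cmod x ^ m)); [apply Rmult_lt_0_compat; lra|]. rewrite Rinv_l by (apply Rgt_not_eq, Rmult_lt_0_compat; lra).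
  assert (R0 * INR m * Cmod x ^ m <= R0 * INR m * d) by (apply Rmult_le_compat_l; nra). lra.
Qed.

Close Scope R_scope.

Theorem theoremF :
  forall (U V : C2 -> Prop) (f finv : C2 -> C2) (p : Z) (q nu : nat) (mu : C)
         (W W' : C2 -> Prop) (Phi Psi : C2 -> C2),
    germ_biholomorphism U V f finv ->
    dissipative f ->
    semi_parabolic f p q mu ->
    normalizing_coordinates f (root_of_unity p q) mu q nu W W' Phi Psi ->
    exists r0 : R, (0 < r0)%R /\
      forall r : R, (0 < r < r0)%R ->
        exists P : nat -> nat -> C2 -> Prop,
          (forall x : C2, Sigma finv (ball0 r) x <->
             exists i j : nat, (i < nu)%nat /\ (j < q)%nat /\ P i j x) /\
          (forall (i j i' j' : nat) (x : C2),
             (i < nu)%nat -> (j < q)%nat -> (i' < nu)%nat -> (j' < q)%nat ->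
             P i j x -> P i' j' x -> i = i' /\ j = j') /\
          (forall i : nat, (i < nu)%nat ->
             petal_cycle f finv (ball0 r) q (P i)) /\
          (forall i j : nat, (i < nu)%nat -> (j < q)%nat ->
             repelling_petal f Phi q (P i j)).
Proof.
  intros U V f g p q nu mu W W' Phi Psi Hf _ Sp Nc.
  Local Open Scope R_scope.
  destruct Hf as ([oU hfU] & [oV hgV] & fU & gV & U0 & f0).
  destruct Sp as (hq & hgcd & [hmu0 hmu] & _ & _ & _).
  destruct Nc as (([oW hPhi] & [oW' hPsi] & PW & PW' & W0 & Phi0) & hnu & (rho & c & a & h & hrho & _ & [_ hh] & hF)).
  assert (W'0 : W' zero) by (rewrite <- Phi0; apply PW, W0).
  assert (Psi0 : Psi zero = zero) by (rewrite <- Phi0 at 1; apply PW, W0).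
  assert (V0 : V zero) by (rewrite <- f0; apply fU, U0).
  assert (g0 : g zero = zero) by (rewrite <- f0 at 1; apply fU, U0).
  set (lam := root_of_unity p q) in *. set (m := (nu * q)%nat) in *.
  assert (hm : (1 <= m)%nat) by (unfold m; nia).
  assert (hl : Cmod lam = 1) by apply root_of_unity_mod.
  assert (lamq : (lam ^ q = 1)%C) by (unfold lam; rewrite root_of_unity_pow; apply root_of_unity_eq_1; [lia|exists p; auto]).
  assert (lamm : (lam ^ m = 1)%C) by (unfold m; rewrite Nat.mul_comm, Cpow_mult_r, lamq; apply Cpow_1_l).
  assert (lmu : (lam - mu)%C <> 0%C). { intro e. assert (lam = mu) by (replace lam with (lam - mu + mu)%C by ring; rewrite e; ring). rewrite H in hl. lra. }
  set (kap := (h (RtoC 0, RtoC 0) / (lam - mu))%C). assert (pk := Cmod_ge_0 kap).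
  destruct (open_C2_0 W' oW' W'0) as (dW' & hdW' & inW'). destruct (open_C2_0 W oW W0) as (dW & hdW & inW).
  destruct (open_C2_0 U oU U0) as (dU & hdU & inU). destruct (open_C2_0 V oV V0) as (dV & hdV & inV).
  assert (cPsi := holo_cont_0 Psi (hPsi _ W'0) Psi0). assert (cPhi := holo_cont_0 Phi (hPhi _ W0) Phi0).
  assert (cf := holo_cont_0 f (hfU _ U0) f0).
  destruct (cf dW hdW) as (d1 & hd1 & H1). destruct (cPsi (Rmin d1 dU)) as (d2 & hd2 & H2); [apply Rmin_glb_lt; auto|].
  destruct (holo_lip_0 Phi (hPhi _ W0) Phi0) as (KP & d3 & hd3 & hKP & H3). destruct (cPsi d3 hd3) as (d4 & hd4 & H4).
  (* Within this radius the composite Phi f Psi is defined and holomorphic, the normal form holds,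
     and Phi is Lipschitz at 0 along the image of Psi. *)
  set (T := Rmin (Rmin rho dW') (Rmin d2 d4)). assert (pT : 0 < T) by (repeat apply Rmin_glb_lt; auto).
  assert (lT : T <= rho /\ T <= dW' /\ T <= d2 /\ T <= d4).
  { unfold T. generalize (Rmin_l (Rmin rho dW') (Rmin d2 d4)) (Rmin_r (Rmin rho dW') (Rmin d2 d4)) (Rmin_l rho dW') (Rmin_r rho dW') (Rmin_l d2 d4) (Rmin_r d2 d4). lra. }
  assert (pd : forall x y : C, Cmod x < T / 2 -> Cmod y < T / 2 -> W' (x, y) /\ U (Psi (x, y)) /\ W (f (Psi (x, y))) /\ norm (Psi (x, y)) < d3).
  { intros x y hx hy. assert (n : norm ((x, y) : C2) < T) by (eapply Rle_lt_trans; [apply norm_C2_bounds|lra]).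
    assert (n2 := H2 (x, y) ltac:(eapply Rlt_le_trans; [exact n|lra])). assert (n3 := Rlt_le_trans _ _ _ n2 (Rmin_l _ _)). assert (n4 := Rlt_le_trans _ _ _ n2 (Rmin_r _ _)).
    split; [|split; [|split]].
    - apply inW'. eapply Rlt_le_trans; [exact n|lra].
    - apply inU, n4.
    - apply inW, H1, n3.
    - apply H4. eapply Rlt_le_trans; [exact n|lra]. }
  set (F := fun z : C2 => Phi (f (Psi z))) in *.
  assert (dF : forall x y, Cmod x < T / 2 -> Cmod y < T / 2 -> fdiff (fun u v => fst (F (u, v))) x y /\ fdiff (fun u v => snd (F (u, v))) x y).
  { intros x y hx hy. destruct (pd x y hx hy) as (w1 & w2 & w3 & _). apply ex_filterdiff_fdiff. unfold F.
    apply (ex_filterdiff_comp' Psi (fun z => Phi (f z))); [apply hPsi, w1|]. apply (ex_filterdiff_comp' f Phi); [apply hfU, w2|apply hPhi, w3]. }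
  destruct (normal_form_bound (fun u v => fst (F (u, v))) lam c a m (T / 2) hl ltac:(lra)) as (r2 & K1 & hr2 & hK1 & B1).
  { intros x y hx hy. apply dF; auto. }
  { intros x y hx hy. destruct (hF x y) as (t & ht & e); [lra|lra|]. exists t. split; [exact ht|]. etransitivity; [apply (f_equal fst e)|]. cbn [fst]. unfold m.
    rewrite !Nat.mul_assoc. reflexivity. }
  set (s1 := Rmin r2 (T / 2)). assert (ps1 : 0 < s1) by (apply Rmin_glb_lt; lra). assert (s1r : s1 <= r2) by apply Rmin_l. assert (s1T : s1 <= T / 2) by apply Rmin_r.
  destruct (germ_straight (fun u v => fst (F (u, v))) (fun u v => snd (F (u, v))) (fun u v => h (u, v)) lam mu kap m s1 K1) as (s2 & K2 & hs2 & G); auto.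
  { intros x y hx hy. apply dF; lra. } { intros x y hx hy. apply B1; lra. }
  { intros x y hx hy. destruct (hF x y) as (t & _ & e); [lra|lra|]. exact (f_equal snd e). }
  { apply ex_filterdiff_fdiff_C, hh. cbn [fst snd]. rewrite Cmod_0. auto. }
  { unfold kap. field. auto. }
  set (PP := fun x y : C => Psi (x, (y + kap * x)%C)).
  set (s3 := T / 2 / (1 + Cmod kap)). assert (ps3 : 0 < s3) by (unfold s3; apply Rdiv_lt_0_compat; lra).
  assert (es3 : (1 + Cmod kap) * s3 = T / 2) by (unfold s3; field; lra). assert (s3T : s3 <= T / 2) by nra.
  assert (pd' : forall x y : C, Cmod x < s3 -> Cmod y < s3 -> W' (x, (y + kap * x)%C) /\ U (PP x y) /\ W (f (PP x y)) /\ norm (PP x y) < d3).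
  { intros x y hx hy. apply pd; [lra|]. rewrite <- es3. apply shear_mod; auto. }
  assert (PPd : forall x y, Cmod x < s3 -> Cmod y < s3 -> fdiff (fun u v => fst (PP u v)) x y /\ fdiff (fun u v => snd (PP u v)) x y).
  { intros x y hx hy. destruct (pd' x y hx hy) as (w1 & _). assert (Q := ex_filterdiff_fdiff Psi _ _ (hPsi _ w1)).
    split; [apply (fdiff_shear (fun u v => fst (Psi (u, v))))|apply (fdiff_shear (fun u v => snd (Psi (u, v))))]; apply Q. }
  assert (PP0 : PP 0%C 0%C = (RtoC 0, RtoC 0)).
  { unfold PP. replace (0 + kap * 0)%C with (RtoC 0) by ring. rewrite <- C2_zero. exact Psi0. }
  (* The norm comes first, because it prescribes the aperture [gam] for which [germ_dyn] has to be
     applied. The constant KP (2 + |kap|) combines the Lipschitz bound of Phi with the shear. *)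
  destruct (nrm_exists PP s3 (KP * (2 + Cmod kap)) m) as (gam & rho0 & KN & aN & hgam & hrho0 & Nm); auto.
  { intros x y hx hy. destruct (pd' x y hx hy) as (w1 & _ & _ & w4). assert (Q := H3 _ w4). unfold PP in Q at 1. rewrite (proj2 (PW' _ w1)) in Q.
    destruct (norm_C2_bounds x (y + kap * x)%C) as (n1 & n2 & _).
    assert (n1' := Rle_trans _ _ _ n1 Q). assert (n2' := Rle_trans _ _ _ n2 Q). set (nn := norm (PP x y)) in *.
    assert (Cmod y <= Cmod (y + kap * x) + Cmod kap * Cmod x). { rewrite <- Cmod_mult. replace y with (y + kap * x - kap * x)%C at 1 by ring. apply Cmod_sub. }
    assert (Cmod kap * Cmod x <= Cmod kap * (KP * nn)) by (apply Rmult_le_compat_l; auto). lra. }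
  destruct (germ_dyn m lam mu _ _ s2 K2 G gam hgam) as (rd & Kg & hrd & HD).
  set (R := Rmin (Rmin rd rho0) s3). assert (pR : 0 < R) by (repeat apply Rmin_glb_lt; auto).
  assert (lR : R <= rd /\ R <= rho0 /\ R <= s3) by (unfold R; generalize (Rmin_l (Rmin rd rho0) s3) (Rmin_r (Rmin rd rho0) s3) (Rmin_l rd rho0) (Rmin_r rd rho0); lra).
  clearbody R. assert (D := HD R ltac:(lra)). assert (Nr := Nm R ltac:(lra)). clear HD Nm.
  set (zx := fun z : C2 => fst (Phi z) : C). set (zy := fun z : C2 => (snd (Phi z) - kap * fst (Phi z))%C).
  destruct (cPhi (R / (1 + Cmod kap))) as (d5 & hd5 & H5); [apply Rdiv_lt_0_compat; lra|].
  (* In this ball the straightened coordinates are defined with values in the bidisc of radius R,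
     and f and g are inverse to each other. *)
  set (r1 := Rmin (Rmin d5 dW) (Rmin dU dV)). assert (pr1 : 0 < r1) by (repeat apply Rmin_glb_lt; auto).
  assert (lr1 : r1 <= d5 /\ r1 <= dW /\ r1 <= dU /\ r1 <= dV) by (unfold r1; generalize (Rmin_l (Rmin d5 dW) (Rmin dU dV)) (Rmin_r (Rmin d5 dW) (Rmin dU dV)) (Rmin_l d5 dW) (Rmin_r d5 dW) (Rmin_l dU dV) (Rmin_r dU dV); lra).
  clearbody r1.
  assert (citer := iter_cont_0 f cf).
  destruct (cont_upto f q r1 citer pr1) as (d6 & hd6 & H6).
  destruct (small_exists m R KN (1000000 * Kg) hm pR (n_KN _ _ _ _ _ _ Nr) ltac:(generalize (d_Kg D); lra)) as (r6 & sm6).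
  (* The radius [d6] keeps the first q images inside the ball of radius r1, as the Abel equation
     requires, and [r6] ensures |w| >= 1000000 Kg throughout the ball. *)
  set (r0 := Rmin (Rmin r1 d6) r6). assert (pr6 : 0 < r6) by apply sm6. assert (pr0 : 0 < r0) by (repeat apply Rmin_glb_lt; auto).
  assert (lr0 : r0 <= r1 /\ r0 <= d6 /\ r0 <= r6) by (unfold r0; generalize (Rmin_l (Rmin r1 d6) r6) (Rmin_r (Rmin r1 d6) r6) (Rmin_l r1 d6) (Rmin_r r1 d6); lra).
  clearbody r0.
  assert (sm : small_radius m R KN (1000000 * Kg) r0). { apply (small_mono _ _ _ _ r6); [generalize (n_KN _ _ _ _ _ _ Nr); lra|auto|lra]. }
  assert (M_zz : forall z, norm z < r1 -> Cmod (zx z) < R /\ Cmod (zy z) < R /\ PP (zx z) (zy z) = z).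
  { intros z hz. assert (Q := H5 z ltac:(lra)). assert (n := norm_C2_bounds (fst (Phi z)) (snd (Phi z))). rewrite <- surjective_pairing in n.
    destruct n as (n1 & n2 & _). assert (q1 := Rle_lt_trans _ _ _ n1 Q). assert (q2 := Rle_lt_trans _ _ _ n2 Q).
    assert (e : R / (1 + Cmod kap) * (1 + Cmod kap) = R) by (field; lra). set (w := R / (1 + Cmod kap)) in *. assert (pw : 0 < w) by (eapply Rle_lt_trans; [apply Cmod_ge_0|exact q1]).
    split; [unfold zx; nra|]. split.
    - unfold zy. eapply Rle_lt_trans; [apply Cmod_sub|]. rewrite Cmod_mult. assert (Cmod kap * Cmod (fst (Phi z)) <= Cmod kap * w) by (apply Rmult_le_compat_l; lra). lra.
    - unfold PP, zx, zy. replace (snd (Phi z) - kap * fst (Phi z) + kap * fst (Phi z))%C with (Cplus (snd (Phi z)) 0) by ring.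
      rewrite Cplus_0_r, <- surjective_pairing. apply PW, inW. lra. }
  assert (M_PP : forall x y, Cmod x < R -> Cmod y < R -> zx (PP x y) = x /\ zy (PP x y) = y).
  { intros x y hx hy. destruct (pd' x y) as (w1 & _); [lra|lra|]. unfold zx, zy, PP. rewrite (proj2 (PW' _ w1)). cbn [fst snd]. split; auto. ring. }
  set (fx := fun x y : C => fst (F (x, (y + kap * x)%C)) : C). set (fy := fun x y : C => (snd (F (x, (y + kap * x)%C)) - kap * fst (F (x, (y + kap * x)%C)))%C).
  change (dyn m lam mu fx fy R gam Kg) in D.
  assert (M_f : forall x y, Cmod x < R -> Cmod y < R -> fx x y = zx (f (PP x y)) /\ fy x y = zy (f (PP x y)) /\ PP (fx x y) (fy x y) = f (PP x y) /\ g (f (PP x y)) = PP x y).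
  { intros x y hx hy. destruct (pd' x y) as (w1 & w2 & w3 & _); [lra|lra|]. split; [reflexivity|]. split; [reflexivity|]. split; [|apply fU, w2].
    change (PP (zx (f (PP x y))) (zy (f (PP x y))) = f (PP x y)). set (z := f (PP x y)) in *.
    unfold PP, zx, zy. replace (snd (Phi z) - kap * fst (Phi z) + kap * fst (Phi z))%C with (Cplus (snd (Phi z)) 0) by ring.
    rewrite Cplus_0_r, <- surjective_pairing. apply PW, w3. }
  assert (M_inv : forall z, norm z < r1 -> f (g z) = z /\ g (f z) = z).
  { intros z hz. split; [apply gV, inV; lra|apply fU, inU; lra]. }
  assert (M_iter : forall z k, norm z < r0 -> (k <= q)%nat -> norm (Nat.iter k f z) < r1).
  { intros z k hz hk. apply H6; auto. lra. }
  assert (M_Phi : forall z, norm z < r1 -> Phi z = (zx z, zy z + kap * zx z)%C).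
  { intros z _. unfold zx, zy. replace (snd (Phi z) - kap * fst (Phi z) + kap * fst (Phi z))%C with (Cplus (snd (Phi z)) 0) by ring.
    rewrite Cplus_0_r. apply surjective_pairing. }
  destruct (leaf_index p q nu hq hnu hgcd) as [idx uniq]. set (om := root_of_unity 1 (nu * q)) in *. fold m lam in idx, uniq.
  exists r0. split; auto. intros r hr. assert (hr1 : 0 < r <= r1) by lra.
  (* Petal j of cycle i carries the root of unity om^i lam^j, so f raises j by one modulo q;
     [leaf_index] says that every label occurs exactly once. *)
  exists (fun i j => fiber m lam fx fy R PP r (om ^ i * lam ^ j)%C). split; [|split; [|split]].
  - intro z. rewrite (fiber_Sigma m lam mu fx fy R gam Kg D PP zx zy f g KN aN Nr r1 M_zz M_PP M_f M_inv PP0 r z hr1). split.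
    + intros (th & h1 & h2). apply idx in h1. destruct h1 as (i & j & hi & hj & ->). exists i, j. auto.
    + intros (i & j & hi & hj & hz). exists (om ^ i * lam ^ j)%C. split; auto. apply idx. exists i, j. auto.
  - intros i j i' j' z hi hj hi' hj' h1 h2. apply uniq; auto. apply (fiber_unique _ _ _ _ _ _ _ _ D PP zx zy M_PP r _ _ z h1 h2).
  - intros i hi. apply (fiber_cycle m lam mu fx fy R gam Kg D PP zx zy f g q hq lamq r1 M_zz M_f M_inv citer r (om ^ i)%C hr1).
  - intros i j hi hj. set (th := (om ^ i * lam ^ j)%C).
    assert (thm : (th ^ m = 1)%C) by (apply idx; exists i, j; auto).
    destruct (halfplane m lam mu fx fy R gam Kg D (fun x y => norm (PP x y)) KN (n_KN _ _ _ _ _ _ Nr) (n_up _ _ _ _ _ _ Nr) th thm) as (xr & yr & xo & xn & xb & HH).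
    destruct (petal_start m lam mu fx fy R gam Kg D PP th xr r) as (X & Y & XY).
    apply (leaf_petal m lam mu fx fy R gam Kg D PP zx zy f g KN aN Nr q hq lamq r0 r1 (1000000 * Kg) ltac:(lra) ltac:(lra) sm M_PP M_f M_inv M_iter
      th xr yr xo xn xb HH) with (kap := kap) (X := X) (Y := Y); auto.
    intros x y hx hy. apply PPd; lra.
Qed.
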